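(* Let $\rho$ be a strongly irreducible and proximal Borel probability measure on $\mathrm{SL}_d(\mathbb{R})$ ($d\geqslant 2$) having an exponential moment, and let $\nu$ be the unique $\rho$-stationary Borel probability measure on $\mathbb{P}(\mathbb{R}^d)$. Then there are $\alpha,\beta>0$ and $p\in\mathbb{N}$, $p\geqslant1$, such that for any $\alpha_2>0$ there is $\Delta\in\mathbb{R}_+$ such that \[ \liminf_{b\to\pm\infty}|b|^\alpha\int_{G^\Delta(|b|^{-\alpha_2})}\left|e^{ib\lambda_1(g)}-1\right|^2\,d\rho^{*pn(\beta,b)}(g)>0, \] where $\lambda_1(g)$ is the logarithm of the spectral radius of $g$, $n(\beta,b)=\lfloor\beta\ln|b|\rfloor$, and, for $r>0$, $G^\Delta(r)$ is the set of $g\in\mathrm{SL}_d(\mathbb{R})$ such that $g$ is proximal and $V_g^+$ is $\Delta$-$\nu$-regular at scale $r$.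
   Context: A subgroup of $\mathrm{SL}_d(\mathbb{R})$ is strongly irreducible if it does not fix any finite union of non-trivial (nonzero proper) subspaces of $\mathbb{R}^d$; it is proximal if it contains a proximal element. An element $g$ is proximal if it has a unique eigenvalue of maximal modulus and its eigenspace is a line (simple eigenvalue); equivalently $g$ has a locally attractive fixed point in $\mathbb{P}(\mathbb{R}^d)$, and $V_g^+\in\mathbb{P}(\mathbb{R}^d)$ denotes this attractive fixed point (the dominant eigenline). $\rho$ is strongly irreducible and proximal if its support generates a group with these two properties; $\rho$ has an exponential moment if $\int\|g\|^\varepsilon\,d\rho(g)<+\infty$ for some $\varepsilon>0$. $\mathbb{P}(\mathbb{R}^d)$ carries the distance $d(\mathbb{R}x,\mathbb{R}y)=\frac{\|x\wedge y\|}{\|x\|\|y\|}$ (Euclidean norms). A point $x$ is $\Delta$-$\nu$-regular at scale $r$ if $\nu(B(x,r))\geqslant r^\Delta$. $\rho^{*n}$ is the $n$-fold convolution power. *)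

(* Defs.v *)
From HB Require Import structures.
From mathcomp Require Import all_boot all_order all_algebra.
From mathcomp Require Import complex ring lra.
From mathcomp Require Import all_classical all_reals all_analysis measurable_realfun.
Import Order.TTheory GRing.Theory Num.Theory.
Import numFieldTopology.Exports numFieldNormedType.Exports.

Set Implicit Arguments.
Unset Strict Implicit.
Unset Printing Implicit Defensive.

Local Open Scope classical_set_scope.
Local Open Scope ring_scope.

Section Euclidean.
Context {R : realType} {d : nat}.
Implicit Types u v w : 'cV[R]_d.

Definition dotp u v : R := \sum_i u i ord0 * v i ord0.

Definition enorm u : R := Num.sqrt (dotp u u).

(* The coordinates of u /\ v in the orthonormal basis (e_i /\ e_j)_(i < j) are
   the 2 x 2 minors of the matrix with columns u and v. *)
Definition wedge_norm u v : R :=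
  Num.sqrt (\sum_(p : 'I_d * 'I_d | (p.1 < p.2)%N)
    (u p.1 ord0 * v p.2 ord0 - u p.2 ord0 * v p.1 ord0) ^+ 2).

Lemma dotpC u v : dotp u v = dotp v u.
Proof. by apply: eq_bigr => i _; rewrite mulrC. Qed.

Lemma dotpDl u v w : dotp (u + v) w = dotp u w + dotp v w.
Proof. by rewrite -big_split; apply: eq_bigr => i _; rewrite mxE mulrDl. Qed.

Lemma dotpZl a u w : dotp (a *: u) w = a * dotp u w.
Proof. by rewrite mulr_sumr; apply: eq_bigr => i _; rewrite mxE mulrA. Qed.

Lemma dotpDr u v w : dotp w (u + v) = dotp w u + dotp w v.
Proof. by rewrite dotpC dotpDl !(dotpC w). Qed.

Lemma dotpZr a u w : dotp w (a *: u) = a * dotp w u.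
Proof. by rewrite dotpC dotpZl dotpC. Qed.

Lemma dotp_ge0 u : 0 <= dotp u u.
Proof. by apply: sumr_ge0 => i _; rewrite -expr2 sqr_ge0. Qed.

Lemma dotp_eq0 u : (dotp u u == 0) = (u == 0).
Proof.
apply/eqP/eqP => [u0|->]; last by apply: big1 => i _; rewrite mxE mul0r.
apply/colP => i; rewrite mxE; apply/eqP; rewrite -sqrf_eq0 expr2.
have := psumr_eq0P _ u0; move=> -> // j _.
by rewrite -expr2 sqr_ge0.
Qed.

Lemma sqr_enorm u : enorm u ^+ 2 = dotp u u.
Proof. by rewrite sqr_sqrtr ?dotp_ge0. Qed.

Lemma enorm_ge0 u : 0 <= enorm u.
Proof. exact: sqrtr_ge0. Qed.

Lemma enorm_gt0 u : (0 < enorm u) = (u != 0).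
Proof. by rewrite sqrtr_gt0 lt_neqAle dotp_ge0 andbT eq_sym dotp_eq0. Qed.

Lemma wedge_norm_ge0 u v : 0 <= wedge_norm u v.
Proof. exact: sqrtr_ge0. Qed.

Lemma sqr_wedge_norm u v :
  wedge_norm u v ^+ 2 = dotp u u * dotp v v - dotp u v ^+ 2.
Proof.
rewrite sqr_sqrtr; last by apply: sumr_ge0 => p _; exact: sqr_ge0.
set F := fun i j => (u i ord0 * v j ord0 - u j ord0 * v i ord0) ^+ 2.
have FC i j : F i j = F j i by rewrite /F -sqrrN opprB.
have Fii i : F i i = 0 by rewrite /F subrr expr0n.
set S := \sum_(p | _) _.
have S2 : \sum_i \sum_j F i j = S + S.
  rewrite pair_big /= (bigID (fun p : 'I_d * 'I_d => (p.1 < p.2)%N)) /=.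
  have swapp : involutive (fun p : 'I_d * 'I_d => (p.2, p.1)) by case.
  congr (_ + _).
  rewrite (bigID (fun p : 'I_d * 'I_d => (p.2 < p.1)%N)) /=.
  rewrite [X in _ + X]big1 ?addr0; last first.
    move=> [i j] /= /andP[]; rewrite -!leqNgt => ji ij.
    have -> : i = j by apply/val_inj/eqP; rewrite eqn_leq ij ji.
    exact: Fii.
  rewrite (reindex_inj (inv_inj swapp)) /=.
  apply: eq_big => [[i j]|[i j] _] /=; last by rewrite FC.
  by rewrite -leqNgt; case: ltngtP.
have E : \sum_i \sum_j F i j =
    (dotp u u * dotp v v - dotp u v ^+ 2) + (dotp u u * dotp v v - dotp u v ^+ 2).
  have -> : dotp u u * dotp v v = \sum_i \sum_j
      (u i ord0 * u i ord0) * (v j ord0 * v j ord0).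
    rewrite mulr_suml; apply: eq_bigr => i _.
    by rewrite mulr_sumr.
  have Euv : dotp u v ^+ 2 = \sum_i \sum_j
      (u i ord0 * v i ord0) * (u j ord0 * v j ord0).
    rewrite expr2 mulr_suml; apply: eq_bigr => i _.
    by rewrite mulr_sumr.
  set A := \sum_i \sum_j _ * _.
  have A' : A = \sum_i \sum_j (u j ord0 * u j ord0) * (v i ord0 * v i ord0).
    by rewrite exchange_big.
  rewrite Euv addrACA {2}A' /A -!big_split -!sumrN -!big_split /=.
  apply: eq_bigr => i _; rewrite -!sumrN -!big_split /=; apply: eq_bigr => j _.
  rewrite /F; ring.
lra.
Qed.

Lemma CauchySchwarz_dotp u v : `|dotp u v| <= enorm u * enorm v.
Proof.
rewrite -(@ler_pXn2r _ 2) ?nnegrE ?normr_ge0 ?mulr_ge0 ?enorm_ge0 //.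
rewrite exprMn !sqr_enorm real_normK ?num_real // -subr_ge0 -sqr_wedge_norm.
exact: sqr_ge0.
Qed.

Lemma enorm_triangle u v : enorm (u + v) <= enorm u + enorm v.
Proof.
rewrite -(@ler_pXn2r _ 2) ?nnegrE ?addr_ge0 ?enorm_ge0 // sqrrD !sqr_enorm.
rewrite dotpDl !dotpDr (dotpC v u).
have := le_trans (ler_norm _) (CauchySchwarz_dotp u v); lra.
Qed.

Lemma enormZ a u : enorm (a *: u) = `|a| * enorm u.
Proof. by rewrite /enorm dotpZl dotpZr mulrA -expr2 sqrtrM ?sqr_ge0 // sqrtr_sqr. Qed.

(* dotp v v times the orthogonal projection of u onto the hyperplane v^perp *)
Let rej v u := dotp v v *: u - dotp u v *: v.

Let rejD v u w : rej v (u + w) = rej v u + rej v w.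
Proof. by rewrite /rej dotpDl scalerDr scalerDl opprD addrACA. Qed.

Let rejZ v a u : rej v (a *: u) = a *: rej v u.
Proof. by rewrite /rej dotpZl scalerBr !scalerA (mulrC _ a). Qed.

Let enorm_rej v u : enorm (rej v u) = enorm v * wedge_norm u v.
Proof.
apply/eqP; rewrite -(@eqrXn2 _ 2) ?mulr_ge0 ?enorm_ge0 ?wedge_norm_ge0 //.
apply/eqP; rewrite exprMn !sqr_enorm sqr_wedge_norm /rej -scaleN1r.
rewrite !(dotpDl, dotpDr, dotpZl, dotpZr) (dotpC v u); ring.
Qed.

Lemma wedge_normC u v : wedge_norm u v = wedge_norm v u.
Proof. by congr Num.sqrt; apply: eq_bigr => p _; rewrite -sqrrN; congr (_ ^+ 2); ring. Qed.

Lemma wedge_norm_le u v : wedge_norm u v <= enorm u * enorm v.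
Proof.
rewrite -(@ler_pXn2r _ 2) ?nnegrE ?wedge_norm_ge0 ?mulr_ge0 ?enorm_ge0 //.
rewrite exprMn !sqr_enorm sqr_wedge_norm.
have := sqr_ge0 (dotp u v); lra.
Qed.

Lemma wedge_norm_eq0 u v : v != 0 -> wedge_norm u v = 0 -> exists a, u = a *: v.
Proof.
move=> v0 uv; have /eqP : enorm (rej v u) = 0 by rewrite enorm_rej uv mulr0.
rewrite sqrtr_eq0 => uv0; have : rej v u == 0.
  by rewrite -dotp_eq0 eq_le uv0 dotp_ge0.
rewrite subr_eq0 => /eqP E; exists ((dotp v v)^-1 * dotp u v).
by rewrite -scalerA -E scalerA mulVf ?scale1r // dotp_eq0.
Qed.

Lemma wedge_norm_triangle u v w : v != 0 -> w != 0 ->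
  wedge_norm u w * enorm v <= wedge_norm u v * enorm w + enorm u * wedge_norm v w.
Proof.
move=> v0 w0; have := enorm_gt0 v; have := enorm_gt0 w; rewrite v0 w0 => W0 V0.
have E : dotp v v *: u = rej v u + dotp u v *: v by rewrite /rej subrK.
have := enorm_triangle (rej w (rej v u)) (dotp u v *: rej w v).
rewrite -rejZ -rejD -E !rejZ !enormZ !enorm_rej ger0_norm ?dotp_ge0 // -sqr_enorm.
have H1 := wedge_norm_le (rej v u) w.
have H2 := CauchySchwarz_dotp u v.
rewrite enorm_rej in H1.
move=> H; rewrite -(ler_pM2l (mulr_gt0 W0 V0)).
apply: (le_trans (le_trans _ H)); first by rewrite le_eqVlt; apply/orP; left; apply/eqP; ring.
apply: (@le_trans _ _ (enorm w * (enorm v * wedge_norm u v * enorm w)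
  + (enorm u * enorm v) * (enorm w * wedge_norm v w))); last first.
  by rewrite le_eqVlt; apply/orP; left; apply/eqP; ring.
apply: lerD; first by rewrite ler_pM2l.
by apply: ler_wpM2r => //; rewrite mulr_ge0 ?enorm_ge0 ?wedge_norm_ge0.
Qed.

End Euclidean.

Record projspace (R : realType) (d : nat) :=
  Projspace { line :> {vspace 'cV[R]_d}; _ : \dim line == 1%N }.
HB.instance Definition _ R d := [isSub for @line R d].
HB.instance Definition _ R d := [Choice of projspace R d by <:].

Section ProjectiveSpace.
Context {R : realType} {d : nat}.
Implicit Types x y z : projspace R d.

Lemma dim_proj x : \dim x = 1%N. Proof. by case: x => V /= /eqP. Qed.

Lemma vpick_proj_neq0 x : vpick x != 0.
Proof. by rewrite vpick0 -dimv_eq0 dim_proj. Qed.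

Lemma proj_span x u : u \in line x -> u != 0 -> line x = <[u]>%VS.
Proof.
move=> ux u0; apply/esym/eqP.
by rewrite eqEdim -memvE ux dim_proj dim_vline u0.
Qed.

Definition proj_dist x y : R :=
  wedge_norm (vpick x) (vpick y) / (enorm (vpick x) * enorm (vpick y)).

(* The choice of representatives is immaterial. *)
Lemma proj_distE x y u v : u \in line x -> u != 0 -> v \in line y -> v != 0 ->
  proj_dist x y = wedge_norm u v / (enorm u * enorm v).
Proof.
have wZ a (w w' : 'cV[R]_d) : wedge_norm (a *: w) w' = `|a| * wedge_norm w w'.
  rewrite /wedge_norm -sqrtr_sqr -sqrtrM ?sqr_ge0 // mulr_sumr.
  congr Num.sqrt; apply: eq_bigr => p _; rewrite !mxE; ring.
have aux (a b : R) (w w' : 'cV[R]_d) : a != 0 -> b != 0 ->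
    wedge_norm (a *: w) (b *: w') / (enorm (a *: w) * enorm (b *: w')) =
    wedge_norm w w' / (enorm w * enorm w').
  move=> a0 b0; rewrite wZ wedge_normC wZ !enormZ (wedge_normC w') mulrA.
  by rewrite mulrACA -mulf_div divff ?mul1r // mulf_neq0 ?normr_eq0.
move=> ux u0 vy v0.
have [a ua] : exists a, u = a *: vpick x.
  by apply/vlineP; rewrite -(proj_span (memv_pick x) (vpick_proj_neq0 x)).
have [b vb] : exists b, v = b *: vpick y.
  by apply/vlineP; rewrite -(proj_span (memv_pick y) (vpick_proj_neq0 y)).
rewrite ua in u0 *; rewrite vb in v0 *.
rewrite /proj_dist aux //.
- by apply: contra_neq u0 => ->; rewrite scale0r.
- by apply: contra_neq v0 => ->; rewrite scale0r.
Qed.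

Lemma proj_distxx x : proj_dist x x = 0.
Proof.
rewrite /proj_dist; suff -> : wedge_norm (vpick x) (vpick x) = 0 by rewrite mul0r.
by apply/eqP; rewrite -sqrf_eq0 sqr_wedge_norm -expr2 subrr.
Qed.

Lemma proj_dist_eq0 x y : proj_dist x y = 0 -> x = y.
Proof.
have xy0 : 0 < enorm (vpick x) * enorm (vpick y).
  by rewrite mulr_gt0 ?enorm_gt0 ?vpick_proj_neq0.
move=> /eqP; rewrite mulf_eq0 invr_eq0 (gt_eqF xy0) orbF => /eqP /(wedge_norm_eq0 (vpick_proj_neq0 y))[a xy].
apply: val_inj => /=.
have xy' : vpick x \in line y by rewrite xy memvZ ?memv_pick.
rewrite (proj_span xy' (vpick_proj_neq0 x)).
exact: proj_span (memv_pick x) (vpick_proj_neq0 x).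
Qed.

Lemma proj_distC x y : proj_dist x y = proj_dist y x.
Proof. by rewrite /proj_dist wedge_normC (mulrC (enorm _)). Qed.

Lemma proj_dist_triangle y x z : proj_dist x z <= proj_dist x y + proj_dist y z.
Proof.
rewrite /proj_dist; set u := vpick x; set v := vpick y; set w := vpick z.
have [u0 v0 w0] : [/\ u != 0, v != 0 & w != 0] by split; exact: vpick_proj_neq0.
have [U V W] : [/\ 0 < enorm u, 0 < enorm v & 0 < enorm w].
  by rewrite !enorm_gt0.
have := wedge_norm_triangle u v0 w0.
set a := wedge_norm u w; set b := wedge_norm u v; set c := wedge_norm v w => H.
have -> : a / (enorm u * enorm w) =
    (a * enorm v) / (enorm u * enorm v * enorm w).
  by field; rewrite !gt_eqF.
have -> : b / (enorm u * enorm v) + c / (enorm v * enorm w) =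
    (b * enorm w + enorm u * c) / (enorm u * enorm v * enorm w).
  by field; rewrite !gt_eqF.
by rewrite ler_pM2r // invr_gt0 !mulr_gt0.
Qed.

HB.instance Definition _ := @isMetric.Build R (projspace R d) proj_dist
  proj_distxx proj_dist_eq0 proj_distC proj_dist_triangle.

End ProjectiveSpace.

Lemma dim_line_const1 (R : realType) (d : nat) :
  \dim <[const_mx 1 : 'cV[R]_d.+1]>%VS == 1%N.
Proof.
rewrite dim_vline; suff -> : (const_mx 1 : 'cV[R]_d.+1) != 0 by [].
by apply/eqP => /matrixP /(_ ord0 ord0) /eqP; rewrite !mxE oner_eq0.
Qed.

(* measurableType asks for an inhabited type, and P(R^0) is empty. *)
HB.instance Definition _ (R : realType) (d : nat) :=
  isPointed.Build (projspace R d.+1) (Projspace (dim_line_const1 R d)).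

HB.instance Definition _ (R : realType) (d : nat) :=
  Measurable.copy (projspace R d.+1) (g_sigma_algebraType (@open (projspace R d.+1))).

Record SL (R : realType) (d : nat) :=
  MkSL { SLval :> 'M[R]_d; _ : \det SLval == 1 }.
HB.instance Definition _ R d := [isSub for @SLval R d].
HB.instance Definition _ R d := [Choice of SL R d by <:].

Section SpecialLinear.
Context {R : realType} {d : nat}.
Implicit Types g h : SL R d.

Lemma det_SL g : \det g = 1. Proof. by case: g => A /= /eqP. Qed.

Lemma SL_unitmx g : (g : 'M[R]_d) \in unitmx.
Proof. by rewrite unitmxE det_SL unitr1. Qed.

Fact SL_one_subproof : \det (1%:M : 'M[R]_d) == 1.
Proof. by rewrite det1. Qed.
Definition SL_one := MkSL SL_one_subproof.

Fact SL_mul_subproof g h : \det (g *m h) == 1.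
Proof. by rewrite det_mulmx !det_SL mulr1. Qed.
Definition SL_mul g h := MkSL (SL_mul_subproof g h).

Fact SL_inv_subproof g : \det (invmx g) == 1.
Proof. by rewrite det_inv det_SL invr1. Qed.
Definition SL_inv g := MkSL (SL_inv_subproof g).

Fact SL_mulA : associative SL_mul.
Proof. by move=> g h k; apply: val_inj; rewrite /= mulmxA. Qed.
Fact SL_mul1 : left_id SL_one SL_mul.
Proof. by move=> g; apply: val_inj; rewrite /= mul1mx. Qed.
Fact SL_mulr1 : right_id SL_one SL_mul.
Proof. by move=> g; apply: val_inj; rewrite /= mulmx1. Qed.
Fact SL_mulV : left_inverse SL_one SL_inv SL_mul.
Proof. by move=> g; apply: val_inj; rewrite /= mulVmx // SL_unitmx. Qed.
Fact SL_mulrV : right_inverse SL_one SL_inv SL_mul.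
Proof. by move=> g; apply: val_inj; rewrite /= mulmxV // SL_unitmx. Qed.

HB.instance Definition _ := isGroup.Build (SL R d)
  SL_mulA SL_mul1 SL_mulr1 SL_mulV SL_mulrV.
HB.instance Definition _ := isPointed.Build (SL R d) SL_one.
HB.instance Definition _ :=
  Topological.copy (SL R d) (initial_topology (@SLval R d)).
HB.instance Definition _ :=
  Measurable.copy (SL R d) (g_sigma_algebraType (@open (SL R d))).

Definition SL_action g (x : projspace R d) : {vspace 'cV[R]_d} :=
  (linfun (mulmx (g : 'M[R]_d)) @: line x)%VS.

Fact dim_SL_action g x : \dim (SL_action g x) == 1%N.
Proof.
rewrite limg_dim_eq ?dim_proj //; apply/eqP; rewrite -subv0.
apply/subvP => u; rewrite memv_cap => /andP[_]; rewrite memv_ker lfunE /= memv0.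
by move=> /eqP /(congr1 (mulmx (invmx g))); rewrite mulKmx ?SL_unitmx // mulmx0 => ->.
Qed.

Definition act g x : projspace R d := Projspace (dim_SL_action g x).

End SpecialLinear.

(* The Borel sigma-algebra of 'M_d is generated by the d ^ 2 coordinates, so
   that multiplication is measurable for the product sigma-algebra. *)
Lemma measurable_mx_open d' (T : measurableType d') (R : realType) (d : nat)
    (f : T -> 'M[R]_d) (V : set 'M[R]_d) :
  (forall i j, measurable_fun setT (fun t => f t i j)) -> open V ->
  measurable (f @^-1` V).
Proof.
move=> mf oV.
pose box (p : 'M[rat]_d * nat) : set 'M[R]_d :=
  [set A | forall i j, `|A i j - ratr (p.1 i j)| < p.2.+1%:R^-1].
have -> : f @^-1` V = \bigcup_(p in [set p | box p `<=` V]) (f @^-1` box p).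
  apply/seteqP; split => [t Vt|t [p pV /pV]] //=.
  have : nbhs (f t) V by exact: open_nbhs_nbhs.
  rewrite -nbhs_ballE => -[e /= e0 eV].
  pose n := Num.truncn (2 / e); have ne : 2 * n.+1%:R^-1 < e.
    have H : 2 / e < n.+1%:R by rewrite real_truncnS_gt // num_real.
    by rewrite ltr_pdivrMr // mulrC -ltr_pdivrMr.
  have n0 : 0 < n.+1%:R^-1 :> R by rewrite invr_gt0.
  have q i j : {q : rat | `|f t i j - ratr q| < n.+1%:R^-1}.
    apply/cid; have qi : f t i j - n.+1%:R^-1 < f t i j + n.+1%:R^-1.
      by rewrite ltrD2l gtrN.
    have [q] := rat_in_itvoo qi.
    by rewrite in_itv /= => {}qi; exists q; rewrite distrC ltr_distl.
  exists (\matrix_(i, j) sval (q i j), n) => /=; last first.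
    by move=> i j; rewrite mxE; exact: (svalP (q i j)).
  move=> A /= boxA; apply: eV; split => // i j; rewrite /ball /=.
  have := boxA i j; rewrite mxE => Aq; have := svalP (q i j) => fq.
  rewrite -(subrKA (ratr (sval (q i j)))) (le_lt_trans (ler_normD _ _)) //.
  by rewrite (lt_le_trans _ (ltW ne)) // mulr_natl mulr2n ltrD // distrC.
rewrite bigcup_mkcond; apply: countable_bigcupT_measurable.
  exact: countableP.
move=> p; case: ifPn => // _.
have -> : f @^-1` box p = \bigcap_(ij : 'I_d * 'I_d)
    ((fun t => f t ij.1 ij.2) @^-1` ball (ratr (p.1 ij.1 ij.2) : R) p.2.+1%:R^-1).
  apply/seteqP; split => [t + [i j] _|t + i j] /=.
    by move=> /(_ i j); rewrite /ball /= distrC.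
  by move=> /(_ (i, j) I); rewrite /ball /= distrC.
apply: fin_bigcap_measurable => // ij _.
rewrite -[X in measurable X]setTI; apply: mf => //.
exact: measurable_ball.
Qed.

Lemma measurable_SL_coord (R : realType) (d : nat) (i j : 'I_d) :
  measurable_fun setT (fun g : SL R d => (g : 'M[R]_d) i j).
Proof.
apply: (measurability _ (RGenOpens.measurableE R)) => _ [_ [x [y ->]] <-].
rewrite setTI; apply: sub_sigma_algebra.
exists ((fun A : 'M[R]_d => A i j) @^-1` `]x, y[) => //.
apply: open_comp; last exact: interval_open.
by move=> A _; exact: coord_continuous.
Qed.

Lemma measurable_SL_mul (R : realType) (d : nat) : measurable_fun setT
  (fun gh : SL R d * SL R d => (gh.1 * gh.2)%g).
Proof.
apply: (measurability (@open (SL R d))) => // _ [_ [V oV <-] <-].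
rewrite setTI; apply: (measurable_mx_open (f := fun gh : SL R d * SL R d =>
  (gh.1 : 'M[R]_d) *m (gh.2 : 'M[R]_d))) oV => i j.
under eq_fun do rewrite mxE.
apply: measurable_sum => k; apply: measurable_funM.
- exact: measurableT_comp (measurable_SL_coord _ _) measurable_fst.
- exact: measurableT_comp (measurable_SL_coord _ _) measurable_snd.
Qed.

Section Convolution.
Context {R : realType} {d : nat}.

Definition SL_prod (gh : SL R d * SL R d) : SL R d := (gh.1 * gh.2)%g.

HB.instance Definition _ :=
  isMeasurableFun.Build _ _ _ _ SL_prod (@measurable_SL_mul R d).

Definition convolution (rho1 rho2 : probability (SL R d) R) :
    probability (SL R d) R :=
  distribution (rho1 \x rho2)%E SL_prod.

Fixpoint convolution_power (rho : probability (SL R d) R) (n : nat) :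
    probability (SL R d) R :=
  if n is m.+1 then convolution rho (convolution_power rho m)
  else dirac (1%g : SL R d).

End Convolution.

Section Subgroups.
Context {R : realType} {d : nat}.
Implicit Types (H : set (SL R d)) (g : SL R d).

Definition is_subgroup H := [/\ H 1%g,
  forall g h, H g -> H h -> H (g * h)%g & forall g, H g -> H g^-1%g].

Definition union_of_subspaces (s : seq {vspace 'cV[R]_d}) : set 'cV[R]_d :=
  [set u | exists2 V, V \in s & u \in V].

(* The list has to be nonempty: every subgroup fixes the empty union. *)
Definition strongly_irreducible H := forall s : seq {vspace 'cV[R]_d},
  s != [::] -> (forall V, V \in s -> V != 0%VS /\ V != fullv) ->
  ~ (forall g, H g ->
       mulmx (g : 'M[R]_d) @` union_of_subspaces s = union_of_subspaces s).

Definition complex_mx g : 'M[R[i]]_d := map_mx (real_complex R) g.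

(* Simplicity is algebraic multiplicity one, as required for the eigenline to
   be locally attractive. *)
Definition dominant_eigenvalue g (l : R[i]) :=
  mup l (char_poly (complex_mx g)) = 1%N /\
  forall z, eigenvalue (complex_mx g) z -> z != l -> `|z| < `|l|.

Definition proximal_elt g := exists l, dominant_eigenvalue g l.

Definition proximal H := exists2 g, H g & proximal_elt g.

Definition dominant_eigenline g : set (projspace R d) :=
  [set x | exists2 l : R, dominant_eigenvalue g l%:C%C &
     forall u, u \in line x -> g *m u = l *: u].

Definition spectral_radius g : R :=
  sup [set ComplexField.Normc.normc z | z in [set z | eigenvalue (complex_mx g) z]].

Definition lambda1 g : R := ln (spectral_radius g).

Definition operator_norm (A : 'M[R]_d) : R :=
  sup [set enorm (A *m u) | u in [set u : 'cV[R]_d | enorm u <= 1]].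

End Subgroups.

Definition expi {R : realType} (t : R) : R[i] := (cos t +i* sin t)%C.

Section Measures.
Context {R : realType} {d : nat}.
Implicit Types (rho : probability (SL R d.+1) R)
  (nu : probability (projspace R d.+1) R).

Definition measure_support rho : set (SL R d.+1) :=
  [set g | forall U, open U -> U g -> (0 < rho U)%E].

Definition support_group rho := smallest is_subgroup (measure_support rho).

Definition exponential_moment rho :=
  exists2 e : R, 0 < e & (\int[rho]_g (operator_norm g `^ e)%:E < +oo)%E.

Definition stationary rho nu := forall A, measurable A ->
  nu A = (\int[rho]_g nu (act g @^-1` A))%E.

Definition regular_at nu (Delta r : R) (x : projspace R d.+1) :=
  ((r `^ Delta)%:E <= nu (ball x r))%E.

(* junk value when g is not proximal; see VplusP *)
Definition Vplus (g : SL R d.+1) : projspace R d.+1 := get (dominant_eigenline g).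

Definition G_regular nu (Delta r : R) : set (SL R d.+1) :=
  [set g | proximal_elt g /\ regular_at nu Delta r (Vplus g)].

End Measures.

Section Vplus_correct.
Context {R : realType} {d : nat}.
Implicit Types g : SL R d.+1.

Lemma dominant_eigenvalueE g l : dominant_eigenvalue g l ->
  eigenvalue (complex_mx g) l.
Proof.
move=> [ml _]; rewrite eigenvalue_root_char; apply: contraT => /mupNroot.
by rewrite ml.
Qed.

Lemma eigenvalue_complex_mxJ g z : eigenvalue (complex_mx g) z ->
  eigenvalue (complex_mx g) (conjc z).
Proof.
rewrite !eigenvalue_root_char /complex_mx -map_char_poly => gz.
have := rmorph_root (@conjc R) gz; rewrite -map_poly_comp.
by congr root; apply: eq_map_poly => a /=; rewrite oppr0.
Qed.

Lemma dominant_eigenvalue_real g l : dominant_eigenvalue g l ->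
  l = (complex.Re l)%:C%C.
Proof.
move=> gl; have [_ lmax] := gl.
have /eigenvalue_complex_mxJ/lmax := dominant_eigenvalueE gl.
rewrite normcJ ltxx; case: eqP => [lJ _|_ /(_ isT)//].
by move: lJ; case: l {gl lmax} => a b [/eqP]; rewrite eq_sym -addr_eq0 -mulr2n mulrn_eq0 /= => /eqP ->.
Qed.

Lemma VplusP g : proximal_elt g -> dominant_eigenline g (Vplus g).
Proof.
move=> [l gl]; apply: getPex; have lR := dominant_eigenvalue_real gl.
set a := complex.Re l in lR; rewrite lR in gl.
have := dominant_eigenvalueE gl.
rewrite eigenvalue_root_char /complex_mx -map_char_poly fmorph_root.
have -> : char_poly g = char_poly (g : 'M[R]_d.+1)^T.
  rewrite /char_poly -det_tr; congr (\det _).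
  by apply/matrixP => i j; rewrite !mxE (eq_sym j).
rewrite -eigenvalue_root_char => /eigenvalueP[v gv v0].
have vT0 : v^T != 0 by rewrite -trmx0 (inj_eq trmx_inj).
have dv : \dim <[v^T]>%VS == 1%N by rewrite dim_vline vT0.
exists (Projspace dv), a => // u /vlineP[k ->] /=.
by rewrite -scalemxAr -[g *m _]trmxK trmx_mul trmxK gv linearZ /= !scalerA mulrC.
Qed.

End Vplus_correct.

(* Main.v *)
Require Import Defs.
From mathcomp Require Import all_boot all_order all_algebra.
From mathcomp Require Import complex mxtens perm zify ring lra.
From mathcomp Require Import all_classical all_reals all_analysis measurable_realfun.
Import Order.TTheory GRing.Theory Num.Theory.
Import numFieldTopology.Exports numFieldNormedType.Exports.

Set Implicit Arguments.
Unset Strict Implicit.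
Unset Printing Implicit Defensive.

Local Open Scope classical_set_scope.
Local Open Scope ring_scope.

(** The idea is to exhibit, for each large b, an exponentially heavy set of
    words of length about ln |b| whose attracting line is regular and whose
    logarithm of the spectral radius is moved by b away from the multiples of
    the period. Only inequalities between exponentials of the length are
    needed, so that no rate is optimised.

    The semigroup T generated by the support contains a proximal element
    (semigroup_proximal): otherwise the limits of least rank r > 1 of the
    directions of T would make T, then the whole group, act on an r-dimensional
    quotient by almost conformal maps, whereas the group contains a proximal
    element. Powers of a proximal element are close to a rank one matrix u v up
    to scale, and strong irreducibility turns it into letters of one common
    length close to u v, to u y with y not proportional to v, and to x_j v with
    the x_j forming a basis (letters_exist, alphabet_exists). These letters
    expand a common cone around u.

    For long words A and B in letters close to u v, and B much longer than A,
    the block w = d A c B has tiny 2 x 2 minors compared with the square of its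
    trace. Hence it is proximal, its trace is close to its leading eigenvalue
    (proximal_of_trace), and its trace is nearly the quotient of the coefficient
    v B d A c B u by v B u (block_spectrum). With two choices of the first
    letter d and two choices of c, the factor v B u disappears from the
    alternating sum of the four values of lambda1, which is the logarithm of a
    cross ratio of coefficients. The 2 x 2 minor that measures its distance to 0
    is at most exponentially small, because A is invertible, and exponentially
    small, because A is nearly of rank one (minors_ge, minors_le,
    cross_difference). If b is less than the inverse of the upper bound, b times
    this sum is in [-1, 1] and not too small, so that for one of the four
    blocks the number exp (i b lambda1) is not too close to 1 (good_block).

    A block multiplied by a matrix close to the identity is a block with another
    first letter. Letters and words can thus be chosen by pigeonhole in small
    balls of not too small mass (heavy_cells), and a ball around the good block
    is exponentially heavy for the convolution power and contains only good
    blocks (heavy_block). A second pigeonhole inside this ball, at the scale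
    given by alpha2, keeps half of its mass on points w of which arbitrarily
    small neighbourhoods are still exponentially heavy. All the elements of such
    a neighbourhood contract the cone towards the attracting line of w, and the
    cone has positive mass for nu (nu_cone), so a bounded number of applications
    of stationarity shows that a small ball around this line is heavy
    (cell_regular). This gives oscillating_words, of which the theorem is a
    reformulation with word lengths replaced by beta ln |b|. *)

(** * The l1 norm and the norm of 2 x 2 minors *)

Section L1norm.
Context {K : numDomainType}.

Definition l1 m n (A : 'M[K]_(m, n)) : K := \sum_i \sum_j `|A i j|.

Definition minor2 m n (A : 'M[K]_(m, n)) i j k l : K :=
  A i k * A j l - A i l * A j k.

(** Each 2 x 2 minor is counted four times; up to this factor it is the l1 norm
    of the second exterior power, hence submultiplicative. *)
Definition lam2 m n (A : 'M[K]_(m, n)) : K :=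
  \sum_i \sum_j \sum_k \sum_l `|minor2 A i j k l|.

Lemma l1_ge0 m n (A : 'M[K]_(m, n)) : 0 <= l1 A.
Proof. by apply: sumr_ge0 => i _; apply: sumr_ge0. Qed.

Lemma lam2_ge0 m n (A : 'M[K]_(m, n)) : 0 <= lam2 A.
Proof. by do 4! [apply: sumr_ge0 => ? _]. Qed.

Lemma l1_entry m n (A : 'M[K]_(m, n)) i j : `|A i j| <= l1 A.
Proof.
rewrite /l1 (bigD1 i) //= (bigD1 j) //= -addrA lerDl addr_ge0 ?sumr_ge0 //.
by move=> k _; apply: sumr_ge0.
Qed.

Lemma l1_eq0 m n (A : 'M[K]_(m, n)) : (l1 A == 0) = (A == 0).
Proof.
apply/eqP/eqP => [A0|->]; last first.
  by apply: big1 => i _; apply: big1 => j _; rewrite mxE normr0.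
apply/matrixP => i j; rewrite mxE; apply/eqP; rewrite -normr_le0 -A0.
exact: l1_entry.
Qed.

Lemma l1_0 m n : l1 (0 : 'M[K]_(m, n)) = 0.
Proof. by apply/eqP; rewrite l1_eq0. Qed.

Lemma l1_gt0 m n (A : 'M[K]_(m, n)) : (0 < l1 A) = (A != 0).
Proof. by rewrite lt_def l1_ge0 andbT l1_eq0. Qed.

Lemma l1Z m n a (A : 'M[K]_(m, n)) : l1 (a *: A) = `|a| * l1 A.
Proof.
rewrite mulr_sumr; apply: eq_bigr => i _; rewrite mulr_sumr.
by apply: eq_bigr => j _; rewrite mxE normrM.
Qed.

Lemma l1N m n (A : 'M[K]_(m, n)) : l1 (- A) = l1 A.
Proof. by rewrite -scaleN1r l1Z normrN1 mul1r. Qed.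

Lemma l1BC m n (A B : 'M[K]_(m, n)) : l1 (A - B) = l1 (B - A).
Proof. by rewrite -l1N opprB. Qed.

Lemma l1D m n (A B : 'M[K]_(m, n)) : l1 (A + B) <= l1 A + l1 B.
Proof.
rewrite -big_split ler_sum // => i _; rewrite -big_split ler_sum // => j _.
by rewrite mxE ler_normD.
Qed.

Lemma l1B m n (A B : 'M[K]_(m, n)) : l1 (A - B) <= l1 A + l1 B.
Proof. by rewrite -(l1N B) l1D. Qed.

Lemma sum_norm_mul_le (I J L : finType) (F : I -> J -> K) (G : J -> L -> K) :
  \sum_i \sum_k `|\sum_j F i j * G j k| <=
  (\sum_i \sum_j `|F i j|) * (\sum_j \sum_k `|G j k|).
Proof.
rewrite mulr_suml ler_sum // => i _.
apply: (@le_trans _ _ (\sum_k \sum_j `|F i j| * `|G j k|)).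
  apply: ler_sum => k _; apply: (le_trans (ler_norm_sum _ _ _)).
  by under eq_bigr do rewrite normrM.
rewrite exchange_big mulr_suml ler_sum // => j _.
rewrite -mulr_sumr ler_wpM2l // (bigD1 j) //= lerDl sumr_ge0 // => k _.
exact: sumr_ge0.
Qed.

Lemma l1M m n p (A : 'M[K]_(m, n)) (B : 'M[K]_(n, p)) :
  l1 (A *m B) <= l1 A * l1 B.
Proof.
rewrite /l1; under eq_bigr do under eq_bigr do rewrite mxE.
exact: sum_norm_mul_le.
Qed.

Lemma lam2_pairE m n (A : 'M[K]_(m, n)) : lam2 A =
  \sum_(p : 'I_m * 'I_m) \sum_(q : 'I_n * 'I_n) `|minor2 A p.1 p.2 q.1 q.2|.
Proof.
rewrite /lam2 pair_bigA /=; apply: eq_bigr => p _.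
by rewrite pair_bigA.
Qed.

Lemma minor2_le m n (A : 'M[K]_(m, n)) i j k l : `|minor2 A i j k l| <= lam2 A.
Proof.
rewrite lam2_pairE (bigD1 (i, j)) //= (bigD1 (k, l)) //= -addrA lerDl.
by rewrite addr_ge0 ?sumr_ge0 // => ? _; rewrite sumr_ge0.
Qed.

(** The Cauchy-Binet formula, summed over ordered pairs. *)
Lemma minor2M m n p (A : 'M[K]_(m, n)) (B : 'M[K]_(n, p)) i j k l :
  minor2 (A *m B) i j k l *+ 2 =
  \sum_(q : 'I_n * 'I_n) minor2 A i j q.1 q.2 * minor2 B q.1 q.2 k l.
Proof.
have E : minor2 (A *m B) i j k l =
    \sum_q1 \sum_q2 A i q1 * A j q2 * minor2 B q1 q2 k l.
  rewrite /minor2 !mxE !mulr_suml -sumrB; apply: eq_bigr => q1 _.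
  by rewrite !mulr_sumr -sumrB; apply: eq_bigr => q2 _; ring.
rewrite mulr2n {1}E exchange_big E -big_split /=.
rewrite -(pair_bigA _ (fun q1 q2 => minor2 A i j q1 q2 * minor2 B q1 q2 k l)) /=.
apply: eq_bigr => q1 _; rewrite -big_split; apply: eq_bigr => q2 _ /=.
rewrite /minor2; ring.
Qed.

Lemma lam2M m n p (A : 'M[K]_(m, n)) (B : 'M[K]_(n, p)) :
  lam2 (A *m B) <= lam2 A * lam2 B.
Proof.
apply: (@le_trans _ _ (lam2 (A *m B) *+ 2)).
  by rewrite mulr2n lerDl lam2_ge0.
rewrite !lam2_pairE -sumrMnl.
apply: le_trans (sum_norm_mul_le _ _); apply: ler_sum => a _.
rewrite -sumrMnl ler_sum // => b _.
by rewrite -normrMn minor2M.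
Qed.

Lemma lam2Z m n a (A : 'M[K]_(m, n)) : lam2 (a *: A) = `|a| ^+ 2 * lam2 A.
Proof.
rewrite !lam2_pairE mulr_sumr; apply: eq_bigr => p _; rewrite mulr_sumr.
apply: eq_bigr => q _; rewrite -normrX -normrM; congr `|_|.
by rewrite /minor2 !mxE; ring.
Qed.

Lemma sum_norm_mul4 m n (A B : 'M[K]_(m, n)) :
  \sum_i \sum_j \sum_k \sum_l `|A i k * B j l| = l1 A * l1 B.
Proof.
rewrite /l1 mulr_suml; apply: eq_bigr => i _; rewrite mulr_sumr.
apply: eq_bigr => j _; rewrite mulr_suml; apply: eq_bigr => k _.
by rewrite mulr_sumr; apply: eq_bigr => l _; rewrite normrM.
Qed.

Lemma sum_norm_mul4' m n (A B : 'M[K]_(m, n)) :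
  \sum_i \sum_j \sum_k \sum_l `|A i l * B j k| = l1 A * l1 B.
Proof.
rewrite -sum_norm_mul4; apply: eq_bigr => i _; apply: eq_bigr => j _.
by rewrite exchange_big.
Qed.

(** Minors are quadratic in the entries, hence the perturbation bound. *)
Lemma lam2_add m n (A E : 'M[K]_(m, n)) :
  lam2 (A + E) <= lam2 A + 2 * (l1 A * l1 E + l1 E * l1 A + l1 E * l1 E).
Proof.
rewrite mulr_natl mulr2n.
rewrite -{1}(sum_norm_mul4 A E) -{1}(sum_norm_mul4 E A) -{1}(sum_norm_mul4 E E).
rewrite -(sum_norm_mul4' A E) -(sum_norm_mul4' E A) -(sum_norm_mul4' E E).
rewrite -!big_split ler_sum //= => i _; rewrite -!big_split ler_sum //= => j _.
rewrite -!big_split ler_sum //= => k _; rewrite -!big_split ler_sum //= => l _.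
have -> : minor2 (A + E) i j k l = minor2 A i j k l +
    (A i k * E j l + E i k * A j l + E i k * E j l -
     (A i l * E j k + E i l * A j k + E i l * E j k)).
  by rewrite /minor2 !mxE; ring.
apply: (le_trans (ler_normD _ _)); rewrite lerD2l.
apply: (le_trans (ler_normB _ _)); apply: lerD.
  by apply: (le_trans (ler_normD _ _)); rewrite lerD2r ler_normD.
by apply: (le_trans (ler_normD _ _)); rewrite lerD2r ler_normD.
Qed.

Lemma lam2_0 m n : lam2 (0 : 'M[K]_(m, n)) = 0.
Proof.
by do 4! [rewrite /lam2; apply: big1 => ? _]; rewrite /minor2 !mxE mul0r subr0 normr0.
Qed.

Lemma lam2_le m n (A : 'M[K]_(m, n)) : lam2 A <= 2 * l1 A ^+ 2.
Proof.
have := lam2_add 0 A; rewrite add0r lam2_0 l1_0 mulr0 mul0r !add0r.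
by rewrite expr2.
Qed.

Lemma lam2_rank1 m n (x : 'cV[K]_m) (y : 'rV[K]_n) : lam2 (x *m y) = 0.
Proof.
rewrite lam2_pairE; apply: big1 => p _; apply: big1 => q _.
by rewrite /minor2 !mxE !big_ord1 [X in X - _](_ : _ = x p.1 ord0 * y ord0 q.2 *
  (x p.2 ord0 * y ord0 q.1)) ?subrr ?normr0 //; ring.
Qed.

Definition pair n (y : 'rV[K]_n) (x : 'cV[K]_n) : K := (y *m x) ord0 ord0.

Lemma pairE n (y : 'rV[K]_n) (x : 'cV[K]_n) : y *m x = (pair y x)%:M.
Proof. exact: mx11_scalar. Qed.

Lemma pair_le n (y : 'rV[K]_n) (x : 'cV[K]_n) : `|pair y x| <= l1 y * l1 x.
Proof. exact: le_trans (l1_entry _ _ _) (l1M _ _). Qed.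

Lemma pairDr n (y : 'rV[K]_n) x x' : pair y (x + x') = pair y x + pair y x'.
Proof. by rewrite /pair mulmxDr mxE. Qed.

Lemma pairDl n (y y' : 'rV[K]_n) x : pair (y + y') x = pair y x + pair y' x.
Proof. by rewrite /pair mulmxDl mxE. Qed.

Lemma pairZr n (y : 'rV[K]_n) a x : pair y (a *: x) = a * pair y x.
Proof. by rewrite /pair -scalemxAr mxE. Qed.

Lemma pairZl n (y : 'rV[K]_n) a x : pair (a *: y) x = a * pair y x.
Proof. by rewrite /pair -scalemxAl mxE. Qed.

Lemma pairNr n (y : 'rV[K]_n) x : pair y (- x) = - pair y x.
Proof. by rewrite -scaleN1r pairZr mulN1r. Qed.

Lemma pairM m n (y : 'rV[K]_m) (A : 'M[K]_(m, n)) x :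
  pair (y *m A) x = pair y (A *m x).
Proof. by rewrite /pair mulmxA. Qed.

Lemma rank1M m n p (x : 'cV[K]_m) (y : 'rV[K]_n) (z : 'cV[K]_n) (w : 'rV[K]_p) :
  (x *m y) *m (z *m w) = pair y z *: (x *m w).
Proof.
by rewrite mulmxA -(mulmxA x) pairE mul_mx_scalar scalemxAl.
Qed.

Lemma rank1_col m n (x : 'cV[K]_m) (y : 'rV[K]_n) z : (x *m y) *m z = pair y z *: x.
Proof. by rewrite -mulmxA pairE mul_mx_scalar. Qed.

Lemma row_rank1 m n (x : 'cV[K]_m) (y : 'rV[K]_n) z : z *m (x *m y) = pair z x *: y.
Proof. by rewrite mulmxA pairE mul_scalar_mx. Qed.

Lemma mxtrace_rank1 n (x : 'cV[K]_n) (y : 'rV[K]_n) : \tr (x *m y) = pair y x.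
Proof. by rewrite mxtrace_mulC trace_mx11. Qed.

Lemma mxtrace_le n (A : 'M[K]_n) : `|\tr A| <= l1 A.
Proof.
apply: (le_trans (ler_norm_sum _ _ _)); apply: ler_sum => i _.
by rewrite (bigD1 i) //= lerDl sumr_ge0.
Qed.

(** A matrix with small 2 x 2 minors is close to the rank one matrix built from
    the image of a vector and the image of a linear form: the entries of the
    difference are sums of 2 x 2 minors. *)
Lemma rank1_approx m n (B : 'M[K]_(m, n)) (v : 'rV[K]_m) (u : 'cV[K]_n) :
  l1 (pair v (B *m u) *: B - (B *m u) *m (v *m B)) <= l1 v * l1 u * lam2 B.
Proof.
have E i j : (pair v (B *m u) *: B - (B *m u) *m (v *m B)) i j =
    \sum_k \sum_l v ord0 k * u l ord0 * minor2 B i k j l.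
  rewrite !mxE big_ord1 !mxE.
  have -> : pair v (B *m u) = \sum_k \sum_l v ord0 k * u l ord0 * B k l.
    rewrite /pair mxE; apply: eq_bigr => k _; rewrite mxE mulr_sumr.
    by apply: eq_bigr => l _; ring.
  transitivity (\sum_k \sum_l v ord0 k * u l ord0 * B k l * B i j -
      \sum_k \sum_l (B i l * u l ord0) * (v ord0 k * B k j)).
    congr (_ - _); first by rewrite mulr_suml; apply: eq_bigr => k _; rewrite mulr_suml.
    by rewrite mulr_sumr; apply: eq_bigr => k _; rewrite mulr_suml.
  rewrite -sumrB; apply: eq_bigr => k _.
  rewrite -sumrB; apply: eq_bigr => l _; rewrite /minor2; ring.
apply: (@le_trans _ _ (\sum_i \sum_j \sum_k \sum_l l1 v * l1 u * `|minor2 B i k j l|)).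
  apply: ler_sum => i _; apply: ler_sum => j _; rewrite E.
  apply: (le_trans (ler_norm_sum _ _ _)); apply: ler_sum => k _.
  apply: (le_trans (ler_norm_sum _ _ _)); apply: ler_sum => l _.
  by rewrite normrM ler_wpM2r // normrM ler_pM // l1_entry.
rewrite le_eqVlt; apply/orP; left; apply/eqP.
rewrite /lam2 [RHS]mulr_sumr; apply: eq_bigr => i _; rewrite exchange_big /=.
rewrite [RHS]mulr_sumr; apply: eq_bigr => k _.
rewrite [RHS]mulr_sumr; apply: eq_bigr => j _.
by rewrite [RHS]mulr_sumr.
Qed.

End L1norm.

(** * Eigenvalues and 2 x 2 minors *)

Section Eigenvalues.
Import ComplexField.Normc.
Context {R : realType} {n : nat}.
Notation d := n.+1.

Lemma normC_normc (z : R[i]) : `|z| = (normc z)%:C%C.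
Proof. by []. Qed.

Lemma normc_real (a : R) : normc a%:C%C = `|a|.
Proof. by rewrite /normc /= expr0n /= addr0 sqrtr_sqr. Qed.

Lemma lam2_complex m p (A : 'M[R]_(m, p)) :
  lam2 (map_mx (real_complex R) A) = (lam2 A)%:C%C.
Proof.
rewrite !lam2_pairE rmorph_sum; apply: eq_bigr => a _; rewrite rmorph_sum.
apply: eq_bigr => b _; rewrite normC_normc -normc_real.
congr (normc _)%:C%C; by rewrite /minor2 !mxE rmorphB !rmorphM.
Qed.

Lemma trigM (C : comNzRingType) (A B : 'M[C]_d) : is_trig_mx A -> is_trig_mx B ->
  is_trig_mx (A *m B) /\ forall i, (A *m B) i i = A i i * B i i.
Proof.
move=> /is_trig_mxP tA /is_trig_mxP tB; split.
  apply/is_trig_mxP => i j ij; rewrite mxE big1 // => k _.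
  have [ik|ki] := ltnP i k; first by rewrite tA // mul0r.
  by rewrite tB ?mulr0 // (leq_ltn_trans ki).
move=> i; rewrite mxE (bigD1 i) //= big1 ?addr0 // => k ki.
have [ik|] := ltnP i k; first by rewrite tA // mul0r.
rewrite leq_eqVlt (inj_eq val_inj) (negbTE ki) /= => ki'.
by rewrite tB ?mulr0.
Qed.

Lemma trigX (C : comNzRingType) (A : 'M[C]_d) k : is_trig_mx A ->
  is_trig_mx (A ^+ k) /\ forall i, (A ^+ k) i i = A i i ^+ k.
Proof.
move=> tA; elim: k => [|k [IH1 IH2]].
  by split=> [|i]; rewrite expr0 ?scalar_mx_is_trig ?mxE ?eqxx.
have [H1 H2] := trigM tA IH1; rewrite exprS; split => // i.
by rewrite H2 IH2 exprS.
Qed.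

Lemma unitary_entry (P : 'M[R[i]]_d) i j : P \is unitarymx -> `|P i j| <= 1.
Proof.
move=> /unitarymxP /matrixP /(_ i i); rewrite !mxE eqxx mulr1n => E.
rewrite -(@ler_pXn2r _ 2) ?nnegrE // expr1n -E (bigD1 j) //=.
rewrite !mxE -normCK lerDl sumr_ge0 // => k _.
by rewrite !mxE -normCK exprn_ge0.
Qed.

Lemma lam2_unitary (P : 'M[R[i]]_d) : P \is unitarymx ->
  lam2 P <= 2 * (d ^ 2)%:R ^+ 2.
Proof.
move=> uP; apply: (le_trans (lam2_le _)); rewrite ler_pM2l //.
rewrite lerXn2r ?nnegrE ?l1_ge0 //.
apply: (@le_trans _ _ (\sum_(i < d) \sum_(j < d) 1)).
  by apply: ler_sum => i _; apply: ler_sum => j _; exact: unitary_entry.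
by rewrite !sumr_const !card_ord -mulrnA.
Qed.

Definition schur_const : R := 4 * (d ^ 2)%:R ^+ 4.

(** The eigenvalues are the diagonal entries of a unitarily triangularised
    matrix, whose minors are controlled by those of the matrix itself; the
    diagonal minors of a triangular matrix are products of two eigenvalues. *)
Lemma eigenvalues_exist (A : 'M[R]_d) : exists D : 'I_d -> R[i],
  [/\ char_poly (map_mx (real_complex R) A) = \prod_i ('X - (D i)%:P),
      forall k, (\tr (A ^+ k))%:C%C = \sum_i D i ^+ k &
      forall i j, i != j -> normc (D i) * normc (D j) <= schur_const * lam2 A].
Proof.
set M := map_mx _ A.
have [P uP tP] := Schur M (ltn0Sn n).
have Pu := unitarymx_unit uP.
pose U := P *m M *m invmx P.
have {}tP : is_trig_mx U by rewrite /U -conjumx.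
have EM : M = invmx P *m U *m P by rewrite /U !mulmxA mulVmx // mul1mx mulmxKV.
have uV : invmx P \is unitarymx by rewrite (invmx_unitary uP) trmxC_unitary.
exists (fun i => U i i); split.
- rewrite -(char_poly_trig tP) /char_poly.
  have -> : char_poly_mx U = map_mx polyC P *m char_poly_mx M *m map_mx polyC (invmx P).
    rewrite /char_poly_mx mulmxBr mulmxBl -!map_mxM /= -/U; congr (_ - _).
    by rewrite scalar_mxC -mulmxA -map_mxM mulmxV // map_mx1 mulmx1.
  rewrite !det_mulmx mulrC mulrA -det_mulmx -map_mxM mulVmx //.
  by rewrite map_mx1 det1 mul1r.
- move=> k; have EX : map_mx (real_complex R) (A ^+ k) = invmx P *m (U ^+ k) *m P.
    rewrite rmorphXn /= -/M; elim: k => [|k IH].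
      by rewrite !expr0 mulmx1 mulVmx.
    rewrite !exprS IH {1}EM -[LHS]/(invmx P *m U *m P *m (invmx P *m U ^+ k *m P)).
    by rewrite -[RHS]/(invmx P *m (U *m U ^+ k) *m P) -!mulmxA (mulKVmx Pu).
  rewrite -trace_map_mx EX mxtrace_mulC mulmxA mulmxV // mul1mx.
  by apply: eq_bigr => i _; have [_ ->] := trigX k tP.
- move=> i j ij; 
  have Ec : schur_const%:C%C = 4 * (d ^ 2)%:R ^+ 4 :> R[i].
    by rewrite /schur_const rmorphM rmorphXn !rmorph_nat.
  rewrite -normcM -lecR [X in _ <= X]rmorphM; move: Ec.
  move: schur_const => c Ec; rewrite -[X in X <= _](normC_normc (U i i * U j j)).
  have -> : U i i * U j j = minor2 U i j i j.
    rewrite /minor2; move/is_trig_mxP: tP => tP.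
    have [ij'|] := ltnP i j; first by rewrite (tP i j) // mul0r subr0.
    rewrite leq_eqVlt (inj_eq val_inj) eq_sym (negbTE ij) /= => ji.
    by rewrite (tP j i) // mulr0 subr0.
  apply: (le_trans (minor2_le _ _ _ _ _)).
  apply: (le_trans (lam2M _ _)).
  apply: (@le_trans _ _ (2 * (d ^ 2)%:R ^+ 2 * lam2 M * (2 * (d ^ 2)%:R ^+ 2))).
    apply: ler_pM; rewrite ?lam2_ge0 // ?lam2_unitary //.
    apply: (le_trans (lam2M _ _)); apply: ler_wpM2r; [exact: lam2_ge0|exact: lam2_unitary].
  rewrite lam2_complex le_eqVlt; apply/orP; left; apply/eqP.
  rewrite /= Ec; ring.
Qed.
End Eigenvalues.

(** * Proximality from the trace, and powers of proximal elements *)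

Section Proximality.
Import ComplexField.Normc.
Context {R : realType} {n : nat}.
Notation d := n.+1.
Implicit Types g : SL R d.

Lemma eigenvalue_prodP g (D : 'I_d -> R[i]) :
  char_poly (complex_mx g) = \prod_i ('X - (D i)%:P) ->
  forall z, eigenvalue (complex_mx g) z = (z \in [seq D i | i <- enum 'I_d]).
Proof.
move=> E z; rewrite eigenvalue_root_char E -big_enum /=.
by rewrite -(big_map D xpredT (fun x => 'X - x%:P)) root_prod_XsubC.
Qed.

Lemma mup_prodP g (D : 'I_d -> R[i]) :
  char_poly (complex_mx g) = \prod_i ('X - (D i)%:P) ->
  forall z, mup z (char_poly (complex_mx g)) = #|[pred i | D i == z]|.
Proof.
move=> E z; rewrite E -big_enum /= -(big_map D xpredT (fun x => 'X - x%:P)).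
rewrite mu_prod_XsubC count_map cardE -size_filter {2}/enum_mem; congr size.
rewrite enumT; exact: eq_filter.
Qed.

Lemma spectral_radius_dominant g l : dominant_eigenvalue g l ->
  spectral_radius g = normc l.
Proof.
move=> gl; rewrite /spectral_radius.
set S := [set _ | _ in _]; have Sl : S (normc l).
  by exists l => //=; exact: dominant_eigenvalueE.
have ubS : ubound S (normc l).
  move=> _ [z /= gz <-]; have [->//|zl] := eqVneq z l.
  by have := gl.2 z gz zl; rewrite !normC_normc ltcR => /ltW.
apply/eqP; rewrite eq_le; apply/andP; split; first by apply: ge_sup => //; exists (normc l).
by apply: ub_le_sup => //; exists (normc l).
Qed.

Lemma normc_sum (I : finType) (P : pred I) (F : I -> R[i]) :
  normc (\sum_(i | P i) F i) <= \sum_(i | P i) normc (F i).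
Proof.
elim/big_rec2: _ => [|i y x _ H]; first by rewrite normc0.
by apply: (le_trans (le_normcD _ _)); rewrite lerD2l.
Qed.

Lemma normc_ge0 (z : R[i]) : 0 <= normc z.
Proof. by case: z => a b; exact: sqrtr_ge0. Qed.

Definition trace_const : R := d%:R ^+ 2 * schur_const (n := n).

Lemma trace_const_gt0 : 0 < trace_const.
Proof. by rewrite !mulr_gt0 // exprn_gt0 // ltr0n expn_gt0. Qed.

(** If the 2 x 2 minors are small compared with the trace, the product of any
    two eigenvalues is small, so that one eigenvalue carries the trace. *)
Lemma proximal_of_trace g :
  2 * trace_const * lam2 (g : 'M[R]_d) < (\tr (g : 'M[R]_d)) ^+ 2 ->
  exists2 l : R, dominant_eigenvalue g l%:C%C &
    `|l - \tr (g : 'M[R]_d)| * `|\tr (g : 'M[R]_d)|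
      <= trace_const * lam2 (g : 'M[R]_d).
Proof.
set t := \tr _; set m := lam2 _ => H.
have [D [Echar Etr Eprod]] := eigenvalues_exist (g : 'M[R]_d).
have m0 : 0 <= m by exact: lam2_ge0.
have d0 : 0 < d%:R :> R by rewrite ltr0n.
have sc0 : 0 < schur_const (R := R) (n := n).
  by rewrite !mulr_gt0 // exprn_gt0 // ltr0n expn_gt0.
have tc0 := trace_const_gt0.
have t0 : 0 < `|t|.
  rewrite normr_gt0; apply: contraTneq H => ->; rewrite expr0n /= -leNgt.
  by rewrite !mulr_ge0 // ltW.
pose i0 := [arg max_(i > ord0) normc (D i)]%O.
have Hi0 i : normc (D i) <= normc (D i0).
  by rewrite /i0; case: arg_maxP => // j _ /(_ i); apply.
have tD : t%:C%C = \sum_i D i.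
  by have := Etr 1%N; under [X in _ = X -> _]eq_bigr do rewrite expr1.
have tle : `|t| <= d%:R * normc (D i0).
  rewrite -normc_real tD (le_trans (normc_sum _ _)) //.
  apply: (@le_trans _ _ (\sum_(i < d) normc (D i0))); first exact: ler_sum.
  by rewrite sumr_const card_ord mulr_natl.
have small j : j != i0 -> normc (D j) * `|t| <= d%:R * (schur_const (n := n) * m).
  move=> ji0; apply: (le_trans (ler_wpM2l _ tle)); first exact: normc_ge0.
  by rewrite mulrCA ler_pM2l // Eprod.
have dom j : j != i0 -> normc (D j) < normc (D i0).
  move=> ji0; rewrite -(ltr_pM2r t0) (le_lt_trans (small _ ji0)) //.
  rewrite -(ltr_pM2l d0).
  apply: (@lt_le_trans _ _ (`|t| * `|t|)); last first.
    by rewrite mulrA ler_pM2r.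
  rewrite -expr2 real_normK ?num_real //; apply: le_lt_trans H.
  have -> : d%:R * (d%:R * (schur_const (n := n) * m)) = trace_const * m.
    by rewrite /trace_const; ring.
  have : 0 <= trace_const * m by rewrite mulr_ge0 // ltW.
  lra.
have gl : dominant_eigenvalue g (D i0).
  split.
    rewrite (mup_prodP Echar) -(card1 i0); apply: eq_card => i.
    rewrite !inE; apply/eqP/eqP => [Ei|->//].
    by apply/eqP; apply: contraT => /dom; rewrite Ei ltxx.
  move=> z; rewrite (eigenvalue_prodP Echar) => /mapP[i _ ->] zi.
  by rewrite !normC_normc ltcR dom //; apply: contraNneq zi => ->.
have lR := dominant_eigenvalue_real gl.
exists (complex.Re (D i0)); first by rewrite -lR.
have -> : `|complex.Re (D i0) - t| = normc (\sum_(j | j != i0) D j).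
  have E : (complex.Re (D i0) - t)%:C%C = D i0 - \sum_i D i.
    by rewrite [in RHS]lR -tD rmorphB.
  rewrite -normc_real E (bigD1 i0) //= opprD addrA subrr add0r.
  by rewrite normcN.
apply: (@le_trans _ _ (\sum_(j | j != i0) normc (D j) * `|t|)).
  by rewrite -mulr_suml ler_pM2r // normc_sum.
apply: (@le_trans _ _ (\sum_(j < d) d%:R * (schur_const (n := n) * m))).
  rewrite big_mkcond; apply: ler_sum => j _.
  case: ifPn => [/small//|_]; rewrite !mulr_ge0 //; exact: ltW.
have -> : trace_const * m = d%:R * (d%:R * (schur_const (n := n) * m)).
  by rewrite /trace_const; ring.
by rewrite sumr_const card_ord -[X in X <= _]mulr_natl lexx.
Qed.

Lemma expr_small (x e : R) : 0 <= x -> x < 1 -> 0 < e ->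
  exists K, forall k, (K <= k)%N -> x ^+ k < e.
Proof.
move=> x0 x1 e0; have nx : `|x| < 1 by rewrite ger0_norm.
have /cvgrPdist_lt /(_ _ e0) [K _ HK] := cvg_expr nx.
exists K => k /HK /=; rewrite sub0r normrN ger0_norm //.
exact: exprn_ge0.
Qed.


Lemma contraction_tends0 (a c : nat -> R) (x : R) : 0 <= x -> x < 1 ->
  (forall k, 0 <= a k) ->
  (forall k, a k.+1 <= x * a k + c k) ->
  (forall e, 0 < e -> exists K, forall k, (K <= k)%N -> c k < e) ->
  forall e, 0 < e -> exists K, forall k, (K <= k)%N -> a k < e.
Proof.
move=> x0 x1 a0 ac c0 e e0; have y0 : 0 < 1 - x by rewrite subr_gt0.
have [|K1 HK1] := c0 (e / 2 * (1 - x)); first by rewrite mulr_gt0 // divr_gt0.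
have H k : a (K1 + k)%N <= x ^+ k * a K1 + e / 2.
  elim: k => [|k IH]; first by rewrite addn0 expr0 mul1r lerDl; lra.
  rewrite addnS; apply: (le_trans (ac _)).
  have := ltW (HK1 _ (leq_addr k K1)); have := ler_wpM2l x0 IH.
  rewrite exprS; lra.
have [|K2 HK2] := @expr_small x (e / 2 / (a K1 + 1)) x0 x1.
  by rewrite !divr_gt0 // ltr_wpDl.
exists (K1 + K2)%N => k kK; have -> : k = (K1 + (k - K1))%N.
  by rewrite subnKC // (leq_trans _ kK) ?leq_addr.
apply: (le_lt_trans (H _)).
have /HK2 : (K2 <= k - K1)%N by rewrite leq_subRL // (leq_trans _ kK) // leq_addr.
rewrite ltr_pdivlMr ?ltr_wpDl // => H2.
have : 0 <= x ^+ (k - K1) by exact: exprn_ge0.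
have := a0 K1; lra.
Qed.

(** Over the complex numbers, the powers of a matrix annihilated on Y by a
    product of factors X - z with |z| < 1 tend to zero on Y: the factors are
    removed one at a time, each leaving a contracting recurrence. *)
Lemma powers_tend0 (M : 'M[R[i]]_d) (s : seq R[i]) (Y : 'M[R[i]]_d) :
  {in s, forall z, normc z < 1} ->
  horner_mx M (\prod_(z <- s) ('X - z%:P)) * Y = 0 ->
  forall e : R, 0 < e -> exists K, forall k, (K <= k)%N -> l1 (M ^+ k * Y) < e%:C%C.
Proof.
elim: s Y => [|z s IH] Y s1.
  rewrite big_nil rmorph1 mul1r => -> e e0; exists 0%N => k _.
  by rewrite mulr0 l1_0 (ltcR 0).
rewrite big_cons mulrC rmorphM -mulrA => H.
have s1' : {in s, forall w, normc w < 1}.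
  by move=> w ws; apply: s1; rewrite in_cons ws orbT.
have {}IH := IH _ s1' H.
have ReE k Z : l1 (M ^+ k * Z) = (complex.Re (l1 (M ^+ k * Z)))%:C%C.
  by rewrite RRe_real // ger0_real // l1_ge0.
have H1 e : 0 < e -> exists K, forall k, (K <= k)%N ->
    complex.Re (l1 (M ^+ k * Y)) < e.
  apply: (@contraction_tends0 _
    (fun k => complex.Re (l1 (M ^+ k * (horner_mx M ('X - z%:P) * Y)))) (normc z)).
  - exact: normc_ge0.
  - by apply: s1; rewrite mem_head.
  - by move=> k; rewrite -lecR -ReE l1_ge0.
  - move=> k; rewrite -lecR rmorphD rmorphM /= -!ReE.
    have -> : M ^+ k.+1 * Y = z *: (M ^+ k * Y) + M ^+ k * (horner_mx M ('X - z%:P) * Y).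
      rewrite rmorphB /= horner_mx_X horner_mx_C mulrBl mulrBr.
      rewrite -[z%:M * Y]/(z%:M *m Y) mul_scalar_mx -scalerAr addrC subrK.
      by rewrite mulrA -exprSr.
    by apply: (le_trans (l1D _ _)); rewrite l1Z normC_normc.
  - by move=> e' e'0; have [K HK] := IH _ e'0; exists K => k /HK; rewrite ReE ltcR.
move=> e /H1 [K HK]; exists K => k /HK; by rewrite ReE ltcR.
Qed.

Lemma tends0_eq0 (a : R) : 0 <= a -> (forall e, 0 < e -> a < e) -> a = 0.
Proof.
move=> a0 H; apply/eqP; rewrite eq_le a0 andbT leNgt.
by apply/negP => /H; rewrite ltxx.
Qed.

(** The rank of an idempotent is its trace. *)
Lemma idempotent_trace1 (P : 'M[R]_d) : P *m P = P -> \tr P = 1 ->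
  exists (v : 'rV[R]_d) (u : 'cV[R]_d), P = u *m v /\ pair v u = 1.
Proof.
move=> PP tP; have E := mulmx_base P.
have main r (U : 'M[R]_(d, r)) (V : 'M[R]_(r, d)) :
    row_full U -> row_free V -> U *m V = P -> V *m U = 1%:M.
  move=> /row_fullP[U' HU] /row_freeP[V' HV] UV.
  have : U' *m (P *m P) *m V' = U' *m P *m V' by rewrite PP.
  by rewrite -UV !mulmxA HU mul1mx -!mulmxA HV mulmx1.
have VU := main _ _ _ (col_base_full P) (row_base_free P) E.
have : \tr P = (\rank P)%:R by rewrite -{1}E mxtrace_mulC VU mxtrace1.
rewrite tP => /esym /eqP; rewrite pnatr_eq1 => /eqP rP.
move: (col_base P) (row_base P) E VU; rewrite rP => U V E VU.
by exists V, U; rewrite E /pair VU mxE.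
Qed.

(** The powers of a proximal matrix, normalised by its dominant eigenvalue,
    converge to the projector onto the dominant eigenline. *)
Lemma proximal_limit g : proximal_elt g -> exists (l : R) (v : 'rV[R]_d) (u : 'cV[R]_d),
  [/\ l != 0, pair v u = 1, (g : 'M[R]_d) *m u = l *: u, v *m (g : 'M[R]_d) = l *: v &
    forall e, 0 < e -> exists K, forall k, (K <= k)%N ->
      l1 ((l^-1 *: (g : 'M[R]_d)) ^+ k - u *m v) < e].
Proof.
move=> [lc gl]; have lR := dominant_eigenvalue_real gl.
rewrite lR in gl; move: (complex.Re lc) gl => {lR lc} l gl.
have [D [Echar Etr _]] := eigenvalues_exist (g : 'M[R]_d).
have l0 : l != 0.
  apply/eqP => l0; have := dominant_eigenvalueE gl; rewrite l0.
  move=> /eigenvalueP[w]; rewrite scale0r => gw /negP; apply; apply/eqP.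
  have gu : complex_mx g \in unitmx by rewrite map_unitmx SL_unitmx.
  by rewrite -[w](mulmxK gu) gw mul0mx.
have l0C : l%:C%C != 0 :> R[i] by rewrite (inj_eq (@complexI R) _ 0).
pose N := l^-1 *: (g : 'M[R]_d).
pose M := map_mx (real_complex R) N.
have EM : M = l%:C%C^-1 *: complex_mx g by rewrite /M /N map_mxZ fmorphV.
pose z i := D i / l%:C%C.
have [i0 Di0] : exists i0, [pred i | D i == l%:C%C] =i pred1 i0.
  by apply/card1P; rewrite -(mup_prodP Echar) gl.1.
have zi0 : z i0 = 1.
  by have := Di0 i0; rewrite !inE eqxx => /eqP Ei0; rewrite /z Ei0 divff.
have z1 i : i != i0 -> normc (z i) < 1.
  move=> ii0; rewrite normcM normcV normc_real ltr_pdivrMr ?normr_gt0 // mul1r.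
  rewrite -normc_real -ltcR -!normC_normc; apply: gl.2.
    by rewrite (eigenvalue_prodP Echar) map_f // mem_enum.
  by have := Di0 i; rewrite !inE (negbTE ii0) => ->.
have HM : horner_mx M (\prod_i ('X - (z i)%:P)) = 0.
  have := Cayley_Hamilton (complex_mx g); rewrite Echar !rmorph_prod /= => H.
  under eq_bigr => i _.
    have -> : horner_mx M ('X - (z i)%:P) =
        l%:C%C^-1 *: horner_mx (complex_mx g) ('X - (D i)%:P).
      rewrite !rmorphB /= !horner_mx_X !horner_mx_C EM scalerBr; congr (_ - _).
      by rewrite scale_scalar_mx mulrC.
    over.
  by rewrite scaler_prod H scaler0.
rewrite (bigD1 i0) //= rmorphM /= in HM.
set q := \prod_(i | i != i0) ('X - (z i)%:P) in HM.
set Q := horner_mx M q in HM.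
have MQ : M * Q = Q.
  move: HM; rewrite zi0 rmorphB /= horner_mx_X horner_mx_C mulrBl mul1r.
  by move/eqP; rewrite subr_eq0 => /eqP.
have rQ r : horner_mx M r * Q = r.[1] *: Q.
  elim/poly_ind: r => [|r c IH]; first by rewrite rmorph0 mul0r horner0 scale0r.
  rewrite rmorphD rmorphM /= horner_mx_X horner_mx_C mulrDl -mulrA MQ IH.
  by rewrite hornerMXaddC mulr1 scalerDl -[c%:M * Q]/(c%:M *m Q) mul_scalar_mx.
have q1 : q.[1] != 0.
  rewrite horner_prod; apply/prodf_neq0 => i ii0; rewrite !hornerE subr_eq0.
  by apply: contraTneq (z1 i ii0) => <-; rewrite normc1 ltxx.
pose p := q.[1]^-1 *: Q.
have Mp k : M ^+ k * p = p.
  elim: k => [|k IH]; first by rewrite expr0 mul1r.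
  by rewrite exprS -mulrA IH /p -scalerAr MQ.
have Qp : Q * (1 - p) = 0.
  by rewrite mulrBr mulr1 /p -scalerAr rQ scalerA mulVf // scale1r subrr.
have cvC e : 0 < e -> exists K, forall k, (K <= k)%N -> l1 (M ^+ k - p) < e%:C%C.
  move=> e0; have [||K HK] := @powers_tend0 M [seq z i | i <- enum [pred i | i != i0]]
      (1 - p) _ _ e e0.
  - by move=> _ /mapP[i + ->]; rewrite mem_enum inE => /z1.
  - by rewrite big_map -[RHS]Qp big_enum.
  by exists K => k /HK; rewrite mulrBr mulr1 Mp.
pose P := map_mx (@complex.Re R) p.
have cvN e : 0 < e -> exists K, forall k, (K <= k)%N -> l1 (N ^+ k - P) < e.
  move=> /cvC [K HK]; exists K => k /HK H; rewrite -ltcR; apply: le_lt_trans H.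
  rewrite rmorph_sum ler_sum // => i _; rewrite rmorph_sum ler_sum // => j _ /=.
  have -> : (N ^+ k - P) i j = complex.Re ((M ^+ k - p) i j).
    rewrite !mxE raddfB /=; congr (_ - _).
    by rewrite /M -rmorphXn /= mxE.
  exact: normc_ge_Re.
have eq_lim A B : (forall e, 0 < e -> l1 (A - B) < e) -> A = B :> 'M[R]_d.
  move=> H; apply/eqP; rewrite -subr_eq0 -l1_eq0; apply/eqP.
  by apply: tends0_eq0; rewrite ?l1_ge0.
have N1 : 0 < l1 N + 1 by rewrite ltr_wpDl // l1_ge0.
have NP : N * P = P.
  apply: eq_lim => e e0.
  have [|K HK] := cvN (e / (l1 N + 1)); first by rewrite divr_gt0.
  have -> : N * P - P = (N ^+ K.+1 - P) - N * (N ^+ K - P).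
    by rewrite mulrBr -exprS opprB [in RHS]addrC addrA subrK.
  apply: (le_lt_trans (l1B _ _)).
  apply: (le_lt_trans (lerD (lexx _) (l1M _ _))).
  have := HK _ (leqnSn K); have := HK _ (leqnn K).
  rewrite !ltr_pdivlMr // => H1 H2; have := l1_ge0 N; have := l1_ge0 (N ^+ K - P).
  have := l1_ge0 (N ^+ K.+1 - P).
  nra.
have PN : P * N = P.
  apply: eq_lim => e e0.
  have [|K HK] := cvN (e / (l1 N + 1)); first by rewrite divr_gt0.
  have -> : P * N - P = (N ^+ K.+1 - P) - (N ^+ K - P) * N.
    by rewrite mulrBl -exprSr opprB [in RHS]addrC addrA subrK.
  apply: (le_lt_trans (l1B _ _)).
  apply: (le_lt_trans (lerD (lexx _) (l1M _ _))).
  have := HK _ (leqnSn K); have := HK _ (leqnn K).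
  rewrite !ltr_pdivlMr // => H1 H2; have := l1_ge0 N; have := l1_ge0 (N ^+ K - P).
  have := l1_ge0 (N ^+ K.+1 - P).
  nra.
have NkP k : N ^+ k * P = P.
  by elim: k => [|k IH]; rewrite ?expr0 ?mul1r // exprS -mulrA IH.
have P1 : 0 < l1 P + 1 by rewrite ltr_wpDl // l1_ge0.
have PP : P *m P = P.
  apply: eq_lim => e e0.
  have [|K HK] := cvN (e / (l1 P + 1)); first by rewrite divr_gt0.
  have -> : P *m P - P = - ((N ^+ K - P) * P).
    by rewrite mulrBl NkP opprB.
  rewrite l1N; apply: (le_lt_trans (l1M _ _)).
  have := HK _ (leqnn K); rewrite !ltr_pdivlMr // => H1.
  have := l1_ge0 (N ^+ K - P); have := l1_ge0 P; nra.
have trP : \tr P = 1.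
  apply/eqP; rewrite -subr_eq0 -normr_eq0; apply/eqP; apply: tends0_eq0 => // e e0.
  pose x := \big[Order.max/0]_(i | i != i0) normc (z i).
  have x0 : 0 <= x by rewrite /x; elim/big_rec: _ => // i y _ y0; rewrite le_max normc_ge0.
  have x1 : x < 1 by apply: bigmax_lt => // i /z1.
  have [|K1 HK1] := cvN (e / 2); first by rewrite divr_gt0.
  have [|K2 HK2] := @expr_small x (e / 2 / d%:R) x0 x1.
    by rewrite !divr_gt0 // ltr0n.
  set k := maxn K1 K2.
  have HA : `|\tr P - \tr (N ^+ k)| < e / 2.
    rewrite distrC -raddfB; apply: le_lt_trans (HK1 k (leq_maxl _ _)).
    exact: mxtrace_le.
  have HB : `|\tr (N ^+ k) - 1| < e / 2.
    have H := HK2 k (leq_maxr _ _); rewrite ltr_pdivlMr ?ltr0n // in H.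
    apply: le_lt_trans H.
    have -> : `|\tr (N ^+ k) - 1| = normc (\sum_(i | i != i0) z i ^+ k).
      rewrite -normc_real.
      have -> : (\tr (N ^+ k) - 1)%:C%C = (\tr (N ^+ k))%:C%C - 1 :> R[i].
        by rewrite rmorphB rmorph1.
      congr normc.
      have -> : N ^+ k = (l^-1 ^+ k) *: ((g : 'M[R]_d) ^+ k) by rewrite exprZn.
      rewrite linearZ rmorphM /= Etr rmorphXn fmorphV mulr_sumr.
      rewrite (bigD1 i0) //= -exprMn [_^-1 * _]mulrC -/(z i0) zi0 expr1n addrAC subrr add0r.
      by apply: eq_bigr => i _; rewrite -exprMn [_^-1 * _]mulrC.
    apply: (le_trans (normc_sum _ _)).
    apply: (@le_trans _ _ (\sum_(i < d) x ^+ k)); last first.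
      by rewrite sumr_const card_ord -[X in X <= _]mulr_natr lexx.
    rewrite big_mkcond; apply: ler_sum => i _; case: ifPn => ii0; last exact: exprn_ge0.
    have -> : normc (z i ^+ k) = normc (z i) ^+ k.
      elim: (k) => [|k' IH]; first by rewrite !expr0 normc1.
      by rewrite !exprS normcM IH.
    by rewrite lerXn2r ?nnegrE ?normc_ge0 // /x (bigD1 i) //= le_max lexx.
  have := ler_distD (\tr (N ^+ k)) (\tr P) 1; lra.
have [v [u [Puv vu]]] := idempotent_trace1 PP trP.
have Nu : N *m u = u.
  have : N * P *m u = P *m u by rewrite NP.
  by rewrite -[N * P]/(N *m P) Puv -!mulmxA pairE vu mulmx1.
have vN : v *m N = v.
  have : v *m (P * N) = v *m P by rewrite PN.
  by rewrite -[P * N]/(P *m N) Puv !mulmxA pairE vu mul1mx.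
exists l, v, u; split => //.
- by rewrite -[in RHS]Nu /N -scalemxAl scalerA divff // scale1r.
- by rewrite -[in RHS]vN /N -scalemxAr scalerA divff // scale1r.
- by rewrite -Puv.
Qed.
End Proximality.

(** * Outer masses and convolution powers *)

(** The integral of a nonnegative function is a supremum over simple functions
    below it, so it is monotone without measurability. *)
Lemma le_integral_any d (T : measurableType d) (R : realType)
    (mu : {measure set T -> \bar R}) (D : set T) (f g : T -> \bar R) :
  (forall x, D x -> 0 <= f x)%E -> (forall x, D x -> f x <= g x)%E ->
  (\int[mu]_(x in D) f x <= \int[mu]_(x in D) g x)%E.
Proof.
move=> f0 fg; rewrite integral_mkcond [leRHS]integral_mkcond.
have f0' x : (0 <= (f \_ D) x)%E by exact: erestrict_ge0.
have fg' x : ((f \_ D) x <= (g \_ D) x)%E by apply: lee_restrict.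
rewrite !ge0_integralTE // => [|x]; last exact: le_trans (f0' x) (fg' x).
apply: le_ereal_sup => _ [h /= hf <-]; exists h => //= x.
exact: le_trans (hf x) (fg' x).
Qed.

(** The sets of words used below are images under multiplication, of which no
    measurability is available; their outer measure suffices. *)
Definition outer_ge d (T : measurableType d) (R : realType)
    (mu : set T -> \bar R) (q : R) (S : set T) :=
  forall E, measurable E -> S `<=` E -> (q%:E <= mu E)%E.

Lemma outer_ge_sub d (T : measurableType d) (R : realType)
    (mu : set T -> \bar R) (q : R) (S S' : set T) :
  S `<=` S' -> outer_ge mu q S -> outer_ge mu q S'.
Proof. by move=> SS' H E mE S'E; apply: H => //; exact: subset_trans S'E. Qed.

Section Balls.
Context {R : realType} {d : nat}.
Implicit Types g h : SL R d.

Definition SLball g (e : R) : set (SL R d) :=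
  [set h | l1 (SLval h - SLval g) < e].

Lemma measurable_SLball g e : measurable (SLball g e).
Proof.
have mf : measurable_fun setT (fun h : SL R d => l1 (SLval h - SLval g)).
  apply: measurable_sum => i; apply: measurable_sum => j.
  apply: measurableT_comp => //.
  under eq_fun do rewrite !mxE.
  by apply: measurable_funB => //; exact: measurable_SL_coord.
have -> : SLball g e =
    (fun h : SL R d => l1 (SLval h - SLval g)) @^-1` `]-oo, e[.
  by apply/seteqP; split => h; rewrite /SLball /= in_itv.
by rewrite -[X in measurable X]setTI; apply: mf.
Qed.

Lemma SLball_center g e : 0 < e -> SLball g e g.
Proof. by move=> e0; rewrite /SLball /= subrr l1_0. Qed.

Lemma SLball_nbhs g e : 0 < e -> exists U, [/\ open U, U g & U `<=` SLball g e].
Proof.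
move=> e0; pose del := e / (d * d).+1%:R.
have del0 : 0 < del by rewrite divr_gt0 // ltr0n.
exists ((@SLval R d) @^-1` (ball (SLval g) del)^°); split.
- exists (ball (SLval g) del)^° => //; exact: open_interior.
- exact: nbhsx_ballx.
- move=> h /= /interior_subset [_ H]; rewrite /SLball /=.
  apply: (@le_lt_trans _ _ (\sum_(i < d) \sum_(j < d) del)).
    apply: ler_sum => i _; apply: ler_sum => j _; rewrite !mxE distrC.
    exact: ltW (H i j).
  rewrite !sumr_const !card_ord -mulrnA -mulr_natr /del mulrAC.
  by rewrite ltr_pdivrMr ?ltr0n // ltr_pM2l // ltr_nat.
Qed.

Lemma SL_mulE g h : (g * h)%g = g *m h :> 'M[R]_d.
Proof. by []. Qed.

Lemma SL_invE g : (g^-1)%g = invmx g :> 'M[R]_d.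
Proof. by []. Qed.

Lemma SLball_mul g h e1 e2 e g' h' :
  l1 (SLval g) * e2 + e1 * (l1 (SLval h) + e2) <= e ->
  SLball g e1 g' -> SLball h e2 h' -> SLball (g * h)%g e (g' * h')%g.
Proof.
rewrite /SLball /= => He H1 H2; apply: lt_le_trans He.
have -> : SLval g' *m SLval h' - SLval g *m SLval h =
    SLval g *m (SLval h' - SLval h) + (SLval g' - SLval g) *m SLval h'.
  by rewrite mulmxBr mulmxBl [RHS]addrC addrA subrK.
apply: (le_lt_trans (l1D _ _)).
apply: (le_lt_trans (lerD (l1M _ _) (l1M _ _))).
have l1h' : l1 (SLval h') <= l1 (SLval h) + l1 (SLval h' - SLval h).
  by have := l1D (SLval h) (SLval h' - SLval h); rewrite addrC subrK.
have a0 := l1_ge0 (SLval g); have b0 := l1_ge0 (SLval h).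
have c0 := l1_ge0 (SLval h' - SLval h); have f0 := l1_ge0 (SLval g' - SLval g).
have h0 := l1_ge0 (SLval h').
have : l1 (SLval g' - SLval g) * l1 (SLval h') < e1 * (l1 (SLval h) + e2).
  apply: le_lt_trans (_ : _ <= l1 (SLval g' - SLval g) * (l1 (SLval h) + e2)) _.
    by rewrite ler_wpM2l //; lra.
  by rewrite ltr_pM2r //; lra.
have : l1 (SLval g) * l1 (SLval h' - SLval h) <= l1 (SLval g) * e2.
  by rewrite ler_wpM2l // ltW.
lra.
Qed.

End Balls.

Section ConvolutionPowers.
Context {R : realType} {d : nat}.
Implicit Types (g h : SL R d) (rho : probability (SL R d) R).

Lemma measurable_translate g (A : set (SL R d)) : measurable A ->
  measurable [set h | A (g * h)%g].
Proof.
move=> mA; have -> : [set h | A (g * h)%g] = xsection (SL_prod @^-1` A) g.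
  by rewrite xsectionE.
apply: measurable_xsection; rewrite -[X in measurable X]setTI.
exact: (@measurable_SL_mul R d).
Qed.

Lemma convolution_powerS rho m (A : set (SL R d)) :
  convolution_power rho m.+1 A =
  (\int[rho]_g convolution_power rho m [set h | A (g * h)%g])%E.
Proof.
rewrite /=; transitivity (\int[rho]_g (convolution_power rho m \o
  xsection (SL_prod @^-1` A)) g)%E => //.
by apply: eq_integral => g _ /=; rewrite xsectionE.
Qed.

Lemma measurable_convolution_section rho m (A : set (SL R d)) : measurable A ->
  measurable_fun setT (fun g => convolution_power rho m [set h | A (g * h)%g]).
Proof.
move=> mA; have mA' : measurable (SL_prod @^-1` A : set (SL R d * SL R d)).
  by rewrite -[X in measurable X]setTI; exact: (@measurable_SL_mul R d).
have := measurable_fun_xsection (convolution_power rho m) mA'.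
by congr (measurable_fun _ _); apply/funext => g /=; rewrite xsectionE.
Qed.

(** Only inequalities are propagated, by induction on m: integrating over the
    first letter replaces G and E by their translates. *)
Lemma convolution_power_outer rho m k (G : set (SL R d)) (b : R) S E :
  0 <= b -> measurable G -> measurable E ->
  outer_ge (convolution_power rho k) b S ->
  (forall g h, G g -> S h -> E (g * h)%g) ->
  (convolution_power rho m G * b%:E <= convolution_power rho (m + k) E)%E.
Proof.
move=> b0 + + HS; elim: m G E => [|m IH] G E mG mE GE.
  rewrite add0n /= /dirac indicE; case: (boolP (_ \in G)) => /=.
    by rewrite inE mul1e => G1; apply: HS => // h /(GE _ _ G1); rewrite mul1g.
  by rewrite mul0e.
rewrite addSn !convolution_powerS -ge0_integralZr //; last first.
  exact: measurable_convolution_section.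
apply: le_integral_any => g _.
  by rewrite mule_ge0 ?lee_fin // measure_ge0.
apply: IH => //; try exact: measurable_translate.
by move=> h h' /= Gh Sh; rewrite mulgA; exact: GE.
Qed.


(** The support of the m-th convolution power, expressed with balls for the l1
    norm. *)
Definition power_support rho m : set (SL R d) :=
  [set g | forall e, 0 < e -> (0 < convolution_power rho m (SLball g e))%E].

Lemma power_support_mul rho m k g h :
  power_support rho m g -> power_support rho k h -> power_support rho (m + k) (g * h)%g.
Proof.
move=> sg sh e e0.
pose e1 := Num.min 1 (e / (l1 (SLval g) + l1 (SLval h) + 2)).
have D0 : 0 < l1 (SLval g) + l1 (SLval h) + 2.
  by have := l1_ge0 (SLval g); have := l1_ge0 (SLval h); lra.
have e10 : 0 < e1 by rewrite lt_min ltr01 divr_gt0.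
have He : l1 (SLval g) * e1 + e1 * (l1 (SLval h) + e1) <= e.
  have e11 : e1 <= 1 by rewrite ge_min lexx.
  have : e1 * (l1 (SLval g) + l1 (SLval h) + 2) <= e.
    by rewrite -ler_pdivlMr // ge_min lexx orbT.
  nra.
have := sg _ e10; have := sh _ e10.
set G := SLball g e1; set H := SLball h e1 => H0 G0.
have mH : measurable H by exact: measurable_SLball.
have fH : convolution_power rho k H \is a fin_num by exact: fin_num_measure.
apply: (@lt_le_trans _ _ (convolution_power rho m G * (fine (convolution_power rho k H))%:E)%E).
  by rewrite fineK // mule_gt0.
apply: (@convolution_power_outer rho m k G _ H).
- by rewrite fine_ge0 // measure_ge0.
- exact: measurable_SLball.
- exact: measurable_SLball.
- by move=> E mE HE; rewrite fineK // le_measure // inE.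
- by move=> g' h'; exact: SLball_mul.
Qed.

Lemma convolution_power1 rho A : measurable A -> convolution_power rho 1 A = rho A.
Proof.
move=> mA; rewrite convolution_powerS /= -[in RHS](setIT A) -integral_indic //.
apply: eq_integral => g _; rewrite /dirac !indicE.
suff -> : ((1%g : SL R d) \in [set h | A (g * h)%g]) = (g \in A) by [].
by apply/idP/idP; rewrite !inE /= mulg1.
Qed.

Lemma measure_support1 rho g :
  (forall U, open U -> U g -> (0 < rho U)%E) -> power_support rho 1 g.
Proof.
move=> sg e e0; rewrite convolution_power1; last exact: measurable_SLball.
have [U [oU Ug UB]] := SLball_nbhs g e0.
apply: (lt_le_trans (sg _ oU Ug)); apply: le_measure; rewrite ?inE //.
  exact: sub_sigma_algebra.
exact: measurable_SLball.
Qed.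

End ConvolutionPowers.

(** * The projective action and stationary measures *)

Section ProjectiveAction.
Context {R : realType} {d : nat}.
Implicit Types (g h : SL R d) (u v : 'cV[R]_d) (x y z : projspace R d).

Lemma enorm_le_l1 u : enorm u <= l1 u.
Proof.
rewrite -(@ler_pXn2r _ 2) ?nnegrE ?enorm_ge0 ?l1_ge0 // sqr_enorm /dotp expr2.
rewrite {1}/l1 mulr_suml; apply: ler_sum => i _; rewrite big_ord1.
apply: (le_trans (ler_norm _)); rewrite normrM ler_wpM2l //.
exact: l1_entry.
Qed.

Lemma entry_le_enorm u i : `|u i ord0| <= enorm u.
Proof.
rewrite -(@ler_pXn2r _ 2) ?nnegrE ?enorm_ge0 // sqr_enorm real_normK ?num_real //.
rewrite /dotp (bigD1 i) //= -expr2 lerDl sumr_ge0 // => j _.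
by rewrite -expr2 sqr_ge0.
Qed.

Lemma l1_le_enorm u : l1 u <= d%:R * enorm u.
Proof.
rewrite /l1; apply: (@le_trans _ _ (\sum_(i < d) enorm u)).
  by apply: ler_sum => i _; rewrite big_ord1 entry_le_enorm.
by rewrite sumr_const card_ord mulr_natl.
Qed.

Lemma wedge_le_lam2 u v : wedge_norm u v <= lam2 (row_mx u v).
Proof.
rewrite -(@ler_pXn2r _ 2) ?nnegrE ?wedge_norm_ge0 ?lam2_ge0 //.
rewrite sqr_sqrtr; last by apply: sumr_ge0 => p _; rewrite sqr_ge0.
rewrite expr2 {1}lam2_pairE mulr_suml.
rewrite [X in X <= _]big_mkcond; apply: ler_sum => p _.
have H : `|u p.1 ord0 * v p.2 ord0 - u p.2 ord0 * v p.1 ord0| <=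
    \sum_q `|minor2 (row_mx u v) p.1 p.2 q.1 q.2|.
  rewrite (bigD1 (lshift 1 ord0, rshift 1 ord0)) //=.
  rewrite /minor2 !row_mxEl !row_mxEr [X in _ <= `|_ - X| + _]mulrC.
  by rewrite lerDl sumr_ge0.
case: ifP => _; last by rewrite mulr_ge0 ?lam2_ge0 ?sumr_ge0.
rewrite -(@real_normK _ (_ - _)) ?num_real // expr2; apply: ler_pM => //.
apply: le_trans (minor2_le (row_mx u v) p.1 p.2 (lshift 1 ord0) (rshift 1 ord0)).
by rewrite /minor2 !row_mxEl !row_mxEr [X in _ <= `|_ - X|]mulrC.
Qed.

Lemma minor_le_wedge u v i j :
  `|u i ord0 * v j ord0 - u j ord0 * v i ord0| <= wedge_norm u v.
Proof.
wlog ij : i j / (i < j)%N.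
  move=> H; case: (ltngtP i j) => [/H//|/H|/val_inj ->].
    by rewrite distrC.
  by rewrite subrr normr0 wedge_norm_ge0.
rewrite -(@ler_pXn2r _ 2) ?nnegrE ?wedge_norm_ge0 // real_normK ?num_real //.
rewrite sqr_sqrtr; last by apply: sumr_ge0 => p _; rewrite sqr_ge0.
rewrite (bigD1 (i, j)) //= lerDl; apply: sumr_ge0 => p _; exact: sqr_ge0.
Qed.

Lemma lam2_le_wedge u v : lam2 (row_mx u v) <= (d * d * 4)%:R * wedge_norm u v.
Proof.
have H i j (k l : 'I_(1 + 1)) : `|minor2 (row_mx u v) i j k l| <= wedge_norm u v.
  have w0 := wedge_norm_ge0 u v.
  case: (split_ordP k) => k' ->; case: (split_ordP l) => l' ->;
    rewrite /minor2 ?row_mxEl ?row_mxEr !ord1.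
  - by rewrite mulrC subrr normr0.
  - by rewrite [X in `|_ - X|]mulrC; exact: minor_le_wedge.
  - by rewrite distrC [X in `|_ - X|]mulrC; exact: minor_le_wedge.
  - by rewrite mulrC subrr normr0.
rewrite /lam2; apply: (@le_trans _ _ (\sum_(i < d) \sum_(j < d) \sum_(k < 1 + 1)
    \sum_(l < 1 + 1) wedge_norm u v)).
  by do 4! [apply: ler_sum => ? _]; exact: H.
rewrite !sumr_const !card_ord -!mulrnA -[X in X <= _]mulr_natl.
set N := (X in X%:R * _ <= _); have -> : N = (d * d * 4)%N by rewrite /N; ring.
exact: lexx.
Qed.

Lemma wedge_mulmx (A : 'M[R]_d) u v :
  wedge_norm (A *m u) (A *m v) <= lam2 A * ((d * d * 4)%:R * wedge_norm u v).
Proof.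
apply: (le_trans (wedge_le_lam2 _ _)); rewrite -mul_mx_row.
apply: (le_trans (lam2M _ _)); rewrite ler_wpM2l ?lam2_ge0 //.
exact: lam2_le_wedge.
Qed.

Lemma enorm_mulmx (A : 'M[R]_d) u : enorm (A *m u) <= l1 A * (d%:R * enorm u).
Proof.
apply: (le_trans (enorm_le_l1 _)); apply: (le_trans (l1M _ _)).
by rewrite ler_wpM2l ?l1_ge0 ?l1_le_enorm.
Qed.

Lemma act_line g x u : u \in line x -> g *m u \in line (act g x).
Proof. by move=> ux; have := memv_img (linfun (mulmx (SLval g))) ux; rewrite lfunE. Qed.

Lemma SL_mul_neq0 g u : u != 0 -> g *m u != 0.
Proof.
apply: contra_neq => gu.
by rewrite -(mulKmx (SL_unitmx g) u) gu mulmx0.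
Qed.

(** The action is Lipschitz on the projective space, hence Borel; the inverse
    matrix bounds the norms of the images from below. *)
Lemma proj_dist_act g x y : proj_dist (act g x) (act g y) <=
  lam2 (SLval g) * (d * d * 4)%:R * (l1 (invmx (SLval g)) * d%:R) ^+ 2 * proj_dist x y.
Proof.
set u := vpick x; set v := vpick y.
have [u0 v0] : u != 0 /\ v != 0 by split; exact: vpick_proj_neq0.
have [ux vy] : u \in line x /\ v \in line y by split; exact: memv_pick.
rewrite (proj_distE ux u0 vy v0).
rewrite (proj_distE (act_line g ux) (SL_mul_neq0 g u0) (act_line g vy) (SL_mul_neq0 g v0)).
have inv w : enorm w <= l1 (invmx (SLval g)) * d%:R * enorm (g *m w).
  by rewrite -mulrA -{1}(mulKmx (SL_unitmx g) w); exact: enorm_mulmx.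
have gu0 : 0 < enorm (g *m u) by rewrite enorm_gt0 SL_mul_neq0.
have gv0 : 0 < enorm (g *m v) by rewrite enorm_gt0 SL_mul_neq0.
have eu0 : 0 < enorm u by rewrite enorm_gt0.
have ev0 : 0 < enorm v by rewrite enorm_gt0.
set c := l1 _ * d%:R in inv *; clearbody c.
have W := wedge_mulmx (SLval g) u v.
rewrite ler_pdivrMr ?mulr_gt0 //; apply: (le_trans W).
rewrite -!mulrA ler_wpM2l ?lam2_ge0 // ler_wpM2l //.
have E : c * (c * (wedge_norm u v * ((enorm u * enorm v)^-1 * (enorm (g *m u) * enorm (g *m v)))))
  = wedge_norm u v * ((c * enorm (g *m u)) * (c * enorm (g *m v)) / (enorm u * enorm v)).
  by field; rewrite !gt_eqF.
rewrite E ler_peMr ?wedge_norm_ge0 // ler_pdivlMr ?mulr_gt0 // mul1r.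
by apply: ler_pM; rewrite ?enorm_ge0.
Qed.

End ProjectiveAction.

Section Stationary.
Context {R : realType} {d : nat}.
Implicit Types (g h : SL R d.+1) (x y z : projspace R d.+1).
Implicit Types (rho : probability (SL R d.+1) R) (nu : probability (projspace R d.+1) R).

Lemma projball x e : ball x e = [set y | proj_dist x y < e].
Proof. by rewrite ballEmdist. Qed.

Lemma open_projball x e : open (ball x e).
Proof.
rewrite openE => y; rewrite projball /= => xy; rewrite /interior -nbhs_ballE.
exists (e - proj_dist x y); first by rewrite /= subr_gt0.
move=> z; rewrite !projball /= => yz.
by rewrite (le_lt_trans (proj_dist_triangle y _ _)) // addrC -ltrBrDr.
Qed.

Lemma measurable_projball x e : measurable (ball x e).
Proof. by apply: sub_sigma_algebra; exact: open_projball. Qed.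

Lemma open_act g (U : set (projspace R d.+1)) : open U -> open (act g @^-1` U).
Proof.
rewrite !openE => oU x /oU; rewrite /interior /= -!nbhs_ballE => -[e /= e0 eU].
set c := lam2 (SLval g) * (d.+1 * d.+1 * 4)%:R * (l1 (invmx (SLval g)) * d.+1%:R) ^+ 2.
have c0 : 0 <= c by rewrite mulr_ge0 ?sqr_ge0 // mulr_ge0 ?lam2_ge0.
exists (e / (c + 1)); first by rewrite /= divr_gt0 // ltr_wpDl.
move=> y; rewrite projball /= ltr_pdivlMr ?ltr_wpDl // => xy.
apply: eU; rewrite projball /=; apply: (le_lt_trans (proj_dist_act _ _ _)).
apply: le_lt_trans xy; rewrite -/c mulrC ler_wpM2l ?lerDl //.
by rewrite divr_ge0 ?wedge_norm_ge0 // mulr_ge0 ?enorm_ge0.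
Qed.

Lemma measurable_act g (A : set (projspace R d.+1)) : measurable A ->
  measurable (act g @^-1` A).
Proof.
have : measurable_fun setT (act g : projspace R d.+1 -> projspace R d.+1).
  apply: (measurability (@open (projspace R d.+1))) => // _ [V oV <-].
  by rewrite setTI; apply: sub_sigma_algebra; exact: open_act.
by move=> H mA; rewrite -[X in measurable X]setTI; exact: H.
Qed.

Lemma act1 x : act (1%g : SL R d.+1) x = x.
Proof.
apply: val_inj => /=; rewrite /SL_action; apply/vspaceP => u; apply/idP/idP.
  by move=> /memv_imgP[w wx ->]; rewrite lfunE /= mul1mx.
by move=> ux; apply/memv_imgP; exists u => //; rewrite lfunE /= mul1mx.
Qed.

Lemma actM g h x : act (g * h)%g x = act g (act h x).
Proof.
apply: val_inj => /=; rewrite /SL_action; apply/vspaceP => u; apply/idP/idP.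
  move=> /memv_imgP[w wx ->]; apply/memv_imgP; exists (h *m w); first exact: act_line.
  by rewrite !lfunE /= mulmxA.
move=> /memv_imgP[w + ->] => /memv_imgP[w' w'x ->].
by apply/memv_imgP; exists w' => //; rewrite !lfunE /= mulmxA.
Qed.

(** The inequality that stationarity leaves after N steps; only inequalities
    are iterated, so that the action need not be jointly measurable. *)
Lemma stationary_outer rho nu N (G : set (SL R d.+1)) (b : R) Y E :
  stationary rho nu -> 0 <= b -> measurable G -> measurable E ->
  outer_ge nu b Y -> (forall g y, G g -> Y y -> E (act g y)) ->
  (convolution_power rho N G * b%:E <= nu E)%E.
Proof.
move=> st b0 + + HY; elim: N G E => [|N IH] G E mG mE GE.
  rewrite /= /dirac indicE; case: (boolP (_ \in G)) => /=.
    by rewrite inE mul1e => G1; apply: HY => // y /(GE _ _ G1); rewrite act1.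
  by rewrite mul0e.
rewrite convolution_powerS st // -ge0_integralZr //; last first.
  exact: measurable_convolution_section.
apply: le_integral_any => g _.
  by rewrite mule_ge0 ?lee_fin // measure_ge0.
apply: IH => //; first exact: measurable_translate.
  exact: measurable_act.
by move=> h y /= Gh Yy; rewrite -actM; exact: GE.
Qed.

End Stationary.

(** * Orbits avoid finitely many subspaces *)

Section FiniteOrbits.
Context {R : realType} {d : nat}.
Implicit Types (g h t : SL R d) (u : 'cV[R]_d) (W : {vspace 'cV[R]_d}).

Definition mapv g W : {vspace 'cV[R]_d} := (linfun (mulmx (SLval g)) @: W)%VS.

Lemma mem_mapv g W u : u \in W -> g *m u \in mapv g W.
Proof. by move=> uW; have := memv_img (linfun (mulmx (SLval g))) uW; rewrite lfunE. Qed.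

Lemma mapvP g W u : u \in mapv g W -> exists2 w, w \in W & u = g *m w.
Proof. by move=> /memv_imgP[w wW ->]; exists w; rewrite ?lfunE. Qed.

Lemma SL_mul_inj g : injective (mulmx (SLval g) : 'cV[R]_d -> 'cV[R]_d).
Proof. by move=> u w guw; rewrite -(mulKmx (SL_unitmx g) u) guw mulKmx ?SL_unitmx. Qed.

Lemma dim_mapv g W : \dim (mapv g W) = \dim W.
Proof.
rewrite limg_dim_eq //; apply/eqP; rewrite -subv0; apply/subvP => u.
rewrite memv_cap => /andP[_]; rewrite memv_ker lfunE /= memv0 => /eqP gu.
by apply/eqP/(SL_mul_inj (g := g)); rewrite gu mulmx0.
Qed.

Lemma mapv_inj g : injective (mapv g).
Proof.
move=> W W' E; apply/eqP; rewrite eqEdim -(dim_mapv g W) E dim_mapv leqnn andbT.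
apply/subvP => u /(mem_mapv g); rewrite E => /mapvP[w wW' /SL_mul_inj ->].
exact: wW'.
Qed.

(** Strong irreducibility for a semigroup, with lists of subspaces instead of
    their unions. *)
Definition no_finite_orbit (T : set (SL R d)) := forall s : seq {vspace 'cV[R]_d},
  s != [::] -> (forall W, W \in s -> W != 0%VS /\ W != fullv) ->
  ~ (forall t, T t -> forall W, W \in s -> mapv t W \in s).

(** A list of subspaces sent into itself by injective maps is permuted by them,
    so that the subspaces of the list have a union fixed by the group. *)
Lemma strongly_irreducible_orbit (S T : set (SL R d)) : S `<=` T ->
  strongly_irreducible (smallest is_subgroup S) -> no_finite_orbit T.
Proof.
move=> ST irr s s0 sP sT; apply: (irr s s0 sP).
pose Stab : set (SL R d) := [set g | mulmx (SLval g) @` union_of_subspaces s = union_of_subspaces s].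
suff : smallest is_subgroup S `<=` Stab by move=> H g /H.
apply: smallest_sub.
  split=> [|g h /= gs hs|g /= gs].
  - apply/seteqP; split => [_ [u us <-]|u us] /=; first by rewrite mul1mx.
    by exists u => //=; rewrite mul1mx.
  - rewrite /Stab /=; rewrite -[RHS]gs -[in RHS]hs image_comp.
    by apply: eq_imagel => u _ /=; rewrite mulmxA.
  - rewrite /Stab /= -{1}gs image_comp; apply/seteqP; split => [_ [u us <-]|u us] /=.
      by rewrite mulKmx ?SL_unitmx.
    by exists u => //=; rewrite mulKmx ?SL_unitmx.
move=> t /ST /sT Tt; have us := undup_uniq s.
have ts : {subset [seq mapv t W | W <- undup s] <= undup s}.
  by move=> _ /mapP[W Ws ->]; rewrite mem_undup Tt // -mem_undup.
have tuniq : uniq [seq mapv t W | W <- undup s] by rewrite map_inj_uniq //; exact: mapv_inj.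
have [|_ tE] := uniq_min_size tuniq ts; first by rewrite size_map.
apply/seteqP; split => [_ [u [W Ws uW] <-]|u [W Ws uW]] /=.
  by exists (mapv t W); [exact: Tt|exact: mem_mapv].
have : W \in [seq mapv t W | W <- undup s] by rewrite tE mem_undup.
move=> /mapP[W' W's WE]; move: uW; rewrite WE => /mapvP[w wW' ->].
by exists w => //; exists W' => //; rewrite -mem_undup.
Qed.

Section Avoid.
Variable T : set (SL R d).
Hypothesis Tmul : forall g h, T g -> T h -> T (g * h)%g.
Hypothesis Tne : exists t, T t.
Hypothesis Tirr : no_finite_orbit T.

Definition covers u (s : seq {vspace 'cV[R]_d}) :=
  (forall W, W \in s -> W != fullv) /\
  forall t, T t -> exists2 W, W \in s & t *m u \in W.

(** An orbit is not contained in finitely many proper subspaces: among the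
    finite coverings, one which is minimal for the largest dimension r and then
    for the number of subspaces of dimension r has its r-dimensional members
    permuted by T. *)
Lemma orbit_avoids u (s : seq {vspace 'cV[R]_d}) : u != 0 ->
  (forall W, W \in s -> W != fullv) ->
  exists2 t, T t & forall W, W \in s -> t *m u \notin W.
Proof.
move=> u0 sP; apply: contrapT => H.
have cov_s : covers u s.
  split=> // t Tt; apply: contrapT => H'; apply: H; exists t => // W Ws.
  by apply/negP => tuW; apply: H'; exists W.
pose small r := `[< exists s', covers u s' /\ forall W, W \in s' -> (\dim W <= r)%N >].
have ex_small : exists r, small r.
  exists d; apply/asboolP; exists s; split => // W _.
  by apply: leq_trans (dimvS (subvf W)) _; rewrite dimvf /dim /= muln1.
case: (ex_minnP ex_small) => r /asboolP Hr rmin.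
pose cnt (s' : seq {vspace 'cV[R]_d}) := count (fun W => \dim W == r) s'.
pose few m := `[< exists s', [/\ covers u s', forall W, W \in s' -> (\dim W <= r)%N &
   (cnt s' <= m)%N] >].
have ex_few : exists m, few m.
  by case: Hr => s' [cs' ds']; exists (cnt s'); apply/asboolP; exists s'.
case: (ex_minnP ex_few) => m /asboolP [s' [[ps' cs'] ds' ms']] mmin.
have r0 : (0 < r)%N.
  case: Tne => t Tt; have [W Ws' tuW] := cs' t Tt; apply: leq_trans (ds' _ Ws').
  rewrite lt0n dimv_eq0; apply: contraTneq tuW => ->; rewrite memv0.
  by apply: contra_neq u0 => tu0; apply: (SL_mul_inj (g := t)); rewrite tu0 mulmx0.
pose F := [seq W <- s' | \dim W == r].
apply: (Tirr (s := F)).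
- apply/negP => /eqP F0.
  suff : small r.-1 by move=> /rmin; rewrite leqNgt prednK // leqnn.
  apply/asboolP; exists s'; split => // W Ws'; rewrite -ltnS prednK // ltn_neqAle ds' // andbT.
  apply: contraT; rewrite negbK => dW; have : W \in F by rewrite mem_filter dW.
  by rewrite F0.
- move=> W; rewrite mem_filter => /andP[/eqP dW Ws']; split; last exact: ps'.
  by rewrite -dimv_eq0 dW -lt0n.
- move=> t Tt W0; rewrite mem_filter => /andP[/eqP dW0 W0s']; apply: contrapT => tW0.
  pose f := linfun (mulmx (SLval t) : 'cV[R]_d -> 'cV[R]_d).
  pose s2 := [seq W <- s' | W != W0] ++ [seq (W0 :&: (f @^-1: W))%VS | W <- s'].
  have lt_dim W : W \in s' -> (\dim (W0 :&: (f @^-1: W))%VS < r)%N.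
    move=> Ws'; rewrite ltn_neqAle -{2}dW0 dimvS ?capvSl // andbT.
    apply/negP => /eqP dE; apply: tW0; rewrite mem_filter dim_mapv dW0 eqxx /=.
    suff -> : mapv t W0 = W by [].
    have sub : (mapv t W0 <= W)%VS.
      have W0E : (W0 :&: (f @^-1: W))%VS = W0.
        by apply/eqP; rewrite eqEdim capvSl dE dW0 leqnn.
      apply/subvP => x /mapvP[w + ->]; rewrite -W0E memv_cap => /andP[_].
      by rewrite -memv_preim lfunE.
    by apply/eqP; rewrite eqEdim sub dim_mapv dW0 ds'.
  suff : few (cnt s2).
    move=> /mmin; rewrite leqNgt => /negP; apply; apply: leq_trans ms'.
    rewrite /cnt count_cat count_map (@eq_in_count _ _ pred0 s'); last first.
      by move=> W Ws1 /=; apply: ltn_eqF; exact: lt_dim.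
    rewrite count_pred0 addn0 count_filter -[X in (_ < X)%N]size_filter -/F.
    rewrite -(count_predC (fun W => W != W0) F) /F !count_filter.
    rewrite (eq_count (a2 := predI (fun W => W != W0) (fun W => \dim W == r))); last first.
      by move=> W /=; rewrite andbC.
    rewrite -[X in (X < _)%N]addn0 ltn_add2l -has_count; apply/hasP.
    by exists W0 => //=; rewrite eqxx dW0 eqxx.
  apply/asboolP; exists s2; split => //.
    split.
      move=> W; rewrite mem_cat mem_filter => /orP[/andP[_]|/mapP[W' W's' ->]]; first exact: ps'.
      apply: contraNneq (ps' _ W0s') => WE; rewrite eqEdim subvf /=.
      by rewrite -WE dimvS ?capvSl.
    move=> t' Tt'; have [W Ws' tuW] := cs' t' Tt'.
    have [WE|WW0] := eqVneq W W0; last first.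
      by exists W; rewrite // mem_cat mem_filter WW0 Ws'.
    have [W' W's' ttuW'] := cs' _ (Tmul Tt Tt').
    exists (W0 :&: (f @^-1: W'))%VS.
      by rewrite mem_cat; apply/orP; right; apply/mapP; exists W'.
    by rewrite memv_cap -WE tuW /= -memv_preim lfunE /= mulmxA.
  move=> W; rewrite mem_cat mem_filter => /orP[/andP[_]|/mapP[W' W's' ->]]; first exact: ds'.
  exact: ltnW (lt_dim _ W's').
Qed.

Lemma memv_lker (y : 'rV[R]_d) (x : 'cV[R]_d) :
  (x \in lker (linfun (mulmx y : 'cV[R]_d -> 'cV[R]_1))) = (pair y x == 0).
Proof.
rewrite memv_ker lfunE /= pairE; apply/eqP/eqP => [/matrixP/(_ ord0 ord0)|->].
  by rewrite !mxE.
by apply/matrixP => i j; rewrite !ord1 !mxE.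
Qed.

Lemma lker_proper (y : 'rV[R]_d) : y != 0 ->
  lker (linfun (mulmx y : 'cV[R]_d -> 'cV[R]_1)) != fullv.
Proof.
apply: contra_neq => E; apply/rowP => j; rewrite mxE.
have : (delta_mx j ord0 : 'cV[R]_d) \in fullv by rewrite memvf.
rewrite -E memv_lker => /eqP; rewrite /pair mxE (bigD1 j) //= big1 ?addr0.
  by rewrite mxE !eqxx mulr1.
by move=> i ij; rewrite mxE (negbTE ij) mulr0.
Qed.

Lemma orbit_avoids_hyperplanes u (s : seq 'rV[R]_d) : u != 0 -> 0 \notin s ->
  exists2 t, T t & forall y, y \in s -> pair y (t *m u) != 0.
Proof.
move=> u0 s0.
have [|t Tt Ht] := @orbit_avoids u [seq lker (linfun (mulmx y : 'cV[R]_d -> 'cV[R]_1)) | y <- s] u0.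
  by move=> _ /mapP[y ys ->]; apply: lker_proper; apply: contraNneq s0 => <-.
by exists t => // y ys; rewrite -memv_lker; apply: Ht; apply/mapP; exists y.
Qed.

(** Each c i is chosen so that its image of u avoids the kernel of v and the span
    of the vectors already found. *)
Lemma orbit_basis u (v : 'rV[R]_d) : u != 0 -> v != 0 ->
  exists c : 'I_d -> SL R d,
    (forall i, T (c i) /\ pair v (c i *m u) != 0) /\
    (\matrix_(i, j) (SLval (c j) *m u) i ord0) \in unitmx.
Proof.
move=> u0 v0.
have step k : (k <= d)%N -> exists s : seq (SL R d), [/\ size s = k,
    forall t, t \in s -> T t /\ pair v (t *m u) != 0 & free [seq SLval t *m u | t <- s]].
  elim: k => [|k IH] kd; first by exists [::]; rewrite /= nil_free.
  have [s [ss sT fs]] := IH (ltnW kd).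
  have [|t Tt Ht] := @orbit_avoids u
      [:: <<[seq SLval t *m u | t <- s]>>%VS; lker (linfun (mulmx v : 'cV[R]_d -> 'cV[R]_1))] u0.
    move=> W; rewrite !inE => /orP[/eqP ->|/eqP ->]; last exact: lker_proper.
    apply: contraTneq kd => E; rewrite -leqNgt -ss.
    have := dim_span [seq SLval t *m u | t <- s]; rewrite E dimvf /dim /= muln1 size_map.
    by [].
  exists (t :: s); split; first by rewrite /= ss.
    move=> t'; rewrite inE => /orP[/eqP ->|/sT //]; split => //.
    by rewrite -memv_lker; apply: Ht; rewrite !inE eqxx orbT.
  by rewrite /= free_cons fs andbT; apply: Ht; rewrite !inE eqxx.
have [s [ss sT fs]] := step d (leqnn d).
exists (fun i => nth 1%g s i); split.
  by move=> i; apply: sT; rewrite mem_nth // ss.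
rewrite -row_free_unit; apply: inj_row_free => w Hw.
have full : <<[seq SLval t *m u | t <- s]>>%VS = fullv.
  apply/eqP; rewrite eqEdim subvf /= dimvf /dim /= muln1.
  by move: fs; rewrite /free => /eqP ->; rewrite size_map ss.
apply/eqP; apply: contraT => w0.
have := lker_proper w0; rewrite eqEdim subvf -full => /negP[]; apply: dimvS.
apply/span_subvP => x.
move=> /mapP[t ts ->]; rewrite memv_lker.
have it : (index t s < d)%N by rewrite -[X in (_ < X)%N]ss index_mem.
have /matrixP /(_ ord0 (Ordinal it)) := Hw; rewrite !mxE => H.
rewrite /pair mxE; apply/eqP; rewrite -[RHS]H; apply: eq_bigr => i _.
by rewrite !mxE /= nth_index.
Qed.
End Avoid.
End FiniteOrbits.

(** T does not preserve the line of v, by irreducibility. If t0 moves this line, so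
    does c or t0 c for every c, and c can be chosen so that neither coefficient
    vanishes. *)
Lemma moving_form (R : realType) (n : nat) (T : set (SL R n.+2))
    (u : 'cV[R]_n.+2) (v : 'rV[R]_n.+2) :
  (forall g h, T g -> T h -> T (g * h)%g) -> (exists t, T t) -> no_finite_orbit T ->
  pair v u != 0 ->
  exists t, [/\ T t, pair v (SLval t *m u) != 0 & forall a, v *m SLval t != a *: v].
Proof.
move=> Tmul Tne Tirr vu.
have v0 : v != 0 by apply: contraNneq vu => ->; rewrite /pair mul0mx mxE.
have u0 : u != 0 by apply: contraNneq vu => ->; rewrite /pair mulmx0 mxE.
apply: contrapT => H.
have H1 t : T t -> pair v (SLval t *m u) != 0 -> exists a, v *m SLval t = a *: v.
  move=> Tt vtu; apply: contrapT => H'; apply: H; exists t; split => // a.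
  by apply/eqP => E; apply: H'; exists a.
pose K := lker (linfun (mulmx v : 'cV[R]_n.+2 -> 'cV[R]_1)).
have [t0 Tt0 Ht0] : exists2 t0, T t0 & forall a, v *m SLval t0 != a *: v.
  apply: contrapT => H'; apply: (Tirr [:: K]) => //.
    move=> W; rewrite inE => /eqP ->; split; last exact: lker_proper.
    apply/negP => /eqP K0; have := limg_ker_dim (linfun (mulmx v : 'cV[R]_n.+2 -> 'cV[R]_1)) fullv.
    rewrite capfv -/K K0 dimv0 add0n dimvf /dim /= muln1 => E.
    by have := dimvS (subvf (limg (linfun (mulmx v : 'cV[R]_n.+2 -> 'cV[R]_1)))); rewrite E dimvf.
  move=> t Tt W; rewrite !inE => /eqP ->.
  have [a va] : exists a, v *m SLval t = a *: v.
    apply: contrapT => Ha; apply: H'; exists t => // a; apply/eqP => E.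
    by apply: Ha; exists a.
  rewrite eqEdim dim_mapv leqnn andbT; apply/subvP => x /mapvP[w wK ->].
  by move: wK; rewrite !memv_lker -pairM va pairZl => /eqP ->; rewrite mulr0.
have vt0 : v *m SLval t0 != 0 by have := Ht0 0; rewrite scale0r.
have [|c Tc Hc] := @orbit_avoids_hyperplanes _ _ T Tmul Tne Tirr u [:: v; v *m SLval t0] u0.
  by rewrite !inE !(eq_sym 0) (negbTE v0) (negbTE vt0).
have [|a va] := H1 c Tc; first by apply: Hc; rewrite mem_head.
have [|a' va'] := H1 _ (Tmul _ _ Tt0 Tc).
  by rewrite -mulmxA -pairM; apply: Hc; rewrite !inE eqxx orbT.
have a0 : a != 0.
  have : pair v (SLval c *m u) != 0 by apply: Hc; rewrite mem_head.
  by rewrite -pairM va pairZl; apply: contraNneq => ->; rewrite mul0r.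
have /negP := Ht0 (a' / a); apply; apply/eqP.
apply: (can_inj (mulmxK (SL_unitmx c))).
by rewrite -mulmxA -scalemxAl va scalerA divfK // -va'.
Qed.

(** * Linear span of the tensor squares of a semigroup *)

Section QuadraticSpan.
Context {R : realType} {d' : nat}.
Notation d := d'.+1.
Variable T : set (SL R d).
Hypothesis Tmul : forall g h, T g -> T h -> T (g * h)%g.

Definition quad_span (Y : 'M[R]_(d * d)) := exists s : seq (R * SL R d),
  (forall p, p \in s -> T p.2) /\
  Y = \sum_(p <- s) p.1 *: (SLval p.2 *t SLval p.2).

Lemma quad_span_elt t : T t -> quad_span (SLval t *t SLval t).
Proof.
move=> Tt; exists [:: (1, t)]; rewrite big_seq1 scale1r; split => // p.
by rewrite inE => /eqP ->.
Qed.

Lemma quad_span0 : quad_span 0.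
Proof. by exists [::]; rewrite big_nil. Qed.

Lemma quad_spanD Y Z : quad_span Y -> quad_span Z -> quad_span (Y + Z).
Proof.
move=> [s [sT ->]] [s' [s'T ->]]; exists (s ++ s'); rewrite big_cat; split => // p.
by rewrite mem_cat => /orP[/sT|/s'T].
Qed.

Lemma quad_spanZ a Y : quad_span Y -> quad_span (a *: Y).
Proof.
move=> [s [sT ->]]; exists [seq (a * p.1, p.2) | p <- s]; split.
  by move=> _ /mapP[p ps ->]; exact: (sT p ps).
by rewrite big_map scaler_sumr; apply: eq_bigr => p _; rewrite scalerA.
Qed.

Lemma quad_span_sum (I : Type) (r : seq I) (P : pred I) (F : I -> 'M[R]_(d * d)) :
  (forall i, P i -> quad_span (F i)) -> quad_span (\sum_(i <- r | P i) F i).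
Proof.
by move=> H; elim/big_rec: _ => [|i Y Pi HY]; [exact: quad_span0|apply: quad_spanD => //; exact: H].
Qed.

Lemma tens_SLM (g h : SL R d) : (SLval g *t SLval g) *m (SLval h *t SLval h) =
  SLval (g * h)%g *t SLval (g * h)%g.
Proof. by rewrite tensmx_mul. Qed.

Lemma quad_spanM Y Z : quad_span Y -> quad_span Z -> quad_span (Y *m Z).
Proof.
move=> [s [sT ->]] [s' [s'T ->]]; rewrite mulmx_suml big_seq.
apply: quad_span_sum => p ps; rewrite mulmx_sumr big_seq; apply: quad_span_sum => q qs.
rewrite -scalemxAl -scalemxAr scalerA; apply: quad_spanZ.
by rewrite tens_SLM; apply: quad_span_elt; apply: Tmul; [exact: sT|exact: s'T].
Qed.

(** By Cayley-Hamilton, the inverse of t (x) t is a combination of its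
    positive powers. *)
Lemma quad_span_inv (t : SL R d) : T t ->
  quad_span 1%:M /\ quad_span (SLval t^-1%g *t SLval t^-1%g).
Proof.
move=> Tt; pose M : 'M[R]_((d * d).-1.+1) := SLval t *t SLval t.
pose N : 'M[R]_((d * d).-1.+1) := SLval t^-1%g *t SLval t^-1%g.
have one_tens : (1%:M : 'M[R]_d) *t (1%:M : 'M[R]_d) = 1%:M.
  apply/matrixP => i j; case: (mxtens_indexP i) => i0 i1; case: (mxtens_indexP j) => j0 j1.
  rewrite tensmxE !mxE -natrM mulnb; congr (nat_of_bool _)%:R.
  by rewrite (inj_eq (can_inj (@mxtens_indexK _ _))) xpair_eqE.
have NM : N *m M = 1%:M.
  rewrite /N /M -[LHS]/((SLval t^-1%g *t SLval t^-1%g) *m (SLval t *t SLval t)).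
  by rewrite tens_SLM mulVg one_tens.
have MX k : (0 < k)%N -> quad_span (M ^+ k : 'M[R]_(d * d)).
  elim: k => // -[|k] IH _; first by rewrite expr1; exact: quad_span_elt.
  by rewrite exprS; apply: (@quad_spanM M (M ^+ k.+1)); [exact: quad_span_elt|exact: IH].
have CH := Cayley_Hamilton M.
set chi := char_poly M in CH.
have c0 : chi`_0 != 0.
  rewrite char_poly_det mulf_neq0 ?signr_eq0 // -unitfE -unitmxE.
  by have [_] := mulmx1_unit NM.
have HX : horner_mx M chi = \sum_(i < size chi) chi`_i *: M ^+ i.
  by rewrite -[in LHS](coefK chi) poly_def rmorph_sum; apply: eq_bigr => i _; rewrite /= linearZ /= rmorphXn /= horner_mx_X.
have sz : (0 < size chi)%N by rewrite size_char_poly.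
have key (Z : 'M[R]_((d * d).-1.+1)) :
    (forall i, (0 < i)%N -> quad_span (Z * M ^+ i : 'M[R]_(d * d))) ->
    quad_span (Z : 'M[R]_(d * d)).
  move=> HZ; have : Z * horner_mx M chi = 0 by rewrite CH mulr0.
  rewrite HX mulr_sumr; move: sz; case: (size chi) => // m _.
  rewrite big_ord_recl /= expr0 -scalerAr mulr1 => /eqP; rewrite addr_eq0 => /eqP E.
  have -> : Z = - (chi`_0)^-1 *: \sum_(i < m) Z * (chi`_(lift ord0 i) *: M ^+ lift ord0 i).
    by rewrite scaleNr -scalerN -E scalerA mulVf // scale1r.
  apply: quad_spanZ; apply: quad_span_sum => i _.
  by rewrite -scalerAr; apply: quad_spanZ; apply: HZ.
have q1 : quad_span (1 : 'M[R]_((d * d).-1.+1)).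
  by apply: key => i i0; rewrite mul1r; exact: MX.
split=> //; apply: (key N) => -[//|[|i]] _.
  by rewrite expr1 -[N * M]/(N *m M) NM.
by rewrite exprS mulrA -[N * M]/(N *m M) NM mul1r; exact: MX.
Qed.

(** The tensor squares of the semigroup span an algebra which contains those of
    their inverses: identities that are linear in g (x) g pass from the semigroup
    to the group. *)
Lemma quad_span_group (S : set (SL R d)) (h : SL R d) : S `<=` T ->
  (exists t, T t) -> smallest is_subgroup S h ->
  quad_span (SLval h *t SLval h).
Proof.
move=> ST [t0 Tt0] Hh.
pose A : set (SL R d) := [set g | quad_span (SLval g *t SLval g) /\
  quad_span (SLval g^-1%g *t SLval g^-1%g)].
suff : smallest is_subgroup S `<=` A by move=> /(_ _ Hh)[].
apply: smallest_sub; last first.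
  by move=> t /ST Tt; split; [exact: quad_span_elt|have [] := quad_span_inv Tt].
have q1 : quad_span (SLval 1%g *t SLval 1%g).
  by rewrite -(mulVg t0) -tens_SLM; apply: quad_spanM;
    [have [] := quad_span_inv Tt0|exact: quad_span_elt].
split=> [|g h' [g1 g2] [h1 h2]|g [g1 g2]].
- by split; rewrite ?invg1.
- by split; rewrite ?invgM -tens_SLM; exact: quad_spanM.
- by split; rewrite ?invgK.
Qed.

End QuadraticSpan.

(** * Compactness and the Euclidean norm of matrices *)

Lemma bounded_subsequence (R : realType) m p (X : nat -> 'M[R]_(m, p)) :
  (forall k, l1 (X k) <= 1) ->
  exists Z, forall e, 0 < e -> forall K, exists2 k, (K <= k)%N & l1 (X k - Z) < e.
Proof.
move=> X1.
have cA := @rV_compact R (m * p) (fun=> [set` `[(-1 : R), 1]]) (fun=> @segment_compact R _ _).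
set A := [set v | _] in cA.
have FA : ((fun k => mxvec (X k)) @ \oo) A.
  exists 0%N => // k _ i; rewrite /= in_itv /= -ler_norml.
  case: (mxvec_indexP i) => a b; rewrite mxvecE.
  exact: le_trans (l1_entry _ _ _) (X1 k).
have [q [_ cq]] := cA _ _ FA.
exists (vec_mx q) => e e0 K.
pose del := e / (m * p).+1%:R.
have del0 : 0 < del by rewrite divr_gt0 // ltr0n.
have FT : ((fun k => mxvec (X k)) @ \oo) [set v | exists2 k, (K <= k)%N & v = mxvec (X k)].
  by exists K => // k Kk /=; exists k.
have [_ [[k Kk ->] [_ qk]]] := cq _ _ FT (nbhsx_ballx q del del0).
exists k => //; rewrite -[X k]mxvecK.
apply: (@le_lt_trans _ _ (\sum_(i < m) \sum_(j < p) del)).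
  apply: ler_sum => i _; apply: ler_sum => j _; rewrite !mxE.
  by rewrite distrC; apply: ltW; have := qk ord0 (mxvec_index i j).
rewrite !sumr_const !card_ord -mulrnA -mulr_natr /del mulrAC.
by rewrite ltr_pdivrMr ?ltr0n // ltr_pM2l // ltr_nat mulnC.
Qed.

Section SquareNorm.
Context {R : realType}.

Definition sq m n (A : 'M[R]_(m, n)) : R := \sum_i \sum_j (A i j) ^+ 2.

Lemma sq_ge0 m n (A : 'M[R]_(m, n)) : 0 <= sq A.
Proof. by do 2! [apply: sumr_ge0 => ? _]; exact: sqr_ge0. Qed.

Lemma sq_le_l1 m n (A : 'M[R]_(m, n)) : sq A <= l1 A ^+ 2.
Proof.
rewrite expr2 {2}/l1 mulr_sumr; apply: ler_sum => i _; rewrite mulr_sumr.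
apply: ler_sum => j _; rewrite -real_normK ?num_real // expr2 ler_wpM2r //.
exact: l1_entry.
Qed.

Lemma entry_le_sq m n (A : 'M[R]_(m, n)) i j : (A i j) ^+ 2 <= sq A.
Proof.
rewrite /sq (bigD1 i) //= (bigD1 j) //= -addrA lerDl addr_ge0 ?sumr_ge0 //.
  by move=> k _; exact: sqr_ge0.
by move=> k _; apply: sumr_ge0 => l _; exact: sqr_ge0.
Qed.

Lemma sq_eq0 m n (A : 'M[R]_(m, n)) : sq A = 0 -> A = 0.
Proof.
move=> A0; apply/matrixP => i j; rewrite mxE; apply/eqP; rewrite -sqrf_eq0.
by rewrite eq_le sqr_ge0 andbT -A0 entry_le_sq.
Qed.

Lemma sqZ m n a (A : 'M[R]_(m, n)) : sq (a *: A) = a ^+ 2 * sq A.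
Proof.
rewrite /sq mulr_sumr; apply: eq_bigr => i _; rewrite mulr_sumr.
by apply: eq_bigr => j _; rewrite mxE exprMn.
Qed.

Lemma cauchy_schwarz_sum n (a b : 'I_n -> R) :
  (\sum_i a i * b i) ^+ 2 <= (\sum_i a i ^+ 2) * (\sum_i b i ^+ 2).
Proof.
have := CauchySchwarz_dotp (\col_i a i) (\col_i b i).
rewrite -(@ler_pXn2r _ 2) ?nnegrE ?mulr_ge0 ?enorm_ge0 // exprMn !sqr_enorm.
rewrite real_normK ?num_real //; rewrite /dotp.
under eq_bigr do rewrite !mxE; under [X in X * _]eq_bigr do rewrite !mxE -expr2.
by under [X in _ * X]eq_bigr do rewrite !mxE -expr2.
Qed.

Lemma sqM m n p (A : 'M[R]_(m, n)) (B : 'M[R]_(n, p)) : sq (A *m B) <= sq A * sq B.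
Proof.
rewrite /sq mulr_suml; apply: ler_sum => i _.
rewrite [X in _ * X]exchange_big mulr_sumr; apply: ler_sum => j _.
by rewrite mxE; exact: cauchy_schwarz_sum.
Qed.

Lemma sq_tr m n (A : 'M[R]_(m, n)) : sq A^T = sq A.
Proof.
rewrite /sq exchange_big; apply: eq_bigr => i _; apply: eq_bigr => j _.
by rewrite mxE.
Qed.

Lemma sq_parallelogram m n (A B : 'M[R]_(m, n)) :
  sq (2^-1 *: (A + B)) = (sq A + sq B) / 2 - sq (A - B) / 4.
Proof.
rewrite sqZ /sq -big_split !mulr_suml mulr_sumr -sumrB; apply: eq_bigr => i _.
rewrite -big_split !mulr_suml mulr_sumr -sumrB; apply: eq_bigr => j _.
by rewrite !mxE /=; field.
Qed.

Lemma sq_col1 (n : nat) (x : 'cV[R]_n) : sq x = pair x^T x.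
Proof.
rewrite /sq /pair mxE; apply: eq_bigr => i _.
by rewrite big_ord1 mxE expr2.
Qed.

End SquareNorm.

(** * Almost invariant quadratic forms *)

(** A bounded semigroup of matrices with bounded inverses almost preserves a
    positive quadratic form. Take Q almost minimising the largest square norm
    of N^T Q N over the semigroup, among the forms that stay uniformly
    positive under the semigroup; k^T Q k is then another almost minimiser, and
    by the parallelogram identity two almost minimisers are close. *)
Lemma almost_invariant_form (R : realType) r (K : set 'M[R]_r) (B : R) :
  (forall k k', K k -> K k' -> K (k *m k')) ->
  (forall k, K k -> [/\ k \in unitmx, sq k <= B & sq (invmx k) <= B]) ->
  exists m C : R, [/\ 0 < m, 0 < C & forall e, 0 < e -> exists Q : 'M[R]_r,
    [/\ forall x : 'cV[R]_r, m * sq x <= pair x^T (Q *m x), sq Q <= C &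
        forall k, K k -> sq (k^T *m Q *m k - Q) <= e]].
Proof.
move=> Kmul KB.
pose K1 : set 'M[R]_r := [set N | N = 1%:M \/ K N].
pose b := `|B| + sq (1%:M : 'M[R]_r) + 1.
have b1 : 1 <= b.
  by have := normr_ge0 B; have := sq_ge0 (1%:M : 'M[R]_r); rewrite /b; lra.
have b0 : 0 < b by lra.
have K1B N : K1 N -> [/\ N \in unitmx, sq N <= b & sq (invmx N) <= b].
  have Bb : B <= b.
    by have := ler_norm B; have := sq_ge0 (1%:M : 'M[R]_r); rewrite /b; lra.
  case=> [->|/KB[uN N1 N2]]; last by split; rewrite ?(le_trans _ Bb).
  rewrite unitmx1 invmx1; have := normr_ge0 B; rewrite /b.
  by split; lra.
have K1K N k : K1 N -> K k -> K1 (k *m N).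
  by case=> [->|KN] Kk; right; rewrite ?mulmx1 //; exact: Kmul.
pose m := b^-1; have m0 : 0 < m by rewrite invr_gt0.
pose P : set 'M[R]_r := [set Q | forall N, K1 N -> forall x : 'cV[R]_r,
  m * sq x <= pair x^T (N^T *m Q *m N *m x)].
pose V (Q : 'M[R]_r) : set R := [set sq (N^T *m Q *m N) | N in K1].
pose F Q := sup (V Q).
have ubV Q : ubound (V Q) (b * sq Q * b).
  move=> _ [N KN <-]; have [_ Nb _] := K1B _ KN.
  apply: (le_trans (sqM _ _)); apply: ler_pM; rewrite ?sq_ge0 //.
  by apply: (le_trans (sqM _ _)); rewrite sq_tr ler_wpM2r ?sq_ge0.
have supV Q : has_sup (V Q).
  split; last by exists (b * sq Q * b); exact: ubV.
  by exists (sq (1%:M^T *m Q *m 1%:M)); exists 1%:M => //; left.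
have leF Q N : K1 N -> sq (N^T *m Q *m N) <= F Q.
  by move=> KN; apply: ub_le_sup; [case: (supV Q)|exists N].
have PI : P 1%:M.
  move=> N KN x; have [uN _ Nb] := K1B _ KN.
  rewrite mulmx1 -mulmxA -pairM -trmx_mul -sq_col1 ler_pdivrMl //.
  rewrite -{1}(mulKmx uN x); apply: (le_trans (sqM _ _)).
  by rewrite ler_wpM2r ?sq_ge0.
pose FP := [set F Q | Q in P].
have infFP : has_inf FP.
  split; first by exists (F 1%:M); exists 1%:M.
  exists 0 => _ [Q _ <-]; apply: le_trans (leF Q 1%:M _); first exact: sq_ge0.
  by left.
pose mu := inf FP.
have leFP Q : P Q -> mu <= F Q.
  by move=> PQ; apply: ge_inf; [case: infFP|exists Q].
exists m, (`|mu| + 1); split; [exact: m0|by rewrite ltr_wpDl|].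
move=> e e0; pose e1 := Num.min 1 (e / (b * b * 4)).
have e10 : 0 < e1 by rewrite lt_min ltr01 divr_gt0 // !mulr_gt0.
have [_ [Q PQ <-] FQ] := inf_adherent e10 infFP.
exists Q; split.
- by move=> x; have := PQ 1%:M (or_introl erefl) x; rewrite trmx1 mul1mx mulmx1.
- have := leF Q 1%:M (or_introl erefl); rewrite trmx1 mul1mx mulmx1 => H.
  apply: (le_trans H); apply: ltW; apply: (lt_le_trans FQ); apply: lerD.
    exact: ler_norm.
  by rewrite ge_min lexx.
- move=> k Kk; set Q' := k^T *m Q *m k.
  have EQ' N : N^T *m Q' *m N = (k *m N)^T *m Q *m (k *m N).
    by rewrite trmx_mul /Q' !mulmxA.
  have FQ' N : K1 N -> sq (N^T *m Q' *m N) <= F Q.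
    by move=> KN; rewrite EQ'; apply: leF; exact: K1K.
  pose M := 2^-1 *: (Q + Q').
  have PM : P M.
    move=> N KN x; have h1 := PQ N KN x; have h2 := PQ _ (K1K _ _ KN Kk) x.
    rewrite -EQ' in h2; rewrite /M -scalemxAr -!scalemxAl pairZr mulmxDr !mulmxDl pairDr.
    lra.
  have FM : F M <= F Q - sq (Q' - Q) / (b * b * 4).
    apply: ge_sup; first by case: (supV M).
    move=> _ [N KN <-]; have [uN Nb Nb'] := K1B _ KN.
    rewrite /M -scalemxAr -scalemxAl mulmxDr mulmxDl sq_parallelogram.
    have h1 := leF Q N KN; have h2 := FQ' N KN.
    have uNT : N^T \in unitmx by rewrite unitmx_tr.
    have : sq (Q' - Q) <= b * b * sq (N^T *m Q *m N - N^T *m Q' *m N).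
      have E : Q - Q' = invmx N^T *m (N^T *m Q *m N - N^T *m Q' *m N) *m invmx N.
        have E0 X : invmx N^T *m (N^T *m X *m N) *m invmx N = X.
          by rewrite -!mulmxA mulKmx // mulmxV // mulmx1.
        by rewrite mulmxBr mulmxBl !E0.
      rewrite -[Q' - Q]opprB -scaleN1r sqZ sqrrN expr1n mul1r {1}E.
      apply: (le_trans (sqM _ _)).
      rewrite mulrC -mulrA; apply: ler_pM; rewrite ?sq_ge0 //.
      apply: (le_trans (sqM _ _)); rewrite ler_wpM2r ?sq_ge0 //.
      by rewrite -trmx_inv sq_tr.
    move=> h3; have : sq (Q' - Q) / (b * b * 4) <= sq (N^T *m Q *m N - N^T *m Q' *m N) / 4.
      rewrite ler_pdivrMr ?mulr_gt0 //; lra.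
    lra.
  have := leFP M PM => h1.
  have h2 : sq (Q' - Q) / (b * b * 4) <= e1 by lra.
  have h3 : e1 <= e / (b * b * 4) by rewrite ge_min lexx orbT.
  have := le_trans h2 h3; rewrite ler_pM2r // invr_gt0 !mulr_gt0 //.
Qed.

(** * Limits of least rank *)

(** The words of the random walk lie in this semigroup, while irreducibility and
    proximality are assumed for the group generated by S. *)
Definition semigroup_of (R : realType) d (S : set (SL R d)) :=
  smallest (fun A : set (SL R d) => forall g h, A g -> A h -> A (g * h)%g) S.

Lemma semigroup_mul (R : realType) d (S : set (SL R d)) g h :
  semigroup_of S g -> semigroup_of S h -> semigroup_of S (g * h)%g.
Proof.
by move=> Sg Sh A AP; apply: (AP.1); [exact: (Sg A AP)|exact: (Sh A AP)].
Qed.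

Section LimitCone.
Context {R : realType} {d' : nat}.
Notation d := d'.+1.
Variable T : set (SL R d).
Hypothesis Tmul : forall g h, T g -> T h -> T (g * h)%g.
Hypothesis Tne : exists t, T t.
Hypothesis Tirr : no_finite_orbit T.

(** The closure of R T, which unlike T contains matrices that are not invertible. *)
Definition limit_cone (X : 'M[R]_d) := forall e, 0 < e ->
  exists (a : R) (t : SL R d), T t /\ l1 (a *: SLval t - X) < e.

Lemma limit_cone_elt t : T t -> limit_cone (SLval t).
Proof. by move=> Tt e e0; exists 1, t; rewrite scale1r subrr l1_0. Qed.

Lemma limit_coneZ a X : limit_cone X -> limit_cone (a *: X).
Proof.
move=> CX e e0; have a0 : 0 < `|a| + 1 by rewrite ltr_wpDl.
have [|b [t [Tt H]]] := CX (e / (`|a| + 1)); first by rewrite divr_gt0.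
exists (a * b), t; split => //; rewrite -scalerA -scalerBr l1Z.
move: H; rewrite ltr_pdivlMr // => H; have := l1_ge0 (b *: SLval t - X).
have := normr_ge0 a; nra.
Qed.

Lemma limit_coneM X Y : limit_cone X -> limit_cone Y -> limit_cone (X *m Y).
Proof.
move=> CX CY e e0.
have D0 : 0 < l1 X + l1 Y + 2 by have := l1_ge0 X; have := l1_ge0 Y; lra.
pose e1 := Num.min 1 (e / (l1 X + l1 Y + 2)).
have e10 : 0 < e1 by rewrite lt_min ltr01 divr_gt0.
have e11 : e1 <= 1 by rewrite ge_min lexx.
have e12 : e1 * (l1 X + l1 Y + 2) <= e by rewrite -ler_pdivlMr // ge_min lexx orbT.
have [a [t [Tt Ht]]] := CX _ e10; have [b [s [Ts Hs]]] := CY _ e10.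
exists (a * b), (t * s)%g; split; first exact: Tmul.
have -> : (a * b) *: SLval (t * s)%g - X *m Y =
    (a *: SLval t) *m (b *: SLval s - Y) + (a *: SLval t - X) *m Y.
  rewrite mulmxBr mulmxBl addrA subrK; congr (_ - _).
  by rewrite -scalemxAl -scalemxAr scalerA.
apply: (le_lt_trans (l1D _ _)).
apply: (le_lt_trans (lerD (l1M _ _) (l1M _ _))).
have h1 : l1 (a *: SLval t) <= l1 X + l1 (a *: SLval t - X).
  by have := l1D X (a *: SLval t - X); rewrite addrC subrK.
have := l1_ge0 X; have := l1_ge0 Y; have := l1_ge0 (a *: SLval t - X).
have := l1_ge0 (b *: SLval s - Y); have := l1_ge0 (a *: SLval t).
move=> p1 p2 p3 p4 p5.
have q1 : l1 (a *: SLval t) * l1 (b *: SLval s - Y) <= (l1 X + 1) * e1.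
  by apply: ler_pM => //; lra.
have q2 : l1 (a *: SLval t - X) * l1 Y <= e1 * l1 Y by rewrite ler_wpM2r // ltW.
nra.
Qed.

Lemma limit_cone_closed X :
  (forall e, 0 < e -> exists2 Y, limit_cone Y & l1 (Y - X) < e) -> limit_cone X.
Proof.
move=> H e e0; have [|Y CY YX] := H (e / 2); first by rewrite divr_gt0.
have [|a [t [Tt HY]]] := CY (e / 2); first by rewrite divr_gt0.
exists a, t; split => //; have -> : a *: SLval t - X = (a *: SLval t - Y) + (Y - X).
  by rewrite addrA subrK.
by apply: (le_lt_trans (l1D _ _)); lra.
Qed.

Lemma rank_neq0 m p (A : 'M[R]_(m, p)) : A != 0 -> (0 < \rank A)%N.
Proof. by rewrite lt0n mxrank_eq0. Qed.

(** A limit X of least rank may be nilpotent; some t moves a vector of its image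
    out of its kernel, and X is then replaced by a product with t. *)
Lemma minimal_rank_limit : exists (r : nat) (X : 'M[R]_d),
  [/\ (0 < r)%N, limit_cone X, \rank X = r, \rank (X *m X) = r &
      forall Y, limit_cone Y -> Y != 0 -> (r <= \rank Y)%N].
Proof.
have [t0 Tt0] := Tne.
pose P r := `[< exists X, [/\ limit_cone X, X != 0 & \rank X = r] >].
have exP : exists r, P r.
  exists (\rank (SLval t0)); apply/asboolP; exists (SLval t0); split => //.
    exact: limit_cone_elt.
  by apply: contraTneq (SL_unitmx t0) => ->; rewrite unitmxE det0 unitr0.
case: (ex_minnP exP) => r /asboolP [X [CX X0 rX]] rmin.
have rmin' Y : limit_cone Y -> Y != 0 -> (r <= \rank Y)%N.
  by move=> CY Y0; apply: rmin; apply/asboolP; exists Y.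
have [w Xw] : exists w : 'cV[R]_d, X *m w != 0.
  apply: contrapT => H; move/negP: X0; apply; apply/eqP/matrixP => i j; rewrite mxE.
  have : X *m delta_mx j ord0 = 0 :> 'cV[R]_d.
    by apply: contrapT => H'; apply: H; exists (delta_mx j ord0); apply/eqP.
  by rewrite -colE => /matrixP /(_ i ord0); rewrite !mxE.
have [|t Tt Ht] := @orbit_avoids _ _ T Tmul Tne Tirr _
    [:: lker (linfun (mulmx X : 'cV[R]_d -> 'cV[R]_d))] Xw.
  move=> W; rewrite inE => /eqP ->; apply: contraNneq Xw => E.
  have : w \in fullv by rewrite memvf.
  by rewrite -E memv_ker lfunE.
have XtX0 : X *m (SLval t *m X) != 0.
  apply/negP => /eqP E; have := Ht _ (mem_head _ _).
  by rewrite memv_ker lfunE /= !mulmxA -(mulmxA X) E mul0mx eqxx.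
have tu := SL_unitmx t.
have t_inj m (A : 'M[R]_(d, m)) : A != 0 -> SLval t *m A != 0.
  by apply: contra_neq => E; rewrite -(mulKmx tu A) E mulmx0.
pose Y := SLval t *m X.
have CY : limit_cone Y by apply: limit_coneM => //; exact: limit_cone_elt.
have Y0 : Y != 0 by exact: t_inj.
have rY : \rank Y = r.
  by apply/eqP; rewrite eqn_leq rmin' // andbT -rX mxrankM_maxr.
exists r, Y; split => //; first by rewrite -rX rank_neq0.
apply/eqP; rewrite eqn_leq -{1}rY mxrankM_maxr rmin' //; first exact: limit_coneM.
by rewrite /Y -mulmxA t_inj.
Qed.

(** On its image, a matrix with the same rank as its square is invertible. *)
Lemma rank_factor (X : 'M[R]_d) r : \rank X = r -> \rank (X *m X) = r ->
  exists (U : 'M[R]_(d, r)) (V : 'M[R]_(r, d)) (U' : 'M[R]_(r, d)) (V' : 'M[R]_(d, r)),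
  [/\ X = U *m V, U' *m U = 1%:M, V *m V' = 1%:M & V *m U \in unitmx].
Proof.
move=> rX rXX; move: (mulmx_base X) (row_base_free X) (col_base_full X).
move: (col_base X) (row_base X); rewrite rX => U V E /row_freeP[V' VV'] /row_fullP[U' UU'].
exists U, V, U', V'; split => //.
rewrite -row_free_unit /row_free eqn_leq rank_leq_row /=.
rewrite -{1}rXX -E -mulmxA (mulmxA V U V).
by apply: leq_trans (mxrankM_maxr _ _) _; rewrite mxrankM_maxl.
Qed.

End LimitCone.

(** * Compression to the image of a limit of least rank *)

Section Compressed.
Context {R : realType} {d' : nat}.
Notation d := d'.+1.
Variable T : set (SL R d).
Hypothesis Tmul : forall g h, T g -> T h -> T (g * h)%g.
Variables (r : nat) (U : 'M[R]_(d, r)) (V U' : 'M[R]_(r, d)) (V' : 'M[R]_(d, r)).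
Hypothesis r_gt0 : (0 < r)%N.
Hypothesis CUV : limit_cone T (U *m V).
Hypothesis UU' : U' *m U = 1%:M.
Hypothesis VV' : V *m V' = 1%:M.
Hypothesis VU : V *m U \in unitmx.
Hypothesis rmin : forall Y, limit_cone T Y -> Y != 0 -> (r <= \rank Y)%N.

(** Matrices with the image and the kernel of U V, in coordinates for which
    composition becomes the product of r x r matrices. *)
Definition blowup (N : 'M[R]_r) : 'M[R]_d := U *m N *m invmx (V *m U) *m V.
Definition compress (X : 'M[R]_d) : 'M[R]_r := V *m X *m (U *m (V *m U)).
Definition compressed : set 'M[R]_r := [set N | limit_cone T (blowup N)].

Lemma blowupK N : U' *m blowup N *m V' *m (V *m U) = N.
Proof.
by rewrite /blowup !mulmxA UU' mul1mx -(mulmxA _ V V') VV' mulmx1 -!mulmxA mulVmx ?mulmx1.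
Qed.

Lemma blowupM N N' : blowup N *m blowup N' = blowup (N *m N').
Proof.
rewrite /blowup -!mulmxA (mulmxA V U) (mulmxA (invmx (V *m U)) (V *m U)) mulVmx //.
by rewrite mul1mx.
Qed.

Lemma compressedM N N' : compressed N -> compressed N' -> compressed (N *m N').
Proof. by move=> DN DN'; rewrite /compressed /= -blowupM; exact: limit_coneM. Qed.

Lemma compressedZ a N : compressed N -> compressed (a *: N).
Proof.
rewrite /compressed /= /blowup -scalemxAr -!scalemxAl; exact: limit_coneZ.
Qed.

Lemma compressed_elt X : limit_cone T X -> compressed (compress X).
Proof.
move=> CX; rewrite /compressed /= (_ : blowup _ = (U *m V) *m X *m (U *m V)).
  by do 2! apply: limit_coneM => //.
by rewrite /blowup /compress !mulmxA -(mulmxA _ V U) mulmxK.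
Qed.

Lemma compressed_closed N :
  (forall e, 0 < e -> exists2 N', compressed N' & l1 (N' - N) < e) -> compressed N.
Proof.
move=> H; apply: limit_cone_closed => e e0.
pose c := l1 U * l1 (invmx (V *m U) *m V) + 1.
have c0 : 0 < c by rewrite ltr_wpDl // mulr_ge0 ?l1_ge0.
have [|N' DN' NN'] := H (e / c); first by rewrite divr_gt0.
exists (blowup N') => //.
have -> : blowup N' - blowup N = U *m (N' - N) *m (invmx (V *m U) *m V).
  by rewrite /blowup mulmxBr mulmxBl !mulmxA.
apply: (le_lt_trans (l1M _ _)); rewrite ltr_pdivlMr // in NN'.
apply: le_lt_trans NN'; rewrite /c.
have := l1_ge0 (invmx (V *m U) *m V); have := l1_ge0 (N' - N).
move=> p1 p2.
apply: (le_trans (ler_wpM2r p2 (l1M _ _))).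
by rewrite mulrDr mulr1 mulrCA mulrA lerDl.
Qed.

Lemma compressed_unit N : compressed N -> N != 0 -> N \in unitmx.
Proof.
move=> DN N0; rewrite -row_free_unit /row_free eqn_leq rank_leq_row /=.
have B0 : blowup N != 0.
  by apply: contra_neq N0 => B0; rewrite -(blowupK N) B0 mulmx0 !mul0mx.
apply: leq_trans (rmin DN B0) _; rewrite /blowup -!mulmxA.
by apply: leq_trans (mxrankM_maxr _ _) _; rewrite mxrankM_maxl.
Qed.

Lemma l1_row_mx m p q (A : 'M[R]_(m, p)) (B : 'M[R]_(m, q)) :
  l1 (row_mx A B) = l1 A + l1 B.
Proof.
rewrite /l1 -big_split; apply: eq_bigr => i _ /=; rewrite big_split_ord /=.
by congr (_ + _); apply: eq_bigr => j _; rewrite ?row_mxEl ?row_mxEr.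
Qed.

Lemma l1_lim m p (A : 'M[R]_(m, p)) a :
  (forall e, 0 < e -> exists2 B, l1 B = a & l1 (B - A) < e) -> l1 A = a.
Proof.
move=> H; apply/eqP; rewrite -subr_eq0 -normr_eq0; apply/eqP.
apply: tends0_eq0 => // e /H[B <- BA]; apply: le_lt_trans BA.
rewrite ler_norml; have := l1D (B - A) A; have := l1D (A - B) B.
by rewrite !subrK l1BC; lra.
Qed.

(** By compactness, nonzero compressed limits are uniformly far from singular:
    a singular limit would have a smaller rank. *)
Lemma compressed_expands : exists2 c, 0 < c &
  forall N (x : 'cV[R]_r), compressed N -> c * l1 N * l1 x <= l1 (N *m x).
Proof.
apply: contrapT => H.
have H1 (k : nat) : exists Nx : 'M[R]_(r, r + 1), [/\ compressed (lsubmx Nx),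
    l1 (lsubmx Nx) = 2^-1, l1 (rsubmx Nx) = 2^-1 &
    l1 (lsubmx Nx *m rsubmx Nx) <= k.+1%:R^-1].
  have : ~ forall N (x : 'cV[R]_r), compressed N -> k.+1%:R^-1 * l1 N * l1 x <= l1 (N *m x).
    by move=> H'; apply: H; exists k.+1%:R^-1 => //; rewrite invr_gt0 ltr0n.
  move=> /existsNP[N /existsNP[x /not_implyP[DN /negP]]]; rewrite -ltNge => Hlt.
  have N0 : 0 < l1 N.
    rewrite lt_neqAle l1_ge0 andbT; apply: contraTneq Hlt => <-.
    by rewrite mulr0 mul0r -leNgt l1_ge0.
  have x0 : 0 < l1 x.
    rewrite lt_neqAle l1_ge0 andbT; apply: contraTneq Hlt => <-.
    by rewrite mulr0 -leNgt l1_ge0.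
  pose a := (2 * l1 N)^-1; pose b := (2 * l1 x)^-1.
  have a0 : 0 < a by rewrite invr_gt0 mulr_gt0.
  have b0 : 0 < b by rewrite invr_gt0 mulr_gt0.
  exists (row_mx (a *: N) (b *: x)); rewrite row_mxKl row_mxKr; split.
  - exact: compressedZ.
  - by rewrite l1Z gtr0_norm // /a invfM -mulrA mulVf ?mulr1 // gt_eqF.
  - by rewrite l1Z gtr0_norm // /b invfM -mulrA mulVf ?mulr1 // gt_eqF.
  - rewrite -scalemxAl -scalemxAr !l1Z !gtr0_norm //.
    have -> : k.+1%:R^-1 = a * (b * (4 * (k.+1%:R^-1 * l1 N * l1 x))).
      by rewrite /a /b; field; rewrite !gt_eqF // addrC natr1 ltr0n.
    rewrite ler_pM2l // ler_pM2l //.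
    move: Hlt (l1_ge0 (N *m x)); move: (_ * l1 N * l1 x) => X; lra.
have [X HX] := choice H1.
have X1 k : l1 (X k) <= 1.
  by have [_ h1 h2 _] := HX k; rewrite -(hsubmxK (X k)) l1_row_mx h1 h2; lra.
have [Z HZ] := bounded_subsequence X1.
have HZ' e : 0 < e -> forall K, exists2 k, (K <= k)%N &
    l1 (lsubmx (X k) - lsubmx Z) < e /\ l1 (rsubmx (X k) - rsubmx Z) < e.
  move=> e0 K; have [k Kk] := HZ e e0 K.
  have -> : X k - Z = row_mx (lsubmx (X k) - lsubmx Z) (rsubmx (X k) - rsubmx Z).
    by rewrite -{1}(hsubmxK (X k)) -{1}(hsubmxK Z) opp_row_mx add_row_mx.
  rewrite l1_row_mx => He.
  exists k => //; have := l1_ge0 (lsubmx (X k) - lsubmx Z).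
  by have := l1_ge0 (rsubmx (X k) - rsubmx Z); split; lra.
have DZ : compressed (lsubmx Z).
  apply: compressed_closed => e e0; have [k _ [Hk _]] := HZ' e e0 0%N.
  by exists (lsubmx (X k)) => //; have [] := HX k.
have Z1 : l1 (lsubmx Z) = 2^-1.
  apply: l1_lim => e e0; have [k _ [Hk _]] := HZ' e e0 0%N.
  by exists (lsubmx (X k)) => //; have [] := HX k.
have Z2 : l1 (rsubmx Z) = 2^-1.
  apply: l1_lim => e e0; have [k _ [_ Hk]] := HZ' e e0 0%N.
  by exists (rsubmx (X k)) => //; have [] := HX k.
have Zu : lsubmx Z \in unitmx.
  by apply: compressed_unit => //; rewrite -l1_gt0 Z1; lra.
have Zx : lsubmx Z *m rsubmx Z = 0.
  apply/eqP; rewrite -l1_eq0; apply/eqP; apply: tends0_eq0; first exact: l1_ge0.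
  move=> e e0; pose K := Num.truncn (2 / e).
  have K0 : K.+1%:R^-1 < e / 2.
    have K1 : 2 / e < K.+1%:R by rewrite real_truncnS_gt // num_real.
    rewrite invf_plt ?posrE ?divr_gt0 ?ltr0n //.
    by rewrite invf_div.
  have [|k Kk [Hk1 Hk2]] := HZ' (e / 2) _ K; first by rewrite divr_gt0.
  have [_ h1 h2 h3] := HX k.
  have h4 : k.+1%:R^-1 <= K.+1%:R^-1 :> R.
    by rewrite lef_pV2 ?posrE ?ltr0n // ler_nat ltnS.
  have -> : lsubmx Z *m rsubmx Z = lsubmx (X k) *m rsubmx (X k)
      - lsubmx (X k) *m (rsubmx (X k) - rsubmx Z) - (lsubmx (X k) - lsubmx Z) *m rsubmx Z.
    by rewrite mulmxBr mulmxBl !opprB [X in X + _]addrC subrK addrC subrK.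
  apply: (le_lt_trans (l1B _ _)).
  have q1 := l1B (lsubmx (X k) *m rsubmx (X k)) (lsubmx (X k) *m (rsubmx (X k) - rsubmx Z)).
  have q2 := l1M (lsubmx (X k)) (rsubmx (X k) - rsubmx Z).
  have q3 := l1M (lsubmx (X k) - lsubmx Z) (rsubmx Z).
  rewrite h1 in q2; rewrite Z2 in q3.
  have h5 := le_lt_trans (le_trans h3 h4) K0; clear h3 h4 K0; lra.
have : rsubmx Z = 0 by rewrite -(mulKmx Zu (rsubmx Z)) Zx mulmx0.
by move=> Z0; move: Z2; rewrite Z0 l1_0 => /eqP; rewrite eq_sym invr_eq0 pnatr_eq0.
Qed.

Lemma det_le m (A : 'M[R]_m) : `|\det A| <= (m`!)%:R * l1 A ^+ m.
Proof.
apply: (le_trans (ler_norm_sum _ _ _)).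
apply: (@le_trans _ _ (\sum_(s : 'S_m) l1 A ^+ m)).
  apply: ler_sum => s _; rewrite normrM normrX normrN1 expr1n mul1r normr_prod.
  apply: (@le_trans _ _ (\prod_(i < m) l1 A)); last by rewrite prodr_const card_ord.
  by apply: ler_prod => i _; rewrite normr_ge0 l1_entry.
by rewrite sumr_const card_Sn mulr_natl.
Qed.

Lemma l1_cols m p (A : 'M[R]_(m, p)) : l1 A = \sum_j l1 (col j A).
Proof.
rewrite /l1 exchange_big; apply: eq_bigr => j _; apply: eq_bigr => i _.
by rewrite big_ord1 mxE.
Qed.

Lemma det1_l1_ge (A : 'M[R]_r) : `|\det A| = 1 -> (r`!)%:R^-1 <= l1 A.
Proof.
move=> dA; have := det_le A; rewrite dA; have f0 : 0 < (r`!)%:R :> R by rewrite ltr0n fact_gt0.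
have A0 := l1_ge0 A; rewrite -ler_pdivrMl // mulr1 => H.
have [A1|A1] := lerP (l1 A) 1.
  have E : l1 A ^+ r = l1 A * l1 A ^+ r.-1 by rewrite -exprS prednK.
  by apply: (le_trans H); rewrite E ler_piMr // exprn_ile1.
apply: le_trans (ltW A1); rewrite invf_le1 // -[1]/(1%:R) ler_nat fact_gt0 //.
Qed.

(** Every nonzero compressed limit has a multiple in this semigroup, which is
    bounded. *)
Definition compressed1 : set 'M[R]_r := [set N | compressed N /\ `|\det N| = 1].

(** By compressed_expands the norm of a compressed limit controls its inverse; a
    determinant of modulus 1 then bounds the norm itself from both sides. *)
Lemma compressed1_bounded : exists B, forall N, compressed1 N ->
  [/\ N \in unitmx, sq N <= B & sq (invmx N) <= B].
Proof.
have [c c0 Hc] := compressed_expands.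
have f0 : 0 < (r`!)%:R^-1 :> R by rewrite invr_gt0 ltr0n fact_gt0.
pose b := l1 (1%:M : 'M[R]_r) / (c * (r`!)%:R^-1).
exists (b ^+ 2) => N [DN dN].
have uN : N \in unitmx by rewrite unitmxE unitfE -normr_eq0 dN oner_eq0.
have dV : `|\det (invmx N)| = 1 by rewrite det_inv normfV dN invr1.
have expand : c * l1 N * l1 (invmx N) <= l1 (1%:M : 'M[R]_r).
  rewrite -(mulmxV uN) [X in _ * X <= _]l1_cols [X in _ <= X]l1_cols mulr_sumr.
  apply: ler_sum => j _; apply: (le_trans (Hc N (col j (invmx N)) DN)).
  by rewrite !colE mulmxA.
have h1 := det1_l1_ge dN; have h2 := det1_l1_ge dV.
have a0 := l1_ge0 N; have b0 := l1_ge0 (invmx N).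
have le_b x : 0 <= x -> c * (r`!)%:R^-1 * x <= l1 (1%:M : 'M[R]_r) -> x ^+ 2 <= b ^+ 2.
  move=> x0 Hx; have xb : x <= b by rewrite /b ler_pdivlMr ?mulr_gt0 // mulrC.
  by rewrite lerXn2r ?nnegrE // (le_trans x0).
split=> //; apply: (le_trans (sq_le_l1 _)); apply: le_b => //; apply: le_trans expand.
  by rewrite -!mulrA ler_pM2l // mulrC ler_wpM2l.
by rewrite -!mulrA ler_pM2l // ler_wpM2r.
Qed.

Lemma compressed1M N N' : compressed1 N -> compressed1 N' -> compressed1 (N *m N').
Proof.
move=> [DN dN] [DN' dN']; split; first exact: compressedM.
by rewrite det_mulmx normrM dN dN' mulr1.
Qed.

Lemma compressed_scale N : compressed N -> N != 0 ->
  exists2 a, a != 0 & compressed1 (a^-1 *: N).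
Proof.
move=> DN N0; have uN := compressed_unit DN N0.
have d0 : 0 < `|\det N| by rewrite normr_gt0 -unitfE -unitmxE.
pose a := `|\det N| `^ (r%:R^-1).
have a0 : 0 < a by rewrite powR_gt0.
exists a; first by rewrite gt_eqF.
split; first exact: compressedZ.
have ar : a ^+ r = `|\det N|.
  by rewrite /a -powR_mulrn ?powR_ge0 // -powRrM mulVf ?powRr1 // ?pnatr_eq0 -?lt0n.
by rewrite detZ normrM normrX gtr0_norm ?invr_gt0 // exprVn ar mulVf // gt_eqF.
Qed.

(** The form compress(X)^T Q compress(X), extended linearly in X (x) X. *)
Definition pull (Q : 'M[R]_r) (Y : 'M[R]_(d * d)) : 'M[R]_r :=
  \matrix_(a, b) \sum_i \sum_j Q i j *
    ((V *t V) *m Y *m ((U *m (V *m U)) *t (U *m (V *m U))))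
      (mxtens_index (i, j)) (mxtens_index (a, b)).

Lemma pull_tens Q X : pull Q (X *t X) = (compress X)^T *m Q *m compress X.
Proof.
apply/matrixP => a b; rewrite mxE.
under eq_bigr do under eq_bigr do rewrite !tensmx_mul tensmxE -/(compress X).
move: (compress X) => P; rewrite exchange_big !mxE; apply: eq_bigr => j _.
by rewrite mxE mulr_suml; apply: eq_bigr => i _; rewrite mxE; ring.
Qed.

Lemma pull0 Q : pull Q 0 = 0.
Proof.
apply/matrixP => a b; rewrite !mxE big1 // => i _; rewrite big1 // => j _.
by rewrite mulmx0 mul0mx mxE mulr0.
Qed.

Lemma pullDZ Q c Y Z : pull Q (c *: Y + Z) = c *: pull Q Y + pull Q Z.
Proof.
apply/matrixP => a b; rewrite !mxE mulr_sumr -big_split; apply: eq_bigr => i _ /=.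
rewrite mulr_sumr -big_split; apply: eq_bigr => j _ /=.
by rewrite mulmxDr mulmxDl -scalemxAr -scalemxAl !mxE mulrDr mulrCA.
Qed.

Definition almost_invariant (Q : 'M[R]_r) (e : R) :=
  forall k, compressed1 k -> sq (k^T *m Q *m k - Q) <= e.

Lemma sqD_le m p (A B : 'M[R]_(m, p)) : sq (A + B) <= 2 * sq A + 2 * sq B.
Proof.
have := sq_parallelogram A B; rewrite sqZ => H; have := sq_ge0 (A - B).
have -> : sq (A + B) = 4 * (2^-1 ^+ 2 * sq (A + B)) by field.
lra.
Qed.

(** A compressed element of T is a multiple of an element of compressed1, so the
    pull back of an almost invariant form is almost proportional to this form;
    this is linear in X (x) X and extends to the span. *)
Lemma pull_almost_invariant Y : quad_span T Y -> exists s A : R, 0 <= A /\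
  forall Q e, almost_invariant Q e -> sq (pull Q Y - s *: Q) <= A * e.
Proof.
move=> [l [lT ->]]; elim: l lT => [|[c t] l IH] lT.
  exists 0, 0; split => // Q e _; rewrite big_nil pull0 scale0r subrr mul0r.
  by rewrite /sq big1 // => i _; rewrite big1 // => j _; rewrite mxE expr0n.
have [|s [A [A0 HA]]] := IH; first by move=> p pl; apply: lT; rewrite in_cons pl orbT.
have Tt : T t by apply: (lT (c, t)); rewrite mem_head.
have Dt : compressed (compress (SLval t)) by apply/compressed_elt/limit_cone_elt.
have [s1 [A1 [A10 H1]]] : exists s A : R, 0 <= A /\
    forall Q e, almost_invariant Q e -> sq (pull Q (SLval t *t SLval t) - s *: Q) <= A * e.
  have [t0|t0] := eqVneq (compress (SLval t)) 0.
    exists 0, 0; split => // Q e _; rewrite pull_tens t0 trmx0 !mul0mx scale0r subrr mul0r.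
    by rewrite /sq big1 // => i _; rewrite big1 // => j _; rewrite mxE expr0n.
  have [a a0 Ka] := compressed_scale Dt t0.
  exists (a ^+ 2), ((a ^+ 2) ^+ 2); split => [|Q e inv]; first exact: sqr_ge0.
  rewrite pull_tens; set N := a^-1 *: compress (SLval t) in Ka.
  have -> : compress (SLval t) = a *: N by rewrite /N scalerA divff // scale1r.
  rewrite [(a *: N)^T]linearZ /= -!scalemxAl -scalemxAr scalerA -expr2 -scalerBr sqZ.
  by rewrite ler_wpM2l ?sqr_ge0 // inv.
exists (c * s1 + s), (2 * (c ^+ 2 * A1) + 2 * A); split.
  by have := mulr_ge0 (sqr_ge0 c) A10; lra.
move=> Q e inv; rewrite big_cons /= pullDZ.
have -> : c *: pull Q (SLval t *t SLval t) + pull Q (\sum_(j <- l) j.1 *: (SLval j.2 *t SLval j.2)) -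
    (c * s1 + s) *: Q = c *: (pull Q (SLval t *t SLval t) - s1 *: Q) +
    (pull Q (\sum_(j <- l) j.1 *: (SLval j.2 *t SLval j.2)) - s *: Q).
  by rewrite scalerBr scalerDl scalerA opprD addrACA.
apply: (le_trans (sqD_le _ _)); rewrite sqZ.
have h1 := H1 Q e inv; have h2 := HA Q e inv; have h3 := sqr_ge0 c.
have h4 : c ^+ 2 * sq (pull Q (SLval t *t SLval t) - s1 *: Q) <= c ^+ 2 * (A1 * e).
  by rewrite ler_wpM2l.
lra.
Qed.

Lemma pair_sq_le m (x y : 'cV[R]_m) : (pair x^T y) ^+ 2 <= sq x * sq y.
Proof. by apply: (le_trans (entry_le_sq _ _ _)); rewrite -(sq_tr x); exact: sqM. Qed.

Lemma form_le m (G : 'M[R]_m) x del : 0 <= del -> sq G <= del ^+ 2 ->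
  `|pair x^T (G *m x)| <= del * sq x.
Proof.
move=> d0 HG; rewrite -(@ler_pXn2r _ 2) ?nnegrE ?mulr_ge0 ?sq_ge0 //.
rewrite real_normK ?num_real //; apply: (le_trans (pair_sq_le _ _)).
apply: (le_trans (ler_wpM2l (sq_ge0 _) (sqM _ _))).
rewrite exprMn expr2 mulrCA -!expr2 ler_wpM2r ?sqr_ge0 //.
Qed.

(** Up to an arbitrarily small error, the compression multiplies an almost
    invariant form by a scalar; these forms are uniformly equivalent to the square
    norm. *)
Lemma compress_quasiconformal : exists2 kap, 0 < kap &
  forall X, quad_span T (X *t X) -> forall x y : 'cV[R]_r,
    kap * sq (compress X *m x) * sq y <= sq (compress X *m y) * sq x.
Proof.
have [B HB] := compressed1_bounded.
have [m [C [m0 C0 HQ]]] := almost_invariant_form compressed1M HB.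
pose c := 1 + C; have c0 : 0 < c by rewrite /c; lra.
exists (m ^+ 2 / c ^+ 2); first by rewrite divr_gt0 // exprn_gt0.
move=> X qX x y; have [s [A [A0 HA]]] := pull_almost_invariant qX.
pose s' := Num.max s 0.
have key del : 0 < del -> m * sq (compress X *m x) <= s' * c * sq x + del * sq x /\
    s' * m * sq y - del * sq y <= c * sq (compress X *m y).
  move=> del0; have [|Q [Qm QC Qinv]] := HQ (del ^+ 2 / (A + 1)).
    by rewrite divr_gt0 ?exprn_gt0 // ltr_wpDl.
  have := HA Q _ Qinv; rewrite pull_tens; set P := compress X; clearbody P; set G := _ - _ => HG.
  have {}HG : sq G <= del ^+ 2.
    apply: (le_trans HG); rewrite mulrA ler_pdivrMr ?ltr_wpDl //.
    by rewrite mulrC ler_wpM2l ?sqr_ge0 // lerDl.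
  have E z : pair z^T (G *m z) = pair (P *m z)^T (Q *m (P *m z)) - s * pair z^T (Q *m z).
    rewrite /G mulmxBl pairDr pairNr -scalemxAl pairZr trmx_mul.
    by rewrite pairM -!mulmxA.
  have Qu z : `|pair z^T (Q *m z)| <= c * sq z.
    apply: form_le; first exact: ltW.
    by apply: (le_trans QC); rewrite /c; nra.
  have hx := form_le x (ltW del0) HG; have hy := form_le y (ltW del0) HG.
  rewrite E in hx; rewrite E in hy.
  have q1 := Qm (P *m x); have q2 := Qm x; have q3 := Qm y.
  have u1 := Qu x; have u2 := Qu (P *m y).
  have x0 := sq_ge0 x; have y0 := sq_ge0 y; have py0 := sq_ge0 (P *m y).
  move: hx hy u1 u2; rewrite !ler_norml => /andP[hx1 hx2] /andP[hy1 hy2] /andP[u1 u1'] /andP[u2 u2'].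
  have mx0 : 0 <= m * sq x by rewrite mulr_ge0 // ltW.
  have my0 : 0 <= m * sq y by rewrite mulr_ge0 // ltW.
  rewrite /s'; case: (lerP s 0) => s0.
    rewrite mul0r !mul0r add0r; split.
      have : s * pair x^T (Q *m x) <= 0 by rewrite mulr_le0_ge0 //; lra.
      lra.
    have : 0 <= del * sq y by rewrite mulr_ge0 // ltW.
    have : 0 <= c * sq (P *m y) by rewrite mulr_ge0 // ltW.
    lra.
  split.
    have : s * pair x^T (Q *m x) <= s * (c * sq x) by rewrite ler_wpM2l // ltW.
    lra.
  have : s * (m * sq y) <= s * pair y^T (Q *m y) by rewrite ler_wpM2l // ltW.
  lra.
have x0 := sq_ge0 x; have y0 := sq_ge0 y.
have lim (a b z : R) : 0 <= z -> (forall del, 0 < del -> a <= b + del * z) -> a <= b.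
  move=> z0 H; apply/ler_addgt0Pr => e e0.
  apply: (le_trans (H (e / (z + 1)) _)); first by rewrite divr_gt0 // ltr_wpDl.
  rewrite lerD2l mulrAC ler_pdivrMr ?ltr_wpDl // ler_wpM2l ?lerDl //.
  exact: ltW.
have k1 : m * sq (compress X *m x) <= s' * c * sq x.
  by apply: (lim _ _ (sq x)) => // del /key[].
have k2 : s' * m * sq y <= c * sq (compress X *m y).
  by apply: (lim _ _ (sq y)) => // del /key[_]; lra.
rewrite -mulrA mulrAC ler_pdivrMr ?exprn_gt0 //.
have s0 : 0 <= s' by rewrite /s' le_max lexx orbT.
have h1 : m * sq (compress X *m x) * (m * sq y) <= s' * c * sq x * (m * sq y).
  by rewrite ler_wpM2r // mulr_ge0 // ltW.
have h2 : s' * m * sq y * (c * sq x) <= c * sq (compress X *m y) * (c * sq x).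
  by rewrite ler_wpM2r // mulr_ge0 // ltW.
nra.
Qed.
End Compressed.

(** * A proximal element in the semigroup *)

Section SemigroupProximal.
Context {R : realType} {n : nat}.
Notation d := n.+2.

Lemma sq_lipschitz m p (A B : 'M[R]_(m, p)) :
  sq A <= sq B + l1 (A - B) * (l1 A + l1 B).
Proof.
rewrite -[X in X <= _]addr0 -(subrr (sq B)) addrCA lerD2l.
apply: (@le_trans _ _ (l1 (A - B) * l1 (A + B))); last first.
  by rewrite ler_wpM2l ?l1_ge0 // l1D.
rewrite /sq -sumrB {1}/l1 mulr_suml; apply: ler_sum => i _.
rewrite -sumrB mulr_suml; apply: ler_sum => j _.
have -> : A i j ^+ 2 - B i j ^+ 2 = (A - B) i j * (A + B) i j.
  by rewrite !mxE; ring.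
apply: (le_trans (ler_norm _)); rewrite normrM ler_wpM2l //.
exact: l1_entry.
Qed.

Lemma semigroup_nonempty (S : set (SL R d)) :
  strongly_irreducible (smallest is_subgroup S) -> exists t, semigroup_of S t.
Proof.
move=> irr; apply: contrapT => H.
have S0 g : ~ S g.
  by move=> Sg; apply: H; exists g => A [_ SA]; exact: SA.
have H1 : smallest is_subgroup S `<=` [set 1%g].
  apply: smallest_sub => [|g /S0 //].
  by split=> [|g h /= -> ->|g /= ->]; rewrite ?mulg1 ?invg1.
pose W := <[const_mx 1 : 'cV[R]_d]>%VS.
have dW : \dim W = 1%N by apply/eqP; exact: dim_line_const1.
apply: (irr [:: W]) => //.
  move=> V; rewrite inE => /eqP ->; split; apply/negP => /eqP E; move: dW; rewrite E.
    by rewrite dimv0.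
  by rewrite dimvf /dim /= muln1.
by move=> g /H1 /= ->; apply/seteqP; split => [_ [u us <-]|u us] /=;
  [rewrite mul1mx|exists u => //=; rewrite mul1mx].
Qed.

(** If the least rank r of a limit of directions were larger than 1, the
    compressions of the elements of the group would be uniformly quasi-conformal,
    whereas those of the powers of a proximal element, put in general position,
    tend to a rank one matrix. So r is 1, and the elements of the semigroup close
    to a rank one matrix with a nonzero trace are proximal. *)
Lemma semigroup_proximal (S : set (SL R d)) :
  strongly_irreducible (smallest is_subgroup S) ->
  proximal (smallest is_subgroup S) ->
  exists2 t, semigroup_of S t & proximal_elt t.
Proof.
move=> irr [h Hh hprox]; set T := semigroup_of S.
have Tmul : forall g h, T g -> T h -> T (g * h)%g by exact: semigroup_mul.
have Tne : exists t, T t by exact: semigroup_nonempty.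
have ST : S `<=` T by exact: sub_smallest.
have TH : T `<=` smallest is_subgroup S.
  by move=> t Tt G Gp; case: (Gp) => [[G1 Gm Gi] SG]; exact: (Tt G (conj Gm SG)).
have Tirr : no_finite_orbit T by exact: strongly_irreducible_orbit irr.
have [r [X [r0 CX rX rXX rmin]]] := minimal_rank_limit Tmul Tne Tirr.
have [U [V [U' [V' [E UU' VV' VU]]]]] := rank_factor rX rXX.
have CUV : limit_cone T (U *m V) by rewrite -E.
have [r1|r2] := leqP r 1; last first.
  have [kap kap0 QC] := compress_quasiconformal Tmul r0 CUV UU' VV' VU rmin.
  have [l [v [u [l0 vu _ _ hlim]]]] := proximal_limit hprox.
  have u0 : u != 0.
    by apply: contra_eq_neq vu => ->; rewrite /pair mulmx0 mxE eq_sym oner_neq0.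
  have v0 : v != 0.
    by apply: contra_eq_neq vu => ->; rewrite /pair mul0mx mxE eq_sym oner_neq0.
  pose z : 'cV[R]_r := delta_mx (Ordinal r0) ord0.
  have z0 : z != 0.
    by apply/eqP => /matrixP /(_ (Ordinal r0) ord0); rewrite !mxE !eqxx => /eqP; rewrite oner_eq0.
  have Uz0 : U *m z != 0.
    by apply: contra_neq z0 => Uz; rewrite -[z]mul1mx -UU' -mulmxA Uz mulmx0.
  have [|g Tg Hg] := @orbit_avoids _ _ T Tmul Tne Tirr _
      [:: lker (linfun (mulmx V : 'cV[R]_d -> 'cV[R]_r))] u0.
    move=> W; rewrite inE => /eqP ->; apply/negP => /eqP EK.
    have : V' *m z \in fullv by rewrite memvf.
    rewrite -EK memv_ker lfunE /= mulmxA VV' mul1mx => /eqP z0'.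
    by rewrite z0' eqxx in z0.
  have [|g' Tg' Hg'] := @orbit_avoids_hyperplanes _ _ T Tmul Tne Tirr _ [:: v] Uz0.
    by rewrite inE eq_sym.
  (* g and g' put the limit u v of the powers of h in general position: its
     compression a b is nonzero, of rank one *)
  pose a := V *m (SLval g *m u); pose b := v *m SLval g' *m (U *m (V *m U)).
  have a0 : a != 0 by have := Hg _ (mem_head _ _); rewrite memv_ker lfunE.
  have b0 : b != 0.
    apply/negP => /eqP b0; have /eqP := Hg' _ (mem_head _ _); apply.
    have vgU : v *m SLval g' *m U = 0.
      by rewrite -(mulmxK VU (v *m SLval g' *m U)) -(mulmxA (_ *m _) U) -/b b0 mul0mx.
    by rewrite -pairM -pairM vgU /pair mul0mx mxE.
  pose N := l^-1 *: SLval h; pose Z := a *m b.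
  pose M k := compress U V (SLval g *m (N ^+ k) *m SLval g').
  have EZ : Z = compress U V (SLval g *m (u *m v) *m SLval g').
    by rewrite /Z /a /b /compress !mulmxA.
  pose c := l1 V * l1 (SLval g) * (l1 (SLval g') * l1 (U *m (V *m U))) + 1.
  have c0 : 0 < c by rewrite ltr_wpDl // !mulr_ge0 ?l1_ge0.
  have limM e : 0 < e -> exists k, l1 (M k - Z) < e.
    move=> e0; have [|K HK] := hlim (e / c); first by rewrite divr_gt0.
    exists K; have := HK _ (leqnn K); rewrite ltr_pdivlMr // => H.
    rewrite EZ /M /compress -mulmxBl -mulmxBr -mulmxBl -mulmxBr.
    apply: le_lt_trans H.
    rewrite -/N; move: (N ^+ K - u *m v) => D.
    have -> : V *m (SLval g *m D *m SLval g') *m (U *m (V *m U)) =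
      (V *m SLval g) *m D *m (SLval g' *m (U *m (V *m U))) by rewrite !mulmxA.
    apply: (le_trans (l1M _ _)).
    have D0 := l1_ge0 D.
    have q1 : l1 (V *m SLval g *m D) <= l1 V * l1 (SLval g) * l1 D.
      by apply: (le_trans (l1M _ _)); rewrite ler_wpM2r // l1M.
    have q2 := l1M (SLval g') (U *m (V *m U)).
    apply: (@le_trans _ _ (l1 V * l1 (SLval g) * l1 D * (l1 (SLval g') * l1 (U *m (V *m U))))).
      by apply: ler_pM; rewrite ?l1_ge0.
    by rewrite /c mulrDr mulr1 [X in X <= _](_ : _ = l1 D * (l1 V * l1 (SLval g) *
      (l1 (SLval g') * l1 (U *m (V *m U))))) ?lerDl //; ring.
  have QCM k (x y : 'cV[R]_r) : kap * sq (M k *m x) * sq y <= sq (M k *m y) * sq x.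
    have Hgk : smallest is_subgroup S (g * (h ^+ k) * g')%g.
      move=> G Gp; case: (Gp) => [[G1 Gm Gi] SG].
      have Gh : G h by exact: Hh.
      apply: (Gm); last exact: TH.
      apply: (Gm); first exact: TH.
      by elim: (k) => [|k' IH]; rewrite ?expg0 // expgS; exact: (Gm).
    have qs := quad_span_group Tmul ST Tne Hgk.
    have hx : SLval (h ^+ k)%g = SLval h ^+ k.
      by elim: (k) => [|k' IH]; rewrite ?expg0 // expgS exprS -IH.
    have EM : M k = (l^-1 ^+ k) *: compress U V (SLval (g * (h ^+ k) * g')%g).
      rewrite /M /N exprZn /compress -hx -!scalemxAr -!scalemxAl -!scalemxAr.
      by rewrite -!scalemxAl.
    have := QC _ qs x y; rewrite EM -!scalemxAl !sqZ => H.
    have := ler_wpM2l (sqr_ge0 (l^-1 ^+ k)) H; lra.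
  have [y y0 by0] : exists2 y : 'cV[R]_r, y != 0 & pair b y = 0.
    pose K := lker (linfun (mulmx b : 'cV[R]_r -> 'cV[R]_1)).
    exists (vpick K); last by apply/eqP; rewrite -memv_lker memv_pick.
    rewrite vpick0; apply/negP => /eqP K0.
    have := limg_ker_dim (linfun (mulmx b : 'cV[R]_r -> 'cV[R]_1)) fullv.
    rewrite capfv -/K K0 dimv0 add0n dimvf /dim /= muln1 => Er.
    have := dimvS (subvf (limg (linfun (mulmx b : 'cV[R]_r -> 'cV[R]_1)))).
    by rewrite Er dimvf /dim /= muln1 leqNgt r2.
  pose x := b^T.
  have bx : pair b x != 0.
    have -> : pair b x = sq x by rewrite sq_col1 trmxK.
    apply: contra_neq b0 => /sq_eq0 /(congr1 trmx); rewrite trmxK => ->.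
    by rewrite trmx0.
  have Zy : Z *m y = 0 by rewrite /Z rank1_col by0 scale0r.
  have Zx : 0 < sq (Z *m x).
    rewrite lt_neqAle sq_ge0 andbT eq_sym; apply: contra_neq a0 => /sq_eq0.
    rewrite /Z rank1_col => /eqP; rewrite scaler_eq0 (negbTE bx) /=.
    by move/eqP.
  have sy : 0 < sq y.
    by rewrite lt_neqAle sq_ge0 andbT eq_sym; apply: contra_neq y0 => /sq_eq0.
  exfalso.
  pose C1 := (l1 Z + 1) * l1 y * l1 y * sq x.
  pose C2 := kap * (l1 x * ((l1 Z + 1) * l1 x + l1 Z * l1 x)) * sq y.
  have Z0 := l1_ge0 Z; have x0 := l1_ge0 x; have ly0 := l1_ge0 y; have sx0 := sq_ge0 x.
  have C10 : 0 <= C1 by rewrite /C1 !mulr_ge0 // addr_ge0.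
  have C20 : 0 <= C2.
    by rewrite /C2 mulr_ge0 ?sq_ge0 // mulr_ge0 ?(ltW kap0) // mulr_ge0 // addr_ge0 // mulr_ge0 // addr_ge0.
  pose A := kap * sq (Z *m x) * sq y; have A0 : 0 < A by rewrite !mulr_gt0.
  pose e := Num.min 1 (A / (C1 + C2 + 1)).
  have CC : 0 < C1 + C2 + 1 by lra.
  have e0 : 0 < e by rewrite lt_min ltr01 divr_gt0.
  have [k Hk] := limM e e0; set del := l1 (M k - Z) in Hk.
  have del0 : 0 <= del by exact: l1_ge0.
  have del1 : del <= 1 by apply: ltW; apply: (lt_le_trans Hk); rewrite ge_min lexx.
  have delA : del * (C1 + C2 + 1) < A.
    by rewrite -ltr_pdivlMr //; apply: (lt_le_trans Hk); rewrite ge_min lexx orbT.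
  have lM (w : 'cV[R]_r) : l1 (M k *m w) <= (l1 Z + 1) * l1 w.
    apply: (le_trans (l1M _ _)); rewrite ler_wpM2r ?l1_ge0 //.
    by have := l1D Z (M k - Z); rewrite addrC subrK => H; apply: (le_trans H); rewrite lerD2l.
  have lMZ (w : 'cV[R]_r) : l1 (M k *m w - Z *m w) <= del * l1 w by rewrite -mulmxBl l1M.
  have h1 : sq (M k *m y) <= del * ((l1 Z + 1) * l1 y * l1 y).
    apply: (le_trans (sq_lipschitz _ (Z *m y))); rewrite Zy l1_0 addr0.
    have -> : sq (0 : 'cV[R]_r) = 0 by rewrite /sq big1 // => i _; rewrite big1 // => j _; rewrite mxE expr0n.
    rewrite add0r subr0.
    have := lMZ y; rewrite Zy subr0 => hy.
    have -> : del * ((l1 Z + 1) * l1 y * l1 y) = (del * l1 y) * ((l1 Z + 1) * l1 y) by ring.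
    by apply: ler_pM; rewrite ?l1_ge0.
  have h2 : sq (Z *m x) <= sq (M k *m x) + del * (l1 x * ((l1 Z + 1) * l1 x + l1 Z * l1 x)).
    apply: (le_trans (sq_lipschitz _ (M k *m x))); rewrite lerD2l l1BC mulrA.
    apply: ler_pM; rewrite ?l1_ge0 ?addr_ge0 ?l1_ge0 //.
    by rewrite addrC; apply: lerD => //; exact: l1M.
  have h3 := QCM k x y.
  have h4 : sq (M k *m y) * sq x <= del * C1.
    by have := ler_wpM2r sx0 h1; rewrite /C1; lra.
  have h5 : A <= kap * sq (M k *m x) * sq y + del * C2.
    have := ler_wpM2r (ltW sy) (ler_wpM2l (ltW kap0) h2); rewrite /A /C2; lra.
  have : A <= del * C1 + del * C2.
    by apply: (le_trans h5); rewrite lerD2r; exact: le_trans h3 h4.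
  rewrite leNgt => /negP; apply; apply: le_lt_trans delA.
  by rewrite 2!mulrDr mulr1 lerDl.
have {}r1 : r = 1%N by apply/eqP; rewrite eqn_leq r1.
clear rX rXX rmin UU' VV' CUV U' V'.
have [xx [yy [EX xy]]] : exists (x : 'cV[R]_d) (y : 'rV[R]_d), X = x *m y /\ pair y x != 0.
  move: U V E VU; rewrite r1 => U1 V1 E1 VU1; exists U1, V1; split => //.
  by move: VU1; rewrite pairE unitmxE det_scalar1 unitfE.
have tau0 : \tr X != 0 by rewrite EX mxtrace_rank1.
have LX : lam2 X = 0 by rewrite EX lam2_rank1.
set tau := \tr X in tau0; pose tc := trace_const (R := R) (n := n.+1).
have tc0 : 0 < tc := trace_const_gt0.
have X0 := l1_ge0 X.
pose e0 := tau ^+ 2 / (32 * tc * (2 * l1 X + 1)).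
have t20 : 0 < tau ^+ 2 by rewrite exprn_even_gt0.
have D0 : 0 < 32 * tc * (2 * l1 X + 1) by rewrite !mulr_gt0 //; lra.
pose e := Num.min 1 (Num.min (`|tau| / 2) e0).
have e_gt0 : 0 < e by rewrite !lt_min ltr01 !divr_gt0 ?normr_gt0.
have e1 : e <= 1 by rewrite ge_min lexx.
have e2 : e <= `|tau| / 2 by rewrite !ge_min lexx orbT.
have e3 : e * (32 * tc * (2 * l1 X + 1)) <= tau ^+ 2.
  by rewrite -ler_pdivlMr // !ge_min lexx !orbT.
have [a [t [Tt H]]] := CX e e_gt0.
exists t; first exact: Tt.
set Y := a *: SLval t in H.
have LY : lam2 Y <= 2 * e * (2 * l1 X + 1).
  have := lam2_add X (Y - X); rewrite addrC subrK LX add0r => hl.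
  apply: (le_trans hl); have := l1_ge0 (Y - X).
  move: (l1 (Y - X)) H => del H del0.
  have : del * l1 X <= e * l1 X by rewrite ler_wpM2r // ltW.
  have : del * del <= e * 1 by apply: ler_pM => //; lra.
  lra.
have TY : tau ^+ 2 <= 4 * (\tr Y) ^+ 2.
  have d1 : `|\tr Y - tau| <= `|tau| / 2.
    apply: le_trans e2; rewrite -raddfB; apply: (le_trans (mxtrace_le _)).
    exact: ltW.
  have d2 : `|tau| <= 2 * `|\tr Y|.
    have := ler_distD (\tr Y) tau 0; rewrite !subr0 distrC; lra.
  rewrite -(@real_normK _ tau) ?num_real // -(@real_normK _ (\tr Y)) ?num_real //.
  have -> : 4 * `|\tr Y| ^+ 2 = (2 * `|\tr Y|) ^+ 2 by ring.
  by rewrite lerXn2r ?nnegrE ?mulr_ge0.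
have key : 2 * tc * lam2 Y < (\tr Y) ^+ 2.
  have : 2 * tc * lam2 Y <= 2 * tc * (2 * e * (2 * l1 X + 1)).
    by rewrite ler_wpM2l // mulr_ge0 // ltW.
  lra.
have a0 : a != 0.
  by apply: contraTneq key => a0; rewrite /Y a0 scale0r mxtrace0 lam2_0 mulr0 expr0n ltxx.
have [l gl _] : exists2 l : R, dominant_eigenvalue t l%:C%C &
    `|l - \tr (SLval t)| * `|\tr (SLval t)| <= trace_const (n := n.+1) * lam2 (SLval t).
  apply: proximal_of_trace; move: key; rewrite /Y lam2Z mxtraceZ exprMn real_normK ?num_real //.
  by rewrite mulrCA ltr_pM2l // exprn_even_gt0.
by exists l%:C%C.
Qed.
End SemigroupProximal.

(** * Letters close to rank one matrices *)

Section MatrixLimits.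
Context {R : realType}.

Definition mcvg m p (A : nat -> 'M[R]_(m, p)) (B : 'M[R]_(m, p)) :=
  forall e, 0 < e -> exists K, forall k, (K <= k)%N -> l1 (A k - B) < e.

Lemma mcvg_cst m p (B : 'M[R]_(m, p)) : mcvg (fun=> B) B.
Proof. by move=> e e0; exists 0%N => k _; rewrite subrr l1_0. Qed.

Lemma mcvgM m p q (A : nat -> 'M[R]_(m, p)) (B : nat -> 'M[R]_(p, q)) A0 B0 :
  mcvg A A0 -> mcvg B B0 -> mcvg (fun k => A k *m B k) (A0 *m B0).
Proof.
move=> HA HB e e0.
have D0 : 0 < l1 A0 + l1 B0 + 2 by have := l1_ge0 A0; have := l1_ge0 B0; lra.
pose e1 := Num.min 1 (e / (l1 A0 + l1 B0 + 2)).
have e10 : 0 < e1 by rewrite lt_min ltr01 divr_gt0.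
have e11 : e1 <= 1 by rewrite ge_min lexx.
have e12 : e1 * (l1 A0 + l1 B0 + 2) <= e by rewrite -ler_pdivlMr // ge_min lexx orbT.
have [K1 H1] := HA _ e10; have [K2 H2] := HB _ e10.
exists (maxn K1 K2) => k; rewrite geq_max => /andP[/H1 h1 /H2 h2].
have -> : A k *m B k - A0 *m B0 = A k *m (B k - B0) + (A k - A0) *m B0.
  by rewrite mulmxBr mulmxBl addrA subrK.
apply: (le_lt_trans (l1D _ _)).
apply: (le_lt_trans (lerD (l1M _ _) (l1M _ _))).
have h3 : l1 (A k) <= l1 A0 + l1 (A k - A0).
  by have := l1D A0 (A k - A0); rewrite addrC subrK.
have p1 := l1_ge0 A0; have p2 := l1_ge0 B0; have p3 := l1_ge0 (A k - A0).
have p4 := l1_ge0 (B k - B0); have p5 := l1_ge0 (A k).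
have q1 : l1 (A k) * l1 (B k - B0) <= (l1 A0 + 1) * e1 by apply: ler_pM => //; lra.
have q2 : l1 (A k - A0) * l1 B0 <= e1 * l1 B0 by rewrite ler_wpM2r // ltW.
nra.
Qed.

Lemma mcvgZ m p a (A : nat -> 'M[R]_(m, p)) A0 :
  mcvg A A0 -> mcvg (fun k => a *: A k) (a *: A0).
Proof.
move=> HA e e0; have a0 : 0 < `|a| + 1 by rewrite ltr_wpDl.
have [|K HK] := HA (e / (`|a| + 1)); first by rewrite divr_gt0.
exists K => k /HK; rewrite ltr_pdivlMr // -scalerBr l1Z => h.
apply: le_lt_trans h; rewrite mulrC ler_wpM2l ?l1_ge0 // lerDl //.
Qed.

Lemma mcvg_comp m p (A : nat -> 'M[R]_(m, p)) A0 (f : nat -> nat) :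
  (forall K, exists K', forall k, (K' <= k)%N -> (K <= f k)%N) ->
  mcvg A A0 -> mcvg (fun k => A (f k)) A0.
Proof.
move=> Hf HA e e0; have [K HK] := HA e e0; have [K' HK'] := Hf K.
by exists K' => k /HK' /HK.
Qed.

Lemma mcvgX m (A : nat -> 'M[R]_m.+1) A0 j :
  mcvg A A0 -> mcvg (fun k => A k ^+ j) (A0 ^+ j).
Proof.
move=> HA; elim: j => [|j IH]; first by rewrite expr0; exact: mcvg_cst.
by rewrite exprS; under eq_fun do rewrite exprS; exact: mcvgM.
Qed.

Lemma eq_mcvg m p (A B : nat -> 'M[R]_(m, p)) A0 :
  (exists K, forall k, (K <= k)%N -> A k = B k) -> mcvg A A0 -> mcvg B A0.
Proof.
move=> [K1 HK1] HA e /HA [K2 HK2]; exists (maxn K1 K2) => k.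
by rewrite geq_max => /andP[/HK1 <- /HK2].
Qed.

Lemma rank1X n (x : 'cV[R]_n.+1) (y : 'rV[R]_n.+1) j :
  (x *m y) ^+ j.+1 = pair y x ^+ j *: (x *m y).
Proof.
elim: j => [|j IH]; first by rewrite expr0 expr1 scale1r.
by rewrite exprS IH -scalerAr -[_ * _]/((x *m y) *m (x *m y)) rank1M scalerA exprSr.
Qed.

End MatrixLimits.

Section Letters.
Context {R : realType} {n : nat}.
Notation d := n.+2.
Implicit Types (rho : probability (SL R d) R) (g h t : SL R d).

Lemma power_support1 rho : power_support rho 0 1%g.
Proof.
move=> e e0; rewrite /= /dirac indicE mem_set ?lte01 //.
exact: SLball_center.
Qed.

Lemma power_supportX rho m g k : power_support rho m g -> power_support rho (m * k) (g ^+ k)%g.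
Proof.
move=> Hg; elim: k => [|k IH]; first by rewrite muln0 expg0; exact: power_support1.
by rewrite mulnS expgS; exact: power_support_mul.
Qed.

Lemma SLvalX g k : SLval (g ^+ k)%g = SLval g ^+ k.
Proof. by elim: k => [|k IH]; rewrite ?expg0 // expgS exprS -IH. Qed.

Lemma semigroup_length rho t : semigroup_of (measure_support rho) t ->
  exists2 m, (0 < m)%N & power_support rho m t.
Proof.
have : semigroup_of (measure_support rho) `<=` [set t | exists2 m, (0 < m)%N & power_support rho m t].
  apply: smallest_sub => [g h /= [m m0 Hg] [k k0 Hh]|g Hg].
    by exists (m + k)%N; rewrite ?addn_gt0 ?m0 //; exact: power_support_mul.
  by exists 1%N => //; exact: measure_support1.
by move=> H /H.
Qed.

(** The attracting vector u and the attracting form v of a proximal element of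
    the semigroup, and images of them in general position. *)
Record directions := Directions {
  dir_u : 'cV[R]_d; dir_v : 'rV[R]_d; dir_x : 'I_d -> 'cV[R]_d; dir_y : 'rV[R]_d;
  dir_vu : pair dir_v dir_u = 1;
  dir_vx : forall j, pair dir_v (dir_x j) != 0;
  dir_basis : (\matrix_(i, j) dir_x j i ord0) \in unitmx;
  dir_yu : pair dir_y dir_u != 0;
  dir_yv : forall a, dir_y != a *: dir_v }.

Definition near_rank1 (sigma e : R) (X : 'M[R]_d) (x : 'cV[R]_d) (y : 'rV[R]_d) :=
  l1 (sigma^-1 *: X - x *m y) < e.

(** Words of one common length, close up to one common scalar to rank one
    matrices with prescribed images and kernels. With g proximal of length L,
    the length of (c g^j)^L is a multiple of L whatever the length of c, and its
    direction is still that of c u v; powers of g then adjust the length. *)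
Lemma letters_exist rho : strongly_irreducible (support_group rho) ->
  proximal (support_group rho) ->
  exists D : directions, forall e, 0 < e ->
  exists (ell : nat) (sigma : R) (a b : SL R d) (c : 'I_d -> SL R d),
  [/\ (0 < ell)%N /\ sigma != 0,
      power_support rho ell a /\ near_rank1 sigma e (SLval a) (dir_u D) (dir_v D),
      power_support rho ell b /\ near_rank1 sigma e (SLval b) (dir_u D) (dir_y D) &
      forall j, power_support rho ell (c j) /\
        near_rank1 sigma e (SLval (c j)) (dir_x D j) (dir_v D)].
Proof.
move=> irr prox; set T := semigroup_of (measure_support rho).
have Tmul : forall g h, T g -> T h -> T (g * h)%g by exact: semigroup_mul.
have Tne : exists t, T t by exact: semigroup_nonempty.
have Tirr : no_finite_orbit T.
  by apply: strongly_irreducible_orbit irr; exact: sub_smallest.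
have [g Tg gprox] := semigroup_proximal irr prox.
have [l [v [u [l0 vu gu vg hlim]]]] := proximal_limit gprox.
have u0 : u != 0 by apply: contra_eq_neq vu => ->; rewrite /pair mulmx0 mxE eq_sym oner_neq0.
have v0 : v != 0 by apply: contra_eq_neq vu => ->; rewrite /pair mul0mx mxE eq_sym oner_neq0.
have [L L0 gL] := semigroup_length Tg.
have [c0 [Hc0 cbasis]] := orbit_basis Tmul Tne Tirr u0 v0.
have exlen i : exists m, power_support rho m (c0 i).
  by have [m _ Hm] := semigroup_length (Hc0 i).1; exists m.
have [len Hlen] := choice exlen.
have [|d0 [Td0 vd0u d0v]] := @moving_form _ _ T u v Tmul Tne Tirr.
  by rewrite vu oner_neq0.
have [m _ d0m] := semigroup_length Td0.
pose x j := l^-1 ^+ len j * pair v (SLval (c0 j) *m u) ^+ L.-1 *: (SLval (c0 j) *m u).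
pose y := l^-1 ^+ m * pair v (SLval d0 *m u) ^+ L.-1 *: (v *m SLval d0).
have lV k : l^-1 ^+ k != 0 by rewrite expf_neq0 // invr_neq0.
have vx j : pair v (x j) != 0.
  rewrite /x pairZr mulf_neq0 ?(Hc0 j).2 // mulf_neq0 //.
  by rewrite expf_neq0 // (Hc0 j).2.
have yu : pair y u != 0.
  by rewrite /y pairZl pairM mulf_neq0 // mulf_neq0 // expf_neq0.
have xbasis : (\matrix_(i, j) x j i ord0) \in unitmx.
  have -> : \matrix_(i, j) x j i ord0 = (\matrix_(i, j) (SLval (c0 j) *m u) i ord0) *m
      diag_mx (\row_j (l^-1 ^+ len j * pair v (SLval (c0 j) *m u) ^+ L.-1)).
    apply/matrixP => i j; rewrite mul_mx_diag [RHS]mxE [X in X * _]mxE [X in _ * X]mxE mulrC.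
    by rewrite mxE /x mxE.
  rewrite unitmx_mul cbasis /= unitmxE det_diag unitfE.
  apply/prodf_neq0 => j _; rewrite mxE mulf_neq0 //.
  by rewrite expf_neq0 // (Hc0 j).2.
have yv a : y != a *: v.
  apply/eqP; rewrite /y => /(congr1 (fun z => (l^-1 ^+ m * pair v (SLval d0 *m u) ^+ L.-1)^-1 *: z)).
  rewrite !scalerA mulVf ?scale1r; last by rewrite mulf_neq0 // expf_neq0.
  by apply/eqP; exact: d0v.
exists (Directions vu vx xbasis yu yv) => e e0 /=.
pose N := l^-1 *: SLval g.
have Ncvg : mcvg (fun k => N ^+ k) (u *m v) by exact: hlim.
pose q j := (L * j + j)%N.
(* the three families of words of length L * q j *)
pose A j : SL R d := (g ^+ q j)%g.
pose C i j : SL R d := ((c0 i * g ^+ j) ^+ L * g ^+ (j - len i))%g.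
pose B j : SL R d := (g ^+ (j - m) * (g ^+ j * d0) ^+ L)%g.
have qbig K : exists K', forall k, (K' <= k)%N -> (K <= q k)%N.
  by exists K => k kK; rewrite (leq_trans kK) // leq_addl.
have subbig p K : exists K', forall k, (K' <= k)%N -> (K <= k - p)%N.
  by exists (K + p)%N => k kK; rewrite leq_subRL ?(leq_trans _ kK) ?leq_addl // addnC.
have idbig K : exists K', forall k, (K' <= k)%N -> (K <= k)%N by exists K.
have XL (z : 'cV[R]_d) (w : 'rV[R]_d) : (z *m w) ^+ L = pair w z ^+ L.-1 *: (z *m w).
  by rewrite -rank1X prednK.
have Acvg : mcvg (fun j => (l ^+ q j)^-1 *: SLval (A j)) (u *m v).
  apply: eq_mcvg (mcvg_comp qbig Ncvg); exists 0%N => k _.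
  by rewrite /N exprZn exprVn SLvalX.
have Ccvg i : mcvg (fun j => (l ^+ q j)^-1 *: SLval (C i j)) (x i *m v).
  have -> : x i *m v = l^-1 ^+ len i *: ((SLval (c0 i) *m (u *m v)) ^+ L *m (u *m v)).
    by rewrite (mulmxA (SLval (c0 i)) u v) XL -[in RHS]scalemxAl rank1M vu scale1r scalerA /x -scalemxAl.
  apply: eq_mcvg (mcvgZ (l^-1 ^+ len i) (mcvgM (mcvgX L (mcvgM (mcvg_cst (SLval (c0 i)))
    Ncvg)) (mcvg_comp (subbig (len i)) Ncvg))).
  exists (len i) => k lk; rewrite /C SL_mulE !SLvalX SL_mulE SLvalX.
  have E1 : SLval (c0 i) *m N ^+ k = l^-1 ^+ k *: (SLval (c0 i) *m SLval g ^+ k).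
    by rewrite /N exprZn -scalemxAr.
  rewrite E1 /N !exprZn -scalemxAl -scalemxAr !scalerA.
  congr (_ *: _); rewrite -exprM -!exprD -exprVn; congr (_ ^+ _).
  by rewrite /q; lia.
have Bcvg : mcvg (fun j => (l ^+ q j)^-1 *: SLval (B j)) (u *m y).
  have -> : u *m y = l^-1 ^+ m *: ((u *m v) *m ((u *m v) *m SLval d0) ^+ L).
    by rewrite -(mulmxA u v (SLval d0)) XL -[in RHS]scalemxAr rank1M vu scale1r scalerA /y -scalemxAr pairM.
  apply: eq_mcvg (mcvgZ (l^-1 ^+ m) (mcvgM (mcvg_comp (subbig m) Ncvg)
    (mcvgX L (mcvgM Ncvg (mcvg_cst (SLval d0)))))).
  exists m => k lk; rewrite /B SL_mulE !SLvalX SL_mulE SLvalX.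
  have E1 : N ^+ k *m SLval d0 = l^-1 ^+ k *: (SLval g ^+ k *m SLval d0).
    by rewrite /N exprZn -scalemxAl.
  rewrite E1 /N !exprZn -scalemxAl -scalemxAr !scalerA.
  congr (_ *: _); rewrite -exprM -!exprD -exprVn; congr (_ ^+ _).
  by rewrite /q; lia.
have [K0 HA] := Acvg e e0; have [K1 HB] := Bcvg e e0.
have exC i : exists K, forall k, (K <= k)%N -> l1 ((l ^+ q k)^-1 *: SLval (C i k) - x i *m v) < e.
  exact: (Ccvg i e e0).
have [KC HC] := choice exC.
pose j := (maxn (maxn K0 K1) (\max_i KC i) + (\max_i len i) + m).+1.
have jlen i : (len i <= j)%N.
  by rewrite /j -addnS (leq_trans _ (leq_addr _ _)) // (leq_trans (leq_bigmax i)) // leq_addl.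
have jm : (m <= j)%N by rewrite /j -addSn leq_addl.
have jK : (maxn (maxn K0 K1) (\max_i KC i) <= j)%N by rewrite /j -addSn -addSn -addnA leqW ?leq_addr.
exists (L * q j)%N, (l ^+ q j), (A j), (B j), (fun i => C i j); split.
- by rewrite muln_gt0 L0 /q addn_gt0 orbT expf_neq0.
- split; first exact: power_supportX.
  by apply: HA; apply: leq_trans jK; rewrite !leq_max leqnn.
- split; last by apply: HB; apply: leq_trans jK; rewrite !leq_max leqnn orbT.
  have -> : (L * q j = L * (j - m) + (L * j + m) * L)%N.
    have [k jE] : exists k, j = (m + k)%N by exists (j - m)%N; rewrite subnKC.
    by rewrite /q jE addKn; ring.
  apply: power_support_mul; first exact: power_supportX.
  apply: power_supportX; apply: power_support_mul => //; exact: power_supportX.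
- move=> i; split; last first.
    by apply: HC; apply: leq_trans jK; rewrite leq_max leq_bigmax orbT.
  have -> : (L * q j = (len i + L * j) * L + L * (j - len i))%N.
    have [k jE] : exists k, j = (len i + k)%N by exists (j - len i)%N; rewrite subnKC.
    by rewrite /q jE addKn; ring.
  apply: power_support_mul; last exact: power_supportX.
  apply: power_supportX; apply: power_support_mul => //; exact: power_supportX.
Qed.
End Letters.

(** * Cones and alphabets *)

Section Cones.
Context {R : realType} {d' : nat}.
Notation d := d'.+1.
Variables (v : 'rV[R]_d) (u : 'cV[R]_d) (eta H : R).

(** A cone around the vector u on which v is a coordinate along u; eta is its
    width. *)
Definition in_cone (x : 'cV[R]_d) := l1 (x - pair v x *: u) <= eta * `|pair v x|.

Definition expands (s : R) (X : 'M[R]_d) := forall x, in_cone x ->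
  in_cone (X *m x) /\ s * `|pair v x| <= `|pair v (X *m x)|.

Definition in_dual_cone (y : 'rV[R]_d) := l1 y <= H * `|pair y u|.

Definition dual_expands (s : R) (X : 'M[R]_d) := forall y, in_dual_cone y ->
  in_dual_cone (y *m X) /\ s * `|pair y u| <= `|pair (y *m X) u|.

Lemma expandsM s t X Y : 0 <= s -> expands s X -> expands t Y -> expands (s * t) (X *m Y).
Proof.
move=> s0 HX HY x /HY[cY hY]; have [cX hX] := HX _ cY; rewrite -mulmxA; split=> //.
by apply: le_trans hX; rewrite -mulrA ler_wpM2l.
Qed.

Lemma dual_expandsM s t X Y : 0 <= t ->
  dual_expands s X -> dual_expands t Y -> dual_expands (s * t) (X *m Y).
Proof.
move=> t0 HX HY y /HX[cX hX]; have [cY hY] := HY _ cX; rewrite mulmxA; split=> //.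
by apply: le_trans hY; rewrite mulrAC mulrC ler_wpM2l // mulrC.
Qed.

Lemma in_coneZ a x : in_cone x -> in_cone (a *: x).
Proof.
rewrite /in_cone pairZr -scalerA -scalerBr l1Z normrM mulrCA => h.
by rewrite ler_wpM2l.
Qed.

(** The image of z is (y z) u up to the error E z, which is small when y z is
    comparable with the norm of z. *)
Lemma near_rank1_cone (E : 'M[R]_d) (y : 'rV[R]_d) (z : 'cV[R]_d) (e tau G Z : R) :
  1 <= G -> 0 < eta -> eta <= 1 -> l1 u <= G -> l1 v <= G -> pair v u = 1 ->
  l1 E <= e -> tau <= `|pair y z| -> l1 z <= Z -> 0 <= tau ->
  4 * G ^+ 2 * (e * Z) <= eta * tau ->
  in_cone ((u *m y + E) *m z) /\ tau / 2 <= `|pair v ((u *m y + E) *m z)|.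
Proof.
move=> G1 eta0 eta1 uG vG vu Ee yz zZ tau0 He.
have e0 : 0 <= e by exact: le_trans (l1_ge0 E) Ee.
have Z0 : 0 <= Z by exact: le_trans (l1_ge0 z) zZ.
have eZ : 0 <= e * Z by exact: mulr_ge0.
set w := E *m z; have lw : l1 w <= e * Z.
  by apply: (le_trans (l1M _ _)); apply: ler_pM; rewrite ?l1_ge0.
have EX : (u *m y + E) *m z = pair y z *: u + w by rewrite mulmxDl rank1_col.
have vX : pair v ((u *m y + E) *m z) = pair y z + pair v w.
  by rewrite EX pairDr pairZr vu mulr1.
have vw : `|pair v w| <= G * (e * Z).
  by apply: (le_trans (pair_le _ _)); apply: ler_pM; rewrite ?l1_ge0.
have G0 : 0 <= G by lra.
have GG : G * (e * Z) <= G ^+ 2 * (e * Z).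
  by rewrite expr2 -mulrA ler_wpM2l // ler_peMl.
have eZG : e * Z <= G ^+ 2 * (e * Z).
  by apply: le_trans GG; rewrite ler_peMl.
have et : eta * tau <= tau by rewrite ler_piMl.
have hv : tau / 2 <= `|pair v ((u *m y + E) *m z)|.
  rewrite vX; have := ler_normB (pair y z + pair v w) (pair v w); rewrite addrK; lra.
split=> //; rewrite /in_cone.
apply: (@le_trans _ _ (eta * (tau / 2))); last by rewrite ler_wpM2l // ltW.
have -> : (u *m y + E) *m z - pair v ((u *m y + E) *m z) *: u = w - pair v w *: u.
  by rewrite vX EX scalerDl opprD addrACA subrr add0r.
apply: (le_trans (l1B _ _)); rewrite l1Z.
have : `|pair v w| * l1 u <= G * (e * Z) * G by apply: ler_pM; rewrite ?l1_ge0.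
have -> : G * (e * Z) * G = G ^+ 2 * (e * Z) by ring.
lra.
Qed.

Lemma cone_bounds x G : 1 <= G -> 0 < eta -> eta <= 1 -> l1 u <= G -> pair v u = 1 -> in_cone x ->
  l1 x <= 2 * G * `|pair v x| /\
  forall y, l1 y <= G -> `|pair y x - pair v x * pair y u| <= G * eta * `|pair v x|.
Proof.
move=> G1 eta0 eta1 uG vu cx; have p0 := normr_ge0 (pair v x).
have et : eta * `|pair v x| <= `|pair v x| by rewrite ler_piMl.
split.
  have := l1D (x - pair v x *: u) (pair v x *: u); rewrite subrK l1Z => h.
  apply: (le_trans h); move: cx; rewrite /in_cone.
  have : `|pair v x| * l1 u <= `|pair v x| * G by rewrite ler_wpM2l.
  have : `|pair v x| <= `|pair v x| * G by rewrite ler_peMr.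
  lra.
move=> y yG; have -> : pair y x - pair v x * pair y u = pair y (x - pair v x *: u).
  by rewrite pairDr pairNr pairZr.
apply: (le_trans (pair_le _ _)); rewrite -mulrA.
by apply: ler_pM; rewrite ?l1_ge0.
Qed.

End Cones.

(** Neumann estimate for the inverse of a perturbed matrix. *)
Lemma unit_perturb (R : realType) d (X0 F : 'M[R]_d) : X0 \in unitmx ->
  l1 (invmx X0) * l1 F <= 2^-1 ->
  X0 + F \in unitmx /\ l1 (invmx (X0 + F)) <= 2 * l1 (invmx X0).
Proof.
move=> uX HF.
have uXF : X0 + F \in unitmx.
  rewrite -unitmx_tr -row_free_unit; apply: inj_row_free => w Hw.
  have {}Hw : (X0 + F) *m w^T = 0 by rewrite -[LHS]trmxK trmx_mul trmxK Hw trmx0.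
  have E : w^T = - (invmx X0 *m F *m w^T).
    apply/eqP; rewrite -addr_eq0 -{1}(mulKmx uX w^T) -mulmxA -mulmxDr.
    by rewrite -mulmxDl Hw mulmx0.
  apply/eqP; rewrite -(inj_eq trmx_inj) trmx0 -l1_eq0 eq_le l1_ge0 andbT.
  have : l1 w^T <= 2^-1 * l1 w^T.
    rewrite {1}E l1N; apply: (le_trans (l1M _ _)); rewrite ler_wpM2r ?l1_ge0 //.
    exact: le_trans (l1M _ _) HF.
  by have := l1_ge0 w^T; lra.
split=> //; set Y := invmx (X0 + F).
have E : Y = invmx X0 - invmx X0 *m F *m Y.
  have : invmx X0 *m ((X0 + F) *m Y) = invmx X0 by rewrite mulmxV // mulmx1.
  rewrite mulmxDl mulmxDr mulKmx // mulmxA => E.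
  by apply/eqP; rewrite eq_sym subr_eq E.
have : l1 Y <= l1 (invmx X0) + 2^-1 * l1 Y.
  rewrite {1}E; apply: (le_trans (l1B _ _)); rewrite lerD2l.
  apply: (le_trans (l1M _ _)); rewrite ler_wpM2r ?l1_ge0 //.
  exact: le_trans (l1M _ _) HF.
by lra.
Qed.

(** Letters close to u v form A, letters close to u y form B, and letters close to
    x_j v form C j; the latter leave the cone, to which a letter of A brings back.
    The fields al_wedge and al_basis quantify the independence of the two forms and
    of the d vectors. *)
Record alphabet (R : realType) (n : nat) := Alphabet {
  al_v : 'rV[R]_n.+2; al_u : 'cV[R]_n.+2;
  al_eta : R; al_H : R; al_s : R; al_M : R; al_om : R; al_I : R;
  al_A : set (SL R n.+2); al_B : set (SL R n.+2); al_C : 'I_n.+2 -> set (SL R n.+2);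
  al_vu : pair al_v al_u = 1;
  al_eta0 : 0 < al_eta; al_eta1 : al_eta <= 1; al_H1 : 1 <= al_H; al_etaH : al_H * al_eta <= 2^-1;
  al_uH : l1 al_u <= al_H; al_vH : l1 al_v <= al_H;
  al_s0 : 0 < al_s; al_M1 : 1 <= al_M; al_om0 : 0 < al_om; al_I0 : 0 < al_I;
  al_cone : forall x, in_cone al_v al_u al_eta x -> l1 x <= al_H * `|pair al_v x|;
  al_Aexp : forall a, al_A a -> expands al_v al_u al_eta al_s (SLval a);
  al_Bexp : forall b, al_B b -> expands al_v al_u al_eta al_s (SLval b);
  al_ACexp : forall a j c, al_A a -> al_C j c ->
    expands al_v al_u al_eta (al_s * al_s) (SLval a *m SLval c);
  al_Adual : forall a, al_A a -> dual_expands al_u al_H al_s (SLval a);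
  al_sM : al_s <= al_M;
  al_AM : forall a, al_A a -> [/\ l1 (SLval a) <= al_M, l1 (invmx (SLval a)) <= al_M &
    lam2 (SLval a) <= al_s ^+ 2 / 2];
  al_BM : forall b, al_B b -> l1 (SLval b) <= al_M;
  al_CM : forall j c, al_C j c -> l1 (SLval c) <= al_M /\ l1 (invmx (SLval c)) <= al_M;
  al_wedge : forall y a b, in_dual_cone al_u al_H y -> al_A a -> al_B b ->
    al_om * `|pair y al_u| ^+ 2 <= lam2 (col_mx (y *m SLval a) (y *m SLval b));
  al_basis : forall x (c : 'I_n.+2 -> SL R n.+2), in_cone al_v al_u al_eta x ->
    pair al_v x != 0 -> (forall j, al_C j (c j)) ->
    let X := \matrix_(i, j) (SLval (c j) *m x) i ord0 in
    X \in unitmx /\ l1 (invmx X) * `|pair al_v x| <= al_I }.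

(** * Construction of an alphabet *)

Section BuildAlphabet.
Context {R : realType} {n : nat}.
Notation d := n.+2.

Lemma lam2_col_parallel (v y : 'rV[R]_d) : v != 0 -> lam2 (col_mx v y) = 0 ->
  exists a, y = a *: v.
Proof.
move=> v0 L0.
have [k vk] : exists k, v ord0 k != 0.
  apply: contrapT => H; move/negP: v0; apply; apply/eqP/rowP => k; rewrite mxE.
  by apply/eqP; apply: contraT => vk; exfalso; apply: H; exists k.
exists (y ord0 k / v ord0 k); apply/rowP => j; rewrite mxE.
have : `|minor2 (col_mx v y) (lshift 1 ord0) (rshift 1 ord0) k j| <= 0.
  by rewrite -L0; exact: minor2_le.
rewrite normr_le0 /minor2 !col_mxEu !col_mxEd subr_eq0 => /eqP E.
by rewrite mulrAC (mulrC (y _ _)) -E mulrAC mulfV // mul1r.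
Qed.

Lemma l1_col_mx m1 m2 p (A : 'M[R]_(m1, p)) (B : 'M[R]_(m2, p)) :
  l1 (col_mx A B) = l1 A + l1 B.
Proof.
rewrite /l1 big_split_ord /=; congr (_ + _); apply: eq_bigr => i _;
  by apply: eq_bigr => j _; rewrite ?col_mxEu ?col_mxEd.
Qed.

Lemma near_split (sigma e : R) (X : 'M[R]_d) x y : sigma != 0 ->
  near_rank1 sigma e X x y ->
  exists E, [/\ X = sigma *: (x *m y + E), l1 E < e & l1 E <= e].
Proof.
move=> s0 h; exists (sigma^-1 *: X - x *m y); split => //; last exact: ltW.
by rewrite addrC subrK scalerA divff // scale1r.
Qed.

Lemma near_rank1_ball (sigma e : R) (g h : SL R d) x y : sigma != 0 ->
  near_rank1 sigma (e / 2) (SLval g) x y -> SLball g (`|sigma| * (e / 2)) h ->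
  near_rank1 sigma e (SLval h) x y.
Proof.
move=> s0 hg hh; rewrite /near_rank1.
have -> : sigma^-1 *: SLval h - x *m y =
    sigma^-1 *: (SLval h - SLval g) + (sigma^-1 *: SLval g - x *m y).
  by rewrite scalerBr addrA subrK.
apply: (le_lt_trans (l1D _ _)).
have : l1 (sigma^-1 *: (SLval h - SLval g)) < e / 2.
  rewrite l1Z normfV mulrC ltr_pdivrMr ?normr_gt0 // mulrC; exact: hh.
by move: hg; rewrite /near_rank1; lra.
Qed.

Lemma expandsZ (v : 'rV[R]_d) u eta s a X : 0 <= s -> expands v u eta s X ->
  expands v u eta (`|a| * s) (a *: X).
Proof.
move=> s0 HX x /HX[cX hX]; rewrite -scalemxAl; split; first exact: in_coneZ.
by rewrite pairZr normrM -mulrA ler_wpM2l.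
Qed.

Variable D : directions (R := R) (n := n).
Let u := dir_u D. Let v := dir_v D. Let y := dir_y D. Let x := dir_x D.

Lemma direction_bound : exists G : R, [/\ 1 <= G, l1 u <= G /\ l1 v <= G, l1 y <= G /\ G^-1 <= `|pair y u| &
  forall j, l1 (x j) <= G /\ G^-1 <= `|pair v (x j)|].
Proof.
pose G := 1 + l1 u + l1 v + l1 y + `|pair y u|^-1 + \sum_j (l1 (x j) + `|pair v (x j)|^-1).
have U := l1_ge0 u; have V := l1_ge0 v; have Y := l1_ge0 y.
have P : 0 < `|pair y u|^-1 by rewrite invr_gt0 normr_gt0 dir_yu.
have T j : 0 <= l1 (x j) + `|pair v (x j)|^-1 by rewrite addr_ge0 ?l1_ge0.
have S0 : 0 <= \sum_j (l1 (x j) + `|pair v (x j)|^-1) by apply: sumr_ge0.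
have Sj j : l1 (x j) + `|pair v (x j)|^-1 <= \sum_j (l1 (x j) + `|pair v (x j)|^-1).
  by rewrite [X in _ <= X](bigD1 j) //= lerDl sumr_ge0.
have G0 : 0 < G by rewrite /G; lra.
exists G; split; rewrite /G; [by lra|by split; lra|split; first by lra|move=> j].
  rewrite invf_ple ?posrE ?normr_gt0 ?dir_yu //; lra.
have := Sj j; have := l1_ge0 (x j).
have Q : 0 < `|pair v (x j)|^-1 by rewrite invr_gt0 normr_gt0 dir_vx.
split; first by lra.
rewrite invf_ple ?posrE ?normr_gt0 ?dir_vx //; lra.
Qed.


Lemma expands_le (v' : 'rV[R]_d) u' eta s t X : s <= t ->
  expands v' u' eta t X -> expands v' u' eta s X.
Proof.
move=> st HX z /HX[cX hX]; split=> //; apply: le_trans hX.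
by rewrite ler_wpM2r.
Qed.

Section Estimates.
Variables (G e sigma : R).
Hypothesis G1 : 1 <= G.
Hypothesis uG : l1 u <= G.
Hypothesis vG : l1 v <= G.
Hypothesis yG : l1 y <= G.
Hypothesis yuG : G^-1 <= `|pair y u|.
Hypothesis xG : forall j, l1 (x j) <= G.
Hypothesis vxG : forall j, G^-1 <= `|pair v (x j)|.
Hypothesis e0 : 0 < e.
Hypothesis eG : e * G ^+ 6 <= 200^-1.
Hypothesis s0 : sigma != 0.

Let vu : pair v u = 1. Proof. exact: dir_vu. Qed.
Let eta := (8 * G ^+ 2)^-1.
Let H := 4 * G.

Let G0 : 0 < G. Proof. exact: lt_le_trans ltr01 G1. Qed.
Let eGk k : (k <= 6)%N -> e * G ^+ k <= 200^-1.
Proof.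
move=> k6; apply: le_trans eG; rewrite ler_pM2l //.
by rewrite ler_weXn2l.
Qed.
Let eta0 : 0 < eta. Proof. by rewrite invr_gt0 mulr_gt0 // exprn_gt0. Qed.
Let eta1 : eta <= 1.
Proof.
by rewrite invf_le1 ?mulr_gt0 ?exprn_gt0 //; have := exprn_ege1 2 G1; lra.
Qed.
Let etaG : eta * G ^+ 2 = 8^-1.
Proof. by rewrite /eta; field; rewrite gt_eqF. Qed.


Let cone_step (E : 'M[R]_d) (w : 'rV[R]_d) (z : 'cV[R]_d) (xi : R) : 0 <= xi ->
  l1 E <= e -> l1 z <= 2 * G * xi -> (2 * G)^-1 * xi <= `|pair w z| ->
  in_cone v u eta ((u *m w + E) *m z) /\
  (4 * G)^-1 * xi <= `|pair v ((u *m w + E) *m z)|.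
Proof.
move=> xi0 Ee zb q.
have t0 : 0 <= (2 * G)^-1 * xi by rewrite mulr_ge0 // invr_ge0 mulr_ge0 // ltW.
have [] := near_rank1_cone G1 eta0 eta1 uG vG vu Ee q zb t0.
  have -> : 4 * G ^+ 2 * (e * (2 * G * xi)) =
      (128 * (e * G ^+ 6)) * (eta * ((2 * G)^-1 * xi)).
    by rewrite /eta; field; rewrite gt_eqF.
  rewrite ler_piMl ?(mulr_ge0 (ltW eta0) t0) //; have := eG; lra.
move=> h1 h2; split=> //; suff -> : (4 * G)^-1 * xi = (2 * G)^-1 * xi / 2 by [].
by field; rewrite gt_eqF.
Qed.

Let rank1_expands (E : 'M[R]_d) (w : 'rV[R]_d) :
  l1 w <= G -> G^-1 <= `|pair w u| -> l1 E <= e ->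
  expands v u eta (4 * G)^-1 (u *m w + E).
Proof.
move=> wG wu Ee z cz; have [zb zy] := cone_bounds G1 eta0 eta1 uG vu cz.
have {zy} zw := zy w wG.
have xi0 : 0 <= `|pair v z| by exact: normr_ge0.
apply: cone_step => //.
have h := lerB_dist (pair v z * pair w u) (pair w z).
rewrite normrM distrC in h.
have h1 : `|pair v z| * G^-1 <= `|pair v z| * `|pair w u| by rewrite ler_wpM2l.
have h2 : G * eta * `|pair v z| <= (2 * G)^-1 * `|pair v z|.
  rewrite ler_wpM2r // -(ler_pM2r G0).
  have -> : (2 * G)^-1 * G = 2^-1 by field; rewrite gt_eqF.
  have -> : G * eta * G = 8^-1 by rewrite -etaG; ring.
  lra.
have h3 : `|pair v z| * G^-1 = (2 * G)^-1 * `|pair v z| + (2 * G)^-1 * `|pair v z| by field; rewrite gt_eqF.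
lra.
Qed.

Let rank1_pair_expands (E F : 'M[R]_d) j : l1 E <= e -> l1 F <= e ->
  expands v u eta (4 * G)^-1 ((u *m v + E) *m (x j *m v + F)).
Proof.
move=> Ee Fe z cz; have [zb _] := cone_bounds G1 eta0 eta1 uG vu cz.
rewrite -mulmxA; set z' := (x j *m v + F) *m z.
have xi0 : 0 <= `|pair v z| by exact: normr_ge0.
have z'E : z' = pair v z *: x j + F *m z by rewrite /z' mulmxDl rank1_col.
have lF : l1 (F *m z) <= e * (2 * G * `|pair v z|).
  by apply: (le_trans (l1M _ _)); apply: ler_pM; rewrite ?l1_ge0.
have e2 : 2 * (e * G ^+ 1) <= 4^-1 by have := @eGk 1%N isT; lra.
apply: cone_step => //.
  rewrite z'E; apply: (le_trans (l1D _ _)); rewrite l1Z.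
  have h1 : `|pair v z| * l1 (x j) <= `|pair v z| * G by rewrite ler_wpM2l.
  have h2 : e * (2 * G * `|pair v z|) <= G * `|pair v z|.
    have -> : e * (2 * G * `|pair v z|) = 2 * (e * G ^+ 1) * `|pair v z| by ring.
    by rewrite ler_wpM2r //; have := G1; lra.
  by have := lF; lra.
rewrite z'E pairDr pairZr.
have h := ler_normB (pair v z * pair v (x j) + pair v (F *m z)) (pair v (F *m z)).
rewrite addrK normrM in h.
have h1 : `|pair v z| * G^-1 <= `|pair v z| * `|pair v (x j)| by rewrite ler_wpM2l.
have h2 : `|pair v (F *m z)| <= (2 * G)^-1 * `|pair v z|.
  apply: (le_trans (pair_le _ _)).
  apply: (@le_trans _ _ (G * (e * (2 * G * `|pair v z|)))).
    by apply: ler_pM; rewrite ?l1_ge0.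
  have -> : G * (e * (2 * G * `|pair v z|)) = (4 * (e * G ^+ 3)) * ((2 * G)^-1 * `|pair v z|).
    by field; rewrite gt_eqF.
  rewrite ler_piMl //; last by have := @eGk 3%N isT; lra.
  by rewrite mulr_ge0 // invr_ge0 mulr_ge0 // ltW.
have h3 : `|pair v z| * G^-1 = (2 * G)^-1 * `|pair v z| + (2 * G)^-1 * `|pair v z|.
  by field; rewrite gt_eqF.
lra.
Qed.

Let rank1_dual_expands (E : 'M[R]_d) : l1 E <= e ->
  dual_expands u H (4 * G)^-1 (u *m v + E).
Proof.
move=> Ee z; rewrite /in_dual_cone => cz; set xi := `|pair z u| in cz *.
have xi0 : 0 <= xi by exact: normr_ge0.
have zE : z *m (u *m v + E) = pair z u *: v + z *m E.
  by rewrite mulmxDr row_rank1.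
have lE : l1 (z *m E) <= H * xi * e.
  by apply: (le_trans (l1M _ _)); apply: ler_pM; rewrite ?l1_ge0.
have hu : xi / 2 <= `|pair (z *m (u *m v + E)) u|.
  rewrite zE pairDl pairZl vu mulr1.
  have h := ler_normB (pair z u + pair (z *m E) u) (pair (z *m E) u).
  rewrite addrK -/xi in h.
  have : `|pair (z *m E) u| <= xi / 2.
    apply: (le_trans (pair_le _ _)).
    apply: (@le_trans _ _ (H * xi * e * G)); first by apply: ler_pM; rewrite ?l1_ge0.
    have -> : H * xi * e * G = (8 * (e * G ^+ 2)) * (xi / 2) by rewrite /H; field.
    by rewrite ler_piMl ?divr_ge0 //; have := @eGk 2%N isT; lra.
  lra.
have rG : (4 * G)^-1 <= 2^-1 by rewrite lef_pV2 ?posrE ?mulr_gt0 //; have := G1; lra.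
split; last by apply: le_trans hu; rewrite mulrC ler_wpM2l.
apply: (@le_trans _ _ (H * (xi / 2))); last by rewrite ler_wpM2l // mulr_ge0 // ltW.
rewrite zE; apply: (le_trans (l1D _ _)); rewrite l1Z -/xi.
have h1 : xi * l1 v <= xi * G by rewrite ler_wpM2l.
have h2 : H * xi * e = (4 * (e * G ^+ 1)) * xi by rewrite /H; ring.
have h3 : 4 * (e * G ^+ 1) * xi <= G * xi.
  by rewrite ler_wpM2r //; have := @eGk 1%N isT; have := G1; lra.
rewrite /H; move: lE; rewrite h2; lra.
Qed.

Let near_l1 (E : 'M[R]_d) (z : 'cV[R]_d) (w : 'rV[R]_d) :
  l1 z <= G -> l1 w <= G -> l1 E <= e -> l1 (z *m w + E) <= 2 * G ^+ 2.
Proof.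
move=> zG wG Ee; apply: (le_trans (l1D _ _)).
have h : l1 (z *m w) <= G * G.
  by apply: (le_trans (l1M _ _)); apply: ler_pM; rewrite ?l1_ge0.
have := @eGk 0%N isT; rewrite expr0 mulr1; have := exprn_ege1 2 G1.
rewrite expr2; lra.
Qed.

Let near_lam2 (E : 'M[R]_d) : l1 E <= e -> lam2 (u *m v + E) <= (4 * G)^-1 ^+ 2 / 2.
Proof.
move=> Ee; apply: (le_trans (lam2_add _ _)); rewrite lam2_rank1 add0r.
have h : l1 (u *m v) <= G * G.
  by apply: (le_trans (l1M _ _)); apply: ler_pM; rewrite ?l1_ge0.
have eG2 : e <= G ^+ 2.
  by have := @eGk 0%N isT; rewrite expr0 mulr1; have := exprn_ege1 2 G1; lra.
have g0 : 0 <= G * G by rewrite mulr_ge0 // ltW.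
have h1 : l1 (u *m v) * l1 E <= G * G * e by apply: ler_pM; rewrite ?l1_ge0.
have h2 : l1 E * l1 E <= G ^+ 2 * e by apply: ler_pM; rewrite ?l1_ge0 // (le_trans Ee).
apply: (@le_trans _ _ (6 * (e * G ^+ 4) * G ^- 2)).
  have -> : 6 * (e * G ^+ 4) * G ^- 2 = 6 * G ^+ 2 * e.
    by field; rewrite gt_eqF.
  by move: h1 h2; rewrite !expr2; lra.
have -> : (4 * G)^-1 ^+ 2 / 2 = 32^-1 * G ^- 2 by field; rewrite gt_eqF.
rewrite ler_wpM2r ?invr_ge0 ?exprn_ge0 ?ltW //.
by have := @eGk 4%N isT; lra.
Qed.

Let near_wedge (E F : 'M[R]_d) (z : 'rV[R]_d) (om : R) :
  om = lam2 (col_mx v y) -> e * (200 * G ^+ 2) <= om ->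
  l1 E <= e -> l1 F <= e -> in_dual_cone u H z ->
  om / 2 * `|pair z u| ^+ 2 <= lam2 (col_mx (z *m (u *m v + E)) (z *m (u *m y + F))).
Proof.
move=> omE eom Ee Fe; rewrite /in_dual_cone => cz.
have t0 : 0 <= `|pair z u| by exact: normr_ge0.
have C (X : 'M[R]_d) w : z *m (u *m w + X) = pair z u *: w + z *m X.
  by rewrite mulmxDr row_rank1.
rewrite !C; set X0 := col_mx v y in omE; set Y := col_mx (z *m E) (z *m F).
have XE : col_mx (pair z u *: v + z *m E) (pair z u *: y + z *m F) = pair z u *: X0 + Y.
  by rewrite scale_col_mx add_col_mx.
rewrite XE; set W := pair z u *: X0 + Y.
have lY : l1 Y <= 8 * G * `|pair z u| * e.
  rewrite l1_col_mx.
  have h (X : 'M[R]_d) : l1 X <= e -> l1 (z *m X) <= H * `|pair z u| * e.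
    by move=> Xe; apply: (le_trans (l1M _ _)); apply: ler_pM; rewrite ?l1_ge0.
  by have := h _ Ee; have := h _ Fe; rewrite /H; lra.
have e1 : e <= 200^-1 by have := @eGk 0%N isT; rewrite expr0 mulr1.
have lX : l1 (pair z u *: X0) <= 2 * G * `|pair z u|.
  rewrite l1Z mulrC; apply: ler_wpM2r => //.
  have -> : l1 X0 = l1 v + l1 y by exact: l1_col_mx.
  by move: vG yG; move: (l1 v) (l1 y) => a b; lra.
have Gt : 0 <= G * `|pair z u| by rewrite mulr_ge0 // ltW.
have lW : l1 W <= 3 * (G * `|pair z u|).
  apply: (le_trans (l1D _ _)).
  have : G * `|pair z u| * e <= G * `|pair z u| * 200^-1 by rewrite ler_wpM2l.
  lra.
have := lam2_add W (- Y); rewrite l1N {1}/W addrK lam2Z -omE (mulrC _ om).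
set t := `|pair z u| in t0 lY lX Gt lW *.
have p1 : l1 W * l1 Y <= 3 * (G * t) * (8 * G * t * e) by apply: ler_pM; rewrite ?l1_ge0.
have p2 : l1 Y * l1 Y <= (8 * G * t * e) * (8 * G * t * e) by apply: ler_pM; rewrite ?l1_ge0.
have Q0 : 0 <= (G * t) ^+ 2 * e by rewrite mulr_ge0 ?sqr_ge0 // ltW.
have p3 : (G * t) ^+ 2 * e * e <= (G * t) ^+ 2 * e * 200^-1 by rewrite ler_wpM2l.
have p4 : e * (200 * G ^+ 2) * t ^+ 2 <= om * t ^+ 2 by rewrite ler_wpM2r ?sqr_ge0.
have E1 : 3 * (G * t) * (8 * G * t * e) = 24 * ((G * t) ^+ 2 * e) by ring.
have E2 : (8 * G * t * e) * (8 * G * t * e) = 64 * ((G * t) ^+ 2 * e * e) by ring.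
have E3 : e * (200 * G ^+ 2) * t ^+ 2 = 200 * ((G * t) ^+ 2 * e) by ring.
rewrite E1 in p1; rewrite E2 in p2; rewrite E3 in p4.
rewrite (mulrC (l1 Y) (l1 W)).
have -> : om / 2 * t ^+ 2 = om * t ^+ 2 / 2 by rewrite mulrAC.
move: (om * t ^+ 2) (lam2 W) (l1 W * l1 Y) (l1 Y * l1 Y) p1 p2 p3 p4 Q0 => a b c f.
move: ((G * t) ^+ 2 * e * e) ((G * t) ^+ 2 * e) => g h; lra.
Qed.

Let near_basis (E : 'I_d -> 'M[R]_d) (z : 'cV[R]_d) (X0 : 'M[R]_d) :
  X0 = \matrix_(i, j) x j i ord0 ->
  e * (4 * d%:R * G * (l1 (invmx X0) + 1)) <= 1 ->
  (forall j, l1 (E j) <= e) -> in_cone v u eta z -> pair v z != 0 ->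
  let X := \matrix_(i, j) ((x j *m v + E j) *m z) i ord0 in
  X \in unitmx /\ l1 (invmx X) * `|pair v z| <= 2 * l1 (invmx X0).
Proof.
move=> X0E eX Ee cz vz; have [zb _] := cone_bounds G1 eta0 eta1 uG vu cz.
have uX0 : X0 \in unitmx by rewrite X0E dir_basis.
pose F : 'M[R]_d := \matrix_(i, j) ((pair v z)^-1 * (E j *m z) i ord0).
have XE : \matrix_(i, j) ((x j *m v + E j) *m z) i ord0 = pair v z *: (X0 + F).
  apply/matrixP => i j; rewrite X0E [LHS]mxE mulmxDl rank1_col [LHS]mxE [X in X + _ = _]mxE.
  rewrite [RHS]mxE [X in _ = _ * X]mxE [X in _ = _ * (X + _)]mxE [X in _ = _ * (_ + X)]mxE.
  by rewrite mulrDr mulrA divff // mul1r.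
move=> /=; rewrite XE.
have lF : l1 F <= d%:R * (2 * G * e).
  rewrite /l1 exchange_big /=.
  have -> : d%:R * (2 * G * e) = \sum_(j < d) (2 * G * e).
    by rewrite sumr_const card_ord mulr_natl.
  apply: ler_sum => j _.
  under eq_bigr do rewrite mxE normrM.
  rewrite -mulr_sumr normfV mulrC ler_pdivrMr ?normr_gt0 //.
  apply: (@le_trans _ _ (l1 (E j *m z))).
    by rewrite /l1; apply: ler_sum => i _; rewrite big_ord1.
  apply: (le_trans (l1M _ _)).
  have -> : 2 * G * e * `|pair v z| = e * (2 * G * `|pair v z|) by ring.
  by apply: ler_pM; rewrite ?l1_ge0.
have l0 := l1_ge0 (invmx X0).
have [|uX lX] := @unit_perturb R d X0 F uX0.
  apply: (@le_trans _ _ (l1 (invmx X0) * (d%:R * (2 * G * e)))); first by rewrite ler_wpM2l.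
  have q : 0 <= e * (4 * d%:R * G) by rewrite !mulr_ge0 // ltW.
  have : e * (4 * d%:R * G) * l1 (invmx X0) <= e * (4 * d%:R * G) * (l1 (invmx X0) + 1).
    by rewrite ler_wpM2l // lerDl.
  move: eX; rewrite !mulrA => eX h; lra.
rewrite unitmxZ ?unitfE // uX; split=> //.
rewrite invmxZ ?unitmxZ ?unitfE // l1Z normfV mulrAC mulVf ?normr_eq0 // mul1r //.
Qed.

(** The rank one models satisfy the estimates with margins that depend only on the
    directions, and e is small compared with these margins. The inverses, which
    have no limit, are bounded separately by Z. *)
Lemma alphabet_of_directions (Z om : R) : 0 <= Z -> om = lam2 (col_mx v y) -> 0 < om ->
  e * (200 * G ^+ 2) <= om ->
  e * (4 * d%:R * G * (l1 (invmx (\matrix_(i, j) x j i ord0)) + 1)) <= 1 ->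
  exists W : alphabet R n,
  [/\ al_v W = v /\ al_u W = u,
      forall g, near_rank1 sigma e (SLval g) u v -> l1 (invmx (SLval g)) <= Z -> al_A W g,
      forall g, near_rank1 sigma e (SLval g) u y -> al_B W g &
      forall j g, near_rank1 sigma e (SLval g) (x j) v -> l1 (invmx (SLval g)) <= Z ->
        al_C W j g].
Proof.
move=> Z0 omE om0 eom eX.
set X0 := \matrix_(i, j) _ in eX.
have sg : 0 < `|sigma| by rewrite normr_gt0.
pose s := `|sigma| * (4 * G)^-1.
have G4 : 0 < (4 * G)^-1 by rewrite invr_gt0 mulr_gt0.
have ss : 0 < s by rewrite mulr_gt0.
pose M := 1 + `|sigma| * (2 * G ^+ 2) + Z.
have sM : `|sigma| * (2 * G ^+ 2) <= M by rewrite /M; lra.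
have ZM : Z <= M by have := mulr_ge0 (ltW sg) (mulr_ge0 (ler0n _ 2) (exprn_ge0 2 (ltW G0))); rewrite /M; lra.
have Hs : H * eta <= 2^-1.
  rewrite -(ler_pM2r G0); have -> : H * eta * G = 4 * (eta * G ^+ 2) by rewrite /H; ring.
  by rewrite etaG; have := G1; lra.
have cone z : in_cone v u eta z -> l1 z <= H * `|pair v z|.
  move=> cz; have [zb _] := cone_bounds G1 eta0 eta1 uG vu cz.
  apply: (le_trans zb); rewrite ler_wpM2r // /H; have := G0; lra.
have nz (k z : 'cV[R]_d) (w : 'rV[R]_d) g : l1 z <= G -> l1 w <= G ->
    near_rank1 sigma e (SLval g) z w -> l1 (SLval g) <= M.
  move=> zG wG /(near_split s0)[E [-> _ Ee]]; rewrite l1Z.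
  by apply: le_trans sM; rewrite ler_wpM2l // near_l1.
have G4M : (4 * G)^-1 <= 2 * G ^+ 2.
  apply: (@le_trans _ _ 1); last by have := exprn_ege1 2 G1; lra.
  by rewrite invf_le1 ?mulr_gt0 //; have := G1; lra.
pose nearA := [set g : SL R d | near_rank1 sigma e (SLval g) u v /\ l1 (invmx (SLval g)) <= Z].
pose nearB := [set g : SL R d | near_rank1 sigma e (SLval g) u y].
pose nearC j := [set g : SL R d | near_rank1 sigma e (SLval g) (x j) v /\ l1 (invmx (SLval g)) <= Z].
have H1 : 1 <= H by rewrite /H; have := G1; lra.
have uH : l1 u <= H by rewrite /H; have := G0; have := uG; lra.
have vH : l1 v <= H by rewrite /H; have := G0; have := vG; lra.
have vuG : G^-1 <= `|pair v u| by rewrite vu normr1 invf_le1 ?G1.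
have M1 : 1 <= M by have := mulr_ge0 (ltW sg) (mulr_ge0 (ler0n _ 2) (exprn_ge0 2 (ltW G0))); rewrite /M; have := Z0; lra.
pose I := 2 * (l1 (invmx X0) + 1) / `|sigma|.
have I0 : 0 < I by rewrite divr_gt0 // mulr_gt0 // ltr_wpDl // l1_ge0.
pose om' := sigma ^+ 2 * (om / 2) * `|sigma| ^+ 2.
have om0' : 0 < `|sigma| ^+ 2 * (om / 2) by rewrite mulr_gt0 ?exprn_gt0 // divr_gt0.
have Aexp g : nearA g -> expands v u eta s (SLval g).
  move=> [/(near_split s0)[E [-> _ Ee]] _].
  by apply: expandsZ; [exact: ltW|exact: rank1_expands].
have Bexp g : nearB g -> expands v u eta s (SLval g).
  move=> /(near_split s0)[E [-> _ Ee]].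
  by apply: expandsZ; [exact: ltW|exact: rank1_expands].
have ACexp g j h : nearA g -> nearC j h -> expands v u eta (s * s) (SLval g *m SLval h).
  move=> [/(near_split s0)[E [-> _ Ee]] _] [/(near_split s0)[F [-> _ Fe]] _].
  rewrite -[X in expands _ _ _ _ X]scalemxAl -[X in _ *: X]scalemxAr scalerA.
  apply: (@expands_le _ _ _ _ (`|sigma * sigma| * (4 * G)^-1)); last first.
    by apply: expandsZ; [exact: ltW|exact: rank1_pair_expands].
  rewrite normrM /s; have -> : `|sigma| * (4 * G)^-1 * (`|sigma| * (4 * G)^-1) =
    `|sigma| * `|sigma| * (4 * G)^-1 * (4 * G)^-1 by ring.
  rewrite ler_piMr ?mulr_ge0 ?(ltW G4) // invf_le1 ?mulr_gt0 //; have := G1; lra.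
have Adual g : nearA g -> dual_expands u H s (SLval g).
  move=> [/(near_split s0)[E [-> _ Ee]] _] z /(rank1_dual_expands Ee)[cz hz].
  rewrite -scalemxAr /in_dual_cone l1Z pairZl normrM; split.
    by rewrite mulrCA ler_wpM2l.
  by rewrite /s -mulrA ler_wpM2l.
have sM' : s <= M by apply: le_trans sM; rewrite ler_wpM2l // ltW.
have AM g : nearA g -> [/\ l1 (SLval g) <= M, l1 (invmx (SLval g)) <= M & lam2 (SLval g) <= s ^+ 2 / 2].
  move=> [ng gZ]; split; [by apply: nz ng|exact: le_trans ZM|].
  have [E [-> _ Ee]] := near_split s0 ng; rewrite lam2Z.
  have -> : s ^+ 2 / 2 = `|sigma| ^+ 2 * ((4 * G)^-1 ^+ 2 / 2) by rewrite /s; move: (4 * G)^-1 => t; field.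
  by rewrite ler_wpM2l ?sqr_ge0 // near_lam2.
have BM g : nearB g -> l1 (SLval g) <= M by apply: nz.
have CM j g : nearC j g -> l1 (SLval g) <= M /\ l1 (invmx (SLval g)) <= M.
  by move=> [ng gZ]; split; [apply: nz ng|exact: le_trans ZM].
have wedge z g h : in_dual_cone u H z -> nearA g -> nearB h ->
    `|sigma| ^+ 2 * (om / 2) * `|pair z u| ^+ 2 <= lam2 (col_mx (z *m SLval g) (z *m SLval h)).
  move=> cz [/(near_split s0)[E [-> _ Ee]] _] /(near_split s0)[F [-> _ Fe]].
  rewrite -!scalemxAr -scale_col_mx lam2Z -mulrA ler_wpM2l ?sqr_ge0 //.
  exact: near_wedge.
have basis z (c : 'I_d -> SL R d) : in_cone v u eta z -> pair v z != 0 ->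
    (forall j, nearC j (c j)) ->
    let X := \matrix_(i, j) (SLval (c j) *m z) i ord0 in
    X \in unitmx /\ l1 (invmx X) * `|pair v z| <= I.
  move=> cz vz Hc X.
  have exE j : exists E : 'M[R]_d, SLval (c j) = sigma *: (x j *m v + E) /\ l1 E <= e.
    by have [/(near_split s0)[E [-> _ Ee]] _] := Hc j; exists E.
  have [E HE] := choice exE.
  have [uY lY] := near_basis (erefl X0) eX (fun j => (HE j).2) cz vz.
  set Y := \matrix_(i, j) _ in uY lY.
  have XY : X = sigma *: Y.
    apply/matrixP => i j; rewrite [LHS]mxE (HE j).1 -scalemxAl [LHS]mxE [RHS]mxE.
    by rewrite [X in _ = _ * X]mxE.
  rewrite XY unitmxZ ?unitfE // uY; split=> //.
  rewrite invmxZ ?unitmxZ ?unitfE // l1Z normfV -mulrA mulrC /I ler_wpM2r ?invr_ge0 ?ltW //.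
  by have := lY; lra.
by exists (Alphabet vu eta0 eta1 H1 Hs uH vH ss M1 om0' I0 cone Aexp Bexp ACexp Adual sM' AM BM CM wedge basis).
Qed.
End Estimates.

Lemma wedge_directions_gt0 : 0 < lam2 (col_mx v y).
Proof.
rewrite lt_neqAle lam2_ge0 andbT eq_sym; apply/eqP => L0.
have v0 : v != 0.
  by apply: contra_eq_neq (dir_vu D) => v0; rewrite -/v v0 /pair mul0mx mxE eq_sym oner_neq0.
by have [a ya] := lam2_col_parallel v0 L0; have := dir_yv D a; rewrite -/y ya eqxx.
Qed.
End BuildAlphabet.

Lemma invmx_ball (R : realType) d (g : SL R d) :
  exists2 r : R, 0 < r & forall h, SLball g r h -> l1 (invmx (SLval h)) <= 2 * l1 (invmx (SLval g)).
Proof.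
exists (2 * (l1 (invmx (SLval g)) + 1))^-1.
  by rewrite invr_gt0 mulr_gt0 // ltr_wpDl // l1_ge0.
move=> h; rewrite /SLball /= => hg.
have -> : SLval h = SLval g + (SLval h - SLval g) by rewrite addrC subrK.
apply: (unit_perturb (SL_unitmx g) _).2; have l0 := l1_ge0 (invmx (SLval g)).
apply: (@le_trans _ _ (l1 (invmx (SLval g)) * (2 * (l1 (invmx (SLval g)) + 1))^-1)).
  by rewrite ler_wpM2l // ltW.
rewrite ler_pdivrMr ?mulr_gt0 ?ltr_wpDl //; lra.
Qed.

(** All the letters come from the same convolution power, so that the masses of
    words with the same number of letters can be compared. The first property,
    with arbitrarily small e, serves to charge the cone. *)
Lemma alphabet_exists (R : realType) n (rho : probability (SL R n.+2) R) :
  strongly_irreducible (support_group rho) -> proximal (support_group rho) ->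
  exists2 D : directions (R := R) (n := n), (forall e, 0 < e -> exists (ell : nat) (sigma : R) (a : SL R n.+2),
    sigma != 0 /\ power_support rho ell a /\ near_rank1 sigma e (SLval a) (dir_u D) (dir_v D)) &
  exists (W : alphabet R n) (ell : nat) (r : R) (a b : SL R n.+2) (c : 'I_n.+2 -> SL R n.+2),
  [/\ al_v W = dir_v D /\ al_u W = dir_u D, (0 < ell)%N /\ 0 < r,
      power_support rho ell a /\ SLball a r `<=` al_A W,
      power_support rho ell b /\ SLball b r `<=` al_B W &
      forall j, power_support rho ell (c j) /\ SLball (c j) r `<=` al_C W j].
Proof.
move=> irr prox; have [D HD] := letters_exist irr prox; exists D.
  move=> e /HD[ell [sigma [a [b [c [[_ s0] [sa na] _ _]]]]]].
  by exists ell, sigma, a.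
have [G [G1 [uG vG] [yG yuG] xG]] := direction_bound D.
have om0 := wedge_directions_gt0 D; set om := lam2 _ in om0.
set X0 := \matrix_(i, j) dir_x D j i ord0.
have G0 : 0 < G by exact: lt_le_trans ltr01 G1.
have l0 : 0 < l1 (invmx X0) + 1 by rewrite ltr_wpDl // l1_ge0.
(* the three conditions on e of alphabet_of_directions *)
pose c1 := 200 * G ^+ 6; pose c2 := 200 * G ^+ 2 / om.
pose c3 := 4 * n.+2%:R * G * (l1 (invmx X0) + 1).
have c10 : 0 < c1 by rewrite mulr_gt0 // exprn_gt0.
have c20 : 0 < c2 by rewrite divr_gt0 // mulr_gt0 // exprn_gt0.
have c30 : 0 < c3 by rewrite !mulr_gt0.
pose e := (c1 + c2 + c3)^-1.
have e0 : 0 < e by rewrite invr_gt0 !addr_gt0.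
have ec t : t <= c1 + c2 + c3 -> e * t <= 1.
  by move=> h; rewrite /e mulrC ler_pdivrMr ?mul1r // !addr_gt0.
have e1 : e * G ^+ 6 <= 200^-1.
  have := ec c1; rewrite /c1; have -> : e * (200 * G ^+ 6) = 200 * (e * G ^+ 6) by ring.
  move=> h; suff : 200 * (e * G ^+ 6) <= 1 by lra.
  by apply: h; rewrite -/c1; lra.
have e2 : e * (200 * G ^+ 2) <= om.
  have h : e * c2 <= 1 by apply: ec; lra.
  by rewrite -[om]mul1r -ler_pdivrMr // -mulrA.
have e3 : e * c3 <= 1 by apply: ec; lra.
have [ell [sigma [a [b [c [[ell0 s0] [sa na] [sb nb] Hc]]]]]] := HD (e / 2) (divr_gt0 e0 (ltr0Sn _ 1)).
have [ra ra0 Ha] := invmx_ball a.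
have exrc j : exists r, 0 < r /\ forall h, SLball (c j) r h ->
    l1 (invmx (SLval h)) <= 2 * l1 (invmx (SLval (c j))).
  by have [r r0 Hr] := invmx_ball (c j); exists r.
have [rc Hrc] := choice exrc.
pose Z := 2 * l1 (invmx (SLval a)) + \sum_j 2 * l1 (invmx (SLval (c j))).
have Zc j : 2 * l1 (invmx (SLval (c j))) <= Z.
  rewrite /Z (bigD1 j) //= addrCA lerDl addr_ge0 ?mulr_ge0 ?l1_ge0 //.
  by apply: sumr_ge0 => i _; rewrite mulr_ge0 ?l1_ge0.
have Za : 2 * l1 (invmx (SLval a)) <= Z.
  by rewrite lerDl; apply: sumr_ge0 => i _; rewrite mulr_ge0 ?l1_ge0.
have Z0 : 0 <= Z by apply: le_trans Za; rewrite mulr_ge0 ?l1_ge0.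
have [W [WE WA WB WC]] := alphabet_of_directions G1 uG vG yG yuG (fun j => (xG j).1)
  (fun j => (xG j).2) e0 e1 s0 Z0 (erefl om) om0 e2 e3.
have se : 0 < `|sigma| * (e / 2) by rewrite mulr_gt0 ?normr_gt0 // divr_gt0.
pose r := Num.min (`|sigma| * (e / 2)) (Num.min ra (\big[Num.min/1]_j rc j)).
have r0 : 0 < r.
  rewrite !lt_min se ra0 /=; apply: (big_ind (fun t => 0 < t)) => //.
  - by move=> s t s0' t0; rewrite lt_min s0' t0.
  - by move=> j _; exact: (Hrc j).1.
have rs : r <= `|sigma| * (e / 2) by rewrite ge_min lexx.
have rra : r <= ra by rewrite !ge_min lexx orbT.
have rrc j : r <= rc j.
  rewrite /r !ge_min; apply/orP; right; apply/orP; right.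
  exact: bigmin_le_cond.
have sub (g : SL R n.+2) t : r <= t -> SLball g r `<=` SLball g t.
  by move=> rt h; rewrite /SLball /= => /lt_le_trans; apply.
exists W, ell, r, a, b, c; split=> //.
- split=> // h hr; apply: WA; first by exact: near_rank1_ball s0 na (sub _ _ rs _ hr).
  exact: le_trans (Ha _ (sub _ _ rra _ hr)) Za.
- by split=> // h hr; apply: WB; exact: near_rank1_ball s0 nb (sub _ _ rs _ hr).
- move=> j; have [sc nc] := Hc j; split=> // h hr; apply: WC.
    by exact: near_rank1_ball s0 nc (sub _ _ rs _ hr).
  exact: le_trans ((Hrc j).2 _ (sub _ _ (rrc j) _ hr)) (Zc j).
Qed.

(** * Blocks: trace and spectral radius *)

Section Logarithm.
Context {R : realType}.
Implicit Types a b t : R.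

Lemma ln_sub_le a b : 0 < a -> 0 < b -> ln a - ln b <= (a - b) / b.
Proof.
move=> a0 b0; rewrite -ln_div ?posrE // mulrBl divff ?gt_eqF //.
have h : a / b = 1 + (a / b - 1) by rewrite addrC subrK.
rewrite {1}h; apply: le_ln1Dx; rewrite ltrBrDl subrr; exact: divr_gt0.
Qed.

Lemma ln_ratio_le a b t : 0 < b -> `|a - b| <= t * b -> t <= 2^-1 ->
  0 < a /\ `|ln a - ln b| <= 2 * t.
Proof.
move=> b0 h t2; have t0 : 0 <= t.
  by rewrite -(pmulr_lge0 _ b0); apply: le_trans h.
have tb : t * b <= 2^-1 * b by rewrite ler_wpM2r // ltW.
have [h1 h2] : a - b <= t * b /\ b - a <= t * b.
  by split; apply: le_trans h; [exact: ler_norm|rewrite distrC ler_norm].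
have a0 : 0 < a by lra.
split=> //.
have k1 := ln_sub_le a0 b0; have k2 := ln_sub_le b0 a0.
have k3 : (a - b) / b <= t by rewrite ler_pdivrMr.
have k4 : (b - a) / a <= 2 * t.
  rewrite ler_pdivrMr //.
  have : t * (2^-1 * b) <= t * a by rewrite ler_wpM2l //; lra.
  lra.
by rewrite ler_norml; lra.
Qed.

Lemma ln_ratio_ge a b : 0 < a -> 0 < b -> a <= 2 * b ->
  `|a - b| <= 2 * b * `|ln a - ln b|.
Proof.
move=> a0 b0 ab.
have k1 := ln_sub_le a0 b0; have k2 := ln_sub_le b0 a0.
rewrite ler_pdivlMr // in k1; rewrite ler_pdivlMr // in k2.
have N1 := ler_norm (ln a - ln b); have N2 := ler_norm (ln b - ln a).
rewrite distrC in N2; have N0 := normr_ge0 (ln a - ln b).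
set L := `|ln a - ln b| in N0 N1 N2 *.
have [ge|lt] := leP b a.
  rewrite ger0_norm ?subr_ge0 //.
  have : L * a <= L * (2 * b) by rewrite ler_wpM2l.
  have : (ln a - ln b) * a <= L * a by rewrite ler_wpM2r // ltW.
  lra.
rewrite ltr0_norm ?subr_lt0 // opprB.
have : (ln b - ln a) * b <= L * b by rewrite ler_wpM2r // ltW.
have : 0 <= L * b by rewrite mulr_ge0 // ltW.
lra.
Qed.
End Logarithm.

Section Words.
Context {R : realType} {n : nat}.
Notation d := n.+2.
Implicit Types (g h : SL R d) (S : set (SL R d)).

(** The empty word is excluded, so that the bounds on letters multiply without
    additional constants. *)
Fixpoint words S k : set (SL R d) :=
  if k is k'.+1 then [set g | exists a h, [/\ S a, words S k' h & g = (a * h)%g]] else S.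

Variable W : alphabet R n.
Local Notation v := (al_v W).
Local Notation u := (al_u W).
Local Notation s := (al_s W).
Local Notation M := (al_M W).
Local Notation H := (al_H W).
Local Notation expd := (expands (al_v W) (al_u W) (al_eta W)).
Local Notation cone := (in_cone (al_v W) (al_u W) (al_eta W)).
Local Notation dcone := (in_dual_cone (al_u W) (al_H W)).

Let s0 : 0 <= s. Proof. exact: ltW (al_s0 W). Qed.
Let M0 : 0 <= M. Proof. exact: le_trans ler01 (al_M1 W). Qed.
Let H0 : 0 <= H. Proof. exact: le_trans ler01 (al_H1 W). Qed.

Lemma words_expand k A : words (al_A W) k A ->
  [/\ expd (s ^+ k.+1) (SLval A),
      dual_expands u H (s ^+ k.+1) (SLval A) &
      forall j c, al_C W j c -> expd (s ^+ k.+2) (SLval A *m SLval c)].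
Proof.
elim: k A => [|k IH] A.
  move=> /= HA; rewrite expr1 expr2; split; [exact: al_Aexp|exact: al_Adual|].
  by move=> j c; exact: al_ACexp.
move=> [a [h [Ha /IH[h1 h2 h3] ->]]]; rewrite SL_mulE; split.
- by rewrite exprS; apply: expandsM => //; exact: al_Aexp.
- by rewrite exprS; apply: dual_expandsM => //; [exact: exprn_ge0|exact: al_Adual].
- move=> j c Hc; rewrite exprS -mulmxA; apply: expandsM => //; first exact: al_Aexp.
  exact: h3 Hc.
Qed.

Lemma words_norm k A : words (al_A W) k A ->
  [/\ l1 (SLval A) <= M ^+ k.+1, l1 (invmx (SLval A)) <= M ^+ k.+1 &
      lam2 (SLval A) <= (s ^+ 2 / 2) ^+ k.+1].
Proof.
elim: k A => [|k IH] A.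
  by move=> /= HA; rewrite !expr1; exact: al_AM.
move=> [a [h [Ha /IH[h1 h2 h3] ->]]]; have [a1 a2 a3] := al_AM Ha.
have aE : invmx (SLval (a * h)%g) = invmx (SLval h) *m invmx (SLval a).
  by rewrite -!SL_invE invgM SL_mulE.
rewrite aE SL_mulE !(exprS _ k.+1); split.
- by apply: (le_trans (l1M _ _)); apply: ler_pM; rewrite ?l1_ge0.
- by rewrite mulrC; apply: (le_trans (l1M _ _)); apply: ler_pM; rewrite ?l1_ge0.
- by apply: (le_trans (lam2M _ _)); apply: ler_pM; rewrite ?lam2_ge0.
Qed.

Definition first_letter g := al_A W g \/ al_B W g.

(** The first letter, in A or B, and the letter c are those that vary; the first
    one also absorbs small perturbations of the whole block. *)
Definition block na nb g := exists a A c B, [/\ first_letter a, words (al_A W) na A,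
  (exists j, al_C W j c), words (al_A W) nb B & g = (a * A * c * B)%g].

(** The quotient M / s bounds the distortion of the letters around the word A,
    and each letter of B divides the 2 x 2 minors relatively to the squares of the
    entries by 2. *)
Definition block_error na nb : R :=
  (64 * trace_const (R := R) (n := n.+1) + 8 * H ^+ 2 + 8 * d%:R ^+ 4 * H ^+ 4) *
  (M / s) ^+ (2 * na.+3) / 2 ^+ nb.+1.

Let Q1 : 1 <= M / s.
Proof. by rewrite ler_pdivlMr ?al_s0 // mul1r al_sM. Qed.

Let Q0 : 0 <= M / s. Proof. exact: le_trans ler01 Q1. Qed.

Let tc0 : 0 < trace_const (R := R) (n := n.+1). Proof. exact: trace_const_gt0. Qed.

Let error_ge na nb t m : (m <= 2 * na.+3)%N ->
  0 <= t -> t <= 64 * trace_const (R := R) (n := n.+1) + 8 * H ^+ 2 + 8 * d%:R ^+ 4 * H ^+ 4 ->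
  t * (M / s) ^+ m / 2 ^+ nb.+1 <= block_error na nb.
Proof.
move=> mk t0 tC; rewrite /block_error ler_wpM2r ?invr_ge0 ?exprn_ge0 //.
by apply: ler_pM => //; rewrite ?exprn_ge0 // ler_weXn2l.
Qed.

(** As B is close to a rank one matrix, the trace of X B is close to the quotient of
    v B X B u by v B u, of which the denominator does not depend on X. *)
Definition block_beta B : R := pair v (SLval B *m u).
Definition block_pair B X : R := pair (v *m SLval B) (X *m (SLval B *m u)).

Let first_bound a : first_letter a -> expd s (SLval a) /\ l1 (SLval a) <= M.
Proof.
move=> [Ha|Hb]; last by split; [exact: al_Bexp|exact: al_BM].
by split; [exact: al_Aexp|have [] := al_AM Ha].
Qed.

Lemma tail_bounds nb B : words (al_A W) nb B ->
  [/\ s ^+ nb.+1 <= `|block_beta B|, cone (SLval B *m u), dcone (v *m SLval B),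
      l1 (SLval B *m u) <= H * `|block_beta B| & l1 (v *m SLval B) <= H * `|block_beta B|].
Proof.
move=> HB; have [eB dB _] := words_expand HB.
have cu : cone u by rewrite /in_cone al_vu scale1r subrr l1_0 normr1 mulr1 ltW // al_eta0.
have [cB hB] := eB _ cu; rewrite al_vu normr1 mulr1 in hB.
have dv : dcone v by rewrite /in_dual_cone al_vu normr1 mulr1 al_vH.
have [dB' _] := dB _ dv.
split=> //; first exact: al_cone.
by move: dB'; rewrite /in_dual_cone pairM.
Qed.

Lemma middle_bounds na a A j c : first_letter a -> words (al_A W) na A -> al_C W j c ->
  let X := SLval a *m SLval A *m SLval c in
  [/\ expd (s ^+ na.+3) X, l1 X <= M ^+ na.+3 & lam2 X <= 2 * M ^+ (2 * na.+3)].
Proof.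
move=> Ha HA Hc X.
have [ea la] := first_bound Ha; have [_ _ /(_ j c Hc) eAc] := words_expand HA.
have [lA _ _] := words_norm HA; have [lc _] := al_CM Hc.
have lX : l1 X <= M ^+ na.+3.
  rewrite exprSr exprS; apply: (le_trans (l1M _ _)); apply: ler_pM; rewrite ?l1_ge0 //.
  by apply: (le_trans (l1M _ _)); apply: ler_pM; rewrite ?l1_ge0.
split=> //.
  by rewrite exprS /X -(mulmxA (SLval a)); exact: expandsM.
apply: (le_trans (lam2_le _)); rewrite ler_wpM2l // mulnC exprM.
by rewrite lerXn2r // nnegrE ?l1_ge0 ?exprn_ge0.
Qed.

(** In the cone, X B u is close to its component along u, on which the form v B
    takes the value block_beta. *)
Lemma block_pair_ge nb B e X : words (al_A W) nb B -> 0 <= e -> expd e X ->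
  `|block_beta B| ^+ 2 * e / 2 <= `|block_pair B X|.
Proof.
move=> HB e0 eX; have [_ cB _ lB lB'] := tail_bounds HB.
have [cx hx] := eX _ cB; set x := X *m _ in cx hx.
have -> : block_pair B X = pair v x * block_beta B + pair (v *m SLval B) (x - pair v x *: u).
  rewrite /block_pair -/x pairDr pairNr pairZr /block_beta -(pairM v (SLval B) u).
  by rewrite addrC subrK.
set r := pair (v *m SLval B) _.
have hr : `|r| <= 2^-1 * (`|block_beta B| * `|pair v x|).
  apply: (le_trans (pair_le _ _)).
  apply: (@le_trans _ _ (H * `|block_beta B| * (al_eta W * `|pair v x|))).
    by apply: ler_pM; rewrite ?l1_ge0.
  have -> : H * `|block_beta B| * (al_eta W * `|pair v x|) =
    (H * al_eta W) * (`|block_beta B| * `|pair v x|) by ring.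
  by rewrite ler_wpM2r ?mulr_ge0 // al_etaH.
have := lerB_dist (pair v x * block_beta B) (- r); rewrite opprK normrN normrM.
have : `|block_beta B| * (e * `|block_beta B|) <= `|block_beta B| * `|pair v x|.
  by rewrite ler_wpM2l.
have E : `|block_beta B| ^+ 2 * e / 2 = 2^-1 * (`|block_beta B| * (e * `|block_beta B|)).
  by field.
rewrite E (mulrC `|pair v x|).
move: (`|block_beta B| * (e * `|block_beta B|)) (`|block_beta B| * `|pair v x|) hr => p q; lra.
Qed.

Lemma block_pair_le nb B e X : words (al_A W) nb B -> l1 X <= e ->
  `|block_pair B X| <= H ^+ 2 * `|block_beta B| ^+ 2 * e.
Proof.
move=> HB Xe; have [_ _ _ lB lB'] := tail_bounds HB.
apply: (le_trans (pair_le _ _)).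
have -> : H ^+ 2 * `|block_beta B| ^+ 2 * e = (H * `|block_beta B|) * (e * (H * `|block_beta B|)).
  by ring.
apply: ler_pM; rewrite ?l1_ge0 //; apply: (le_trans (l1M _ _)).
by apply: ler_pM; rewrite ?l1_ge0.
Qed.

Let split_rate m k : M ^+ m * (s ^+ 2 / 2) ^+ k = (M / s) ^+ m / 2 ^+ k * (s ^+ m * (s ^+ k) ^+ 2).
Proof.
rewrite !expr_div_n; rewrite exprAC; field.
by rewrite !expf_neq0 ?pnatr_eq0 // gt_eqF // al_s0.
Qed.

Lemma block_lam2 na a A j c nb B : first_letter a -> words (al_A W) na A -> al_C W j c ->
  words (al_A W) nb B ->
  lam2 (SLval (a * A * c * B)%g) <=
    2 * (M / s) ^+ (2 * na.+3) / 2 ^+ nb.+1 * (s ^+ (na.+3 + nb.+1)) ^+ 2.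
Proof.
move=> Ha HA Hc HB; have [_ _ lX] := middle_bounds Ha HA Hc.
have [_ _ lB] := words_norm HB.
rewrite SL_mulE; apply: (le_trans (lam2M _ _)).
apply: (@le_trans _ _ (2 * M ^+ (2 * na.+3) * (s ^+ 2 / 2) ^+ nb.+1)).
  by apply: ler_pM; rewrite ?lam2_ge0 // !SL_mulE.
rewrite -mulrA split_rate le_eqVlt; apply/orP; left; apply/eqP.
have -> : s ^+ (2 * na.+3) = (s ^+ na.+3) ^+ 2 by rewrite mulnC exprM.
rewrite exprD; move: (s ^+ na.+3) (s ^+ nb.+1) ((M / s) ^+ (2 * na.+3)) (2 ^+ nb.+1) => p q r t.
ring.
Qed.

(** The trace of a block is comparable with the matrix coefficient block_pair
    divided by block_beta, and its spectral radius with its trace: both errors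
    are governed by the 2 x 2 minors, which the long word B makes small. *)
Lemma block_spectrum na a A j c nb B : first_letter a -> words (al_A W) na A -> al_C W j c ->
  words (al_A W) nb B -> block_error na nb <= 4^-1 ->
  let w := (a * A * c * B)%g in
  [/\ s ^+ (na.+3 + nb.+1) / 4 <= `|\tr (SLval w)|,
      proximal_elt w,
      `|lambda1 w - ln `|\tr (SLval w)| | <= block_error na nb &
      `|ln `|\tr (SLval w)| - (ln `|block_pair B (SLval a *m SLval A *m SLval c)|
          - ln `|block_beta B|)| <= block_error na nb].
Proof.
move=> Ha HA Hc HB be w; set X := SLval a *m SLval A *m SLval c.
have [eX lX _] := middle_bounds Ha HA Hc; rewrite -/X in eX lX.
have [_ _ lB] := words_norm HB; have [bB _ _ _ _] := tail_bounds HB.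
have wE : SLval w = X *m SLval B by rewrite /w !SL_mulE.
set be' := block_error na nb in be *.
have sp : 0 < s by exact: al_s0.
have sk k : 0 < s ^+ k by rewrite exprn_gt0.
have b0 : 0 < `|block_beta B| by apply: lt_le_trans bB; exact: sk.
have Pge := block_pair_ge HB (ltW (sk na.+3)) eX.
set P := block_pair B X in Pge *; set bt := block_beta B in bB b0 Pge *.
have P0 : 0 < `|P|.
  by apply: lt_le_trans Pge; rewrite divr_gt0 // mulr_gt0 // exprn_gt0.
set T := \tr (SLval w).
have err : `|bt * T - P| <= M ^+ na.+3 * (H ^+ 2 * (s ^+ 2 / 2) ^+ nb.+1).
  have -> : bt * T - P = \tr (X *m (bt *: SLval B - (SLval B *m u) *m (v *m SLval B))).
    rewrite mulmxBr -scalemxAr mxtraceD mxtraceZ -wE linearN /=.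
    congr (_ - _).
    by rewrite [X *m _](mulmxA X (SLval B *m u) (v *m SLval B)) mxtrace_rank1.
  apply: (le_trans (mxtrace_le _)); apply: (le_trans (l1M _ _)).
  apply: ler_pM; rewrite ?l1_ge0 //.
  apply: (le_trans (rank1_approx _ _ _)).
  by rewrite expr2; apply: ler_pM; rewrite ?mulr_ge0 ?l1_ge0 ?lam2_ge0 //; apply: ler_pM; rewrite ?l1_ge0 ?al_vH ?al_uH.
pose t := 2 * H ^+ 2 * (M / s) ^+ na.+3 / 2 ^+ nb.+1.
have t0 : 0 <= t by rewrite divr_ge0 ?exprn_ge0 // mulr_ge0 ?exprn_ge0 // mulr_ge0 ?sqr_ge0.
have c0 : 0 <= H ^+ 2 by rewrite sqr_ge0.
have c1 : 0 <= 8 * d%:R ^+ 4 * H ^+ 4 by rewrite !mulr_ge0 ?exprn_ge0.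
have tbe : 4 * t <= be'.
  have -> : 4 * t = 8 * H ^+ 2 * (M / s) ^+ na.+3 / 2 ^+ nb.+1 by rewrite /t; ring.
  apply: (@error_ge na nb (8 * H ^+ 2) na.+3); [by rewrite leq_pmull|by rewrite mulr_ge0|].
  by move: tc0 c1; move: (8 * d%:R ^+ 4 * H ^+ 4) trace_const => p q; lra.
have errP : `|bt * T - P| <= t * `|P|.
  apply: (le_trans err).
  have -> : M ^+ na.+3 * (H ^+ 2 * (s ^+ 2 / 2) ^+ nb.+1) = t * ((s ^+ nb.+1) ^+ 2 * s ^+ na.+3 / 2).
    rewrite mulrCA split_rate /t; field; by rewrite !expf_neq0 ?pnatr_eq0 // gt_eqF // al_s0.
  rewrite ler_wpM2l //; apply: le_trans Pge; rewrite ler_wpM2r ?invr_ge0 // ler_wpM2r ?(ltW (sk _)) //.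
  by rewrite lerXn2r // nnegrE ?normr_ge0 ?(ltW (sk _)).
have t2 : t <= 2^-1 by lra.
have errN : `| `|bt * T| - `|P| | <= t * `|P|.
  by apply: le_trans errP; exact: ler_dist_dist.
have [bT0 lnT] := ln_ratio_le P0 errN t2.
have T0 : 0 < `|T| by move: bT0; rewrite normrM pmulr_rgt0.
have Tge : s ^+ (na.+3 + nb.+1) / 4 <= `|T|.
  rewrite -(ler_pM2l b0) -normrM.
  have hP : `|P| / 2 <= `|bt * T|.
    have h1 := ler_normB (bt * T) (bt * T - P); rewrite opprB addrC subrK in h1.
    have : t * `|P| <= 2^-1 * `|P| by rewrite ler_wpM2r.
    by move: errP h1; rewrite (addrC (bt * T)); lra.
  apply: (le_trans _ hP).
  have : s ^+ (na.+3 + nb.+1) * `|bt| <= `|bt| ^+ 2 * s ^+ na.+3.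
    rewrite exprD; have -> : `|bt| ^+ 2 * s ^+ na.+3 = s ^+ na.+3 * `|bt| * `|bt| by ring.
    by rewrite mulrAC; apply: ler_wpM2l => //; rewrite mulr_ge0 ?(ltW (sk _)).
  by move: Pge; move: (`|bt| ^+ 2 * s ^+ na.+3) (s ^+ (na.+3 + nb.+1)) => p q; lra.
have be0 : 0 <= be' by lra.
have lamw := block_lam2 Ha HA Hc HB; rewrite -/w in lamw.
set r := 2 * _ / _ in lamw.
have tcr : 32 * (trace_const (R := R) (n := n.+1) * r) <= be'.
  have -> : 32 * (trace_const (R := R) (n := n.+1) * r) =
    64 * trace_const (R := R) (n := n.+1) * (M / s) ^+ (2 * na.+3) / 2 ^+ nb.+1 by rewrite /r; ring.
  apply: (@error_ge na nb (64 * trace_const (R := R) (n := n.+1)) (2 * na.+3)); [exact: leqnn|by rewrite mulr_ge0 // ltW|].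
  by move: c0 c1; move: (8 * d%:R ^+ 4 * H ^+ 4) (H ^+ 2) => p q; lra.
have sT : (s ^+ (na.+3 + nb.+1)) ^+ 2 <= 16 * `|T| ^+ 2.
  have -> : 16 * `|T| ^+ 2 = (4 * `|T|) ^+ 2 by rewrite exprMn; ring.
  by rewrite lerXn2r // ?nnegrE ?(ltW (sk _)) ?mulr_ge0 //; move: Tge; lra.
have lamT : trace_const (R := R) (n := n.+1) * lam2 (SLval w) <= be' / 2 * `|T| ^+ 2.
  apply: (@le_trans _ _ (trace_const (R := R) (n := n.+1) * r * (s ^+ (na.+3 + nb.+1)) ^+ 2)).
    by rewrite -mulrA ler_wpM2l // ltW.
  apply: (@le_trans _ _ (be' / 32 * (16 * `|T| ^+ 2))); last first.
    rewrite le_eqVlt; apply/orP; left; apply/eqP; by field.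
  apply: ler_pM => //; first by rewrite mulr_ge0 ?(ltW tc0) // /r divr_ge0 ?exprn_ge0 // mulr_ge0 ?exprn_ge0.
    exact: sqr_ge0.
  by move: tcr; lra.
have TT : T ^+ 2 = `|T| ^+ 2 by rewrite real_normK ?num_real.
have T2 : 0 < `|T| ^+ 2 by rewrite exprn_gt0.
have [|l gl hl] := @proximal_of_trace R n.+1 w.
  rewrite -/T TT -mulrA; have : be' * `|T| ^+ 2 <= 4^-1 * `|T| ^+ 2 by rewrite ler_wpM2r // ltW.
  move: lamT; move: (trace_const (R := R) (n := n.+1) * lam2 _) => p; lra.
rewrite -/T in hl.
have hl' : `| `|l| - `|T| | <= be' / 2 * `|T|.
  apply: (le_trans (ler_dist_dist _ _)); rewrite -(ler_pM2r T0).
  have -> : be' / 2 * `|T| * `|T| = be' / 2 * `|T| ^+ 2 by ring.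
  exact: le_trans hl lamT.
have [|l0 lnl] := ln_ratio_le T0 hl'; first by lra.
split.
- exact: Tge.
- by exists l%:C%C.
- rewrite /lambda1 (spectral_radius_dominant gl) normc_real.
  by move: lnl; have -> : 2 * (be' / 2) = be' by field.
- move: lnT; rewrite normrM lnM ?posrE //.
  have -> : ln `|bt| + ln `|T| - ln `|P| = ln `|T| - (ln `|P| - ln `|bt|) by ring.
  by move=> h; apply: (le_trans h); lra.
Qed.
End Words.

(** * Cross differences and contraction *)

(** One of the minors is at least half their average. *)
Lemma lam2_max (R : realType) m p (A : 'M[R]_(m.+1, p.+1)) (t : R) : 0 < t -> t <= lam2 A ->
  exists i i' j j', t <= 2 * (m.+1%:R ^+ 2 * p.+1%:R ^+ 2) * `|minor2 A i i' j j'|.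
Proof.
move=> t0 tA; apply: contrapT => H.
pose c : R := m.+1%:R ^+ 2 * p.+1%:R ^+ 2.
have c0 : 0 < c by rewrite mulr_gt0 // exprn_gt0.
have K i i' j j' : `|minor2 A i i' j j'| <= t / (2 * c).
  rewrite ler_pdivlMr ?mulr_gt0 // mulrC leNgt; apply/negP => h; apply: H.
  by exists i, i', j, j'; exact: ltW.
have : lam2 A <= \sum_(i < m.+1) \sum_(i' < m.+1) \sum_(j < p.+1) \sum_(j' < p.+1) t / (2 * c).
  by do 4! [apply: ler_sum => ? _].
rewrite !sumr_const !card_ord -!mulrnA -[X in _ <= X]mulr_natr !natrM => h.
have : t <= t / 2.
  apply: (le_trans tA); apply: (le_trans h); rewrite le_eqVlt; apply/orP; left; apply/eqP.
  by rewrite /c; field; rewrite !nat1r !pnatr_eq0.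
lra.
Qed.

Lemma norm_le_dist (R : realType) (x y e : R) : `|x - y| <= e -> `|x| <= `|y| + e /\ `|y| <= `|x| + e.
Proof.
move=> h; have h1 := ler_normD y (x - y); rewrite addrC subrK in h1.
have h2 := ler_normB x (x - y); rewrite opprB addrC subrK in h2.
by split; lra.
Qed.

Section Cross.
Context {R : realType} {n : nat}.
Notation d := n.+2.
Variable W : alphabet R n.
Local Notation v := (al_v W).
Local Notation u := (al_u W).
Local Notation s := (al_s W).
Local Notation M := (al_M W).
Local Notation H := (al_H W).
Local Notation Q := (al_M W / al_s W).

Let sp : 0 < s. Proof. exact: al_s0. Qed.
Let M0 : 0 <= M. Proof. exact: le_trans ler01 (al_M1 W). Qed.
Let H0 : 0 <= H. Proof. exact: le_trans ler01 (al_H1 W). Qed.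
Let Mk k : 0 < M ^+ k. Proof. by rewrite exprn_gt0 // (lt_le_trans ltr01 (al_M1 W)). Qed.
Let Hk k : 0 < H ^+ k. Proof. by rewrite exprn_gt0 // (lt_le_trans ltr01 (al_H1 W)). Qed.
Let d0 k : 0 < d%:R ^+ k :> R. Proof. by rewrite exprn_gt0. Qed.

Section Minors.
Variables (na nb : nat) (a b A B : SL R d) (c : 'I_d -> SL R d).
Hypothesis Aa : al_A W a.
Hypothesis Bb : al_B W b.
Hypothesis wA : words (al_A W) na A.
Hypothesis wB : words (al_A W) nb B.
Hypothesis Cc : forall j, al_C W j (c j).

Let y := v *m SLval B.
Let x := SLval B *m u.
Let beta := block_beta W B.
Let Y : 'M[R]_(1 + 1, d) := col_mx (y *m SLval a) (y *m SLval b).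
Let X : 'M[R]_d := \matrix_(i, j) (SLval (c j) *m x) i ord0.
Let m := Y *m SLval A *m X.
Definition coef_of g j := block_pair W B (SLval g *m SLval A *m SLval (c j)).

Let mE (i : 'I_(1 + 1)) j : m i j = if i == ord0 then coef_of a j else coef_of b j.
Proof.
have colX : col j X = SLval (c j) *m x by apply/colP => k; rewrite !mxE.
have E (g : SL R d) : (y *m SLval g *m SLval A *m X) ord0 j = coef_of g j.
  rewrite /coef_of /block_pair -/y -/x /pair.
  have -> : y *m (SLval g *m SLval A *m SLval (c j) *m x) =
      y *m SLval g *m SLval A *m (SLval (c j) *m x) by rewrite !mulmxA.
  by rewrite -colX !colE mulmxA -colE [RHS]mxE.
rewrite /m /Y !mul_col_mx -!E; case: (unliftP ord0 i) => [k ->|->] /=.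
  by rewrite ord1 (_ : lift ord0 0 = rshift 1 0) ?col_mxEd //; apply: val_inj.
have o0 : (ord0 : 'I_(1 + 1)) = lshift 1 ord0 by apply: val_inj.
by rewrite o0 col_mxEu.
Qed.

(** The coefficients are those of a product with A as a factor, and the 2 x 2
    minors of A are small. *)
Lemma minors_le j j' :
  `|coef_of a j * coef_of b j' - coef_of a j' * coef_of b j| <=
    16 * d%:R ^+ 2 * M ^+ 4 * H ^+ 4 * `|beta| ^+ 4 * (s ^+ 2 / 2) ^+ na.+1.
Proof.
have := minor2_le m ord0 ord_max j j'; rewrite /minor2 !mE /= => h; apply: (le_trans h).
have [_ _ _ lx ly] := tail_bounds wB; rewrite -/x -/y -/beta in lx ly.
have [_ _ lA] := words_norm wA; have [la _ _] := al_AM Aa; have lb := al_BM Bb.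
have b0 : 0 <= H * `|beta| by exact: mulr_ge0.
have lY : l1 Y <= 2 * (H * `|beta| * M).
  rewrite /Y l1_col_mx mulr_natl mulr2n.
  by apply: lerD; apply: (le_trans (l1M _ _)); apply: ler_pM; rewrite ?l1_ge0.
have lX : l1 X <= d%:R * (M * (H * `|beta|)).
  rewrite /l1 exchange_big /=.
  have -> : d%:R * (M * (H * `|beta|)) = \sum_(k < d) M * (H * `|beta|).
    by rewrite sumr_const card_ord mulr_natl.
  apply: ler_sum => k _; apply: (@le_trans _ _ (l1 (SLval (c k) *m x))).
    by rewrite /l1; apply: ler_sum => i _; rewrite big_ord1 mxE.
  apply: (le_trans (l1M _ _)); apply: ler_pM; rewrite ?l1_ge0 //.
  by have [] := al_CM (Cc k).
have pX : 0 <= d%:R * (M * (H * `|beta|)) by rewrite !mulr_ge0.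
have pY : 0 <= 2 * (H * `|beta| * M) by rewrite !mulr_ge0.
apply: (le_trans (lam2M _ _)); apply: (@le_trans _ _
  (2 * (2 * (H * `|beta| * M)) ^+ 2 * (s ^+ 2 / 2) ^+ na.+1 * (2 * (d%:R * (M * (H * `|beta|))) ^+ 2))).
  apply: ler_pM; rewrite ?lam2_ge0 //.
    apply: (le_trans (lam2M _ _)); apply: ler_pM; rewrite ?lam2_ge0 //.
    by apply: (le_trans (lam2_le _)); rewrite ler_wpM2l // lerXn2r ?nnegrE ?l1_ge0.
  by apply: (le_trans (lam2_le _)); rewrite ler_wpM2l // lerXn2r ?nnegrE ?l1_ge0.
rewrite le_eqVlt; apply/orP; left; apply/eqP.
by move: ((s ^+ 2 / 2) ^+ na.+1) `|beta| d%:R => p q r; ring.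
Qed.

(** Some minor of the coefficients is not too small: the forms y a, y b are
    independent and the vectors c_j x form a basis, quantitatively, and the
    inverse of the long word A is at most exponentially large. *)
Lemma minors_ge : exists j j',
  al_om W * `|beta| ^+ 4 <= 32 * d%:R ^+ 2 * al_I W ^+ 2 * M ^+ (2 * na.+1) *
    `|coef_of a j * coef_of b j' - coef_of a j' * coef_of b j|.
Proof.
have [lb0 cx dy lx ly] := tail_bounds wB; rewrite -/x -/y -/beta in lb0 cx dy lx ly.
have bp : 0 < `|beta| by apply: lt_le_trans lb0; rewrite exprn_gt0.
have [_ lA _] := words_norm wA.
have vx : pair v x != 0 by rewrite -normr_gt0.
have [uX lX] := al_basis cx vx Cc; rewrite -/X in uX lX.
have wY := al_wedge dy Aa Bb; rewrite pairM -/x in wY.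
have YE : Y = m *m (invmx X *m invmx (SLval A)).
  by rewrite /m mulmxA mulmxK // mulmxK // SL_unitmx.
have I0 : 0 < al_I W by exact: al_I0.
have lXb : l1 (invmx X) <= al_I W / `|beta| by rewrite ler_pdivlMr.
pose K := (2 * (al_I W / `|beta|) ^+ 2) * (2 * (M ^+ na.+1) ^+ 2).
have K0 : 0 < K by apply: mulr_gt0; rewrite mulr_gt0 // exprn_gt0 // divr_gt0.
have lm : al_om W * `|beta| ^+ 2 / K <= lam2 m.
  rewrite ler_pdivrMr //; apply: (le_trans wY); rewrite -/Y {1}YE.
  apply: (le_trans (lam2M _ _)); rewrite ler_wpM2l ?lam2_ge0 //.
  apply: (le_trans (lam2M _ _)); apply: ler_pM; rewrite ?lam2_ge0 //.
    apply: (le_trans (lam2_le _)); rewrite ler_wpM2l // lerXn2r ?nnegrE ?l1_ge0 //.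
    by rewrite divr_ge0 // ltW.
  by apply: (le_trans (lam2_le _)); rewrite ler_wpM2l // lerXn2r ?nnegrE ?l1_ge0 ?(ltW (Mk _)).
have om0 := al_om0 W.
have t0 : 0 < al_om W * `|beta| ^+ 2 / K by rewrite divr_gt0 // mulr_gt0 // exprn_gt0.
have [i [i' [j [j' hm]]]] := lam2_max t0 lm.
have m0 : 0 < `|minor2 m i i' j j'|.
  rewrite lt_def normr_ge0 andbT; apply/eqP => m0.
  by move: (lt_le_trans t0 hm); rewrite m0 mulr0 ltxx.
exists j, j'.
have -> : `|coef_of a j * coef_of b j' - coef_of a j' * coef_of b j| = `|minor2 m i i' j j'|.
  move: m0; rewrite /minor2 !mE; case: (eqVneq i ord0) => _; case: (eqVneq i' ord0) => _ //.
  - by rewrite mulrC subrr normr0 ltxx.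
  - by move=> _; rewrite -normrN opprB (mulrC (coef_of b j')) (mulrC (coef_of b j)).
  - by rewrite mulrC subrr normr0 ltxx.
move: hm; rewrite ler_pdivrMr // => hm.
rewrite -(ler_pM2r (_ : 0 < `|beta| ^- 2)) ?invr_gt0 ?exprn_gt0 //.
have -> : al_om W * `|beta| ^+ 4 * `|beta| ^- 2 = al_om W * `|beta| ^+ 2.
  by field; rewrite gt_eqF.
apply: (le_trans hm); rewrite le_eqVlt; apply/orP; left; apply/eqP.
rewrite /K (mulnC 2) exprM; move: (M ^+ na.+1) d%:R (`|minor2 m i i' j j'|) => p q r.
by field; rewrite gt_eqF.
Qed.

Let dist_norm_eq (p q : R) : `|p - q| <= `|q| / 2 -> `| `|p| - `|q| | = `|p - q|.
Proof.
case: (ger0P q) => q0; case: (ger0P p) => p0 // h.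
- by move: h; rewrite ler_norml; lra.
- by move: h; rewrite ler_norml; lra.
- by rewrite opprK addrC -normrN opprD opprK addrC distrC addrC.
Qed.

Definition cross_rate k : R := 64 * d%:R ^+ 2 * H ^+ 4 * Q ^+ 4 / 2 ^+ k.+1.
Definition cross_const : R := 64 * d%:R ^+ 2 * al_I W ^+ 2 * H ^+ 4.

(** The difference of the four values of lambda1 is, up to the errors of the
    traces, the logarithm of a cross ratio of the coefficients: it is close to
    zero as A is nearly of rank one, but not closer than exponentially. *)
Lemma cross_difference : block_error W na nb <= 4^-1 -> cross_rate na <= 2^-1 ->
  exists j j', let w g k := (g * A * c k * B)%g in
  let Phi := lambda1 (w a j) + lambda1 (w b j') - lambda1 (w a j') - lambda1 (w b j) in
  `|Phi| <= 2 * cross_rate na + 8 * block_error W na nb /\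
  al_om W <= cross_const * M ^+ (4 * na + 8) * (`|Phi| + 8 * block_error W na nb).
Proof.
have expE : (4 * na + 8 = 2 * na.+1 + na.+3 * 2)%N by lia.
move=> be cr; have [j [j' hm]] := minors_ge; exists j, j' => w Phi.
set e := block_error W na nb in be *.
have [lb0 _ _ _ _] := tail_bounds wB; rewrite -/beta in lb0.
have bp : 0 < `|beta| by apply: lt_le_trans lb0; rewrite exprn_gt0.
have fa : first_letter W a by left.
have fb : first_letter W b by right.
have spec g k : first_letter W g ->
    [/\ `|beta| ^+ 2 * s ^+ na.+3 / 2 <= `|coef_of g k|,
        `|coef_of g k| <= H ^+ 2 * `|beta| ^+ 2 * M ^+ na.+3 &
        `|lambda1 (w g k) - (ln `|coef_of g k| - ln `|beta|)| <= 2 * e].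
  move=> fg; have [_ _ h1 h2] := block_spectrum fg wA (Cc k) wB be.
  have [eX lX _] := middle_bounds fg wA (Cc k).
  split; [exact: block_pair_ge wB (exprn_ge0 _ (ltW sp)) eX|exact: block_pair_le wB lX|].
  rewrite (_ : 2 * e = e + e); last by ring.
  apply: le_trans (lerD h1 h2); rewrite -/beta -/(coef_of g k).
  apply: le_trans (ler_normD _ _); rewrite le_eqVlt; apply/orP; left; apply/eqP.
  by congr `|_|; rewrite /w; ring.
have [g1 l1' s1] := spec a j fa; have [g2 l2 s2] := spec b j' fb.
have [g3 l3 s3] := spec a j' fa; have [g4 l4 s4] := spec b j fb.
have p0 : 0 < `|beta| ^+ 2 * s ^+ na.+3 / 2 by rewrite divr_gt0 // mulr_gt0 // exprn_gt0.
have q1 := lt_le_trans p0 g1; have q2 := lt_le_trans p0 g2.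
have q3 := lt_le_trans p0 g3; have q4 := lt_le_trans p0 g4.
rewrite {}/Phi.
move: (lambda1 (w a j)) (lambda1 (w b j')) (lambda1 (w a j')) (lambda1 (w b j)) s1 s2 s3 s4 => y1 y2 y3 y4 s1 s2 s3 s4.
pose Phi := y1 + y2 - y3 - y4; rewrite -/Phi.
set x1 := coef_of a j in hm g1 l1' s1 q1 *; set x2 := coef_of b j' in hm g2 l2 s2 q2 *.
set x3 := coef_of a j' in hm g3 l3 s3 q3 *; set x4 := coef_of b j in hm g4 l4 s4 q4 *.
pose L := ln `|x1 * x2| - ln `|x3 * x4|.
have PL : `|Phi - L| <= 8 * e.
  have -> : Phi - L = (y1 - (ln `|x1| - ln `|beta|)) + (y2 - (ln `|x2| - ln `|beta|))
      + ((ln `|x3| - ln `|beta|) - y3) + ((ln `|x4| - ln `|beta|) - y4).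
    rewrite /Phi /L !normrM (lnM q1 q2) (lnM q3 q4).
    by move: (ln `|x1|) (ln `|x2|) (ln `|x3|) (ln `|x4|) (ln `|beta|) => *; ring.
  rewrite distrC in s3; rewrite distrC in s4.
  apply: (le_trans (ler_normD _ _)); apply: (le_trans (lerD (ler_normD _ _) (lexx _))).
  apply: (le_trans (lerD (lerD (ler_normD _ _) (lexx _)) (lexx _))).
  by move: s1 s2 s3 s4; lra.
have D0 : 0 < `|x3 * x4| by rewrite normrM mulr_gt0.
have Dge : `|beta| ^+ 4 * (s ^+ na.+3) ^+ 2 / 4 <= `|x3 * x4|.
  rewrite normrM; apply: le_trans (_ : _ <= (`|beta| ^+ 2 * s ^+ na.+3 / 2) * (`|beta| ^+ 2 * s ^+ na.+3 / 2)) _.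
    by rewrite le_eqVlt; apply/orP; left; apply/eqP; field.
  by apply: ler_pM => //; exact: ltW.
have Dle : `|x3 * x4| <= H ^+ 4 * `|beta| ^+ 4 * (M ^+ na.+3) ^+ 2.
  rewrite normrM; apply: (@le_trans _ _ ((H ^+ 2 * `|beta| ^+ 2 * M ^+ na.+3) * (H ^+ 2 * `|beta| ^+ 2 * M ^+ na.+3))).
    by apply: ler_pM.
  by rewrite le_eqVlt; apply/orP; left; apply/eqP; ring.
have cr0 : 0 <= cross_rate na.
  have Q0 : 0 <= Q by rewrite divr_ge0 // ltW.
  apply: divr_ge0; last exact: exprn_ge0.
  apply: mulr_ge0; last exact: exprn_ge0.
  apply: mulr_ge0; last exact: exprn_ge0.
  by apply: mulr_ge0 => //; exact: exprn_ge0.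
have minD : `|x1 * x2 - x3 * x4| <= cross_rate na * `|x3 * x4|.
  apply: (le_trans (minors_le j j')).
  apply: (@le_trans _ _ (cross_rate na * (`|beta| ^+ 4 * (s ^+ na.+3) ^+ 2 / 4))); last by rewrite ler_wpM2l.
  rewrite le_eqVlt; apply/orP; left; apply/eqP; rewrite /cross_rate !expr_div_n (exprAC s 2).
  have -> : s ^+ na.+3 = s ^+ na.+1 * s ^+ 2 by rewrite -exprD addn2.
  have := expf_neq0 na.+1 (_ : s != 0); have : (2 : R) ^+ na.+1 != 0 by rewrite expf_neq0 // pnatr_eq0.
  move: (s ^+ na.+1) ((2 : R) ^+ na.+1) `|beta| d%:R => p q r t q0 _.
  by field; rewrite q0 gt_eqF.
have h2 : `|x1 * x2 - x3 * x4| <= `|x3 * x4| / 2.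
  by apply: (le_trans minD); rewrite mulrC ler_wpM2l.
have dE := dist_norm_eq h2.
have minD' : `| `|x1 * x2| - `|x3 * x4| | <= cross_rate na * `|x3 * x4| by rewrite dE.
have [N0 lnle] := ln_ratio_le D0 minD' cr.
have ab : `|x1 * x2| <= 2 * `|x3 * x4|.
  have : cross_rate na * `|x3 * x4| <= 2^-1 * `|x3 * x4| by rewrite ler_wpM2r // ltW.
  move: minD'; rewrite ler_norml; lra.
have lnge := ln_ratio_ge N0 D0 ab; rewrite dE -/L in lnge; rewrite -/L in lnle.
have [PhiL LPhi] := norm_le_dist PL.
split; first by apply: (le_trans PhiL); rewrite lerD2r.
rewrite -(ler_pM2r (_ : 0 < `|beta| ^+ 4)) ?exprn_gt0 //.
apply: (le_trans hm).
have I0 := al_I0 W.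
apply: (@le_trans _ _ (32 * d%:R ^+ 2 * al_I W ^+ 2 * M ^+ (2 * na.+1) *
   (2 * (H ^+ 4 * `|beta| ^+ 4 * (M ^+ na.+3) ^+ 2) * (`|Phi| + 8 * e)))).
  rewrite ler_wpM2l ?mulr_ge0 ?exprn_ge0 ?(ltW I0) //.
  by apply: (le_trans lnge); apply: ler_pM; rewrite ?mulr_ge0 ?normr_ge0 ?ler_pM2l //.
rewrite le_eqVlt; apply/orP; left; apply/eqP; rewrite /cross_const.
have -> : M ^+ (4 * na + 8) = M ^+ (2 * na.+1) * (M ^+ na.+3) ^+ 2.
  by rewrite -exprM -exprD expE.
by move: (M ^+ (2 * na.+1)) (M ^+ na.+3) `|beta| (`|Phi| + 8 * e) d%:R (al_I W) H => *; ring.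
Qed.
End Minors.

Lemma block_norm na nb g : block W na nb g -> l1 (SLval g) <= M ^+ (na + nb + 4).
Proof.
move=> [a [A [c [B [Ha HA [j Hc] HB ->]]]]].
have [_ lX _] := middle_bounds Ha HA Hc; have [lB _ _] := words_norm HB.
rewrite !SL_mulE; apply: (le_trans (l1M _ _)).
have -> : (na + nb + 4 = na.+3 + nb.+1)%N by lia.
by rewrite exprD; apply: ler_pM; rewrite ?l1_ge0.
Qed.

(** The first letter of w is w (A c B)^-1, and the inverse of A c B is at most
    exponentially large. *)
Lemma block_ball na nb a A c B j r e w : words (al_A W) na A -> al_C W j c ->
  words (al_A W) nb B -> e * M ^+ (na + nb + 3) <= r ->
  SLball (a * A * c * B)%g e w -> exists2 a', SLball a r a' & w = (a' * A * c * B)%g.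
Proof.
move=> HA Hc HB er we; pose X := (A * c * B)%g.
exists (w * X^-1)%g; last first.
  have -> : (w * X^-1 * A * c * B = w * (X^-1 * X))%g by rewrite /X !mulgA.
  by rewrite mulVg mulg1.
have [_ lA _] := words_norm HA; have [_ lc] := al_CM Hc; have [_ lB _] := words_norm HB.
have lX : l1 (SLval X^-1%g) <= M ^+ (na + nb + 3).
  have -> : SLval X^-1%g = invmx (SLval B) *m (invmx (SLval c) *m invmx (SLval A)).
    by rewrite /X !invgM !SL_mulE !SL_invE.
  have -> : (na + nb + 3 = nb.+1 + na.+2)%N by lia.
  rewrite exprD (exprS M na.+1); apply: (le_trans (l1M _ _)); apply: ler_pM; rewrite ?l1_ge0 //.
  by apply: (le_trans (l1M _ _)); apply: ler_pM; rewrite ?l1_ge0.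
have wE : SLval (w * X^-1)%g - SLval a = (SLval w - SLval (a * A * c * B)%g) *m SLval X^-1%g.
  rewrite mulmxBl -!SL_mulE; congr (_ - SLval _).
  have -> : (a * A * c * B = a * X)%g by rewrite /X !mulgA.
  by rewrite mulgK.
rewrite /SLball /= wE; apply: (le_lt_trans (l1M _ _)); apply: lt_le_trans er.
have X0 : 0 < l1 (SLval X^-1%g).
  rewrite l1_gt0; apply/eqP => X0; have := det_SL X^-1%g.
  by rewrite X0 det0 => /esym/eqP; rewrite oner_eq0.
apply: (@lt_le_trans _ _ (e * l1 (SLval X^-1%g))); first by rewrite ltr_pM2r.
by rewrite ler_wpM2l // ltW // (le_lt_trans (l1_ge0 _) we).
Qed.

Lemma block_lambda1 na nb g h t : block W na nb g -> block W na nb h ->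
  block_error W na nb <= 4^-1 -> l1 (SLval h - SLval g) <= t * s ^+ (na.+3 + nb.+1) ->
  t <= 8^-1 -> `|lambda1 h - lambda1 g| <= 2 * block_error W na nb + 8 * t.
Proof.
move=> bg bh be hg t8.
have spec k : block W na nb k -> s ^+ (na.+3 + nb.+1) / 4 <= `|\tr (SLval k)| /\
    `|lambda1 k - ln `|\tr (SLval k)| | <= block_error W na nb.
  move=> [a [A [c [B [Ha HA [j Hc] HB ->]]]]].
  by have [h1 _ h2 _] := block_spectrum Ha HA Hc HB be.
have [tg lg] := spec g bg; have [th lh] := spec h bh.
have sk : 0 < s ^+ (na.+3 + nb.+1) by rewrite exprn_gt0.
have tg0 : 0 < `|\tr (SLval g)| by apply: lt_le_trans tg; rewrite divr_gt0.
have t0 : 0 <= t by rewrite -(pmulr_lge0 _ sk); apply: le_trans hg; exact: l1_ge0.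
have trd : `| `|\tr (SLval h)| - `|\tr (SLval g)| | <= (4 * t) * `|\tr (SLval g)|.
  apply: (le_trans (ler_dist_dist _ _)).
  have -> : \tr (SLval h) - \tr (SLval g) = \tr (SLval h - SLval g) by rewrite linearB.
  apply: (le_trans (mxtrace_le _)); apply: (le_trans hg).
  have -> : t * s ^+ (na.+3 + nb.+1) = 4 * t * (s ^+ (na.+3 + nb.+1) / 4) by field.
  by rewrite ler_wpM2l // mulr_ge0.
have [|_ ld] := ln_ratio_le tg0 trd; first lra.
move: lg lh ld; rewrite !ler_norml.
by move: (lambda1 h) (lambda1 g) (ln _) (ln _) => *; lra.
Qed.

Lemma block_cone na nb g x : block W na nb g -> in_cone v u (al_eta W) x ->
  in_cone v u (al_eta W) (SLval g *m x) /\
  s ^+ (na.+3 + nb.+1) * enorm x <= d%:R * H ^+ 2 * enorm (SLval g *m x).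
Proof.
move=> [a [A [c [B [Ha HA [j Hc] HB ->]]]]] cx.
have [eX _ _] := middle_bounds Ha HA Hc; have [eB _ _] := words_expand HB.
have /(_ x cx) := expandsM (exprn_ge0 na.+3 (ltW sp)) eX eB.
rewrite -!SL_mulE -exprD => -[cg hg]; split=> //.
have h1 : enorm x <= H * `|pair v x|.
  by apply: le_trans (enorm_le_l1 _) _; exact: al_cone.
set y := SLval _ *m x in cg hg *.
have h2 : `|pair v y| <= H * (d%:R * enorm y).
  apply: (le_trans (pair_le _ _)); apply: ler_pM; rewrite ?l1_ge0 ?al_vH //.
  exact: l1_le_enorm.
set p := s ^+ _ in hg *; have p0 : 0 <= p by rewrite exprn_ge0 // ltW.
apply: (@le_trans _ _ (H * (p * `|pair v x|))).
  by rewrite mulrCA ler_wpM2l.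
apply: (@le_trans _ _ (H * (H * (d%:R * enorm y)))); last first.
  by rewrite le_eqVlt; apply/orP; left; apply/eqP; ring.
by rewrite ler_wpM2l //; exact: le_trans hg h2.
Qed.

(** Blocks contract the projective distance on the cone, by the quotient of
    their 2 x 2 minors by the square of their expansion. *)
Lemma block_contract na nb g x z : block W na nb g -> in_cone v u (al_eta W) x ->
  in_cone v u (al_eta W) z ->
  wedge_norm (SLval g *m x) (SLval g *m z) * (enorm x * enorm z) <=
  block_error W na nb * wedge_norm x z * (enorm (SLval g *m x) * enorm (SLval g *m z)).
Proof.
move=> bg cx cz; have [_ hx] := block_cone bg cx; have [_ hz] := block_cone bg cz.
case: bg hx hz => [a [A [c [B [Ha HA [j Hc] HB ->]]]]] hx hz.
have lg := block_lam2 Ha HA Hc HB.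
set g' := (a * A * c * B)%g in lg hx hz *.
set p := s ^+ (na.+3 + nb.+1) in lg hx hz; have p0 : 0 <= p by rewrite exprn_ge0 // ltW.
set r := 2 * _ / _ in lg.
have r0 : 0 <= r.
  rewrite /r; apply: divr_ge0; last exact: exprn_ge0.
  by apply: mulr_ge0 => //; apply: exprn_ge0; rewrite divr_ge0 // ltW.
have be : 4 * d%:R ^+ 4 * H ^+ 4 * r <= block_error W na nb.
  have -> : 4 * d%:R ^+ 4 * H ^+ 4 * r =
    8 * d%:R ^+ 4 * H ^+ 4 * Q ^+ (2 * na.+3) / 2 ^+ nb.+1.
    by rewrite /r; move: d%:R (Q ^+ _) (2 ^- _) => *; ring.
  rewrite /block_error ler_wpM2r ?invr_ge0 ?exprn_ge0 // ler_wpM2r ?exprn_ge0 ?divr_ge0 ?(ltW sp) //.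
  by rewrite lerDr addr_ge0 // ?mulr_ge0 ?exprn_ge0 // ltW // trace_const_gt0.
clearbody r; have wg := wedge_mulmx (SLval g') x z.
have w0 : 0 <= wedge_norm x z by exact: wedge_norm_ge0.
apply: (@le_trans _ _ (r * p ^+ 2 * ((d * d * 4)%:R * wedge_norm x z) * (enorm x * enorm z))).
  rewrite ler_wpM2r ?mulr_ge0 ?enorm_ge0 //; apply: (le_trans wg).
  by rewrite ler_wpM2r // mulr_ge0.
apply: (@le_trans _ _ (4 * d%:R ^+ 4 * H ^+ 4 * r * wedge_norm x z *
    (enorm (SLval g' *m x) * enorm (SLval g' *m z)))); last first.
  by rewrite ler_wpM2r ?mulr_ge0 ?enorm_ge0 // ler_wpM2r.
have -> : r * p ^+ 2 * ((d * d * 4)%:R * wedge_norm x z) * (enorm x * enorm z) =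
  (4 * d%:R ^+ 2 * r * wedge_norm x z) * ((p * enorm x) * (p * enorm z)).
  by rewrite !natrM; move: d%:R (enorm x) (enorm z) (wedge_norm x z) => *; ring.
have -> : 4 * d%:R ^+ 4 * H ^+ 4 * r * wedge_norm x z * (enorm (SLval g' *m x) * enorm (SLval g' *m z)) =
  (4 * d%:R ^+ 2 * r * wedge_norm x z) * ((d%:R * H ^+ 2 * enorm (SLval g' *m x)) *
   (d%:R * H ^+ 2 * enorm (SLval g' *m z))).
  by move: d%:R (enorm (SLval g' *m x)) (enorm (SLval g' *m z)) (wedge_norm x z) => *; ring.
rewrite ler_wpM2l ?mulr_ge0 ?exprn_ge0 //.
by apply: ler_pM => //; rewrite mulr_ge0 ?enorm_ge0.
Qed.
End Cross.

(** * Pigeonhole and masses of balls *)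

Section Cells.
Context {R : realType} {d : nat}.
Variable mu : probability (SL R d) R.

(** A bound for the number of cells of diameter e in a grid covering the ball of
    radius M. *)
Definition cell_bound (M e : R) : R := (2 * M * (d * d)%:R / e + 1) ^+ (d * d).

Section Grid.
Variables (M e : R).
Hypothesis d0 : (0 < d)%N.
Hypothesis M0 : 0 <= M.
Hypothesis e0 : 0 < e.

Let h : R := e / (d * d)%:R.
Let h0 : 0 < h. Proof. by rewrite divr_gt0 // ltr0n muln_gt0 d0. Qed.
Let m := (Num.truncn (2 * M / h)).+1.

Let cell (f : {ffun 'I_d * 'I_d -> 'I_m}) : set (SL R d) :=
  [set g | forall p, (f p)%:R * h <= SLval g p.1 p.2 + M < (f p).+1%:R * h].

Let measurable_cell f : measurable (cell f).
Proof.
have -> : cell f = \bigcap_(p : 'I_d * 'I_d)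
    ((fun g : SL R d => SLval g p.1 p.2) @^-1` `[(f p)%:R * h - M, (f p).+1%:R * h - M[%classic).
  apply/seteqP; split=> g Hg p => [_|] /=.
    by rewrite in_itv /= lerBlDr ltrBrDr; exact: Hg.
  by have := Hg p I; rewrite /= in_itv /= lerBlDr ltrBrDr.
apply: fin_bigcap_measurable => // p _.
rewrite -[X in measurable X]setTI; apply: measurable_SL_coord => //.
Qed.

Let cell_diam f g g' : cell f g -> cell f g' -> l1 (SLval g - SLval g') <= e.
Proof.
move=> Hg Hg'; have -> : e = \sum_(i < d) \sum_(j < d) h.
  rewrite !sumr_const !card_ord -mulrnA -mulr_natr /h divfK // pnatr_eq0.
  by rewrite -lt0n muln_gt0 d0.
apply: ler_sum => i _; apply: ler_sum => j _; rewrite !mxE.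
have /andP[a1 a2] := Hg (i, j); have /andP[b1 b2] := Hg' (i, j).
have E : (f (i, j)).+1%:R * h = (f (i, j))%:R * h + h by rewrite -natr1 mulrDl mul1r.
rewrite /= in a1 a2 b1 b2; rewrite E in a2 b2.
by rewrite ler_norml; apply/andP; split; lra.
Qed.

Let cell_cover g : l1 (SLval g) <= M -> exists f, cell f g.
Proof.
move=> gM.
have b p : 0 <= (SLval g p.1 p.2 + M) / h <= 2 * M / h.
  have : `|SLval g p.1 p.2| <= M by exact: le_trans (l1_entry _ _ _) gM.
  rewrite ler_norml => /andP[h1 h2]; apply/andP; split.
    by rewrite divr_ge0 ?(ltW h0) //; lra.
  by rewrite ler_pM2r ?invr_gt0 //; lra.
have lt p : (Num.truncn ((SLval g p.1 p.2 + M) / h) < m)%N.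
  by rewrite ltnS; apply: le_truncn; have /andP[] := b p.
exists [ffun p => Ordinal (lt p)] => p; rewrite ffunE /=.
have /andP[b1 _] := b p; have /andP[] := truncn_itv b1.
by rewrite ler_pdivlMr // ltr_pdivrMr // => -> ->.
Qed.

Let card_cells : #|{ffun 'I_d * 'I_d -> 'I_m}|%:R <= cell_bound M e.
Proof.
rewrite card_ffun card_prod !card_ord natrX /cell_bound lerXn2r ?nnegrE //.
  by rewrite addr_ge0 // divr_ge0 ?(ltW e0) // !mulr_ge0.
rewrite /m -natr1 lerD2r.
have -> : 2 * M * (d * d)%:R / e = 2 * M / h by rewrite /h invf_div mulrA.
have p : 0 <= 2 * M / h by rewrite divr_ge0 ?(ltW h0) // mulr_ge0.
by have /andP[] := truncn_itv p.
Qed.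

(** Pigeonhole over a finite grid of small cells: the points that lie in cells
    of mass less than t only carry a small mass. *)
Lemma heavy_cells (S : set (SL R d)) (t : R) : measurable S -> 0 <= t ->
  exists L, [/\ measurable L, (mu (L `&` S) <= (cell_bound M e * t)%:E)%E &
    forall g, ~ L g -> l1 (SLval g) <= M -> exists C, [/\ measurable C, C g,
      (t%:E <= mu (C `&` S))%E & forall h, C h -> l1 (SLval h - SLval g) <= e]].
Proof.
move=> mS t0; pose light f := (mu (cell f `&` S) < t%:E)%E.
pose L s := \big[setU/set0]_(f <- s | light f) cell f.
have mL s : measurable (L s).
  by apply: bigsetU_measurable => f _; exact: measurable_cell.
have sL s : (mu (L s `&` S) <= ((size s)%:R * t)%:E)%E.
  elim: s => [|f s IH]; first by rewrite /L big_nil set0I measure0 lee_fin mul0r.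
  rewrite /L big_cons; case: ifPn => lf /=; last first.
    by apply: (le_trans IH); rewrite lee_fin ler_wpM2r // ler_nat.
  rewrite setIUl; apply: (le_trans (measureU2 _ _ _)).
  - by apply: measurableI => //; exact: measurable_cell.
  - by apply: measurableI => //; exact: mL.
  - have -> : ((size (f :: s))%:R * t)%:E = (t%:E + ((size s)%:R * t)%:E)%E.
      by rewrite -EFinD /= -natr1 mulrDl mul1r addrC.
    by apply: leeD; [exact: (ltW lf)|exact: IH].
exists (L (enum {: {ffun 'I_d * 'I_d -> 'I_m}})); split; first exact: mL.
  apply: (le_trans (sL _)); rewrite lee_fin ler_wpM2r // -cardE.
  exact: card_cells.
move=> g Lg gM; have [f fg] := cell_cover gM.
exists (cell f); split; [exact: measurable_cell|exact: fg| |].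
  rewrite leNgt; apply/negP => lf; apply: Lg.
  by rewrite /L big_enum_cond /= (bigD1 f) //=; left.
by move=> h' fh; exact: cell_diam.
Qed.

(** With S the whole group: a set of outer mass q is not covered by the light
    cells. *)
Lemma heavy_ball (X : set (SL R d)) (q : R) : 0 < q -> outer_ge mu q X ->
  (forall g, X g -> l1 (SLval g) <= M) ->
  exists2 g, X g & ((q / (2 * cell_bound M e))%:E <= mu (SLball g (2 * e)))%E.
Proof.
move=> q0 Xq XM; pose t := q / (2 * cell_bound M e).
have c0 : 0 < cell_bound M e.
  by rewrite exprn_gt0 // ltr_wpDl // divr_ge0 ?(ltW e0) // !mulr_ge0.
have t0 : 0 < t by rewrite divr_gt0 // mulr_gt0.
have [L [mL muL HL]] := heavy_cells (measurableT : measurable [set: SL R d]) (ltW t0).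
have [g [Xg Lg]] : exists g, X g /\ ~ L g.
  apply: contrapT => H; have XL : X `<=` L.
    by move=> g Xg; apply: contrapT => Lg; apply: H; exists g.
  have := le_trans (Xq _ mL XL) _; rewrite setIT in muL => /(_ _ muL).
  rewrite lee_fin /t; have -> : cell_bound M e * (q / (2 * cell_bound M e)) = q / 2.
    by field; rewrite gt_eqF.
  by lra.
exists g => //; have [C [mC Cg tC CD]] := HL g Lg (XM g Xg).
apply: (le_trans tC); rewrite setIT; apply: le_measure; rewrite ?inE //.
  exact: measurable_SLball.
move=> h' /CD hh; rewrite /SLball /=; apply: (le_lt_trans hh).
by have := e0; lra.
Qed.
End Grid.
End Cells.

Section Masses.
Context {R : realType} {n : nat}.
Notation d := n.+2.
Variable rho : probability (SL R d) R.

Lemma outer_ge_measure d' (T : measurableType d') (mu : probability T R) (q : R) S :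
  measurable S -> (q%:E <= mu S)%E -> outer_ge mu q S.
Proof. by move=> mS qS E mE SE; apply: (le_trans qS); apply: le_measure; rewrite ?inE. Qed.

Lemma words_mass ell (S : set (SL R d)) (q : R) k : measurable S -> 0 <= q ->
  (q%:E <= convolution_power rho ell S)%E ->
  outer_ge (convolution_power rho (ell * k.+1)) (q ^+ k.+1) (words S k).
Proof.
move=> mS q0 qS; elim: k => [|k IH].
  by rewrite muln1 expr1; exact: outer_ge_measure.
move=> E mE SE; rewrite mulnS exprS EFinM.
apply: le_trans (@convolution_power_outer R _ rho ell _ S _ _ _ (exprn_ge0 k.+1 q0) mS mE IH _).
  by rewrite lee_wpmul2r // lee_fin exprn_ge0.
by move=> g h Sg Wh; apply: SE => /=; exists g, h.
Qed.

Lemma ball_mass_mul m k g h (e e' q1 q2 L : R) : 1 <= L -> 0 <= q1 -> 0 <= q2 ->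
  0 <= e -> e <= e' -> e' <= 1 -> l1 (SLval g) <= L -> l1 (SLval h) <= L ->
  (q1%:E <= convolution_power rho m (SLball g e))%E ->
  (q2%:E <= convolution_power rho k (SLball h e'))%E ->
  ((q1 * q2)%:E <= convolution_power rho (m + k) (SLball (g * h)%g (3 * L * e')))%E.
Proof.
move=> L1 q10 q20 e0 ee' e1 gL hL H1 H2; rewrite EFinM.
apply: (@le_trans _ _ (convolution_power rho m (SLball g e) * q2%:E)%E).
  by rewrite lee_wpmul2r // lee_fin.
apply: (@convolution_power_outer R _ rho m k (SLball g e) q2 (SLball h e')) => //.
- exact: measurable_SLball.
- exact: measurable_SLball.
- by apply: outer_ge_measure => //; exact: measurable_SLball.
move=> g' h'; apply: SLball_mul.
have p1 : l1 (SLval g) * e' <= L * e' by rewrite ler_wpM2r //; lra.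
have p2 : e * (l1 (SLval h) + e') <= e' * (L + 1).
  by apply: ler_pM => //; [rewrite addr_ge0 ?l1_ge0 //; lra|lra].
have p3 : e' <= L * e' by rewrite ler_peMl //; lra.
lra.
Qed.
End Masses.

(** * The stationary measure charges the cone *)

Section Push.
Context {R : realType} {n : nat}.
Notation d := n.+2.
Variables (rho : probability (SL R d) R) (nu : probability (projspace R d) R).
Hypothesis nu_stat : stationary rho nu.

(** One application of stationarity. *)
Lemma outer_push N (G : set (SL R d)) (q b : R) Y Y' : measurable G -> 0 <= b ->
  (q%:E <= convolution_power rho N G)%E -> outer_ge nu b Y ->
  (forall g y, G g -> Y y -> Y' (act g y)) -> outer_ge nu (q * b) Y'.
Proof.
move=> mG b0 qG HY GY E mE YE; rewrite EFinM.
apply: (@le_trans _ _ (convolution_power rho N G * b%:E)%E).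
  by rewrite lee_wpmul2r // lee_fin.
by apply: (@stationary_outer R n.+1 rho nu N G b Y E) => // g y Gg Yy; apply: YE; exact: GY.
Qed.

(** The common kernel of the forms v t, when it is nonzero, is made smaller by
    an element of T that moves one of its vectors out of the kernel of v. *)
Lemma forms_cover (T : set (SL R d)) (v : 'rV[R]_d) :
  (forall g h, T g -> T h -> T (g * h)%g) -> (exists t, T t) -> no_finite_orbit T ->
  v != 0 -> exists ts : seq (SL R d), (forall t, t \in ts -> T t) /\
    forall x, x != 0 -> exists2 t, t \in ts & pair v (SLval t *m x) != 0.
Proof.
move=> Tmul Tne Tirr v0.
pose K (ts : seq (SL R d)) : {vspace 'cV[R]_d} := foldr (fun t U =>
  (lker (linfun (mulmx (v *m SLval t) : 'cV[R]_d -> 'cV[R]_1)) :&: U)%VS) fullv ts.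
have Kx ts x : x \notin K ts -> exists2 t, t \in ts & pair v (SLval t *m x) != 0.
  elim: ts => [|t ts IH] /=; first by rewrite memvf.
  rewrite memv_cap negb_and memv_lker => /orP[h|/IH[t' tt ht]].
    by exists t; rewrite ?mem_head // -pairM.
  by exists t' => //; rewrite inE tt orbT.
have step k : exists ts : seq (SL R d), (forall t, t \in ts -> T t) /\ (\dim (K ts) <= d - k)%N.
  elim: k => [|k [ts [Tts dts]]].
    by exists [::]; split=> //=; rewrite subn0 (leq_trans (dimvS (subvf _))) // dimvf /dim /= muln1.
  have [K0|K0] := eqVneq (K ts) 0%VS.
    by exists ts; rewrite K0 dimv0.
  have xK : vpick (K ts) \in K ts by exact: memv_pick.
  have x0 : vpick (K ts) != 0 by rewrite vpick0.
  have v0s : (0 : 'rV[R]_d) \notin [:: v] by rewrite inE eq_sym.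
  have [t Tt Ht] := orbit_avoids_hyperplanes Tmul Tne Tirr x0 v0s.
  exists (t :: ts); split.
    by move=> t'; rewrite inE => /orP[/eqP ->|/Tts].
  have lt : (\dim (K (t :: ts)) < \dim (K ts))%N.
    have sub : (K (t :: ts) <= K ts)%VS by exact: capvSr.
    rewrite ltnNge; apply/negP => le.
    have /eqP E : K (t :: ts) == K ts by rewrite eqEdim sub.
    move: xK; rewrite -{2}E /= memv_cap memv_lker => /andP[/eqP xt _].
    by have := Ht v (mem_head _ _); rewrite -pairM xt eqxx.
  by have := leq_trans lt dts; rewrite subnS; case: (d - k)%N.
have [ts [Tts]] := step d; rewrite subnn leqn0 dimv_eq0 => /eqP K0.
by exists ts; split=> // x x0; apply: Kx; rewrite K0 memv0.
Qed.
End Push.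

Section Projective.
Context {R : realType} {n : nat}.
Notation d := n.+2.

(** The points on which a linear form is not too small form a ball centred at
    the line orthogonal to its kernel. *)
Lemma form_ball (y : 'rV[R]_d) : y != 0 -> exists p : projspace R d,
  forall (x : projspace R d) z, z \in line x -> z != 0 ->
  proj_dist p x ^+ 2 * (enorm z ^+ 2 * enorm y^T ^+ 2) = enorm z ^+ 2 * enorm y^T ^+ 2 - pair y z ^+ 2.
Proof.
move=> y0; have yT0 : y^T != 0 by rewrite -trmx0 (inj_eq trmx_inj).
have dy : \dim <[y^T]>%VS == 1%N by rewrite dim_vline yT0.
exists (Projspace dy) => x z zx z0.
have yl : y^T \in line (Projspace dy) by exact: memv_line.
rewrite (proj_distE yl yT0 zx z0).
have -> : pair y z = dotp y^T z.
  by rewrite /pair /dotp mxE; apply: eq_bigr => i _; rewrite mxE.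
have e1 : enorm z != 0 by rewrite gt_eqF // enorm_gt0.
have e2 : enorm y^T != 0 by rewrite gt_eqF // enorm_gt0.
rewrite exprMn exprVn sqr_wedge_norm -!sqr_enorm.
by move: e1 e2; move: (enorm z) (enorm y^T) (dotp _ _) => a b c a0 b0; field; rewrite a0 b0.
Qed.

Lemma wedge_norm_sub (a b : 'cV[R]_d) : wedge_norm a b = wedge_norm (a - b) b.
Proof.
congr Num.sqrt; apply: eq_bigr => p _; congr (_ ^+ 2); rewrite !mxE; ring.
Qed.

Definition proj_cone (v : 'rV[R]_d) u eta : set (projspace R d) :=
  [set x | exists z, [/\ z \in line x, z != 0 & in_cone v u eta z]].

Variables (rho : probability (SL R d) R) (nu : probability (projspace R d) R).
Hypothesis nu_stat : stationary rho nu.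
Hypothesis irr : strongly_irreducible (support_group rho).

(** Finitely many translates of the complement of the kernel of v cover the
    projective space, so that one of them is charged; stationarity moves this
    charge to the complement itself. *)
Lemma nu_off_kernel (v : 'rV[R]_d) : v != 0 -> exists b c : R, [/\ 0 < b, 0 < c &
  outer_ge nu b [set x | exists z, [/\ z \in line x, z != 0 & l1 z <= c * `|pair v z|]]].
Proof.
move=> v0; set T := semigroup_of (measure_support rho).
have Tmul : forall g h, T g -> T h -> T (g * h)%g by exact: semigroup_mul.
have Tne : exists t, T t by exact: semigroup_nonempty.
have Tirr : no_finite_orbit T by apply: strongly_irreducible_orbit irr; exact: sub_smallest.
have [ts [Tts cov]] := forms_cover Tmul Tne Tirr v0.
have [p Hp] := form_ball v0.
have vT : 0 < enorm v^T by rewrite enorm_gt0 -trmx0 (inj_eq trmx_inj).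
pose r k : R := 1 - k.+1%:R^-1.
have r0 k : 0 <= r k by rewrite /r subr_ge0 invf_le1 // ler1n.
have r1 k : r k < 1 by rewrite /r ltrBlDr ltrDl invr_gt0.
(* the balls of radius 1 - 1 / (k + 1) exhaust the complement of a hyperplane *)
pose F i k := if (i < size ts)%N then act (nth 1%g ts i) @^-1` ball p (r k) else set0.
have mF i k : measurable (F i k).
  rewrite /F; case: ifP => // _; apply: measurable_act; exact: measurable_projball.
have covF : [set: projspace R d] = \bigcup_i \bigcup_k F i k.
  apply/seteqP; split=> // x _.
  have [t tts vt] := cov (vpick x) (vpick_proj_neq0 x).
  have z0 : SLval t *m vpick x != 0 by apply: SL_mul_neq0; exact: vpick_proj_neq0.
  have zl : SLval t *m vpick x \in line (act t x) by apply: act_line; exact: memv_pick.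
  have E := Hp _ _ zl z0.
  set D := proj_dist p _ in E.
  have D0 : 0 <= D by rewrite /D /proj_dist divr_ge0 ?wedge_norm_ge0 // mulr_ge0 ?enorm_ge0.
  have ez : 0 < enorm (SLval t *m vpick x) by rewrite enorm_gt0.
  have e0 : 0 < enorm (SLval t *m vpick x) ^+ 2 * enorm v^T ^+ 2 by apply: mulr_gt0; exact: exprn_gt0.
  have D1 : D < 1.
    rewrite -(@ltr_pXn2r _ 2) ?nnegrE // expr1n -(ltr_pM2r e0) E mul1r ltrBlDr ltrDl.
    by rewrite lt_def sqr_ge0 expf_neq0.
  exists (index t ts) => //; pose k := Num.truncn (1 - D)^-1; exists k => //.
  rewrite /F index_mem tts nth_index //= projball /= -/D /r ltrBrDl -ltrBrDr.
  rewrite invf_plt ?posrE ?subr_gt0 //.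
  have pD : 0 <= (1 - D)^-1 by rewrite invr_ge0 subr_ge0 ltW.
  by have /andP[] := truncn_itv pD.
have [i [k Fik]] : exists i k, nu (F i k) != 0%E.
  apply: contrapT => H.
  have : nu.-negligible (\bigcup_i \bigcup_k F i k).
    apply: negligible_bigcup => i; apply: negligible_bigcup => k.
    apply/negligibleP => //; apply: contrapT => nz; apply: H; exists i, k.
    by apply/eqP.
  rewrite -covF => negT; have : nu setT = 0%E by apply/negligibleP.
  by rewrite probability_setT => /eqP; rewrite onee_eq0.
move: Fik; rewrite /F; case: ifP => [its|_]; last by rewrite measure0 eqxx.
set t := nth _ _ _; set Y0 := _ @^-1` _ => nz.
have mY : measurable Y0 by apply: measurable_act; exact: measurable_projball.
have Y0fin : nu Y0 \is a fin_num by exact: fin_num_measure.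
pose b0 := fine (nu Y0).
have b00 : 0 < b0 by rewrite fine_gt0 // lt_neqAle eq_sym nz measure_ge0 /= ltey_eq Y0fin.
have [m _ Hm] := semigroup_length (Tts t (mem_nth _ its)).
pose c0 := (1 - r k ^+ 2) * enorm v^T ^+ 2.
have c00 : 0 < c0.
  by rewrite mulr_gt0 ?exprn_gt0 // subr_gt0 expr_lt1.
pose c := d%:R / Num.sqrt c0.
have sc : 0 < Num.sqrt c0 by rewrite sqrtr_gt0.
have cp : 0 < c by rewrite divr_gt0.
have Y0z x : Y0 x -> exists z, [/\ z \in line x, z != 0 & l1 (SLval t *m z) <= c * `|pair v (SLval t *m z)|].
  rewrite /Y0 /= projball /= => xD; exists (vpick x); split; [exact: memv_pick|exact: vpick_proj_neq0|].
  have z0 : SLval t *m vpick x != 0 by apply: SL_mul_neq0; exact: vpick_proj_neq0.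
  have zl : SLval t *m vpick x \in line (act t x) by apply: act_line; exact: memv_pick.
  have E := Hp _ _ zl z0; set z := SLval t *m vpick x in z0 zl E *.
  set D := proj_dist p _ in E xD.
  have D0 : 0 <= D by rewrite /D /proj_dist divr_ge0 ?wedge_norm_ge0 // mulr_ge0 ?enorm_ge0.
  have ez : 0 < enorm z by rewrite enorm_gt0.
  have e0 : 0 < enorm z ^+ 2 * enorm v^T ^+ 2 by apply: mulr_gt0; exact: exprn_gt0.
  have D2 : D ^+ 2 <= r k ^+ 2 by rewrite lerXn2r ?nnegrE // ltW.
  have sz : Num.sqrt c0 * enorm z <= `|pair v z|.
    rewrite -(@ler_pXn2r _ 2) ?nnegrE ?mulr_ge0 ?enorm_ge0 ?(ltW sc) //.
    rewrite exprMn sqr_sqrtr ?(ltW c00) // real_normK ?num_real //.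
    have : D ^+ 2 * (enorm z ^+ 2 * enorm v^T ^+ 2) <= r k ^+ 2 * (enorm z ^+ 2 * enorm v^T ^+ 2).
      by rewrite ler_wpM2r // ltW.
    rewrite E /c0; have -> : (1 - r k ^+ 2) * enorm v^T ^+ 2 * enorm z ^+ 2 =
      enorm z ^+ 2 * enorm v^T ^+ 2 - r k ^+ 2 * (enorm z ^+ 2 * enorm v^T ^+ 2) by ring.
    lra.
  apply: (le_trans (l1_le_enorm _)); rewrite /c -mulrA ler_wpM2l // mulrC ler_pdivlMr //.
  by rewrite mulrC.
pose K := l1 (invmx (SLval t)) * c.
have K0 : 0 <= K by rewrite mulr_ge0 ?l1_ge0 // ltW.
pose e := (2 * (l1 v + 1) * (K + 1))^-1.
have e0 : 0 < e.
  by rewrite invr_gt0 !mulr_gt0 // ltr_wpDl ?l1_ge0.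
have eK : e * (K + 1) * (2 * (l1 v + 1)) = 1.
  rewrite /e; field; rewrite !gt_eqF // ltr_wpDl ?l1_ge0 //.
have ve : l1 v * (e * K) <= 2^-1 /\ e * K <= 1.
  have l0 := l1_ge0 v; have p0 : 0 <= e * K by rewrite mulr_ge0 // ltW.
  by move: eK e0; move: (l1 v) l0 p0 => a a0; nra.
have Gfin : convolution_power rho m (SLball t e) \is a fin_num.
  by apply: fin_num_measure; exact: measurable_SLball.
pose q := fine (convolution_power rho m (SLball t e)).
have q0 : 0 < q by rewrite fine_gt0 // Hm //= ltey_eq Gfin.
exists (q * b0), (2 * (c + 1)); split; [by rewrite mulr_gt0|by rewrite mulr_gt0 // ltr_wpDl // ltW|].
apply: (@outer_push R n rho nu nu_stat m (SLball t e) q b0 Y0) => //.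
- exact: measurable_SLball.
- exact: ltW.
- by rewrite fineK.
- move=> E mE YE; rewrite /b0 fineK //; apply: le_measure; rewrite ?inE //.
move=> g x gt /Y0z[z [zx z0 hz]]; exists (SLval g *m z); split.
- exact: act_line.
- exact: SL_mul_neq0.
set tau := `|pair v (SLval t *m z)| in hz.
have lz : l1 z <= K * tau.
  rewrite -[in l1 z](mulKmx (SL_unitmx t) z); apply: (le_trans (l1M _ _)).
  by rewrite /K -mulrA ler_wpM2l ?l1_ge0.
have tau0 : 0 <= tau by exact: normr_ge0.
have dz : l1 ((SLval g - SLval t) *m z) <= e * K * tau.
  apply: (le_trans (l1M _ _)); rewrite -mulrA; apply: ler_pM; rewrite ?l1_ge0 //.
  exact: ltW gt.
have gE : SLval g *m z = SLval t *m z + (SLval g - SLval t) *m z.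
  by rewrite mulmxBl addrC subrK.
have lg : l1 (SLval g *m z) <= (c + 1) * tau.
  rewrite gE; apply: (le_trans (l1D _ _)); rewrite mulrDl mul1r; apply: lerD => //.
  by apply: (le_trans dz); rewrite ler_piMl // ve.2.
have pg : tau / 2 <= `|pair v (SLval g *m z)|.
  rewrite gE pairDr; set w := _ *m z in dz *.
  have := ler_normB (pair v (SLval t *m z) + pair v w) (pair v w); rewrite addrK -/tau.
  have : `|pair v w| <= tau / 2.
    apply: (le_trans (pair_le _ _)); apply: (@le_trans _ _ (l1 v * (e * K * tau))).
      by rewrite ler_wpM2l ?l1_ge0.
    have -> : l1 v * (e * K * tau) = tau * (l1 v * (e * K)) by ring.
    by apply: ler_wpM2l => //; exact: ve.1.
  lra.
apply: (le_trans lg); rewrite [in X in _ <= X](mulrC 2) -mulrA.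
by apply: ler_wpM2l; [rewrite addr_ge0 // ltW|lra].
Qed.

(** A letter close to u v sends the charged region off the kernel of v into a
    cone around u that is as thin as the letter is close to u v. *)
Lemma nu_cone (D : directions (R := R) (n := n)) (eta : R) : 0 < eta -> eta <= 1 ->
  (forall e : R, 0 < e -> exists ell sigma (a : SL R d), sigma != 0 /\
    power_support rho ell a /\ near_rank1 sigma e (SLval a) (dir_u D) (dir_v D)) ->
  exists2 b : R, 0 < b & outer_ge nu b (proj_cone (dir_v D) (dir_u D) eta).
Proof.
move=> eta0 eta1 HD; set v := dir_v D; set u := dir_u D.
have v0 : v != 0.
  by apply: contra_eq_neq (dir_vu D) => v0; rewrite -/v v0 /pair mul0mx mxE eq_sym oner_neq0.
have [b [c [b0 c0 Hb]]] := nu_off_kernel v0.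
pose G := 1 + l1 u + l1 v.
have lu := l1_ge0 u; have lv := l1_ge0 v.
have [G1 [uG vG]] : 1 <= G /\ l1 u <= G /\ l1 v <= G by rewrite /G; split; [|split]; lra.
have G0 : 0 < G ^+ 2 by rewrite exprn_gt0 //; lra.
pose e := eta / (4 * G ^+ 2 * c).
have e0 : 0 < e by rewrite divr_gt0 // mulr_gt0 // mulr_gt0.
have [ell [sigma [a [s0 [sa na]]]]] := HD (e / 2) (divr_gt0 e0 (ltr0Sn _ 1)).
set r := `|sigma| * (e / 2).
have r0 : 0 < r by rewrite mulr_gt0 ?normr_gt0 // divr_gt0.
have Gfin : convolution_power rho ell (SLball a r) \is a fin_num.
  by apply: fin_num_measure; exact: measurable_SLball.
pose q := fine (convolution_power rho ell (SLball a r)).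
have q0 : 0 < q by rewrite fine_gt0 // sa //= ltey_eq Gfin.
exists (q * b); first by rewrite mulr_gt0.
apply: (@outer_push R n rho nu nu_stat ell (SLball a r) q b _ _ (measurable_SLball _ _) (ltW b0) _ Hb).
  by rewrite fineK.
move=> g x ga [z [zx z0 hz]]; exists (SLval g *m z); split.
- exact: act_line.
- exact: SL_mul_neq0.
have [E [-> _ Ee]] := near_split s0 (near_rank1_ball s0 na ga).
rewrite -scalemxAl; apply: in_coneZ.
apply: (near_rank1_cone G1 eta0 eta1 uG vG (dir_vu D) Ee (lexx _) hz (normr_ge0 _) _).1.
rewrite le_eqVlt; apply/orP; left; apply/eqP; rewrite /e.
by move: G0 c0; move: (G ^+ 2) `|_| => a1 b1 a10 c0; field; rewrite !gt_eqF.
Qed.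
End Projective.

(** * Regularity of attracting lines *)

Section Regularity.
Context {R : realType} {n : nat}.
Notation d := n.+2.
Variable W : alphabet R n.
Local Notation v := (al_v W).
Local Notation u := (al_u W).
Local Notation s := (al_s W).
Local Notation H := (al_H W).
Local Notation cone := (in_cone (al_v W) (al_u W) (al_eta W)).

Lemma in_cone_limit (x : nat -> 'cV[R]_d) (y : 'cV[R]_d) : (forall k, cone (x k)) -> mcvg x y -> cone y.
Proof.
move=> Hx xy; rewrite /in_cone leNgt; apply/negP => gap.
pose g := l1 (y - pair v y *: u) - al_eta W * `|pair v y|.
have g0 : 0 < g by rewrite subr_gt0.
pose C := 2 + l1 v * l1 u + al_eta W * l1 v.
have pv := l1_ge0 v; have pu := l1_ge0 u; have et := al_eta0 W.
have C0 : 0 < C by rewrite /C -addrA ltr_wpDr // addr_ge0 ?mulr_ge0 // ltW.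
have [k Hk] := xy _ (divr_gt0 g0 C0); have {Hk} := Hk k (leqnn k).
rewrite ltr_pdivlMr //; set r := l1 (x k - y) => hr.
have r0 : 0 <= r by exact: l1_ge0.
have := Hx k; rewrite /in_cone.
have vx : `|pair v (x k) - pair v y| <= l1 v * r.
  by rewrite -pairNr -pairDr; exact: pair_le.
have h1 : l1 (y - pair v y *: u) <= l1 (x k - pair v (x k) *: u) + r + l1 v * r * l1 u.
  have -> : y - pair v y *: u = (x k - pair v (x k) *: u) + (y - x k) + (pair v (x k) - pair v y) *: u.
    by apply/colP => i; rewrite !mxE; ring.
  apply: (le_trans (l1D _ _)); apply: lerD.
    by apply: (le_trans (l1D _ _)); rewrite /r (l1BC (x k) y).
  by rewrite l1Z ler_wpM2r.
have h2 : `|pair v (x k)| <= `|pair v y| + l1 v * r := (norm_le_dist vx).1.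
have h3 : al_eta W * `|pair v (x k)| <= al_eta W * (`|pair v y| + l1 v * r) by rewrite ler_wpM2l // ltW.
have {}hr : r * (2 + l1 v * l1 u + al_eta W * l1 v) < l1 (y - pair v y *: u) - al_eta W * `|pair v y| := hr.
move=> h; move: r r0 {vx h2} h1 h3 hr h => r r0 h1 h3 hr h; lra.
Qed.

(** The cone has nonempty interior. *)
Lemma cone_point (w : 'rV[R]_d) : w != 0 -> exists2 x, cone x & pair w x != 0.
Proof.
move=> w0; have et := al_eta0 W; have et1 := al_eta1 W; have vu := al_vu W.
have [wu|wu] := eqVneq (pair w u) 0; last first.
  by exists u => //; rewrite /in_cone vu scale1r subrr l1_0 normr1 mulr1 ltW.
pose x := w^T; have wx : pair w x != 0.
  rewrite /x /pair -[w in w *m _]trmxK; have -> : (w^T^T *m w^T) ord0 ord0 = dotp w^T w^T.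
    by rewrite mxE; apply: eq_bigr => i _; rewrite mxE.
  by rewrite dotp_eq0 -trmx0 (inj_eq trmx_inj).
have pv := l1_ge0 v; have pu := l1_ge0 u; have px := l1_ge0 x.
pose t := al_eta W / (2 * (l1 x + 1) * (1 + l1 v * (l1 u + 1))).
have vu0 : 0 <= l1 v * (l1 u + 1) by rewrite mulr_ge0 // addr_ge0.
have D0 : 0 < 2 * (l1 x + 1) * (1 + l1 v * (l1 u + 1)).
  by apply: mulr_gt0; [apply: mulr_gt0 => //; rewrite ltr_wpDl|rewrite ltr_wpDr].
have t0 : 0 < t by rewrite divr_gt0.
have tD : t * (l1 x + 1) * (1 + l1 v * (l1 u + 1)) = al_eta W / 2.
  have a0 : l1 x + 1 != 0 by rewrite gt_eqF // ltr_wpDl.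
  have b0 : 1 + l1 v * (l1 u + 1) != 0 by rewrite gt_eqF // ltr_wpDr.
  by rewrite /t; move: (l1 x + 1) (1 + _) a0 b0 => a b a0 b0; field; rewrite a0 b0.
exists (u + t *: x); last by rewrite pairDr wu add0r pairZr mulf_neq0 // gt_eqF.
rewrite /in_cone pairDr pairZr vu.
have E : u + t *: x - (1 + t * pair v x) *: u = t *: (x - pair v x *: u).
  by rewrite scalerDl scale1r -scalerA scalerBr opprD addrACA subrr add0r.
rewrite E l1Z (gtr0_norm t0).
have vx : `|pair v x| <= l1 v * l1 x by exact: pair_le.
have h1 : l1 (x - pair v x *: u) <= l1 x + l1 v * l1 x * l1 u.
  by apply: (le_trans (l1B _ _)); rewrite lerD2l l1Z ler_wpM2r.
have k1 : t * l1 (x - pair v x *: u) <= al_eta W / 2.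
  apply: (@le_trans _ _ (t * (l1 x + l1 v * l1 x * l1 u))); first by rewrite ler_wpM2l // ltW.
  have -> : al_eta W / 2 = t * ((l1 x + 1) * (1 + l1 v * (l1 u + 1))) by rewrite mulrA tD.
  apply: ler_wpM2l; first exact: ltW.
  by move: (l1 v) (l1 u) (l1 x) pv pu px => a b c a0 b0 c0; have := mulr_ge0 a0 b0; have := mulr_ge0 a0 c0; have := mulr_ge0 (mulr_ge0 a0 b0) c0; nra.
have k2 : t * `|pair v x| <= 2^-1.
  apply: (@le_trans _ _ (t * (l1 v * l1 x))); first by rewrite ler_wpM2l // ltW.
  apply: (@le_trans _ _ (t * ((l1 x + 1) * (1 + l1 v * (l1 u + 1))))).
    rewrite ler_wpM2l ?(ltW t0) //.
    by move: (l1 v) (l1 u) (l1 x) pv pu px => a b c a0 b0 c0; have := mulr_ge0 a0 b0; have := mulr_ge0 a0 c0; have := mulr_ge0 (mulr_ge0 a0 b0) c0; nra.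
  by rewrite mulrA tD; lra.
have k3 : 2^-1 <= `|1 + t * pair v x|.
  have := ler_normB (1 + t * pair v x) (t * pair v x); rewrite addrK normr1 normrM gtr0_norm //; lra.
apply: (le_trans k1); have : al_eta W * 2^-1 <= al_eta W * `|1 + t * pair v x| by rewrite ler_wpM2l // ltW.
by [].
Qed.

(** The attracting line of a block lies in the cone: iterates of a block send
    a point of the cone to this line. *)
Lemma block_Vplus na nb g : block W na nb g -> proximal_elt g -> exists (l : R) z,
  [/\ z \in line (Vplus g), z != 0, cone z, l != 0 & SLval g *m z = l *: z].
Proof.
move=> bg pg; have [l' [v' [u' [l0' vu' gu' vg' lim]]]] := proximal_limit pg.
have [l [_ lmax] gl] := VplusP pg.
set z := vpick (Vplus g); have zl : z \in line (Vplus g) by exact: memv_pick.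
have z0 : z != 0 by exact: vpick_proj_neq0.
have gz := gl z zl.
have l0 : l != 0.
  apply/eqP => l0; have := SL_mul_neq0 g z0.
  by rewrite gz l0 scale0r eqxx.
have u0' : u' != 0.
  by apply: contra_eq_neq vu' => ->; rewrite /pair mulmx0 mxE eq_sym oner_neq0.
have v0' : v' != 0.
  by apply: contra_eq_neq vu' => ->; rewrite /pair mul0mx mxE eq_sym oner_neq0.
pose N := l'^-1 *: SLval g.
have Ncvg : mcvg (fun k => N ^+ k) (u' *m v') by exact: lim.
have uc : cone u'.
  have [x cx vx] := cone_point v0'.
  have -> : u' = (pair v' x)^-1 *: ((u' *m v') *m x) by rewrite rank1_col scalerA mulVf // scale1r.
  apply: in_coneZ; apply: (@in_cone_limit (fun k => N ^+ k *m x)); last first.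
    exact: mcvgM Ncvg (mcvg_cst x).
  elim=> [|k IH]; first by rewrite expr0 mul1mx.
  rewrite exprS -mulmxA /N -scalemxAl; apply: in_coneZ.
  exact: (block_cone bg IH).1.
suff [c zE] : exists c, z = c *: u' by exists l, z; split=> //; rewrite zE; exact: in_coneZ.
(* the dominant eigenvalue has modulus at least that of l', so that the powers
   of g / l' do not shrink z, and their limit is colinear to u' *)
have ll' : `|l'| <= `|l|.
  have eig : eigenvalue (complex_mx g) l'%:C%C.
    rewrite eigenvalue_root_char /complex_mx -map_char_poly fmorph_root.
    rewrite -eigenvalue_root_char; apply/eigenvalueP; exists v' => //.
  have [E|ne] := eqVneq (l'%:C%C : R[i]) l%:C%C.
    by move: E => /(@complexI R) ->.
  have := lmax _ eig ne; rewrite !normC_normc !normc_real ltcR => /ltW //.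
pose kap := l / l'.
have kap1 : 1 <= `|kap| by rewrite /kap normrM normfV ler_pdivlMr ?normr_gt0 // mul1r.
have Nz k : N ^+ k *m z = kap ^+ k *: z.
  elim: k => [|k IH]; first by rewrite !expr0 mul1mx scale1r.
  rewrite exprSr -[N ^+ k * N]/(N ^+ k *m N) -mulmxA {2}/N -scalemxAl gz scalerA -scalemxAr IH scalerA.
  by rewrite exprS /kap (mulrC l).
have zc : mcvg (fun k => kap ^+ k *: z) (pair v' z *: u').
  have -> : pair v' z *: u' = (u' *m v') *m z by rewrite rank1_col.
  by apply: eq_mcvg (mcvgM Ncvg (mcvg_cst z)); exists 0%N => k _; rewrite Nz.
have vz : pair v' z != 0.
  apply/eqP => vz; rewrite vz scale0r in zc.
  have zp : 0 < l1 z by rewrite l1_gt0.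
  have [k Hk] := zc _ zp; have := Hk k (leqnn k).
  rewrite subr0 l1Z normrX => h; have : 1 <= `|kap| ^+ k by rewrite exprn_ege1.
  by move=> h1; have := lt_le_trans h (_ : l1 z <= `|kap| ^+ k * l1 z); rewrite ler_peMl ?l1_ge0 // ltxx => /(_ isT).
have k1 : kap = 1.
  apply: (mulIf vz); rewrite mul1r -pairZr /kap mulrC -scalerA -gz pairZr -pairM vg' pairZl.
  by rewrite mulrA mulVf // mul1r.
exists (pair v' z); apply/eqP; rewrite -subr_eq0 -l1_eq0; apply/eqP/le_anti; rewrite l1_ge0 andbT.
rewrite leNgt; apply/negP => gap; have [k Hk] := zc _ gap; have := Hk k (leqnn k).
by rewrite k1 expr1n scale1r ltxx.
Qed.

Variables (rho : probability (SL R d) R) (nu : probability (projspace R d) R).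
Hypothesis nu_stat : stationary rho nu.

(** Iterating the blocks of a small cell C moves the cone close to the
    attracting line of any element w of C, so that this line is regular. *)
Lemma cell_regular na nb N (C : set (SL R d)) (q b e r : R) w j : measurable C -> 0 < q ->
  0 <= b -> (q%:E <= convolution_power rho N C)%E -> outer_ge nu b (proj_cone v u (al_eta W)) ->
  (forall g, C g -> block W na nb g) -> C w -> proximal_elt w ->
  (forall g, C g -> l1 (SLval g - SLval w) <= e * s ^+ (na.+3 + nb.+1)) ->
  block_error W na nb <= 2^-1 ->
  block_error W na nb ^+ j + 2 * (d%:R ^+ 2 * H ^+ 2 * e) < r ->
  ((q ^+ j * b)%:E <= nu (ball (Vplus w) r))%E.
Proof.
move=> mC q0 b0 qC HY bC Cw pw eC be jr.
have [l [z0 [z0l z00 cz0 l0 wz0]]] := block_Vplus (bC w Cw) pw.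
set tau := d%:R ^+ 2 * H ^+ 2 * e in jr.
set p := s ^+ (na.+3 + nb.+1) in eC.
have p0 : 0 < p by rewrite exprn_gt0 // al_s0.
have e0 : 0 <= e.
  by have := le_trans (l1_ge0 _) (eC w Cw); rewrite pmulr_lge0.
have d20 : 0 <= d%:R ^+ 2 * H ^+ 2 by rewrite mulr_ge0 ?sqr_ge0.
have tau0 : 0 <= tau by rewrite mulr_ge0.
set be' := block_error W na nb in be jr.
have be0 : 0 <= be'.
  have Q0 : 0 <= al_M W / s by rewrite divr_ge0 // ?(le_trans ler01 (al_M1 W)) // ltW // al_s0.
  have H0 : 0 <= H by exact: le_trans ler01 (al_H1 W).
  rewrite /be' /block_error divr_ge0 ?exprn_ge0 // mulr_ge0 ?exprn_ge0 //.
  by rewrite !addr_ge0 // ?mulr_ge0 ?exprn_ge0 // ltW // trace_const_gt0.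
pose Y i : set (projspace R d) := [set x | exists z, [/\ z \in line x, z != 0, cone z &
  proj_dist x (Vplus w) <= be' ^+ i + 2 * tau]].
have HYi i : outer_ge nu (q ^+ i * b) (Y i).
  elim: i => [|i IH].
    rewrite expr0 mul1r; apply: outer_ge_sub HY => x [z [zx zz cz]]; exists z; split=> //.
    have h : proj_dist x (Vplus w) <= 1.
      rewrite (proj_distE zx zz z0l z00) ler_pdivrMr ?mulr_gt0 ?enorm_gt0 // mul1r.
      exact: wedge_norm_le.
    by rewrite expr0; lra.
  rewrite exprS -mulrA.
  apply: (@outer_push R n rho nu nu_stat N C q _ (Y i)) => //.
    by rewrite mulr_ge0 // exprn_ge0 // ltW.
  move=> g x Cg [z [zx zz cz hx]]; have bg := bC g Cg.
  have gz := act_line g zx; have gz0 := SL_mul_neq0 g zz.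
  have gy := act_line g z0l; have gy0 := SL_mul_neq0 g z00.
  exists (SLval g *m z); split=> //; first exact: (block_cone bg cz).1.
  apply: (le_trans (proj_dist_triangle (act g (Vplus w)) _ _)).
  have h1 : proj_dist (act g x) (act g (Vplus w)) <= be' * proj_dist x (Vplus w).
    rewrite (proj_distE gz gz0 gy gy0) (proj_distE zx zz z0l z00).
    rewrite ler_pdivrMr ?mulr_gt0 ?enorm_gt0 // mulrA -mulrAC ler_pdivlMr ?mulr_gt0 ?enorm_gt0 //.
    exact: block_contract.
  have h2 : proj_dist (act g (Vplus w)) (Vplus w) <= tau.
    have wz : SLval w *m z0 \in line (Vplus w) by rewrite wz0 memvZ.
    have wz00 := SL_mul_neq0 w z00.
    rewrite (proj_distE gy gy0 wz wz00) ler_pdivrMr ?mulr_gt0 ?enorm_gt0 //.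
    rewrite wedge_norm_sub -mulmxBl; apply: (le_trans (wedge_norm_le _ _)).
    rewrite mulrA ler_wpM2r ?enorm_ge0 //.
    apply: (le_trans (enorm_mulmx _ _)).
    apply: (@le_trans _ _ (e * p * (d%:R * enorm z0))).
      by rewrite ler_wpM2r ?mulr_ge0 ?enorm_ge0 //; exact: eC.
    have [_ hg] := block_cone bg cz0.
    have -> : e * p * (d%:R * enorm z0) = (e * d%:R) * (p * enorm z0) by ring.
    have -> : tau * enorm (SLval g *m z0) = (e * d%:R) * (d%:R * H ^+ 2 * enorm (SLval g *m z0)).
      by rewrite /tau; ring.
    by rewrite ler_wpM2l // mulr_ge0.
  have h3 : be' * proj_dist x (Vplus w) <= be' * (be' ^+ i + 2 * tau) by rewrite ler_wpM2l.
  have h4 : be' * (2 * tau) <= tau.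
    have := ler_wpM2r (mulr_ge0 (ler0n _ 2) tau0) be; lra.
  by rewrite exprS; move: h1 h2 h3; rewrite mulrDr; lra.
apply: HYi; first exact: measurable_projball.
move=> x [z [_ _ _ h]]; rewrite projball /= proj_distC.
exact: le_lt_trans h jr.
Qed.
End Regularity.

(** * Oscillation and exponential bounds *)

Section Oscillation.
Context {R : realType}.
Implicit Types x y t : R.

(** The length of the chord of angle t. *)
Definition osc t : R := ComplexField.Normc.normc (expi t - 1).

Lemma oscE t : osc t = 2 * `|sin (t / 2)|.
Proof.
have tE : t = (t / 2) *+ 2 by rewrite -mulr_natr divfK ?pnatr_eq0.
rewrite /osc /expi /=.
have -> : (cos t - 1) ^+ 2 + (sin t - 0) ^+ 2 = (2 * `|sin (t / 2)|) ^+ 2.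
  rewrite exprMn real_normK ?num_real // subr0.
  have c2 : cos t = 2 * cos (t / 2) ^+ 2 - 1.
    by rewrite {1}tE cos_mulr2n mulr_natl.
  have := cos2Dsin2 t; have := cos2Dsin2 (t / 2); rewrite c2.
  move: (cos (t / 2)) (sin (t / 2)) (sin t) => a b c h1 h2.
  have {h2} -> : c ^+ 2 = 1 - (2 * a ^+ 2 - 1) ^+ 2 by lra.
  have -> : b ^+ 2 = 1 - a ^+ 2 by lra.
  ring.
by rewrite sqrtr_sqr ger0_norm // mulr_ge0.
Qed.

Lemma oscN t : osc (- t) = osc t.
Proof. by rewrite !oscE mulNr sinN normrN. Qed.

Lemma oscD x y : osc (x + y) <= osc x + osc y.
Proof.
rewrite !oscE -mulrDr ler_wpM2l // mulrDl sinD.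
apply: (le_trans (ler_normD _ _)); rewrite !normrM.
by apply: lerD; [rewrite ler_piMr ?cos_max|rewrite ler_piMl ?cos_max].
Qed.

Let sin_mean t : 0 < t -> exists2 c, 0 < c < t & sin t = cos c * t.
Proof.
move=> t0; have [|c ct] := @MVT _ (@sin R) (@cos R) 0 t t0 (fun x _ => is_derive_sin x).
  by apply: continuous_subspaceT => x; exact: continuous_sin.
by rewrite sin0 !subr0 => E; exists c.
Qed.

Lemma sin_norm_le t : `|sin t| <= `|t|.
Proof.
wlog t0 : t / 0 < t.
  move=> H; have [t0|t0|->] := ltgtP t 0; [|exact: H|by rewrite sin0 normr0].
  by rewrite -normrN -sinN -[`|t|]normrN; apply: H; rewrite oppr_gt0.
have [c _ ->] := sin_mean t0; rewrite normrM ler_piMl // cos_max //.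
Qed.

Lemma osc_le t : osc t <= `|t|.
Proof.
rewrite oscE; apply: (@le_trans _ _ (2 * `|t / 2|)); first by rewrite ler_wpM2l // sin_norm_le.
by rewrite normrM normfV (ger0_norm (ler0n _ 2)) mulrCA divff // mulr1.
Qed.

Lemma osc_ge t : `|t| <= 1 -> `|t| / 2 <= osc t.
Proof.
wlog t0 : t / 0 < t.
  move=> H; have [t0|t0|->] := ltgtP t 0; [|exact: H|by rewrite normr0 mul0r oscE mulr_ge0].
  by rewrite -normrN -oscN; apply: H; rewrite oppr_gt0.
rewrite (gtr0_norm t0) oscE => t1.
have [|c /andP[c0 ct] ->] := @sin_mean (t / 2); first by rewrite divr_gt0.
have cc : 2^-1 <= cos c.
  have cE : c = (c / 2) *+ 2 by rewrite -mulr_natr divfK ?pnatr_eq0.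
  have := sin_norm_le (c / 2); rewrite (gtr0_norm (_ : 0 < c / 2)) ?divr_gt0 // => h.
  have h2 : `|sin (c / 2)| ^+ 2 <= (c / 2) ^+ 2 by rewrite lerXn2r ?nnegrE // divr_ge0 // ltW.
  rewrite real_normK ?num_real // in h2; rewrite cE cos_mulr2n.
  have -> : cos (c / 2) ^+ 2 *+ 2 = 2 * cos (c / 2) ^+ 2 by rewrite mulr_natl.
  have h3 := cos2Dsin2 (c / 2).
  have : (c / 2) ^+ 2 <= 4^-1 ^+ 2 by rewrite lerXn2r ?nnegrE ?divr_ge0 ?(ltW c0) ?invr_ge0 //; lra.
  have -> : 4^-1 ^+ 2 = 16^-1 :> R by rewrite exprVn -natrX.
  lra.
rewrite normrM !ger0_norm; [|by rewrite divr_ge0 // ltW|lra].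
have : 2^-1 * t <= cos c * t by rewrite ler_wpM2r // ltW.
lra.
Qed.

(** If the four terms of an alternating sum are close to integer multiples of
    the period, so is the sum. *)
Lemma osc_four (b x1 x2 x3 x4 : R) : `|b * (x1 + x2 - x3 - x4)| <= 1 ->
  exists x, [\/ x = x1, x = x2, x = x3 | x = x4] /\ `|b * (x1 + x2 - x3 - x4)| / 8 <= osc (b * x).
Proof.
move=> b1; have := osc_ge b1; set F := `|_|.
have h : osc (b * (x1 + x2 - x3 - x4)) <= osc (b * x1) + osc (b * x2) + osc (b * x3) + osc (b * x4).
  rewrite !mulrBr mulrDr.
  apply: (le_trans (oscD _ _)); rewrite oscN lerD2r.
  by apply: (le_trans (oscD _ _)); rewrite oscN lerD2r oscD.
move=> h2; have [k|k1] := leP (F / 8) (osc (b * x1)); first by exists x1; split=> //; constructor 1.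
have [k|k2] := leP (F / 8) (osc (b * x2)); first by exists x2; split=> //; constructor 2.
have [k|k3] := leP (F / 8) (osc (b * x3)); first by exists x3; split=> //; constructor 3.
have [k|k4] := leP (F / 8) (osc (b * x4)); first by exists x4; split=> //; constructor 4.
lra.
Qed.

Lemma osc_stable b x y : osc (b * x) - `|b| * `|y - x| <= osc (b * y).
Proof.
have := oscD (b * y) (b * (x - y)); rewrite -mulrDr addrC subrK => h.
have := osc_le (b * (x - y)); rewrite normrM distrC; lra.
Qed.
End Oscillation.

Section ExponentialBounds.
Context {R : realType}.
Implicit Types F G : nat -> R.

(** Masses of sets of words are only known up to exponentials of the length of the
    words; this class of sequences is closed under the operations that combine
    them. *)
Definition exp_below F := exists x : R, [/\ 0 < x, x < 1 &
  exists m0, forall m, (m0 <= m)%N -> x ^+ m <= F m].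

Lemma exp_below_le F G : (exists m0, forall m, (m0 <= m)%N -> F m <= G m) ->
  exp_below F -> exp_below G.
Proof.
move=> [m1 FG] [x [x0 x1 [m0 H]]]; exists x; split=> //; exists (maxn m0 m1) => m.
by rewrite geq_max => /andP[/H h /FG]; exact: le_trans.
Qed.

Lemma exp_belowX (c : R) : 0 < c -> exp_below (fun m => c ^+ m).
Proof.
move=> c0; exists (Num.min c 2^-1); split.
- by rewrite lt_min c0 invr_gt0 /=.
- by rewrite gt_min invf_lt1 // ltr1n orbT.
exists 0%N => m _; rewrite lerXn2r ?nnegrE ?(ltW c0) ?ge_min ?lexx //.
by rewrite le_min (ltW c0) invr_ge0 /=.
Qed.

Lemma geometric_lt (a b C : R) : 0 <= a -> a < b -> 0 < C ->
  exists m0, forall m, (m0 <= m)%N -> C * a ^+ m <= b ^+ m.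
Proof.
move=> a0 ab C0; have b0 : 0 < b by exact: le_lt_trans ab.
have ab1 : `|a / b| < 1 by rewrite ger0_norm ?divr_ge0 ?(ltW b0) // ltr_pdivrMr // mul1r.
have /cvgrPdist_lt /(_ C^-1) := cvg_expr ab1.
rewrite invr_gt0 => /(_ C0)[m0 _ H]; exists m0 => m /H /=.
rewrite sub0r normrN normrX ger0_norm ?divr_ge0 ?(ltW b0) // => /ltW.
by rewrite expr_div_n ler_pdivrMr ?exprn_gt0 // mulrC ler_pdivlMr // mulrC.
Qed.

Lemma exp_belowC (c : R) : 0 < c -> exp_below (fun=> c).
Proof.
move=> c0; exists 2^-1; split; rewrite ?invr_gt0 ?invf_lt1 ?ltr1n //.
have [m0 H] := @geometric_lt 2^-1 1 c^-1 ltac:(by rewrite invr_ge0) ltac:(by rewrite invf_lt1 ?ltr1n)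
  ltac:(by rewrite invr_gt0).
by exists m0 => m /H; rewrite expr1n mulrC ler_pdivrMr // mul1r.
Qed.

Lemma exp_belowM F G : exp_below F -> exp_below G -> exp_below (fun m => F m * G m).
Proof.
move=> [x [x0 x1 [m0 Hx]]] [y [y0 y1 [m1 Hy]]]; exists (x * y); split.
- exact: mulr_gt0.
- by rewrite -[1]mulr1 ltr_pM // ltW.
exists (maxn m0 m1) => m; rewrite geq_max => /andP[/Hx h1 /Hy h2].
by rewrite exprMn ler_pM // exprn_ge0 // ltW.
Qed.

Lemma exp_belowP F j : exp_below F -> exp_below (fun m => F m ^+ j).
Proof.
move=> HF; elim: j => [|j IH]; first by apply: (exp_below_le _ (exp_belowC ltr01)); exists 0%N => m _; rewrite expr0.
by apply: (exp_below_le _ (exp_belowM HF IH)); exists 0%N => m _; rewrite exprS.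
Qed.

Lemma exp_below_cell d (L e : nat -> R) : (forall m, 1 <= L m) -> (forall m, 0 < e m) ->
  (forall m, e m <= 1) -> exp_below (fun m => (L m)^-1) -> exp_below e ->
  exp_below (fun m => (2 * @cell_bound R d (L m) (e m))^-1).
Proof.
move=> L1 e0 e1 HL He.
have c0 : 0 < (2 * (d * d)%:R + 1 : R)^-1 by rewrite invr_gt0 ltr_wpDl // mulr_ge0.
have h2 : (0 : R) < 2^-1 by rewrite invr_gt0.
have H := exp_belowM (exp_belowC h2) (exp_belowP (d * d)
  (exp_belowM (exp_belowC c0) (exp_belowM HL He))).
apply: exp_below_le H; exists 0%N => m _.
have Lm := L1 m; have em := e0 m; have em1 := e1 m.
have L0 : 0 < L m by exact: lt_le_trans Lm.
have LE : 1 <= L m / e m by rewrite ler_pdivlMr // mul1r (le_trans em1).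
rewrite /cell_bound invfM -exprVn ler_wpM2l ?invr_ge0 // lerXn2r ?nnegrE //.
- by rewrite !mulr_ge0 // ?invr_ge0 // ?addr_ge0 ?mulr_ge0 // ltW.
- by rewrite invr_ge0 addr_ge0 // !mulr_ge0 // ?invr_ge0 ltW.
have -> : (2 * (d * d)%:R + 1)^-1 * ((L m)^-1 * e m) = ((2 * (d * d)%:R + 1) * (L m / e m))^-1.
  by rewrite [RHS]invfM invf_div (mulrC (e m)).
have D0 : 0 < 2 * L m * (d * d)%:R / e m + 1.
  by rewrite ltr_wpDl // divr_ge0 ?(ltW em) // !mulr_ge0 // ltW.
rewrite lef_pV2 ?posrE //; last by rewrite mulr_gt0 ?divr_gt0 // -invr_gt0.
have -> : 2 * L m * (d * d)%:R / e m = 2 * (d * d)%:R * (L m / e m) by ring.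
by rewrite [X in _ <= X]mulrDl mul1r lerD2l.
Qed.
End ExponentialBounds.

(** * Choice of the lengths *)

Lemma block_length K0 m : (1 <= m)%N -> let nb := ((K0 + 5) * m - m - 4)%N in
  [/\ (nb.+1 + (m + 3) = (K0 + 5) * m)%N, (m + nb + 4 = (K0 + 5) * m)%N & (2 * m.+3 = 6 + 2 * m)%N].
Proof. by rewrite mulnDl; move: (K0 * m)%N => k m1; split; lia. Qed.

Section Rates.
Context {R : realType} {n : nat}.
Notation d := n.+2.
Variable W : alphabet R n.
Local Notation s := (al_s W).
Local Notation M := (al_M W).
Local Notation Q := (al_M W / al_s W).

(** The length of the long word B is K m, up to a constant: K is chosen so that
    the errors decrease faster than the lower bound for the cross differences. *)
Lemma rates : exists (K : nat) (f : R), [/\ (5 <= K)%N, 0 < f, f <= 1 &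
  exists m0, forall m, (m0 <= m)%N ->
  let nb := (K * m - m - 4)%N in let h := f * M ^- 4 ^+ m in
  [/\ (0 < m)%N /\ (m + nb + 4 = K * m)%N,
      block_error W m nb <= h / 100 /\ block_error W m nb <= 2^-1 ^+ m,
      cross_rate W m <= 2^-1,
      2 * cross_rate W m + 8 * block_error W m nb <= (3 / 4) ^+ m &
      h * (cross_const W * M ^+ (4 * m + 8)) <= al_om W]].
Proof.
have M1 := al_M1 W; have M0 : 0 < M by exact: lt_le_trans M1.
have s0 := al_s0 W; have om0 := al_om0 W; have I0 := al_I0 W.
have H1 := al_H1 W; have H0 : 0 < al_H W by exact: lt_le_trans H1.
have Q0 : 0 < Q by rewrite divr_gt0.
have cc0 : 0 < cross_const W.
  by rewrite /cross_const; do 2! [apply: mulr_gt0; last exact: exprn_gt0]; apply: mulr_gt0 => //; exact: exprn_gt0.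
set g := M ^- 4; have g0 : 0 < g by rewrite invr_gt0 exprn_gt0.
have g1 : g <= 1 by rewrite invf_le1 ?exprn_gt0 // exprn_ege1.
pose f := Num.min 1 (al_om W / (cross_const W * M ^+ 8)).
have f0 : 0 < f by rewrite lt_min ltr01 divr_gt0 // mulr_gt0 // exprn_gt0.
have f1 : f <= 1 by rewrite ge_min lexx.
have fom : f * (cross_const W * M ^+ 8) <= al_om W.
  by rewrite -ler_pdivlMr ?mulr_gt0 ?exprn_gt0 // ge_min lexx orbT.
have [K0 HK0] : exists K0 : nat, 2 * Q ^+ 2 * 2^-1 ^+ K0 < g / 2.
  have [] := @geometric_lt R 2^-1 1 (4 * Q ^+ 2 * g^-1 + 1).
  - by rewrite invr_ge0.
  - by rewrite invf_lt1 ?ltr1n.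
  - apply: ltr_wpDl => //; apply: mulr_ge0; last by rewrite invr_ge0 ltW.
    by apply: mulr_ge0 => //; exact: sqr_ge0.
  move=> k /(_ k (leqnn k)); rewrite expr1n => h; exists k.
  have p0 : 0 < 2^-1 ^+ k :> R by rewrite exprn_gt0 // invr_gt0.
  have h2 : 4 * Q ^+ 2 * g^-1 * 2^-1 ^+ k < 1 by move: h p0; rewrite mulrDl mul1r; lra.
  rewrite -(ltr_pM2r (_ : 0 < 2 * g^-1)); last by rewrite mulr_gt0 // invr_gt0.
  have -> : g / 2 * (2 * g^-1) = 1 by field; rewrite gt_eqF.
  by have -> : 2 * Q ^+ 2 * 2^-1 ^+ k * (2 * g^-1) = 4 * Q ^+ 2 * g^-1 * 2^-1 ^+ k by ring.
(* K is at least 5, so that the subtraction in K m - m - 4 is not truncated *)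
pose K := (K0 + 5)%N; pose a := 2 * Q ^+ 2 * 2^-1 ^+ K.
have a0 : 0 <= a by rewrite /a !mulr_ge0 ?exprn_ge0 ?invr_ge0 // ltW.
have ag : a < g / 2.
  have Q20 : 0 <= 2 * Q ^+ 2 by apply: mulr_ge0 => //; exact: sqr_ge0.
  apply: le_lt_trans HK0; rewrite /a /K exprD; apply: ler_wpM2l => //.
  by rewrite ler_piMr ?exprn_ge0 ?invr_ge0 // exprn_ile1 ?invr_ge0 ?invf_le1 ?ler1n.
set C1 := (64 * trace_const (R := R) (n := n.+1) + 8 * al_H W ^+ 2 + 8 * d%:R ^+ 4 * al_H W ^+ 4).
have C10 : 0 < C1.
  have h1 := trace_const_gt0 (R := R) (n := n.+1).
  have h2 : 0 <= 8 * al_H W ^+ 2 by rewrite mulr_ge0 // sqr_ge0.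
  have h3 : 0 <= 8 * d%:R ^+ 4 * al_H W ^+ 4 by rewrite !mulr_ge0 ?exprn_ge0 // ltW.
  by rewrite /C1; move: h1 h2 h3; lra.
have eE m : (1 <= m)%N -> block_error W m (K * m - m - 4) = 8 * C1 * Q ^+ 6 * a ^+ m.
  move=> m1; rewrite /block_error -/C1.
  have [E2 _ E1] := block_length K0 m1; rewrite -/K in E2.
  have E3 : (2 : R) ^+ (K * m - m - 4).+1 * (2 ^+ m * 8) = (2 ^+ K) ^+ m.
    rewrite -(exprM 2 K m) -[in RHS]E2 !(exprD 2); have -> : (2 : R) ^+ 3 = 8 by ring.
    by [].
  have p0 : (2 : R) ^+ (K * m - m - 4).+1 != 0 by rewrite expf_neq0 // pnatr_eq0.
  have p1 : ((2 : R) ^+ K) ^+ m != 0 by rewrite !expf_neq0 // pnatr_eq0.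
  have p2 : (2 : R) ^+ m != 0 by rewrite expf_neq0 // pnatr_eq0.
  rewrite E1 exprD exprM /a !exprMn !exprVn -E3.
  move: (Q ^+ 6) ((Q ^+ 2) ^+ m) ((2 : R) ^+ m) (2 ^+ _.+1) p0 p2 => x y z t t0 z0.
  by field; rewrite t0 z0 expf_neq0 gt_eqF.
exists K, f; split=> //; first by rewrite /K leq_addl.
have D0 : 0 < 8 * C1 * Q ^+ 6 by apply: mulr_gt0; [exact: mulr_gt0|exact: exprn_gt0].
clearbody C1 a.
have ag1 : a < g by apply: (lt_trans ag); rewrite ltr_pdivrMr // mulr_natr mulr2n ltrDl.
have a2 : a < 2^-1 by apply: (lt_le_trans ag); rewrite ler_pdivrMr // mulVf ?pnatr_eq0.
have h34 : 2^-1 < 3 / 4 :> R by rewrite ltr_pdivlMr // mulrC ltr_pdivrMr // -natrM ltr_nat.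
have D1 : 0 < 8 * C1 * Q ^+ 6 * (100 / f) by rewrite mulr_gt0 // divr_gt0.
have [m1 H1'] := geometric_lt a0 ag1 D1.
have [m2 H2'] := geometric_lt a0 a2 D0.
have D3 : 0 < 16 * (8 * C1 * Q ^+ 6) by rewrite mulr_gt0.
have [m3 H3'] := geometric_lt a0 (lt_trans a2 h34) D3.
pose c3 : R := 64 * d%:R ^+ 2 * al_H W ^+ 4 * Q ^+ 4.
have c30 : 0 < c3.
  by rewrite /c3; do 2! [apply: mulr_gt0; last exact: exprn_gt0]; apply: mulr_gt0 => //; exact: exprn_gt0.
have D4 : 0 < 4 * c3 by rewrite mulr_gt0.
have half0 : 0 <= 2^-1 :> R by rewrite invr_ge0.
have [m4 H4'] := geometric_lt half0 h34 D4.
have crE m : cross_rate W m = c3 * 2^-1 ^+ m * 2^-1.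
  by rewrite /cross_rate -/c3 exprSr invfM -exprVn mulrA.
exists (maxn (maxn m1 m2) (maxn m3 m4)).+1 => m hm nb h.
have m0 : (1 <= m)%N by exact: leq_ltn_trans hm.
move: (ltnW hm); rewrite !geq_max => /andP[/andP[l1 l2] /andP[l3 l4]].
have {}H1' := H1' m l1; have {}H2' := H2' m l2.
have {}H3' := H3' m l3; have {}H4' := H4' m l4; clearbody c3.
rewrite /nb crE eE //.
have q1 : (3 / 4 : R) ^+ m <= 1.
  by apply: exprn_ile1; rewrite ?divr_ge0 // ler_pdivrMr // mul1r ler_nat.
split.
- by have [_ E _] := block_length K0 m0.
- split=> //; rewrite /h ler_pdivlMr // -ler_pdivrMl //.
  by apply: le_trans H1'; rewrite le_eqVlt; apply/orP; left; apply/eqP; field; rewrite (gt_eqF f0) (gt_eqF s0).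
- by move: H4'; rewrite -mulrA; lra.
- have z0 : 0 <= (3 / 4 : R) ^+ m by rewrite exprn_ge0 // divr_ge0.
  move: z0 H3' H4'; move: (8 * C1 * Q ^+ 6) (2^-1 ^+ m) (a ^+ m) ((3 / 4) ^+ m) => p x y z z0 k1 k2.
  have k3 : 16 * p * y = 16 * (p * y) by rewrite mulrA.
  have k4 : 4 * c3 * x = 4 * (c3 * x) by rewrite mulrA.
  by move: k1 k2; rewrite k3 k4; move: (p * y) (c3 * x) => e1 e2 k1 k2; lra.
- have -> : h * (cross_const W * M ^+ (4 * m + 8)) = f * (cross_const W * M ^+ 8) * (g ^+ m * (M ^+ 4) ^+ m).
    by rewrite /h exprD exprM; ring.
  by rewrite -exprMn mulVf ?expr1n ?mulr1 // expf_neq0 // gt_eqF.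
Qed.
End Rates.

(** * Heavy sets of good blocks *)

Section GoodWord.
Context {R : realType} {n : nat}.
Notation d := n.+2.
Variable W : alphabet R n.
Local Notation s := (al_s W).
Local Notation M := (al_M W).

(** Among the blocks with prescribed long words, one has a logarithm of the
    spectral radius that b moves away from the multiples of the period; so
    have all the blocks close to it. *)
Lemma good_block na nb (a b A B : SL R d) c (beta h : R) :
  al_A W a -> al_B W b -> words (al_A W) na A -> words (al_A W) nb B ->
  (forall j, al_C W j (c j)) -> 0 < h -> h <= 1 -> block_error W na nb <= h / 100 ->
  cross_rate W na <= 2^-1 -> h * (cross_const W * M ^+ (4 * na + 8)) <= al_om W ->
  1 <= `|beta| -> `|beta| * (2 * cross_rate W na + 8 * block_error W na nb) <= 1 ->
  exists x k, (x = a \/ x = b) /\ let w0 := (x * A * c k * B)%g in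
    forall w, block W na nb w -> l1 (SLval w - SLval w0) <= h / 100 * s ^+ (na.+3 + nb.+1) ->
    h / 100 <= osc (beta * lambda1 w).
Proof.
move=> Ha Hb HA HB Hc h0 h1 be cr hom b1 bPhi.
have be4 : block_error W na nb <= 4^-1 by lra.
have [j [j' [Phile Phige]]] := cross_difference Ha Hb HA HB Hc be4 cr.
set Phi := lambda1 _ + lambda1 _ - lambda1 _ - lambda1 _ in Phile Phige.
have cc0 : 0 < cross_const W * M ^+ (4 * na + 8).
  have H0 : 0 < al_H W by exact: lt_le_trans (al_H1 W).
  have M0 : 0 < M by exact: lt_le_trans (al_M1 W).
  rewrite /cross_const; apply: mulr_gt0; last exact: exprn_gt0.
  apply: mulr_gt0; last exact: exprn_gt0.
  apply: mulr_gt0; last by rewrite exprn_gt0 // al_I0.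
  by apply: mulr_gt0 => //; exact: exprn_gt0.
have Phih : h <= `|Phi| + 8 * block_error W na nb.
  by rewrite -(ler_pM2r cc0) (mulrC (_ + _)); exact: le_trans hom Phige.
have bPhi1 : `|beta * Phi| <= 1.
  by rewrite normrM; apply: le_trans bPhi; rewrite ler_wpM2l.
have [x [xE xosc]] := osc_four bPhi1.
(* the spectral radius of the neighbours of w0 differs too little to compensate
   for the oscillation of w0 *)
have key w0 : block W na nb w0 -> x = lambda1 w0 ->
    forall w, block W na nb w -> l1 (SLval w - SLval w0) <= h / 100 * s ^+ (na.+3 + nb.+1) ->
    h / 100 <= osc (beta * lambda1 w).
  move=> bw0 xw0 w bw ww0.
  have h8 : h / 100 <= 8^-1 by lra.
  have lw := block_lambda1 bw0 bw be4 ww0 h8.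
  have := osc_stable beta (lambda1 w0) (lambda1 w); rewrite -xw0 in lw *; apply: le_trans.
  have E1 : `|beta * Phi| = `|beta| * `|Phi| by rewrite normrM.
  rewrite E1 in xosc.
  have k1 : `|beta| * `|lambda1 w - x| <= `|beta| * (h / 10).
    by rewrite ler_wpM2l //; apply: (le_trans lw); lra.
  have k2 : `|beta| * (92 / 100 * h) <= `|beta| * `|Phi|.
    by rewrite ler_wpM2l //; move: Phih be; move: (`|Phi|) (block_error W na nb) => p q; lra.
  have k3 : h <= `|beta| * h by rewrite ler_peMl // ltW.
  have E2 : `|beta| * (h / 10) = `|beta| * h / 10 by rewrite mulrA.
  have E3 : `|beta| * (92 / 100 * h) = 92 / 100 * (`|beta| * h) by rewrite mulrCA.
  move: xosc k1 k2 k3; rewrite E2 E3.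
  move: (`|beta| * `|Phi|) (`|beta| * h) (osc _) (`|beta| * `|_ - _|) => p q r t; lra.
have blk g k : g = a \/ g = b -> block W na nb (g * A * c k * B)%g.
  move=> gab; exists g, A, (c k), B; split=> //; last by exists k.
  by case: gab => ->; [left|right].
case: xE => E.
- by exists a, j; split; [left|apply: key E; apply: blk; left].
- by exists b, j'; split; [right|apply: key E; apply: blk; right].
- by exists a, j'; split; [left|apply: key E; apply: blk; left].
- by exists b, j; split; [right|apply: key E; apply: blk; right].
Qed.
End GoodWord.

Lemma block_counts na nb : let N := (na + nb + 4)%N in
  [/\ (na.+1 <= N)%N, (nb.+2 <= N)%N, (na.+1 + nb.+2 <= N)%N & (na + nb + 3 <= N)%N].
Proof. by split; lia. Qed.

Lemma radius_bounds (R : realType) (L e : R) : 1 <= L -> 0 < e -> 18 * L ^+ 2 * e <= 1 ->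
  [/\ 0 <= 2 * e <= 1, 2 * e <= 6 * L * e <= 1 & 2 * e <= 18 * L ^+ 2 * e].
Proof.
move=> L1 e0 h; have h1 : e <= L * e by rewrite ler_peMl // ltW.
have h2 : L * e <= L ^+ 2 * e by rewrite ler_wpM2r ?(ltW e0) // expr2 ler_peMr // (le_trans ler01).
by split; [apply/andP; split|apply/andP; split|]; lra.
Qed.

Section HeavyBlock.
Context {R : realType} {n : nat}.
Notation d := n.+2.
Variables (rho : probability (SL R d) R) (W : alphabet R n).
Variables (ell : nat) (r q : R) (a0 b0 : SL R d) (c0 : 'I_d -> SL R d).
Local Notation s := (al_s W).
Local Notation M := (al_M W).
Hypothesis r0 : 0 < r.
Hypothesis q0 : 0 < q.
Hypothesis q1 : q <= 1.
Hypothesis aA : SLball a0 r `<=` al_A W.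
Hypothesis bB : SLball b0 r `<=` al_B W.
Hypothesis cC : forall j, SLball (c0 j) r `<=` al_C W j.
Hypothesis qa : (q%:E <= convolution_power rho ell (SLball a0 (r / 2)))%E.
Hypothesis qb : (q%:E <= convolution_power rho ell (SLball b0 (r / 2)))%E.
Hypothesis qc : forall j, (q%:E <= convolution_power rho ell (SLball (c0 j) (r / 2)))%E.

Let half (x y : SL R d) : SLball x (r / 2) y -> SLball x r y.
Proof.
rewrite /SLball /= => h; apply: (lt_le_trans h).
by rewrite ler_pdivrMr // ler_peMr ?ler1n // ltW.
Qed.

Let half2 (x y z : SL R d) : SLball x (r / 2) y -> SLball y (r / 2) z -> SLball x r z.
Proof.
rewrite /SLball /= => h1 h2; have -> : SLval z - SLval x = (SLval z - SLval y) + (SLval y - SLval x).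
  by rewrite addrA subrK.
by apply: (le_lt_trans (l1D _ _)); move: h1 h2; lra.
Qed.

Lemma words_sub (S S' : set (SL R d)) k : S `<=` S' -> words S k `<=` words S' k.
Proof.
move=> SS'; elim: k => [|k IH] //= g [x [h [/SS' Sx /IH Wh ->]]].
by exists x, h.
Qed.

(** The mass q of the balls around the letters, to the power of the length of the
    block, shared between the cells of a grid. *)
Definition block_mass N (L e : R) : R := q ^+ N / (2 * @cell_bound R d L e).

(** By pigeonhole, the letters and the long words of a good block can be chosen
    in small balls of not too small mass; the ball around the block has at
    least the product of these masses, and contains only good blocks. *)
Lemma heavy_block na nb (L e h beta : R) :
  let N := (na + nb + 4)%N in
  M ^+ N <= L -> 0 < e -> 18 * L ^+ 2 * e <= 1 -> 54 * L ^+ 3 * e * L <= r / 2 ->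
  54 * L ^+ 3 * e <= h / 100 * s ^+ (na.+3 + nb.+1) ->
  0 < h -> h <= 1 -> block_error W na nb <= h / 100 ->
  cross_rate W na <= 2^-1 -> h * (cross_const W * M ^+ (4 * na + 8)) <= al_om W ->
  1 <= `|beta| -> `|beta| * (2 * cross_rate W na + 8 * block_error W na nb) <= 1 ->
  exists w0, let S := SLball w0 (54 * L ^+ 3 * e) in
    ((block_mass N L e ^+ 4)%:E <= convolution_power rho (ell * N) S)%E /\
    forall w, S w -> block W na nb w /\ h / 100 <= osc (beta * lambda1 w).
Proof.
move=> N ML e0 e1 eL es h0 h1 be cr hom bt1 btPhi.
have [le1 le2 le3 le4] := block_counts na nb; rewrite -/N in le1 le2 le3 le4.
have M1 := al_M1 W; have M0 : 0 <= M by exact: le_trans ler01 M1.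
have ML' k : (k <= N)%N -> M ^+ k <= L.
  by move=> kN; apply: le_trans ML; rewrite ler_weXn2l.
have L1 : 1 <= L by have := ML' 0%N isT; rewrite expr0.
have L0 : 0 <= L by exact: le_trans ler01 L1.
have ML1 : M <= L by have := ML' 1%N; rewrite expr1; apply; rewrite /N addn4.
set mu0 := block_mass N L e.
have cb0 : 0 < @cell_bound R d L e.
  by rewrite exprn_gt0 // ltr_wpDl // divr_ge0 ?(ltW e0) // !mulr_ge0.
have mu00 : 0 <= mu0 by rewrite divr_ge0 ?exprn_ge0 ?(ltW q0) // mulr_ge0 // ltW.
have heavy (X : set (SL R d)) k m : (k <= N)%N -> outer_ge (convolution_power rho m) (q ^+ k) X ->
    (forall g, X g -> l1 (SLval g) <= L) ->
    exists2 g, X g & (mu0%:E <= convolution_power rho m (SLball g (2 * e)))%E.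
  move=> kN HX XL; have [g Xg Hg] := heavy_ball (isT : (0 < d)%N) L0 e0 (exprn_gt0 k q0) HX XL.
  exists g => //; apply: le_trans Hg; rewrite lee_fin /mu0 /block_mass.
  apply: ler_wpM2r; first by rewrite invr_ge0 mulr_ge0 // ltW.
  by apply: ler_wiXn2l => //; exact: ltW.
have heavy1 (x : SL R d) : (q%:E <= convolution_power rho ell (SLball x (r / 2)))%E ->
    (forall g, SLball x (r / 2) g -> l1 (SLval g) <= M) ->
    exists2 g, SLball x (r / 2) g & (mu0%:E <= convolution_power rho ell (SLball g (2 * e)))%E.
  move=> qx xM; apply: (heavy _ 1%N) => //.
  - by rewrite /N addn4.
  - by rewrite expr1; apply: outer_ge_measure => //; exact: measurable_SLball.
  - by move=> g /xM h'; exact: le_trans ML1.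
have wordsA k : words (SLball a0 (r / 2)) k `<=` words (al_A W) k.
  by apply: words_sub => g /half /aA.
have heavyW k : (k.+1 <= N)%N -> exists2 g, words (al_A W) k g &
    (mu0%:E <= convolution_power rho (ell * k.+1) (SLball g (2 * e)))%E.
  move=> kN.
  have WL g : words (SLball a0 (r / 2)) k g -> l1 (SLval g) <= L.
    by move=> /wordsA /words_norm[lg _ _]; exact: le_trans (ML' _ kN).
  have [g Wg Hg] := heavy _ _ _ kN
    (@words_mass R n rho ell _ q k (measurable_SLball a0 (r / 2)) (ltW q0) qa) WL.
  by exists g => //; exact: wordsA.
have [a xa Ma] : exists2 g, SLball a0 (r / 2) g & (mu0%:E <= convolution_power rho ell (SLball g (2 * e)))%E.
  by apply: heavy1 => // g /half /aA Hg; have [] := al_AM Hg.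
have [b xb Mb] : exists2 g, SLball b0 (r / 2) g & (mu0%:E <= convolution_power rho ell (SLball g (2 * e)))%E.
  by apply: heavy1 => // g /half /bB Hg; exact: al_BM Hg.
have exc j : exists g, SLball (c0 j) (r / 2) g /\ (mu0%:E <= convolution_power rho ell (SLball g (2 * e)))%E.
  have [g xg Mg] : exists2 g, SLball (c0 j) (r / 2) g & (mu0%:E <= convolution_power rho ell (SLball g (2 * e)))%E.
    by apply: heavy1 => // g /half /cC Hg; have [] := al_CM Hg.
  by exists g.
have [c Hc] := choice exc.
have [A WA MA] : exists2 g, words (al_A W) na g & (mu0%:E <= convolution_power rho (ell * na.+1) (SLball g (2 * e)))%E.
  exact: heavyW.
have [B WB MB] : exists2 g, words (al_A W) nb g & (mu0%:E <= convolution_power rho (ell * nb.+1) (SLball g (2 * e)))%E.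
  by apply: heavyW; exact: ltnW.
have Cc j : al_C W j (c j) by apply: cC; apply: half; exact: (Hc j).1.
have [x [k [xE good]]] := good_block (aA (half xa)) (bB (half xb)) WA WB Cc h0 h1 be cr hom bt1 btPhi.
have [x0 [F [xx0 Fx0 Fl Mx]]] : exists x0 F, [/\ SLball x0 (r / 2) x, SLball x0 r `<=` F,
    (forall g, F g -> first_letter W g) & (mu0%:E <= convolution_power rho ell (SLball x (2 * e)))%E].
  case: xE => ->; [exists a0, (al_A W)|exists b0, (al_B W)]; split=> // g Hg; [by left|by right].
set w0 := (x * A * c k * B)%g in good.
exists w0 => S.
have Mx1 : l1 (SLval x) <= M.
  by case: (Fl x (Fx0 _ (half xx0))) => Hx; [have [] := al_AM Hx|exact: al_BM Hx].
have [lA _ _] := words_norm WA; have [lB _ _] := words_norm WB.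
have [lc _] := al_CM (Cc k).
have lcB : l1 (SLval (c k * B)%g) <= M ^+ nb.+2.
  by rewrite SL_mulE exprS; apply: (le_trans (l1M _ _)); apply: ler_pM; rewrite ?l1_ge0.
have lAcB : l1 (SLval (A * (c k * B))%g) <= M ^+ (na.+1 + nb.+2).
  by rewrite SL_mulE exprD; apply: (le_trans (l1M _ _)); apply: ler_pM; rewrite ?l1_ge0.
have [/andP[r2 r21] /andP[r26 r61] r218] := radius_bounds L1 e0 e1.
have e18 : 18 * L ^+ 2 * e = 3 * L * (6 * L * e) by ring.
have e6 : 3 * L * (2 * e) = 6 * L * e by ring.
have M1' := ball_mass_mul L1 mu00 mu00 r2 (lexx (2 * e)) r21
  (le_trans lc ML1) (le_trans lB (ML' _ (ltnW le2))) (Hc k).2 MB.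
rewrite e6 in M1'.
have M2 := ball_mass_mul L1 mu00 (mulr_ge0 mu00 mu00) r2
  r26 r61
  (le_trans lA (ML' _ le1)) (le_trans lcB (ML' _ le2)) MA M1'.
rewrite -e18 in M2.
have M3 := ball_mass_mul L1 mu00 (mulr_ge0 mu00 (mulr_ge0 mu00 mu00)) r2
  r218 e1
  (le_trans Mx1 ML1) (le_trans lAcB (ML' _ le3)) Mx M2.
split.
  have -> : mu0 ^+ 4 = mu0 * (mu0 * (mu0 * mu0)) by ring.
  have -> : (ell * N = ell + (ell * na.+1 + (ell + ell * nb.+1)))%N by rewrite /N; ring.
  have -> : S = SLball (x * (A * (c k * B)))%g (3 * L * (18 * L ^+ 2 * e)).
    rewrite /S /w0 !mulgA; congr SLball; ring.
  exact: M3.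
move=> w Sw.
have eM : 54 * L ^+ 3 * e * M ^+ (na + nb + 3) <= r / 2.
  apply: le_trans eL; apply: ler_wpM2l; last by exact: ML'.
  by rewrite mulr_ge0 ?(ltW e0) // mulr_ge0 // exprn_ge0.
have [a' xa' wE] := block_ball WA (Cc k) WB eM Sw.
have bw : block W na nb w.
  exists a', A, (c k), B; split=> //; last by exists k.
  by apply: Fl; apply: Fx0; exact: half2 xa'.
by split=> //; apply: good => //; apply: le_trans es; exact: ltW.
Qed.
End HeavyBlock.

(** * Oscillating words with a regular attracting line *)

Lemma block_exponent a b : (a.+3 + b.+1 = a + b + 4)%N.
Proof. lia. Qed.

Lemma half_mass (R : realType) (y1 y2 y3 y4 : R) :
  y4 <= y3 / 2 -> y2 <= y3 / 2 -> y3 <= y1 + y2 -> y4 <= y1.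
Proof. by move=> *; lra. Qed.

Lemma half_quarter_lt (R : realType) (y o : R) : 0 < o -> y <= o / 2 -> y + o / 4 < o.
Proof. by move=> *; lra. Qed.

Section Core.
Context {R : realType} {n : nat}.
Notation d := n.+2.
Variables (rho : probability (SL R d) R) (nu : probability (projspace R d) R).

Lemma block_proximal (W : alphabet R n) na nb g : block W na nb g ->
  block_error W na nb <= 4^-1 -> proximal_elt g.
Proof.
move=> [a [A [c [B [Ha HA [j Hc] HB ->]]]]] be.
by have [_ pg _ _] := block_spectrum Ha HA Hc HB be.
Qed.

Lemma power_mass m g e : power_support rho m g -> 0 < e ->
  exists2 q, 0 < q & (q%:E <= convolution_power rho m (SLball g e))%E.
Proof.
move=> sg e0; have fin : convolution_power rho m (SLball g e) \is a fin_num.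
  by apply: fin_num_measure; exact: measurable_SLball.
exists (fine (convolution_power rho m (SLball g e))); last by rewrite fineK.
by rewrite fine_gt0 // sg //= ltey_eq fin.
Qed.

(** The proposition in terms of the number m, of which the length of the words
    is a multiple: for b not larger than an exponential of m, exponentially
    heavy sets of words have an attracting line of the required regularity and
    a spectral radius that b moves away from the period. Only the regularity
    exponent depends on the scale. *)
Lemma oscillating_words : strongly_irreducible (support_group rho) ->
  proximal (support_group rho) -> stationary rho nu ->
  exists (p : nat) (z : R), [/\ (0 < p)%N, 0 < z, z < 1 &
  forall om : R, 0 < om -> om < 1 -> exists x : R, [/\ 0 < x, x < 1 &
  exists m0, forall m (b : R), (m0 <= m)%N -> 1 <= `|b| -> `|b| * (3 / 4) ^+ m <= 1 ->
  exists S, [/\ measurable S, ((z ^+ m)%:E <= convolution_power rho (p * m) S)%E &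
    forall w, S w -> [/\ proximal_elt w, ((x ^+ m)%:E <= nu (ball (Vplus w) (om ^+ m)))%E &
      z ^+ m <= osc (b * lambda1 w) ^+ 2]]]].
Proof.
move=> irr prox nu_stat.
have [D HD [W [ell [r [a0 [b0 [c0 [[vE uE] [ell0 r0] [sa aA] [sb bB] Hc]]]]]]]] := alphabet_exists irr prox.
have [bb bb0] := nu_cone nu_stat irr (al_eta0 W) (al_eta1 W) HD; rewrite -vE -uE => Hbb.
have [K [f [K5 f0 f1 [m0 Hrates]]]] := rates W.
have r20 : 0 < r / 2 by rewrite divr_gt0.
have [qa qa0 Ha] := power_mass sa r20; have [qb qb0 Hb] := power_mass sb r20.
have exq j : exists q, 0 < q /\ (q%:E <= convolution_power rho ell (SLball (c0 j) (r / 2)))%E.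
  by have [q q0 Hq] := power_mass (Hc j).1 r20; exists q.
have [qc Hqc] := choice exq.
pose q := Num.min (Num.min 1 (Num.min qa qb)) (\big[Num.min/1]_j qc j).
have q0 : 0 < q.
  rewrite !lt_min ltr01 qa0 qb0 /=; apply: (big_ind (fun t => 0 < t)) => //.
  - by move=> y t y0 t0; rewrite lt_min y0 t0.
  - by move=> j _; exact: (Hqc j).1.
have q1 : q <= 1 by rewrite !ge_min lexx.
have {}Ha : (q%:E <= convolution_power rho ell (SLball a0 (r / 2)))%E.
  by apply: le_trans Ha; rewrite lee_fin !ge_min lexx !orbT.
have {}Hb : (q%:E <= convolution_power rho ell (SLball b0 (r / 2)))%E.
  by apply: le_trans Hb; rewrite lee_fin !ge_min lexx !orbT.
have {}Hqc j : (q%:E <= convolution_power rho ell (SLball (c0 j) (r / 2)))%E.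
  apply: le_trans (Hqc j).2; rewrite lee_fin /q ge_min; apply/orP; right.
  exact: bigmin_le_cond.
have cC j : SLball (c0 j) r `<=` al_C W j by exact: (Hc j).2.
have M1 := al_M1 W; have Mp : 0 < al_M W by exact: lt_le_trans M1.
have s0 := al_s0 W.
pose s1 := Num.min (al_s W) 1.
have s10 : 0 < s1 by rewrite lt_min s0 ltr01.
have s11 : s1 <= 1 by rewrite ge_min lexx orbT.
have s1s : s1 <= al_s W by rewrite ge_min lexx.
pose g := al_M W ^- 4; have g0 : 0 < g by rewrite invr_gt0 exprn_gt0.
have g1 : g <= 1 by rewrite invf_le1 ?exprn_gt0 // exprn_ege1.
pose tau := Num.min (r / 2) 1.
have tau0 : 0 < tau by rewrite lt_min r20 ltr01.
have tau1 : tau <= 1 by rewrite ge_min lexx orbT.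
have taur : tau <= r / 2 by rewrite ge_min lexx.
pose L m := al_M W ^+ (K * m); pose sg m := s1 ^+ (K * m); pose h m := f * g ^+ m.
have L1 m : 1 <= L m by exact: exprn_ege1.
have L0 m : 0 < L m by exact: lt_le_trans (L1 m).
have sg0 m : 0 < sg m by exact: exprn_gt0.
have sg1 m : sg m <= 1 by apply: exprn_ile1 => //; exact: ltW.
have h0 m : 0 < h m by rewrite mulr_gt0 // exprn_gt0.
have h1 m : h m <= 1.
  apply: mulr_ile1 => //; [exact: ltW|by rewrite exprn_ge0 // ltW|].
  by apply: exprn_ile1 => //; exact: ltW.
have hsg m : 0 < h m / 100 * sg m by rewrite mulr_gt0 // divr_gt0.
have h11 m : h m / 100 <= 1 by have := h0 m; have := h1 m; move: (h m) => y; lra.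
have h4 m : h m / 100 <= 4^-1 by have := h0 m; have := h1 m; move: (h m) => y; lra.
have hsg1 m : h m / 100 * sg m <= 1.
  by apply: mulr_ile1; [rewrite divr_ge0 // ltW|exact: ltW|exact: h11|exact: sg1].
(* the radius for which the balls of heavy_block, of radius 54 L ^ 3 e, meet its
   three requirements *)
pose e m := tau / 54 * (h m / 100 * sg m) * (L m)^-1 ^+ 4.
have e0 m : 0 < e m.
  apply: mulr_gt0; last by rewrite exprn_gt0 // invr_gt0.
  by apply: mulr_gt0 => //; rewrite divr_gt0.
have L54 m : 54 * L m ^+ 3 * e m * L m = tau * (h m / 100 * sg m).
  by rewrite /e; move: (h m / 100 * sg m) (L0 m) => y; move: (L m) => t t0; field; rewrite gt_eqF.
have L54' m : 54 * L m ^+ 3 * e m <= h m / 100 * sg m.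
  have p0 : 0 <= 54 * L m ^+ 3 * e m by rewrite mulr_ge0 ?(ltW (e0 m)) // mulr_ge0 // exprn_ge0 // ltW.
  apply: (@le_trans _ _ (54 * L m ^+ 3 * e m * L m)); first by rewrite ler_peMr.
  by rewrite L54 ler_piMl // ltW.
have L18 m : 18 * L m ^+ 2 * e m <= 1.
  have := le_trans (L54' m) (hsg1 m); apply: le_trans.
  rewrite ler_wpM2r ?(ltW (e0 m)) //; apply: ler_pM => //; first by rewrite exprn_ge0 // ltW.
    by rewrite ler_nat.
  by rewrite ler_weXn2l.
have e1 m : e m <= 1.
  apply: le_trans (L18 m); rewrite ler_peMl ?(ltW (e0 m)) //.
  by apply: mulr_ege1; [rewrite ler1n|exact: exprn_ege1].
have eL : exp_below (fun m => (L m)^-1).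
  apply: exp_below_le (exp_belowX (_ : 0 < (al_M W)^-1 ^+ K)); last by rewrite exprn_gt0 // invr_gt0.
  by exists 0%N => m _; rewrite -exprM exprVn.
have esg : exp_below sg.
  apply: exp_below_le (exp_belowX (_ : 0 < s1 ^+ K)); last by rewrite exprn_gt0.
  by exists 0%N => m _; rewrite -exprM.
have eh : exp_below h by exact: exp_belowM (exp_belowC f0) (exp_belowX g0).
have c100 : (0 : R) < 100^-1 by rewrite invr_gt0.
have ehsg : exp_below (fun m => h m / 100 * sg m).
  exact: exp_belowM (exp_belowM eh (exp_belowC c100)) esg.
have ee : exp_below e.
  apply: exp_belowM (exp_belowP 4 eL).
  by apply: exp_belowM (exp_belowC _) ehsg; rewrite divr_gt0.
pose mu m := block_mass (n := n) q (K * m) (L m) (e m).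
have cb1 y t : 0 < t -> 0 <= y -> 1 <= @cell_bound R d y t.
  by move=> t0 y0; apply: exprn_ege1; rewrite lerDr divr_ge0 ?(ltW t0) // !mulr_ge0.
have emu : exp_below mu.
  apply: exp_belowM (exp_below_cell d L1 e0 e1 eL ee).
  apply: exp_below_le (exp_belowX (_ : 0 < q ^+ K)); last by rewrite exprn_gt0.
  by exists 0%N => m _; rewrite -exprM.
have mu0 m : 0 < mu m.
  rewrite divr_gt0 ?exprn_gt0 // mulr_gt0 //.
  exact: lt_le_trans (cb1 _ _ (e0 m) (ltW (L0 m))).
have mu1 m : mu m <= 1.
  have c2 : 1 <= 2 * @cell_bound R d (L m) (e m).
    by apply: mulr_ege1; [rewrite ler1n|apply: cb1 => //; exact: ltW].
  rewrite ler_pdivrMr ?mul1r ?(lt_le_trans ltr01 c2) //; apply: le_trans c2.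
  by apply: exprn_ile1 => //; exact: ltW.
have c2 : (0 : R) < 2^-1 by rewrite invr_gt0.
have [z [z0 z1 [mz Hz]]] := exp_belowM (exp_belowM (exp_belowP 4 emu) (exp_belowC c2))
  (exp_belowP 2 (exp_belowM eh (exp_belowC c100))).
exists (ell * K)%N, z; split=> //; first by rewrite muln_gt0 ell0 (leq_trans _ K5).
move=> om om0 om1.
pose dH := d%:R ^+ 2 * al_H W ^+ 2.
have dH1 : 1 <= dH.
  by apply: mulr_ege1; apply: exprn_ege1; rewrite ?ler1n // al_H1.
have dH0 : 0 < dH by exact: lt_le_trans dH1.
(* om only enters here: it fixes the diameter e2 of the cells of the second
   pigeonhole *)
pose e3 m := om ^+ m / (8 * dH).
have e30 m : 0 < e3 m by rewrite divr_gt0 ?exprn_gt0 // mulr_gt0.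
have e31 m : e3 m <= 1.
  rewrite ler_pdivrMr; last exact: mulr_gt0.
  rewrite mul1r; apply: (@le_trans _ _ 1).
    by apply: exprn_ile1; exact: ltW.
  by apply: mulr_ege1 => //; rewrite ler1n.
pose e2 m := e3 m * sg m.
have e20 m : 0 < e2 m by rewrite mulr_gt0.
have e21 m : e2 m <= 1 by apply: mulr_ile1; [exact: ltW|exact: ltW|exact: e31|exact: sg1].
have ee3 : exp_below e3.
  by apply: exp_belowM (exp_belowX om0) (exp_belowC _); rewrite invr_gt0 mulr_gt0.
have ee2 : exp_below e2 by exact: exp_belowM.
pose cb2 m := @cell_bound R d (L m) (e2 m).
have cb20 m : 0 < cb2 m by exact: lt_le_trans (cb1 _ _ (e20 m) (ltW (L0 m))).
pose t m := mu m ^+ 4 * (2 * cb2 m)^-1.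
have t0 m : 0 < t m by rewrite mulr_gt0 ?exprn_gt0 // invr_gt0 mulr_gt0.
have et : exp_below t.
  exact: exp_belowM (exp_belowP 4 emu) (exp_below_cell d L1 e20 e21 eL ee2).
have [j Hj] : exists j, (2^-1 : R) ^+ j < om / 2.
  have [j Hj] := @expr_small R 2^-1 (om / 2) ltac:(by rewrite invr_ge0)
    ltac:(by rewrite invf_lt1 ?ltr1n) ltac:(by rewrite divr_gt0).
  by exists j; exact: Hj.
have [x [x0 x1 [mx Hx]]] := exp_belowM (exp_belowP j et) (exp_belowC bb0).
exists x; split=> //; exists (maxn m0 (maxn mz mx)) => m b.
rewrite !geq_max => /and3P[/Hrates + /Hz {}Hz /Hx {}Hx] b1 bk.
set nb := (K * m - m - 4)%N; rewrite -/g -/(h m) => -[[m1 lenE] [be1 be2] cr crb hom].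
have expE : (m.+3 + nb.+1 = K * m)%N by rewrite block_exponent.
have sgs : sg m <= al_s W ^+ (m.+3 + nb.+1).
  by rewrite expE lerXn2r ?nnegrE ?(ltW s10) ?(ltW s0).
have LM : al_M W ^+ (m + nb + 4) <= L m by rewrite lenE.
have h100 : 0 <= h m / 100 by rewrite divr_ge0 // ltW.
have bPhi : `|b| * (2 * cross_rate W m + 8 * block_error W m nb) <= 1.
  by apply: le_trans bk; rewrite ler_wpM2l.
have LL : 54 * L m ^+ 3 * e m * L m <= r / 2.
  rewrite L54; apply: le_trans taur; rewrite ler_piMr //; exact: ltW.
have Lh : 54 * L m ^+ 3 * e m <= h m / 100 * al_s W ^+ (m.+3 + nb.+1).
  by apply: (le_trans (L54' m)); rewrite ler_wpM2l.
have [w0 []] := heavy_block r0 q0 q1 aA bB cC Ha Hb Hqc LM (e0 m) (L18 m) LL Lh (h0 m) (h1 m) be1 cr hom b1 bPhi.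
rewrite lenE -/(mu m); set S0 := SLball w0 _ => mS0 HS0.
have measS0 : measurable S0 by exact: measurable_SLball.
have [Lc [mL muL HL]] := @heavy_cells R d (convolution_power rho (ell * (K * m))) (L m) (e2 m) isT
  (ltW (L0 m)) (e20 m) S0 (t m) measS0 (ltW (t0 m)).
have be4 : block_error W m nb <= 4^-1 by exact: le_trans be1 (h4 m).
(* the points of S0 that lie in heavy cells *)
exists (S0 `\` Lc); split; first exact: measurableD.
  rewrite -mulnA.
  have zmu : z ^+ m <= mu m ^+ 4 / 2.
    apply: (le_trans Hz); rewrite ler_piMr ?divr_ge0 ?exprn_ge0 ?(ltW (mu0 m)) //.
    by apply: exprn_ile1.
  have ct : cb2 m * t m = mu m ^+ 4 / 2.
    by rewrite /t; field; rewrite gt_eqF.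
  move: mS0 muL; rewrite -/(cb2 m) ct => mS0 muL.
  have Xf : convolution_power rho (ell * (K * m)) (S0 `\` Lc) \is a fin_num.
    by apply: fin_num_measure; exact: measurableD.
  have Yf : convolution_power rho (ell * (K * m)) (Lc `&` S0) \is a fin_num.
    by apply: fin_num_measure; exact: measurableI.
  have : ((mu m ^+ 4)%:E <= convolution_power rho (ell * (K * m)) (S0 `\` Lc) +
      convolution_power rho (ell * (K * m)) (Lc `&` S0))%E.
    by move: mS0; rewrite (measureDI _ measS0 mL) (setIC Lc).
  move: muL; rewrite -(fineK Xf) -(fineK Yf) -EFinD !lee_fin.
  exact: half_mass.
move=> w [Sw Lw]; have [bw ow] := HS0 w Sw.
have [C [mC Cw tC CD]] := HL w Lw (le_trans (block_norm bw) LM).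
have pw := block_proximal bw be4.
split=> //; last first.
  apply: (le_trans Hz); apply: (@le_trans _ _ ((h m / 100) ^+ 2)); last first.
    by rewrite lerXn2r ?nnegrE // (le_trans h100).
  rewrite ler_piMl ?sqr_ge0 //.
  rewrite ler_pdivrMr // mul1r; apply: (@le_trans _ _ 1); last by rewrite ler1n.
  by apply: exprn_ile1 => //; exact: ltW.
apply: le_trans (_ : _ <= ((t m ^+ j * bb)%:E))%E _; first by rewrite lee_fin.
apply: (@cell_regular R n W rho nu nu_stat m nb (ell * (K * m)) (C `&` S0) (t m) bb (e3 m) (om ^+ m) w j) => //.
- exact: measurableI.
- exact: ltW.
- by move=> g' [_ Sg']; exact: (HS0 g' Sg').1.
- move=> g' [Cg' _]; apply: (le_trans (CD g' Cg')).
  by rewrite ler_wpM2l // ltW.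
- by apply: (le_trans be4); rewrite lef_pV2 ?posrE // ler_nat.
have d0 : 0 <= block_error W m nb.
  apply: divr_ge0; last exact: exprn_ge0.
  apply: mulr_ge0; last by rewrite exprn_ge0 // divr_ge0 // ltW.
  have H0 : 0 <= al_H W by exact: le_trans ler01 (al_H1 W).
  by rewrite !addr_ge0 // ?mulr_ge0 ?exprn_ge0 // ltW // trace_const_gt0.
have k1 : block_error W m nb ^+ j <= om ^+ m / 2.
  apply: (@le_trans _ _ ((2^-1 ^+ m) ^+ j)); first by rewrite lerXn2r ?nnegrE ?exprn_ge0 ?invr_ge0.
  rewrite exprAC; apply: (@le_trans _ _ ((om / 2) ^+ m)).
    by rewrite lerXn2r ?nnegrE ?exprn_ge0 ?invr_ge0 ?divr_ge0 ?(ltW om0) ?(ltW Hj).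
  rewrite expr_div_n ler_wpM2l ?exprn_ge0 ?(ltW om0) // lef_pV2 ?posrE ?exprn_gt0 //.
  by rewrite -[leLHS]expr1 ler_weXn2l // ler1n.
have k2 : 2 * (d%:R ^+ 2 * al_H W ^+ 2 * e3 m) = om ^+ m / 4.
  by rewrite -/dH /e3; field; rewrite gt_eqF.
by rewrite k2; apply: half_quarter_lt => //; exact: exprn_gt0.
Qed.
End Core.

(** * The theorem *)

(** Neither the set of regular elements nor lambda1 is known to be measurable; the
    measurable set S bounds the integral from below. *)
Lemma integral_any_ge d (T : measurableType d) (R : realType) (mu : probability T R)
    (G S : set T) (f : T -> R) (c : R) : measurable S -> S `<=` G -> 0 <= c ->
  (forall x, 0 <= f x) -> (forall x, S x -> c <= f x) ->
  (c%:E * mu S <= \int[mu]_(x in G) (f x)%:E)%E.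
Proof.
move=> mS SG c0 f0 fc; rewrite -integral_cst // integral_mkcond [leRHS]integral_mkcond.
apply: le_integral_any => x _; first by apply: erestrict_ge0 => y _; rewrite lee_fin.
rewrite /patch; case: ifPn => [|_]; rewrite ?inE.
  by move=> Sx; rewrite mem_set ?lee_fin; [exact: fc|exact: SG].
by case: ifP => _ //; rewrite lee_fin.
Qed.

Lemma truncn_prop (R : realType) (y : R) : 0 <= y ->
  (Num.truncn y)%:R <= y /\ y < (Num.truncn y)%:R + 1.
Proof. by move=> y0; have /andP[h1 h2] := truncn_itv y0; rewrite natr1. Qed.

Lemma limf_einf_infinity (R : realType) (F : R -> \bar R) (B : R) :
  (forall b, B < `|b| -> (1 <= F b)%E) -> 0 <= B ->
  (0 < limf_einf F (+oo_R))%E /\ (0 < limf_einf F (-oo_R))%E.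
Proof.
move=> HF B0; have inf_ge (A : set R) : (forall b, A b -> B < `|b|) -> (1 <= ereal_inf [set F x | x in A])%E.
  by move=> HA; apply: le_ereal_inf_tmp => _ [b Ab <-]; apply: HF; exact: HA.
have sup_ge (N : set_system R) A : N A -> (forall b, A b -> B < `|b|) ->
    (0 < limf_einf F N)%E.
  move=> NA HA; rewrite limf_einfE; apply: (lt_le_trans lte01).
  by apply: (le_trans (inf_ge A HA)); apply: ereal_sup_ubound; exists A.
split.
- apply: (sup_ge _ [set b | B < b]); last by move=> b /= Bb; exact: lt_le_trans Bb (ler_norm _).
  by exists B; split; [exact: num_real|].
- apply: (sup_ge _ [set b | b < - B]).
    by exists (- B); split; [exact: num_real|].
  by move=> b /= Bb; rewrite -normrN; apply: lt_le_trans (ler_norm _); rewrite ltrNr.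
Qed.

Theorem proposition3p19 (R : realType) (n : nat)
    (rho : probability (SL R n.+2) R) (nu : probability (projspace R n.+2) R)
    (rho_irr : strongly_irreducible (support_group rho))
    (rho_prox : proximal (support_group rho))
    (rho_exp : exponential_moment rho)
    (nu_stat : stationary rho nu) :
  exists (alpha beta : R) (p : nat),
    [/\ 0 < alpha, 0 < beta, (1 <= p)%N &
     forall alpha2 : R, 0 < alpha2 ->
     exists2 Delta : R, 0 <= Delta &
       let F (b : R) : \bar R :=
         ((`|b| `^ alpha)%:E *
          \int[convolution_power rho (p * Num.truncn (beta * ln `|b|))]_(g in
              G_regular nu Delta (`|b| `^ (- alpha2)))
            (ComplexField.Normc.normc (expi (b * lambda1 g) - 1) ^+ 2)%:E)%E in
       (0 < limf_einf F (+oo_R))%E /\ (0 < limf_einf F (-oo_R))%E].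
Proof.
have half_le (t k y : R) : 2 * y <= t + k -> k <= y -> y <= t by move=> *; lra.
have [p [z [p0 z0 z1 core]]] := oscillating_words rho_irr rho_prox nu_stat.
pose lk : R := - ln (3 / 4).
have k0 : 0 < 3 / 4 :> R by rewrite divr_gt0.
have lk0 : 0 < lk by rewrite oppr_gt0 ln_lt0 // k0 /= ltr_pdivrMr // mul1r ltr_nat.
have lz0 : 0 < - ln z by rewrite oppr_gt0 ln_lt0 // z0 z1.
pose beta := 2 / lk; have beta0 : 0 < beta by rewrite divr_gt0.
have blk : beta * lk = 2 by rewrite /beta divfK // gt_eqF.
exists (2 * beta * - ln z), beta, p; split=> //; first by apply: mulr_gt0 => //; exact: mulr_gt0.
move=> alpha2 a20; pose om := expR (- (2 * alpha2 / beta)).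
have om0 : 0 < om by exact: expR_gt0.
have om1 : om < 1 by rewrite expR_lt1 oppr_lt0 divr_gt0 // mulr_gt0.
have [x [x0 x1 [m0 H]]] := core om om0 om1.
have lx0 : 0 < - ln x by rewrite oppr_gt0 ln_lt0 // x0 x1.
exists (beta * - ln x / alpha2) => [|F]; first by rewrite divr_ge0 ?(ltW a20) // mulr_ge0 ?(ltW lx0) ?(ltW beta0).
(* beyond exp Y, the integral part m of beta ln |b| is at least m0 and b is at
   most (4 / 3) ^ m in modulus *)
pose Y := lk + (m0%:R + 1) / beta.
have Y0 : 0 < Y by rewrite ltr_pwDl // divr_ge0 ?(ltW beta0) // addr_ge0.
apply: (@limf_einf_infinity R F (expR Y)); last exact: expR_ge0.
move=> b bY; have b0 : 0 < `|b| by exact: lt_trans (expR_gt0 _) bY.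
pose y := ln `|b|; have bE : `|b| = expR y by rewrite /y lnK.
have yY : Y < y by move: bY; rewrite bE ltr_expR.
have y0 : 0 < y by exact: lt_trans yY.
have powE t : `|b| `^ t = expR (t * y) by rewrite /powR (gt_eqF b0).
have ylk : lk <= y.
  by apply: le_trans (ltW yY); rewrite lerDl divr_ge0 ?(ltW beta0) // addr_ge0.
have ym0 : m0%:R + 1 <= beta * y.
  rewrite mulrC -ler_pdivrMr //; apply: le_trans (ltW yY); rewrite lerDr; exact: ltW.
have by0 : 0 <= beta * y by rewrite mulr_ge0 // ltW.
have [m1 m2] := truncn_prop by0.
rewrite /F -/y; set m := Num.truncn _ in m1 m2 *.
have mm0 : (m0 <= m)%N.
  rewrite -ltnS -(ltr_nat R) -natr1; apply: lt_le_trans (_ : m0%:R < m0%:R + 1) _; first by rewrite ltrDl.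
  by apply: (le_trans ym0); exact: ltW.
(* 2 m / beta is at least y because m is the integral part of beta y *)
have mlk : 2 * y <= (m%:R + 1) * lk.
  rewrite -blk mulrAC; apply: ler_wpM2r; [exact: ltW|exact: ltW].
have ymlk : y <= m%:R * lk by apply: half_le ylk; rewrite -[X in _ + X]mul1r -mulrDl.
have km : (3 / 4 : R) ^+ m = expR (- (m%:R * lk)).
  by rewrite /lk mulrN opprK expRM_natl lnK ?posrE.
have zm : z ^+ m = expR (m%:R * ln z) by rewrite expRM_natl lnK ?posrE.
have xm : x ^+ m = expR (m%:R * ln x) by rewrite expRM_natl lnK ?posrE.
have omm : om ^+ m = expR (- (m%:R * (2 * alpha2 / beta))).
  by rewrite -mulrN expRM_natl.
have b1 : 1 <= `|b| by rewrite bE -expR0 ler_expR ltW.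
have bk : `|b| * (3 / 4) ^+ m <= 1.
  by rewrite bE km -expRD -[X in _ <= X]expR0 ler_expR subr_le0.
have [S [mS zS HS]] := H m b mm0 b1 bk.
have omr : om ^+ m <= `|b| `^ (- alpha2).
  rewrite omm powE ler_expR mulNr lerN2.
  have -> : m%:R * (2 * alpha2 / beta) = alpha2 * (m%:R * lk).
    rewrite /beta; field; rewrite gt_eqF //=.
  by rewrite ler_wpM2l ?(ltW a20).
have SG : S `<=` G_regular nu (beta * - ln x / alpha2) (`|b| `^ (- alpha2)).
  move=> w Sw; have [pw hw _] := HS w Sw; split=> //; rewrite /regular_at.
  apply: (@le_trans _ _ (x ^+ m)%:E).
    rewrite lee_fin powE /powR gt_eqF ?expR_gt0 // expRK xm ler_expR.
    have -> : beta * - ln x / alpha2 * (- alpha2 * y) = (beta * y) * ln x.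
      by field; rewrite gt_eqF.
    by rewrite -lerN2 -!mulrN ler_wpM2r // ltW.
  apply: (le_trans hw); apply: le_measure; rewrite ?inE.
  - exact: measurable_projball.
  - exact: measurable_projball.
  - exact: le_ball.
have int_ge := @integral_any_ge _ _ R (convolution_power rho (p * m)) _ S
  (fun g => osc (b * lambda1 g) ^+ 2) (z ^+ m) mS SG (exprn_ge0 m (ltW z0))
  (fun g => sqr_ge0 _) (fun w Sw => let: And3 _ _ h := HS w Sw in h).
apply: (@le_trans _ _ ((`|b| `^ (2 * beta * - ln z))%:E * ((z ^+ m)%:E * (z ^+ m)%:E))%E).
  rewrite -!EFinM lee_fin powE zm -!expRD -[X in X <= _]expR0 ler_expR.
  have -> : 2 * beta * - ln z * y + (m%:R * ln z + m%:R * ln z) = 2 * ((beta * y - m%:R) * - ln z).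
    by ring.
  by rewrite mulr_ge0 // mulr_ge0 ?subr_ge0 // ltW.
apply: lee_wpmul2l; first by rewrite lee_fin powR_ge0.
apply: le_trans int_ge; apply: lee_wpmul2l; last exact: zS.
by rewrite lee_fin exprn_ge0 // ltW.
Qed.
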